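(* Let $\sigma_0(t)=e^{-t}(1-t)$ and $\sigma_1(t)=e^{-t}t$ for all $t\in\mathbb{R}_+$. Every continuous linear operator $A:L^2(\mathbb{R}_+)\rightarrow L^2(\mathbb{R}_+)$ with the property that $A(\widetilde{\mathcal{M}})\subset\widetilde{\mathcal{M}}$ is determined by its two values $A\sigma_0$ and $A\sigma_1$. Explicitly, for every such $A$, setting \[ \alpha=\mathcal{L}A\sigma_0+\mathcal{L}A\sigma_1\quad\text{and}\quad \xi=\frac{\mathcal{L}A\sigma_0}{\mathcal{L}A\sigma_1}, \] one has \[ A=\mathcal{L}^{-1}M_\kappa C_\xi\mathcal{L}\quad\text{with}\quad \kappa=\sqrt{2\pi}\,(1+\xi)\alpha; \] equivalently, $A$ has the integral representation \[ (Af)(t)=\frac{1}{\sqrt{2\pi}}\int_{y=-\infty}^{\infty}\int_{\tau=0}^{\infty}\alpha(iy)\,(1+\xi(iy))\,e^{-\tau\xi(iy)+iyt}f(\tau)\,d\tau\,dy . \] Moreover, $\alpha$ necessarily has the form $\alpha(w)=e^{-\varepsilon w}\alpha_0(w)$ for some scalar $\varepsilon\geq 0$ and some outer function $\alpha_0\in H^2_{\mathbb{C}_+}$, and $\xi:\mathbb{C}_+\rightarrow\mathbb{C}_+$ is analytic.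
   Context: $\mathbb{C}_+$ is the open right half plane, $\mathbb{D}$ the open unit disk, $\mathbb{R}_+$ the half line $[0,\infty)$; $L^2(\mathbb{R}_+)$ consists of complex-valued functions. $H^2_{\mathbb{C}_+}$ is the Hardy space of analytic functions on $\mathbb{C}_+$ whose square integrals along vertical lines of constant positive real part are uniformly bounded; $H^2_{\mathbb{D}}$ is the Hardy space of analytic functions on $\mathbb{D}$ with square summable Taylor coefficients. Values on the imaginary axis (resp. the unit circle) refer to boundary functions. The Fourier-Laplace transform $\mathcal{L}:L^2(\mathbb{R}_+)\to H^2_{\mathbb{C}_+}$, $(\mathcal{L}f)(w)=\frac{1}{\sqrt{2\pi}}\int_0^\infty f(t)e^{-wt}\,dt$, is a surjective isometry. The map $\Phi:H^2_{\mathbb{C}_+}\to H^2_{\mathbb{D}}$, $(\Phi F)(z)=\frac{2\sqrt{\pi}}{1+z}F\!\left(\frac{1-z}{1+z}\right)$, is a surjective isometry. Put $\mathcal{H}=\Phi\mathcal{L}:L^2(\mathbb{R}_+)\to H^2_{\mathbb{D}}$. A nonzero $G\in H^2_{\mathbb{D}}$ is outer if there is a scalar $\lambda$ with $|\lambda|=1$ such that $G(z)=\lambda\exp\!\left(\frac{1}{2\pi}\int_0^{2\pi}\frac{e^{i\theta}+z}{e^{i\theta}-z}\log|G(e^{i\theta})|\,d\theta\right)$ for all $z\in\mathbb{D}$. A nonzero $F\in H^2_{\mathbb{C}_+}$ is outer if there is a scalar $\lambda$ with $|\lambda|=1$ such that $F(w)=\lambda\exp\!\left(\frac{1}{\pi}\int_{-\infty}^\infty\frac{yw+i}{y+iw}\log|F(iy)|\frac{dy}{1+y^2}\right)$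 for all $w\in\mathbb{C}_+$. A function $f\in L^2(\mathbb{R}_+)$ is minimum phase if $\mathcal{H}f$ is outer; $\mathcal{M}$ is the set of all minimum phase functions. For $\tau\ge 0$, $(T_\tau f)(t)=f(t-\tau)$ if $t\geq\tau$ and $0$ if $t<\tau$. $\widetilde{\mathcal{M}}=\{T_\tau f : f\in\mathcal{M},\ \tau\geq 0\}$. For analytic $\kappa$ on $\mathbb{C}_+$ and analytic $\xi:\mathbb{C}_+\to\mathbb{C}_+$, $(M_\kappa F)(w)=\kappa(w)F(w)$ and $(C_\xi F)(w)=F(\xi(w))$. The integral representation is $\mathcal{L}^{-1}M_\kappa C_\xi\mathcal{L}f$ written out using boundary values on the imaginary axis; when the integrals do not converge absolutely they are interpreted (as oscillatory integrals) as in the standard theory of the Fourier transform on $L^2$. *)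

(* Defs.v *)
From HB Require Import structures.
From mathcomp Require Import all_boot all_order all_algebra.
From mathcomp Require Import complex.
From mathcomp Require Import all_classical all_reals all_analysis.

Set Implicit Arguments.
Unset Strict Implicit.
Unset Printing Implicit Defensive.

Import Order.TTheory GRing.Theory Num.Theory.
Import numFieldNormedType.Exports.

Local Open Scope classical_set_scope.
Local Open Scope ring_scope.
Local Open Scope complex_scope.

Notation normc := ComplexField.Normc.normc.

Section ComplexAnalysis.
Context {R : realType}.
Local Notation C := R[i].
Local Notation mu := (@lebesgue_measure R).
Implicit Types (z w : C) (f g : R -> C) (F G : C -> C) (D : set R).

Definition Rplus : set R := `[0, +oo[%classic.

Definition Cplus : set C := [set w | 0 < complex.Re w].

Definition unit_disk : set C := [set z | normc z < 1].

Definition cexp z : C :=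
  (expR (complex.Re z) * cos (complex.Im z))
    +i* (expR (complex.Re z) * sin (complex.Im z)).

(* The scalars acting on [C^o] are complex, so [derivable _ z 1] is complex
   differentiability at [z]. *)
Definition analytic_on (U : set C) F :=
  forall z, U z -> derivable (F : C^o -> C^o) z 1.

(* Only meaningful when the real and imaginary parts are integrable on [D]. *)
Definition Cintegral D f : C :=
  (\int[mu]_(x in D) complex.Re (f x)) +i* (\int[mu]_(x in D) complex.Im (f x)).

Definition L2norm D f : \bar R :=
  'N[mu]_2%:E[(fun x => (normc (f x))%:E) \_ D]%E.

(* Elements of L^2(D; C) are represented by functions on the line of which only
   the restriction to [D] matters; equality in L^2(D; C) is [ae_eq mu D]. *)
Definition L2 D f : Prop :=
  [/\ measurable_fun D (fun x => complex.Re (f x)),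
      measurable_fun D (fun x => complex.Im (f x)) &
      (L2norm D f < +oo)%E].

Definition L2_cvg D (u : R -> R -> C) f : Prop :=
  [/\ forall T, 0 < T -> L2 D (u T),
      L2 D f &
      L2norm D (fun x => u T x - f x) @[T --> +oo] --> 0%E].

Record continuous_linear_operator D (A : (R -> C) -> R -> C) : Prop := {
  op_L2 : forall f, L2 D f -> L2 D (A f) ;
  op_ae_eq : forall f g, L2 D f -> L2 D g ->
    ae_eq mu D f g -> ae_eq mu D (A f) (A g) ;
  op_linear : forall (a : C) f g, L2 D f -> L2 D g ->
    ae_eq mu D (A (fun t => a * f t + g t)) (fun t => a * A f t + A g t) ;
  op_continuous : forall f, L2 D f -> forall e : R, 0 < e ->
    exists2 d : R, 0 < d & forall g, L2 D g ->
      (L2norm D (fun t => g t - f t)%R < d%:E)%E ->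
      (L2norm D (fun t => A g t - A f t)%R < e%:E)%E }.

Definition H2_Cplus F : Prop :=
  analytic_on Cplus F /\
  exists M : R, forall x : R, 0 < x ->
    (\int[mu]_y ((normc (F (x +i* y)) ^+ 2)%:E) <= M%:E)%E.

Definition H2_disk G : Prop :=
  analytic_on unit_disk G /\
  exists a : nat -> C,
    cvgn (series (fun n => normc (a n) ^+ 2)) /\
    forall z, unit_disk z ->
      series (fun n => a n * z ^+ n : C^o) @ \oo --> (G z : C^o).

(* Boundary functions are radial (resp. horizontal) limits, which exist almost
   everywhere for functions in the Hardy spaces, and for analytic maps of the
   right half plane into itself. *)
Definition bdry_disk G (theta : R) : C :=
  lim ((G (r%:C * cexp (0 +i* theta)) : C^o) @[r --> 1^'-]).

Definition bdry_Cplus F (y : R) : C :=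
  lim ((F (x +i* y) : C^o) @[x --> 0^'+]).

(* For a nonzero H^2 function the log-modulus of the boundary function is
   integrable for the measure in question; in particular the convention
   [ln 0 = 0] only matters on a null set. *)
Definition outer_disk G : Prop :=
  [/\ H2_disk G,
      exists2 z, unit_disk z & G z != 0 &
      exists2 lambda : C, normc lambda = 1 &
        forall z, unit_disk z ->
          G z = lambda * cexp ((2 * pi)^-1%:C *
            Cintegral `[0, 2 * pi]%classic (fun theta =>
              let e := cexp (0 +i* theta) in
              (e + z) / (e - z) * (ln (normc (bdry_disk G theta)))%:C))].

Definition outer_Cplus F : Prop :=
  [/\ H2_Cplus F,
      exists2 w, Cplus w & F w != 0 &
      exists2 lambda : C, normc lambda = 1 &
        forall w, Cplus w ->
          F w = lambda * cexp (pi^-1%:C *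
            Cintegral setT (fun y =>
              (y%:C * w + 'i) / (y%:C + 'i * w)
                * (ln (normc (bdry_Cplus F y)) / (1 + y ^+ 2))%:C))].

Definition laplace f : C -> C := fun w =>
  (Num.sqrt (2 * pi))^-1%:C *
  Cintegral Rplus (fun t => f t * cexp (- (w * t%:C))).

Definition Phi F : C -> C := fun z =>
  (2 * Num.sqrt pi)%:C / (1 + z) * F ((1 - z) / (1 + z)).

Definition minimum_phase f : Prop :=
  L2 Rplus f /\ outer_disk (Phi (laplace f)).

Definition shift (tau : R) f : R -> C := fun t =>
  if tau <= t then f (t - tau) else 0.

Definition shifted_minimum_phase g : Prop :=
  L2 Rplus g /\
  exists f tau, [/\ minimum_phase f, 0 <= tau & ae_eq mu Rplus g (shift tau f)].

Definition mul_op (kappa : C -> C) F : C -> C := fun w => kappa w * F w.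

Definition comp_op (xi : C -> C) F : C -> C := fun w => F (xi w).

(* [f] represents the preimage of [F] under the isometry [laplace] of L^2(R_+)
   onto the Hardy space of the right half plane. *)
Definition is_inverse_laplace F f : Prop :=
  [/\ H2_Cplus F, L2 Rplus f & forall w, Cplus w -> laplace f w = F w].

(* [h t = (2 pi)^(-1/2) \int_y \int_(tau >= 0) k y tau * exp(i y t)], where both
   improper integrals are limits in the mean, as for the Fourier transform on
   L^2: the inner one in L^2(dy), the outer one in L^2(R_+, dt). *)
Definition iterated_fourier_integral (k : R -> R -> C) (h : R -> C) : Prop :=
  exists g : R -> C,
    L2_cvg setT (fun T y => Cintegral `[0, T]%classic (k y)) g /\
    L2_cvg Rplus (fun N t => (Num.sqrt (2 * pi))^-1%:C *
      Cintegral `[- N, N]%classic (fun y => g y * cexp (0 +i* (y * t)))) h.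

Definition sigma0 : R -> C := fun t => (expR (- t) * (1 - t))%:C.

Definition sigma1 : R -> C := fun t => (expR (- t) * t)%:C.

End ComplexAnalysis.

Arguments Rplus {R}.
Arguments Cplus {R}.
Arguments unit_disk {R}.

(* Main.v *)
Require Import Defs.
From mathcomp Require Import all_boot all_order all_algebra.
From mathcomp Require Import complex.
From mathcomp Require Import all_classical all_reals all_analysis.
From HB Require Import structures.
From mathcomp Require Import measurable_realfun ring lra.
Import Order.TTheory GRing.Theory Num.Theory.
Import numFieldNormedType.Exports.
(** The operator [A] is seen through the linear functionals
    [f |-> laplace (A f) w], one for each [w] in the right half plane.  A shift
    by [tau] multiplies a transform by an exponential and outer functions have
    no zeros, so such a functional does not vanish on shifted minimum phase
    functions.  For a polynomial [p], the function [poly_preimage p] is carried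
    by the Laplace transform followed by [Phi] to a constant multiple of [p];
    and a polynomial without zeros in the open disk is outer ([outer_poly]).
    Hence the functional, viewed on polynomials, does not vanish at any
    polynomial that is free of zeros in the disk.  An elementary form of the
    theorem of Gleason, Kahane and Zelazko ([gleason]) then shows that it is a
    constant multiple of evaluation at a point [b] of the disk.  The constant
    and the point can be read off from its values at [(1 - z) / 2] and
    [(1 + z) / 2], which correspond to [sigma0] and [sigma1]: the constant is
    [alpha w], and [xi w = (1 - b) / (1 + b)].  Density of the functions
    [t^k e^{-t}] in L^2 of the half line ([L2_dense]) extends the formula to all
    of L^2 ([A_repr]), and injectivity of the Laplace transform
    ([laplace_inj]) gives the determination of [A] by two values.

    The function [alpha] is the transform of [A] applied to
    [e^{-t} = sigma0 + sigma1], so up to a shift it is the transform of a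
    minimum phase function.  Minimum phase is a condition on the disk, and its
    transfer to the half plane ([outer_transfer]) is a change of variables
    between the circle and the line ([cov_complex]) in the Schwarz integral of
    the log-modulus.  It has two analytic inputs.  The log-modulus of the
    boundary function is integrable ([jensen]).  And radial limits on the circle
    agree with horizontal limits on the line: radii of the disk become curves in
    the half plane that are only asymptotically horizontal, so limits in cones
    are needed, and these exist almost everywhere ([fatou_cone]), by a weak type
    estimate for the Poisson integral.

    For the integral representation, the inner integral over [[0, T]] is
    computed by the representation formula at the boundary: it is almost
    everywhere the boundary function of the transform of [A] applied to [f]
    truncated at [T] ([inner_ae]).  The boundary map is isometric
    ([bdry_iso]), so the inner integrals converge in L^2 to the boundary function
    of the transform of [A f], and the outer integral is Fourier inversion in
    the mean ([inversion]), which follows from the isometry by duality. *)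
Set Implicit Arguments.
Unset Strict Implicit.
Unset Printing Implicit Defensive.
Local Open Scope classical_set_scope.
Local Open Scope ring_scope.
Local Open Scope complex_scope.
Local Notation Re := complex.Re.
Local Notation Im := complex.Im.

(** * Complex arithmetic and limits *)
Section ComplexBasics.
Context {R : realType}.
Local Notation C := R[i].
Implicit Types z w : C.
Lemma eqc z w : Re z = Re w -> Im z = Im w -> z = w.
Proof. by case: z w => [a b] [c d] /= -> ->. Qed.
Lemma Re_add z w : Re (z + w) = Re z + Re w. Proof. by case: z w => [a b] [c d]. Qed.
Lemma Im_add z w : Im (z + w) = Im z + Im w. Proof. by case: z w => [a b] [c d]. Qed.
Lemma Re_opp z : Re (- z) = - Re z. Proof. by case: z. Qed.
Lemma Im_opp z : Im (- z) = - Im z. Proof. by case: z. Qed.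
Lemma Re_mul z w : Re (z * w) = Re z * Re w - Im z * Im w.
Proof. by case: z w => [a b] [c d]. Qed.
Lemma Im_mul z w : Im (z * w) = Re z * Im w + Im z * Re w.
Proof. by case: z w => [a b] [c d]. Qed.
Lemma Re_inv z : Re z^-1 = Re z / (Re z ^+ 2 + Im z ^+ 2).
Proof. by case: z. Qed.
Lemma Im_inv z : Im z^-1 = - Im z / (Re z ^+ 2 + Im z ^+ 2).
Proof. by case: z => a b; rewrite mulNr. Qed.
Lemma Re_real (x : R) : Re x%:C = x. Proof. by []. Qed.
Lemma Im_real (x : R) : Im x%:C = 0. Proof. by []. Qed.
Lemma Re_Complex (x y : R) : Re (x +i* y) = x. Proof. by []. Qed.
Lemma Im_Complex (x y : R) : Im (x +i* y) = y. Proof. by []. Qed.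
Lemma Re_conj z : Re z^* = Re z. Proof. by case: z. Qed.
Lemma Im_conj z : Im z^* = - Im z. Proof. by case: z. Qed.
Lemma Re_1 : Re (1 : C) = 1. Proof. by []. Qed.
Lemma Im_1 : Im (1 : C) = 0. Proof. by []. Qed.
Lemma Re_0 : Re (0 : C) = 0. Proof. by []. Qed.
Lemma Im_0 : Im (0 : C) = 0. Proof. by []. Qed.
Definition cE := (Re_add, Im_add, Re_opp, Im_opp, Re_mul, Im_mul, Re_inv, Im_inv,
  Re_conj, Im_conj, Re_real, Im_real, Re_1, Im_1, Re_0, Im_0, Re_Complex, Im_Complex).
Lemma normcE2 z : normc z ^+ 2 = Re z ^+ 2 + Im z ^+ 2.
Proof. by case: z => a b /=; rewrite sqr_sqrtr // addr_ge0 ?sqr_ge0. Qed.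
Lemma normc_ge0 z : 0 <= normc z. Proof. by case: z => a b; rewrite sqrtr_ge0. Qed.
Lemma normc_norm z : `|z| = (normc z)%:C. Proof. by case: z. Qed.
Lemma normc_leD z w : normc (z + w) <= normc z + normc w.
Proof. exact: le_normcD. Qed.
Lemma normcB z w : normc (z - w) <= normc z + normc w.
Proof. by rewrite -(normcN w); exact: le_normcD. Qed.
Lemma normc_distC z w : normc (z - w) = normc (w - z).
Proof. by rewrite -normcN opprB. Qed.
Lemma normc_real (x : R) : normc x%:C = `|x|.
Proof. by rewrite /= expr0n /= addr0 sqrtr_sqr. Qed.
Lemma normc_eq0 z : (normc z == 0) = (z == 0).
Proof. by apply/eqP/eqP => [/ComplexField.Normc.eq0_normc //|->]; exact: ComplexField.Normc.normc0. Qed.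
Lemma normc_gt0 z : (0 < normc z) = (z != 0).
Proof. by rewrite lt_neqAle normc_ge0 andbT eq_sym normc_eq0. Qed.
Lemma normc_exp z n : normc (z ^+ n) = normc z ^+ n.
Proof.
elim: n => [|n IH]; first by rewrite !expr0 ComplexField.Normc.normc1.
by rewrite !exprS ComplexField.Normc.normcM IH.
Qed.
Lemma normcM z w : normc (z * w) = normc z * normc w.
Proof. exact: ComplexField.Normc.normcM. Qed.
Lemma normcV z : normc z^-1 = (normc z)^-1.
Proof. exact: ComplexField.Normc.normcV. Qed.
Lemma normcJ z : normc z^* = normc z.
Proof. by case: z => a b /=; rewrite sqrrN. Qed.
Lemma normc0 : normc (0 : C) = 0. Proof. exact: ComplexField.Normc.normc0. Qed.
Lemma normc1 : normc (1 : C) = 1. Proof. exact: ComplexField.Normc.normc1. Qed.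
Lemma Re_le_normc z : `|Re z| <= normc z.
Proof.
rewrite -(@ler_pXn2r _ 2) ?nnegrE ?normr_ge0 ?normc_ge0 //.
by rewrite normcE2 real_normK ?num_real // lerDl sqr_ge0.
Qed.
Lemma Im_le_normc z : `|Im z| <= normc z.
Proof.
rewrite -(@ler_pXn2r _ 2) ?nnegrE ?normr_ge0 ?normc_ge0 //.
by rewrite normcE2 real_normK ?num_real // lerDr sqr_ge0.
Qed.
Lemma normc_le_ReIm z : normc z <= `|Re z| + `|Im z|.
Proof.
rewrite -(@ler_pXn2r _ 2) ?nnegrE ?addr_ge0 ?normr_ge0 ?normc_ge0 //.
rewrite normcE2 sqrrD !real_normK ?num_real //.
by rewrite lerD2r lerDl mulrn_wge0 // mulr_ge0.
Qed.
Lemma normc_lerB z w : normc z - normc w <= normc (z - w).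
Proof. by rewrite lerBlDr (le_trans _ (normc_leD _ _))// subrK. Qed.
Lemma normc_dist_dist z w : `|normc z - normc w| <= normc (z - w).
Proof.
rewrite ler_norml normc_lerB andbT lerNl opprB normc_distC; exact: normc_lerB.
Qed.
Lemma normc_sum I (r : seq I) (P : pred I) (F : I -> C) :
  normc (\sum_(i <- r | P i) F i) <= \sum_(i <- r | P i) normc (F i).
Proof.
elim/big_rec2: _ => [|i y x _ h]; first by rewrite normc0.
by apply: le_trans (normc_leD _ _) _; rewrite lerD2l.
Qed.
Lemma mulcJ z : z * z^* = (normc z ^+ 2)%:C.
Proof. by apply: eqc; rewrite !cE ?normcE2 ?cE; ring. Qed.
Lemma Re_cexp z : Re (cexp z) = expR (Re z) * cos (Im z). Proof. by []. Qed.
Lemma Im_cexp z : Im (cexp z) = expR (Re z) * sin (Im z). Proof. by []. Qed.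
Lemma cexpD z w : cexp (z + w) = cexp z * cexp w.
Proof.
by apply: eqc; rewrite !(Re_cexp, Im_cexp, cE) expRD ?cosD ?sinD; ring.
Qed.
Lemma cexp0 : cexp (0 : C) = 1.
Proof. by apply: eqc; rewrite !(Re_cexp, Im_cexp, cE) expR0 ?cos0 ?sin0; ring. Qed.
Lemma normc_cexp z : normc (cexp z) = expR (Re z).
Proof.
apply/eqP; rewrite -(@eqrXn2 _ 2) ?normc_ge0 ?expR_ge0 //; apply/eqP.
by rewrite normcE2 Re_cexp Im_cexp !exprMn -mulrDr cos2Dsin2 mulr1.
Qed.
Lemma cexp_neq0 z : cexp z != 0.
Proof. by rewrite -normc_gt0 normc_cexp expR_gt0. Qed.
Lemma cexpN z : cexp (- z) = (cexp z)^-1.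
Proof.
apply: (mulfI (cexp_neq0 z)); rewrite -cexpD subrr cexp0 divff //.
exact: cexp_neq0.
Qed.
Lemma cexp_real (x : R) : cexp x%:C = (expR x)%:C.
Proof.
by apply: eqc; rewrite !(Re_cexp, Im_cexp, cE) ?cos0 ?sin0 ?mulr1 ?mulr0.
Qed.
Lemma cexp_conj z : cexp z^* = (cexp z)^*.
Proof. by apply: eqc; rewrite !(Re_cexp, Im_cexp, cE) ?cosN ?sinN ?mulrN. Qed.
Lemma cexpMn z n : cexp (z *+ n) = cexp z ^+ n.
Proof.
elim: n => [|n IH]; first by rewrite mulr0n expr0 cexp0.
by rewrite mulrS cexpD IH exprS.
Qed.
Lemma normc_ei (y : R) : normc (cexp (0 +i* y)) = 1.
Proof. by rewrite normc_cexp expR0. Qed.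

(** Reduces complex limits to limits of a real modulus; they are stated in
    that form from here on, so that squeezing and comparison of real functions
    apply to them directly. *)
Lemma ccvgP (T : Type) (F : set_system T) {FF : Filter F} (f : T -> C) (l : C) :
  ((f : T -> C^o) @ F --> (l : C^o)) <-> (normc (f x - l) @[x --> F] --> 0).
Proof.
split=> [/cvgrPdist_lt h|/cvgrPdist_lt h].
- apply/cvgrPdist_lt => e e0.
  have e0' : 0 < e%:C by rewrite ltcR.
  have := h _ e0'; apply: filterS => x.
  by rewrite normc_norm ltcR sub0r normrN ger0_norm ?normc_ge0 // normc_distC.
- apply/cvgrPdist_lt => e; rewrite ltcE => /andP[/eqP ei e0].
  have := h _ e0; apply: filterS => x.
  rewrite sub0r normrN ger0_norm ?normc_ge0 // => hx.
  by rewrite normc_norm ltcE /= ei eqxx /= -[X in normc X]opprB normcN.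
Qed.
Lemma ccvg_ReIm (T : Type) (F : set_system T) {FF : Filter F} (f : T -> C) (l : C) :
  normc (f x - l) @[x --> F] --> 0 <->
  (Re (f x) @[x --> F] --> Re l /\ Im (f x) @[x --> F] --> Im l).
Proof.
split=> [h|[h1 h2]].
- split; apply/cvgrPdist_lt => e e0; have /cvgrPdist_lt /(_ _ e0) := h;
    apply: filterS => x; rewrite sub0r normrN ger0_norm ?normc_ge0 // => hx;
    rewrite distrC.
  + by apply: le_lt_trans hx; rewrite -Re_opp -Re_add Re_le_normc.
  + by apply: le_lt_trans hx; rewrite -Im_opp -Im_add Im_le_normc.
- have -> : (0 : R) = `|Re l - Re l| + `|Im l - Im l| by rewrite !subrr normr0 addr0.
  have h : `|Re (f x) - Re l| + `|Im (f x) - Im l| @[x --> F] -->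
    `|Re l - Re l| + `|Im l - Im l|.
    apply: cvgD; apply: cvg_norm; apply: cvgB => //; exact: cvg_cst.
  have z : `|Re l - Re l| + `|Im l - Im l| = 0 by rewrite !subrr normr0 addr0.
  rewrite z in h *.
  apply: (@squeeze_cvgr _ _ _ _ (fun=> 0) (fun x => `|Re (f x) - Re l| + `|Im (f x) - Im l|)).
  + apply: nearW => x; rewrite normc_ge0 /=.
    by apply: le_trans (normc_le_ReIm _) _; rewrite !cE.
  + exact: cvg_cst.
  + exact: h.
Qed.
Lemma ccvg_squeeze (T : Type) (F : set_system T) {FF : Filter F} (f : T -> C) (l : C) (g : T -> R) :
  (\forall x \near F, normc (f x - l) <= g x) -> g @ F --> 0 ->
  normc (f x - l) @[x --> F] --> 0.
Proof.
move=> h hg; apply: (squeeze_cvgr _ (cvg_cst 0) hg).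
by apply: filterS h => x ->; rewrite normc_ge0.
Qed.
Lemma ccvg_unique (T : Type) (F : set_system T) {FF : ProperFilter F} (f : T -> C) (l m : C) :
  normc (f x - l) @[x --> F] --> 0 -> normc (f x - m) @[x --> F] --> 0 -> l = m.
Proof.
move=> /ccvg_ReIm[h1 h2] /ccvg_ReIm[h3 h4]; apply: eqc.
- exact: (cvg_unique _ h1 h3).
- exact: (cvg_unique _ h2 h4).
Qed.
Lemma ccvgM (T : Type) (F : set_system T) {FF : Filter F} (f g : T -> C) (l m : C) :
  normc (f x - l) @[x --> F] --> 0 -> normc (g x - m) @[x --> F] --> 0 ->
  normc (f x * g x - l * m) @[x --> F] --> 0.
Proof.
move=> /ccvg_ReIm[h1 h2] /ccvg_ReIm[h3 h4]; apply/ccvg_ReIm.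
rewrite !cE; split.
- under eq_fun do rewrite !cE.
  by apply: cvgB; apply: cvgM.
- under eq_fun do rewrite !cE.
  by apply: cvgD; apply: cvgM.
Qed.
Lemma ccvgD (T : Type) (F : set_system T) {FF : Filter F} (f g : T -> C) (l m : C) :
  normc (f x - l) @[x --> F] --> 0 -> normc (g x - m) @[x --> F] --> 0 ->
  normc (f x + g x - (l + m)) @[x --> F] --> 0.
Proof.
move=> /ccvg_ReIm[h1 h2] /ccvg_ReIm[h3 h4]; apply/ccvg_ReIm.
rewrite !cE; split.
- by under eq_fun do rewrite !cE; apply: cvgD.
- by under eq_fun do rewrite !cE; apply: cvgD.
Qed.
Lemma ccvg_cst (T : Type) (F : set_system T) {FF : Filter F} (l : C) :
  normc (l - l) @[x --> F] --> (0:R).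
Proof. by rewrite subrr normc0; exact: cvg_cst. Qed.
Lemma ccvgV (T : Type) (F : set_system T) {FF : Filter F} (f : T -> C) (l : C) :
  l != 0 -> normc (f x - l) @[x --> F] --> 0 ->
  normc ((f x)^-1 - l^-1) @[x --> F] --> 0.
Proof.
move=> l0 /ccvg_ReIm[h1 h2]; apply/ccvg_ReIm.
have n0 : Re l ^+ 2 + Im l ^+ 2 != 0 by rewrite -normcE2 expf_neq0 // normc_eq0.
have h3 : (Re (f x) ^+ 2 + Im (f x) ^+ 2)^-1 @[x --> F] -->
    (Re l ^+ 2 + Im l ^+ 2)^-1.
  by apply: cvgV => //; apply: cvgD; apply: cvgM.
rewrite !cE; split; under eq_fun do rewrite !cE; apply: cvgM => //.
exact: cvgN.
Qed.
Lemma ccvg_normc (T : Type) (F : set_system T) {FF : Filter F} (f : T -> C) (l : C) :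
  normc (f x - l) @[x --> F] --> 0 -> normc (f x) @[x --> F] --> normc l.
Proof.
move=> h; apply/cvgrPdist_lt => e e0; have /cvgrPdist_lt /(_ _ e0) := h.
apply: filterS => x; rewrite sub0r normrN ger0_norm ?normc_ge0 // => hx.
by rewrite distrC; apply: le_lt_trans hx; exact: normc_dist_dist.
Qed.
Lemma ccvg_lim (T : Type) (F : set_system T) {FF : ProperFilter F} (f : T -> C) (l : C) :
  normc (f x - l) @[x --> F] --> 0 -> lim ((f : T -> C^o) @ F) = l.
Proof. by move=> /ccvgP h; apply: cvg_lim h. Qed.
Lemma ccvg_cexp (T : Type) (F : set_system T) {FF : Filter F} (f : T -> C) (l : C) :
  normc (f x - l) @[x --> F] --> 0 -> normc (cexp (f x) - cexp l) @[x --> F] --> 0.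
Proof.
move=> /ccvg_ReIm[h1 h2]; apply/ccvg_ReIm; rewrite /cexp /=; split; apply: cvgM.
- exact: (cvg_comp _ _ h1 (@continuous_expR R _)).
- exact: (cvg_comp _ _ h2 (@continuous_cos R _)).
- exact: (cvg_comp _ _ h1 (@continuous_expR R _)).
- exact: (cvg_comp _ _ h2 (@continuous_sin R _)).
Qed.
Lemma ccvg_real (T : Type) (F : set_system T) {FF : Filter F} (f : T -> R) (l : R) :
  f @ F --> l -> normc ((f x)%:C - l%:C) @[x --> F] --> 0.
Proof. by move=> h; apply/ccvg_ReIm => /=; split => //; exact: cvg_cst. Qed.
End ComplexBasics.

(** * Measurability of real and complex functions *)
Notation mrfun := measurable_fun (only parsing).
Section MeasRe.
Context {d} {T : measurableType d} {R : realType}.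
Local Notation C := R[i].
Implicit Types (D : set T) (f g : T -> R).
Lemma mrD D f g : mrfun D f -> mrfun D g -> mrfun D (fun x => f x + g x).
Proof. exact: measurable_funD. Qed.
Lemma mrN D f : mrfun D f -> mrfun D (fun x => - f x).
Proof. by move=> h; apply: measurableT_comp. Qed.
Lemma mrM D f g : mrfun D f -> mrfun D g -> mrfun D (fun x => f x * g x).
Proof. exact: measurable_funM. Qed.
Lemma mrX D f n : mrfun D f -> mrfun D (fun x => f x ^+ n).
Proof. exact: measurable_funX. Qed.
Lemma mr_cst D (c : R) : mrfun D (fun=> c).
Proof. exact: measurable_cst. Qed.
Lemma mr_comp D f (g : R -> R) : measurable_fun setT g -> mrfun D f -> mrfun D (fun x => g (f x)).
Proof. by move=> h hf; apply: measurableT_comp. Qed.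
Lemma mr_cont D f (g : R -> R) : continuous g -> mrfun D f -> mrfun D (fun x => g (f x)).
Proof. by move=> h; apply: mr_comp; apply: continuous_measurable_fun. Qed.
Lemma mrV D f : mrfun D f -> mrfun D (fun x => (f x)^-1).
Proof.
apply: mr_comp; move=> _ B mB; rewrite setTI.
rewrite (_ : _ @^-1` B = ((@GRing.inv R) @^-1` B `&` [set 0]) `|` ((@GRing.inv R) @^-1` B `&` ~` [set 0])); last first.
  by rewrite -setIUr setUCr setIT.
apply: measurableU.
- have [h|h] := pselect (B (0:R)^-1).
  + rewrite (_ : _ `&` _ = [set 0]) //; apply/seteqP; split=> x /=; first by case.
    by move=> ->; split.
  + rewrite (_ : _ `&` _ = set0) //; apply/seteqP; split=> x //= -[] /[swap] ->.
    by move/h.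
- rewrite setIC.
  have : measurable_fun (~` [set (0:R)]) (@GRing.inv R).
    apply: open_continuous_measurable_fun; first exact/closed_openC/closed_eq.
    by move=> x; rewrite inE /= => /eqP x0; apply: inv_continuous.
  by apply => //; apply: measurableC.
Qed.
Lemma mr_norm D f : mrfun D f -> mrfun D (fun x => `|f x|).
Proof. by move=> h; apply: measurableT_comp. Qed.
Lemma mr_expR D f : mrfun D f -> mrfun D (fun x => expR (f x)).
Proof. by apply: mr_comp; exact: measurable_expR. Qed.
Lemma mr_cos D f : mrfun D f -> mrfun D (fun x => cos (f x)).
Proof. by apply: mr_cont; exact: continuous_cos. Qed.
Lemma mr_sin D f : mrfun D f -> mrfun D (fun x => sin (f x)).
Proof. by apply: mr_cont; exact: continuous_sin. Qed.
Lemma mr_ln D f : mrfun D f -> mrfun D (fun x => ln (f x)).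
Proof. by apply: mr_comp; exact: measurable_ln. Qed.
Lemma mr_sqrt D f : mrfun D f -> mrfun D (fun x => Num.sqrt (f x)).
Proof. by apply: mr_cont; exact: sqrt_continuous. Qed.
Lemma mrS D D' f : measurable D' -> D `<=` D' -> mrfun D' f -> mrfun D f.
Proof. by move=> mD; apply: measurable_funS. Qed.
Lemma mr_sum D I (r : seq I) (P : pred I) (F : I -> T -> R) :
  (forall i, mrfun D (F i)) -> mrfun D (fun x => \sum_(i <- r | P i) F i x).
Proof.
move=> h; elim: r => [|i r IH].
  by under [X in mrfun _ X]eq_fun do rewrite big_nil; exact: mr_cst.
under [X in mrfun _ X]eq_fun do rewrite big_cons.
by case: (P i) => //; exact: mrD.
Qed.
Lemma mr_ext D f g : (forall x, D x -> f x = g x) -> mrfun D f -> mrfun D g.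
Proof. by move=> h; apply: eq_measurable_fun => x; rewrite inE; apply: h. Qed.
Implicit Types u v : T -> C.
Definition mcfun D u := mrfun D (fun x => Re (u x)) /\ mrfun D (fun x => Im (u x)).
Lemma mc_re D u : mcfun D u -> mrfun D (fun x => Re (u x)). Proof. by case. Qed.
Lemma mc_im D u : mcfun D u -> mrfun D (fun x => Im (u x)). Proof. by case. Qed.
Lemma mc_cst D (c : C) : mcfun D (fun=> c). Proof. by split; exact: mr_cst. Qed.
Lemma mcD D u v : mcfun D u -> mcfun D v -> mcfun D (fun x => u x + v x).
Proof.
by case=> a b [c e]; split; under [X in mrfun _ X]eq_fun do rewrite !cE; apply: mrD.
Qed.
Lemma mcN D u : mcfun D u -> mcfun D (fun x => - u x).
Proof.
by case=> a b; split; under [X in mrfun _ X]eq_fun do rewrite !cE; apply: mrN.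
Qed.
Lemma mcM D u v : mcfun D u -> mcfun D v -> mcfun D (fun x => u x * v x).
Proof.
case=> a b [c e]; split; under [X in mrfun _ X]eq_fun do rewrite !cE.
- by apply: mrD; [apply: mrM|apply: mrN; apply: mrM].
- by apply: mrD; apply: mrM.
Qed.
Lemma mcX D u n : mcfun D u -> mcfun D (fun x => u x ^+ n).
Proof.
move=> h; elim: n => [|n IH].
  by under [X in mcfun _ X]eq_fun do rewrite expr0; exact: mc_cst.
by under [X in mcfun _ X]eq_fun do rewrite exprS; exact: mcM.
Qed.
Lemma mc_norm D u : mcfun D u -> mrfun D (fun x => normc (u x)).
Proof.
case=> a b; rewrite (_ : (fun _ => _) = fun x => Num.sqrt (Re (u x) ^+ 2 + Im (u x) ^+ 2)).
  by apply: mr_sqrt; apply: mrD; apply: mrX.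
by apply/funext => x; rewrite -normcE2 sqrtr_sqr ger0_norm ?normc_ge0.
Qed.
Lemma mcV D u : mcfun D u -> mcfun D (fun x => (u x)^-1).
Proof.
case=> a b; split; under [X in mrfun _ X]eq_fun do rewrite !cE.
- by apply: mrM => //; apply: mrV; apply: mrD; apply: mrX.
- by apply: mrM => //; [apply: mrN|apply: mrV; apply: mrD; apply: mrX].
Qed.
Lemma mc_real D f : mrfun D f -> mcfun D (fun x => (f x)%:C).
Proof. by move=> h; split => //=; exact: mr_cst. Qed.
Lemma mc_pair D f g : mrfun D f -> mrfun D g -> mcfun D (fun x => f x +i* g x).
Proof. by move=> h; split. Qed.
Lemma mc_cexp D u : mcfun D u -> mcfun D (fun x => cexp (u x)).
Proof.
case=> a b; split; rewrite /cexp /=.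
- by apply: mrM; [apply: mr_expR|apply: mr_cos].
- by apply: mrM; [apply: mr_expR|apply: mr_sin].
Qed.
Lemma mc_conj D u : mcfun D u -> mcfun D (fun x => (u x)^*).
Proof.
case=> a b; split.
- by under [X in mrfun _ X]eq_fun do rewrite !cE.
- by under [X in mrfun _ X]eq_fun do rewrite !cE; exact: mrN.
Qed.
Lemma mcS D D' u : measurable D' -> D `<=` D' -> mcfun D' u -> mcfun D u.
Proof. by move=> mD s [a b]; split; [apply: mrS a|apply: mrS b]. Qed.
Lemma mc_sum D I (r : seq I) (P : pred I) (F : I -> T -> C) :
  (forall i, mcfun D (F i)) -> mcfun D (fun x => \sum_(i <- r | P i) F i x).
Proof.
move=> h; elim: r => [|i r IH].
  by under [X in mcfun _ X]eq_fun do rewrite big_nil; exact: mc_cst.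
under [X in mcfun _ X]eq_fun do rewrite big_cons.
by case: (P i) => //; exact: mcD.
Qed.
Lemma mc_ext D u v : (forall x, D x -> u x = v x) -> mcfun D u -> mcfun D v.
Proof.
by move=> h [a b]; split; [apply: mr_ext a|apply: mr_ext b] => x /h ->.
Qed.

(** The real and imaginary parts converge too, so this is the real case twice. *)
Lemma mc_lim D (u : nat -> T -> C) v : measurable D -> (forall n, mcfun D (u n)) ->
  (forall x, D x -> normc (u n x - v x) @[n --> \oo] --> 0) -> mcfun D v.
Proof.
move=> mD mu h; split.
- apply: (@measurable_fun_cvg _ _ _ D (fun n x => Re (u n x))).
  + by move=> n; case: (mu n).
  + by move=> x /h /ccvg_ReIm [].
- apply: (@measurable_fun_cvg _ _ _ D (fun n x => Im (u n x))).
  + by move=> n; case: (mu n).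
  + by move=> x /h /ccvg_ReIm [].
Qed.
End MeasRe.
Lemma mr_id {R : realType} (D : set R) : mrfun D (fun x => x).
Proof. exact: measurable_id. Qed.
Lemma mc_rc {R : realType} (D : set R) : mcfun D (real_complex R).
Proof. by split; [exact: mr_id|exact: mr_cst]. Qed.
Ltac meas := repeat match goal with
  | h : ?P |- ?P => exact: h
  | |- mcfun _ (fun=> ?c) => exact: mc_cst
  | |- mrfun _ (fun=> ?c) => exact: mr_cst
  | |- mrfun _ (fun x => x) => exact: mr_id
  | |- mcfun _ (fun x => _ + _) => apply: mcD
  | |- mcfun _ (fun x => - _) => apply: mcN
  | |- mcfun _ (fun x => _ * _) => apply: mcM
  | |- mcfun _ (fun x => _ ^+ _) => apply: mcX
  | |- mcfun _ (fun x => _^-1) => apply: mcV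
  | |- mcfun _ (real_complex _) => exact: mc_rc
  | |- mcfun _ (fun x => _%:C) => apply: mc_real
  | |- mcfun _ (fun x => _ +i* _) => apply: mc_pair
  | |- mcfun _ (fun x => cexp _) => apply: mc_cexp
  | |- mcfun _ (fun x => conjc _) => apply: mc_conj
  | |- mcfun _ (fun x => bigop _ _ _) => apply: mc_sum => ?
  | |- mrfun _ (fun x => _ + _) => apply: mrD
  | |- mrfun _ (fun x => - _) => apply: mrN
  | |- mrfun _ (fun x => _ * _) => apply: mrM
  | |- mrfun _ (fun x => _ ^+ _) => apply: mrX
  | |- mrfun _ (fun x => _^-1) => apply: mrV
  | |- mrfun _ (fun x => normc _) => apply: mc_norm
  | |- mrfun _ (fun x => Re _) => apply: mc_re
  | |- mrfun _ (fun x => Im _) => apply: mc_im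
  | |- mrfun _ (fun x => `|_|) => apply: mr_norm
  | |- mrfun _ (fun x => expR _) => apply: mr_expR
  | |- mrfun _ (fun x => cos _) => apply: mr_cos
  | |- mrfun _ (fun x => sin _) => apply: mr_sin
  | |- mrfun _ (fun x => ln _) => apply: mr_ln
  | |- mrfun _ (fun x => Num.sqrt _) => apply: mr_sqrt
  | |- mrfun _ (fun x => bigop _ _ _) => apply: mr_sum => ?
  end.

(** * Integrals of complex functions *)
Section Integration.
Context {R : realType}.
Local Notation C := R[i].
Local Notation mu := (@lebesgue_measure R).
Implicit Types (D : set R) (f g : R -> R) (u v : R -> C).
Definition rint D f := mu.-integrable D (EFin \o f).

(** Complex integrability is domination by one real function, the modulus; the
    integrals of the two parts are recovered in [cint_re] and [cint_im]. *)
Definition cint D u := mcfun D u /\ rint D (fun x => normc (u x)).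
Lemma rint_le D f g : measurable D -> mrfun D f -> (forall x, D x -> `|f x| <= g x) ->
  rint D g -> rint D f.
Proof.
move=> mD mf h; apply: le_integrable => //; first exact/measurable_EFinP.
by move=> x /h hx /=; rewrite lee_fin (le_trans hx) // ler_norm.
Qed.
Lemma rint_meas D f : rint D f -> mrfun D f.
Proof. by move=> /measurable_int /measurable_EFinP. Qed.
Lemma rintD D f g : measurable D -> rint D f -> rint D g -> rint D (fun x => f x + g x).
Proof. by move=> mD h1 h2; exact: (integrableD _ h1 h2). Qed.
Lemma rintN D f : measurable D -> rint D f -> rint D (fun x => - f x).
Proof. by move=> mD h1; have := @integrableN _ _ _ mu D _ h1; apply. Qed.
Lemma rintB D f g : measurable D -> rint D f -> rint D g -> rint D (fun x => f x - g x).
Proof. by move=> mD h1 h2; apply: rintD => //; exact: rintN. Qed.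
Lemma rintZ D f (k : R) : measurable D -> rint D f -> rint D (fun x => k * f x).
Proof. by move=> mD h1; exact: (integrableZl _ k h1). Qed.
Lemma rint_norm D f : rint D f -> rint D (fun x => `|f x|).
Proof. exact: integrable_norm. Qed.
Lemma rint0 D : measurable D -> rint D (fun=> 0).
Proof. by move=> mD; exact: integrable0. Qed.
Lemma rintS D D' f : measurable D -> measurable D' -> D `<=` D' -> rint D' f -> rint D f.
Proof. by move=> mD mD' s; apply: integrableS. Qed.
Lemma rint_ext D f g : measurable D -> (forall x, D x -> f x = g x) -> rint D f -> rint D g.
Proof.
move=> mD h hf; have := @eq_integrable _ _ _ mu D mD _ (EFin \o g) _ hf; apply.
by move=> x; rewrite inE /= => /h ->.
Qed.
Lemma rint_sum D I (r : seq I) (P : pred I) (F : I -> R -> R) : measurable D ->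
  (forall i, rint D (F i)) -> rint D (fun x => \sum_(i <- r | P i) F i x).
Proof.
move=> mD h; elim: r => [|i r IH].
  by apply: rint_ext (rint0 mD) => // x _; rewrite big_nil.
case: (boolP (P i)) => Pi.
  by apply: rint_ext (rintD mD (h i) IH) => // x _; rewrite big_cons Pi.
by apply: rint_ext IH => // x _; rewrite big_cons (negbTE Pi).
Qed.
Lemma EFin_Rint D f : measurable D -> rint D f ->
  (\int[mu]_(x in D) f x)%:E = (\int[mu]_(x in D) (f x)%:E)%E.
Proof. by move=> mD h; rewrite /Rintegral fineK //; exact: integrable_fin_num. Qed.
Lemma rint_ge0P D f : measurable D -> mrfun D f -> (forall x, D x -> 0 <= f x) ->
  (\int[mu]_(x in D) (f x)%:E < +oo)%E -> rint D f.
Proof.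
move=> mD mf f0 h; apply/integrableP; split; first exact/measurable_EFinP.
apply: le_lt_trans h; apply: ge0_le_integral => //.
- by apply: measurableT_comp => //; exact/measurable_EFinP.
- exact/measurable_EFinP.
- by move=> x /f0 fx /=; rewrite lee_fin ger0_norm.
Qed.
Lemma rint_cst_fin D (c : R) : measurable D -> (mu D < +oo)%E -> rint D (fun=> `|c|).
Proof.
move=> mD fD; apply: rint_ge0P => //.
by rewrite integral_cst // lte_mul_pinfty // lee_fin.
Qed.
Lemma rint_bounded D f (M : R) : measurable D -> (mu D < +oo)%E -> mrfun D f ->
  (forall x, D x -> `|f x| <= M) -> rint D f.
Proof.
move=> mD fD mf h; apply: (@rint_le D f (fun=> `|M|)) => //.
  by move=> x /h /le_trans; apply; exact: ler_norm.
exact: rint_cst_fin.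
Qed.
Lemma rint_ge0B D f (M : R) : measurable D -> mrfun D f -> (forall x, D x -> 0 <= f x) ->
  (\int[mu]_(x in D) (f x)%:E <= M%:E)%E -> rint D f /\ \int[mu]_(x in D) f x <= M.
Proof.
move=> mD mf f0 h.
have hi : rint D f by apply: rint_ge0P => //; apply: le_lt_trans h _; rewrite ltry.
by split => //; rewrite -lee_fin EFin_Rint.
Qed.
Lemma Rint_le0 D f g : measurable D -> rint D f -> rint D g -> (forall x, D x -> f x <= g x) ->
  \int[mu]_(x in D) f x <= \int[mu]_(x in D) g x.
Proof. by move=> mD h1 h2 h; apply: (le_Rintegral _ h1 h2). Qed.
Lemma RintZ D (k : R) f : measurable D -> rint D f ->
  \int[mu]_(x in D) (k * f x) = k * \int[mu]_(x in D) f x.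
Proof. by move=> mD h; exact: (RintegralZl _ _ h). Qed.
Lemma RintD D f g : measurable D -> rint D f -> rint D g ->
  \int[mu]_(x in D) (f x + g x) = \int[mu]_(x in D) f x + \int[mu]_(x in D) g x.
Proof. by move=> mD h h'; exact: (RintegralD _ h h'). Qed.
Lemma RintB D f g : measurable D -> rint D f -> rint D g ->
  \int[mu]_(x in D) (f x - g x) = \int[mu]_(x in D) f x - \int[mu]_(x in D) g x.
Proof. by move=> mD h h'; exact: (RintegralB _ h h'). Qed.
Lemma Rint_sum D I (r : seq I) (P : pred I) (F : I -> R -> R) : measurable D ->
  (forall i, rint D (F i)) ->
  \int[mu]_(x in D) (\sum_(i <- r | P i) F i x) = \sum_(i <- r | P i) \int[mu]_(x in D) F i x.
Proof.
move=> mD h; elim: r => [|i r IH].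
  rewrite big_nil; under eq_Rintegral do rewrite big_nil.
  by rewrite Rintegral_cst // mul0r.
rewrite big_cons -IH; case: (boolP (P i)) => Pi.
  rewrite -(RintegralD _ (h i) (rint_sum _ _ mD h)) //.
  by apply: eq_Rintegral => x _; rewrite big_cons Pi.
by apply: eq_Rintegral => x _; rewrite big_cons (negbTE Pi).
Qed.
Lemma Rint_ae D f g : measurable D -> mrfun D f -> mrfun D g -> ae_eq mu D f g ->
  \int[mu]_(x in D) f x = \int[mu]_(x in D) g x.
Proof.
move=> mD mf mg h; congr fine; apply: ae_eq_integral => //; try exact/measurable_EFinP.
by apply: filterS h => x hx /hx ->.
Qed.
Lemma rint_ae D f g : measurable D -> mrfun D g -> ae_eq mu D f g -> rint D f -> rint D g.
Proof.
move=> mD mg h hf; apply/integrableP; split; first exact/measurable_EFinP.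
rewrite -(_ : \int[mu]_(x in D) `|(f x)%:E| = \int[mu]_(x in D) `|(g x)%:E|)%E.
  by case/integrableP: hf.
apply: ae_eq_integral => //; try by apply: measurableT_comp => //; exact/measurable_EFinP.
- by apply: measurableT_comp => //; apply/measurable_EFinP; exact: rint_meas.
- by apply: filterS h => x hx /hx ->.
Qed.
Lemma aeS (P Q : R -> Prop) : (forall x, P x -> Q x) ->
  {ae mu, forall x, P x} -> {ae mu, forall x, Q x}.
Proof. by move=> h [A [mA A0 hA]]; exists A; split => // x hx; apply: hA => /h. Qed.
Lemma ae2 (P Q S : R -> Prop) : (forall x, P x -> Q x -> S x) ->
  {ae mu, forall x, P x} -> {ae mu, forall x, Q x} -> {ae mu, forall x, S x}.
Proof.
move=> h [A [mA A0 hA]] [B [mB B0 hB]]; exists (A `|` B); split.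
- exact: measurableU.
- by rewrite measureU0.
- move=> x hx; have [p|p] := pselect (P x); last by left; apply: hA.
  by right; apply: hB => q; apply: hx; apply: h.
Qed.
Lemma aeT (P : R -> Prop) : (forall x, P x) -> {ae mu, forall x, P x}.
Proof. by move=> h; exists set0; split => // x /=. Qed.
Lemma rDCT D (F : nat -> R -> R) f g : measurable D -> (forall n, mrfun D (F n)) ->
  mrfun D f ->
  {ae mu, forall x, D x -> F n x @[n --> \oo] --> f x} ->
  {ae mu, forall x n, D x -> `|F n x| <= g x} -> rint D g ->
  rint D f /\ \int[mu]_(x in D) F n x @[n --> \oo] --> \int[mu]_(x in D) f x.
Proof.
move=> mD mF mf hF hg ig.
have [] := @dominated_convergence _ _ R mu D mD (fun n => EFin \o F n) (EFin \o f) (EFin \o g).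
- by move=> n; apply/measurable_EFinP; exact: mF.
- exact/measurable_EFinP.
- apply: aeS hF => x hx /hx h; apply: cvg_comp h _.
  exact: cvg_id.
- exact: ig.
- by apply: aeS hg => x hx n /(hx n); rewrite /= lee_fin.
- move=> i1 _ i2; split => //.
  have h : (\int[mu]_(x in D) (F n x)%:E)%E @[n --> \oo] --> (\int[mu]_(x in D) f x)%:E.
    by rewrite EFin_Rint.
  exact: fine_cvg h.
Qed.
Lemma cint_meas D u : cint D u -> mcfun D u. Proof. by case. Qed.
Lemma cint_norm D u : cint D u -> rint D (fun x => normc (u x)). Proof. by case. Qed.
Lemma cint_le D u g : measurable D -> mcfun D u -> (forall x, D x -> normc (u x) <= g x) ->
  rint D g -> cint D u.
Proof.
move=> mD mu0 h hg; split=> //; apply: rint_le hg => //; first exact: mc_norm.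
by move=> x /h; rewrite ger0_norm ?normc_ge0.
Qed.
Lemma cint_re D u : measurable D -> cint D u -> rint D (fun x => Re (u x)).
Proof.
by move=> mD [[h1 h2] h]; apply: rint_le h => // x _; exact: Re_le_normc.
Qed.
Lemma cint_im D u : measurable D -> cint D u -> rint D (fun x => Im (u x)).
Proof.
by move=> mD [[h1 h2] h]; apply: rint_le h => // x _; exact: Im_le_normc.
Qed.
Lemma cint_ReIm D u : measurable D -> rint D (fun x => Re (u x)) ->
  rint D (fun x => Im (u x)) -> cint D u.
Proof.
move=> mD h1 h2; apply: (@cint_le D u (fun x => `|Re (u x)| + `|Im (u x)|)) => //.
- by split; exact: rint_meas.
- by move=> x _; exact: normc_le_ReIm.
- by apply: rintD => //; exact: rint_norm.
Qed.
Lemma cintD D u v : measurable D -> cint D u -> cint D v -> cint D (fun x => u x + v x).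
Proof.
move=> mD hu hv; apply: (@cint_le D _ (fun x => normc (u x) + normc (v x))) => //.
- by apply: mcD; exact: cint_meas.
- by move=> x _; exact: normc_leD.
- by apply: rintD => //; exact: cint_norm.
Qed.
Lemma cintN D u : measurable D -> cint D u -> cint D (fun x => - u x).
Proof.
move=> mD hu; apply: (@cint_le D _ (fun x => normc (u x))) => //.
- by apply: mcN; exact: cint_meas.
- by move=> x _; rewrite normcN.
- exact: cint_norm.
Qed.
Lemma cintZ D u (c : C) : measurable D -> cint D u -> cint D (fun x => c * u x).
Proof.
move=> mD hu; apply: (@cint_le D _ (fun x => normc c * normc (u x))) => //.
- by apply: mcM; [exact: mc_cst|exact: cint_meas].
- by move=> x _; rewrite normcM.
- by apply: rintZ => //; exact: cint_norm.
Qed.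
Lemma cint0 D : measurable D -> cint D (fun=> 0).
Proof.
move=> mD; apply: (@cint_le D _ (fun=> 0)) => //.
- by move=> x _; rewrite normc0.
- exact: rint0.
Qed.
Lemma cint_ext D u v : measurable D -> (forall x, D x -> u x = v x) -> cint D u -> cint D v.
Proof.
move=> mD h [h1 h2]; split; first exact: mc_ext h1.
by apply: rint_ext h2 => // x /h ->.
Qed.
Lemma cint_sum D I (r : seq I) (P : pred I) (F : I -> R -> C) : measurable D ->
  (forall i, cint D (F i)) -> cint D (fun x => \sum_(i <- r | P i) F i x).
Proof.
move=> mD h; elim: r => [|i r IH].
  by apply: cint_ext (cint0 mD) => // x _; rewrite big_nil.
case: (boolP (P i)) => Pi.
  by apply: cint_ext (cintD mD (h i) IH) => // x _; rewrite big_cons Pi.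
by apply: cint_ext IH => // x _; rewrite big_cons (negbTE Pi).
Qed.
Lemma cintS D D' u : measurable D -> measurable D' -> D `<=` D' -> cint D' u -> cint D u.
Proof. by move=> mD mD' s [a b]; split; [exact: mcS a|exact: rintS b]. Qed.
Lemma cint_real D f : rint D f -> cint D (fun x => (f x)%:C).
Proof.
move=> h; split; first by apply: mc_real; exact: rint_meas.
have := rint_norm h.
by under [X in rint D X -> _]eq_fun do rewrite -normc_real.
Qed.
Lemma Cint_ext D u v : (forall x, D x -> u x = v x) -> Cintegral D u = Cintegral D v.
Proof.
by move=> h; rewrite /Cintegral; congr (_ +i* _); apply: eq_Rintegral => x; rewrite inE => /h ->.
Qed.
Lemma CintD D u v : measurable D -> cint D u -> cint D v ->
  Cintegral D (fun x => u x + v x) = Cintegral D u + Cintegral D v.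
Proof.
move=> mD hu hv; apply: eqc; rewrite !cE /=.
- rewrite -(RintegralD _ (cint_re mD hu) (cint_re mD hv)) //.
  by apply: eq_Rintegral => x _; rewrite cE.
- rewrite -(RintegralD _ (cint_im mD hu) (cint_im mD hv)) //.
  by apply: eq_Rintegral => x _; rewrite cE.
Qed.
Lemma CintZ D (c : C) u : measurable D -> cint D u ->
  Cintegral D (fun x => c * u x) = c * Cintegral D u.
Proof.
move=> mD hu; have h1 := cint_re mD hu; have h2 := cint_im mD hu.
apply: eqc; rewrite !cE /=.
- rewrite -!RintZ // -RintB //; try exact: rintZ.
  by apply: eq_Rintegral => x _; rewrite cE.
- rewrite -!RintZ // -RintD //; try exact: rintZ.
  by apply: eq_Rintegral => x _; rewrite cE.
Qed.
Lemma CintN D u : measurable D -> cint D u ->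
  Cintegral D (fun x => - u x) = - Cintegral D u.
Proof.
move=> mD hu; rewrite -mulN1r -CintZ //.
by apply: Cint_ext => x _; rewrite mulN1r.
Qed.
Lemma CintB D u v : measurable D -> cint D u -> cint D v ->
  Cintegral D (fun x => u x - v x) = Cintegral D u - Cintegral D v.
Proof. by move=> mD hu hv; rewrite CintD ?CintN //; exact: cintN. Qed.
Lemma Cint0 D : measurable D -> Cintegral D (fun=> 0) = 0.
Proof.
by move=> mD; rewrite /Cintegral /= Rintegral_cst // mul0r.
Qed.
Lemma Cint_sum D I (r : seq I) (P : pred I) (F : I -> R -> C) : measurable D ->
  (forall i, cint D (F i)) ->
  Cintegral D (fun x => \sum_(i <- r | P i) F i x) = \sum_(i <- r | P i) Cintegral D (F i).
Proof.
move=> mD h; elim: r => [|i r IH].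
  by rewrite big_nil -[RHS](Cint0 mD); apply: Cint_ext => x _; rewrite big_nil.
rewrite big_cons -IH; case: (boolP (P i)) => Pi.
  rewrite -CintD //; last exact: cint_sum.
  by apply: Cint_ext => x _; rewrite big_cons Pi.
by apply: Cint_ext => x _; rewrite big_cons (negbTE Pi).
Qed.
Lemma Cint_conj D u : measurable D -> cint D u ->
  Cintegral D (fun x => (u x)^*) = (Cintegral D u)^*.
Proof.
move=> mD hu; apply: eqc; rewrite !cE /=.
  by apply: eq_Rintegral => x _; rewrite cE.
rewrite -mulN1r -RintZ //; last exact: cint_im.
by apply: eq_Rintegral => x _; rewrite cE mulN1r.
Qed.
Lemma Cint_real D f : Cintegral D (fun x => (f x)%:C) = (\int[mu]_(x in D) f x)%:C.
Proof. by rewrite /Cintegral /= /Rintegral integral0. Qed.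
Lemma Cint_ae D u v : measurable D -> mcfun D u -> mcfun D v -> ae_eq mu D u v ->
  Cintegral D u = Cintegral D v.
Proof.
move=> mD [a b] [c e] h; rewrite /Cintegral; congr (_ +i* _); apply: Rint_ae => //.
- by apply: aeS h => x hx /hx ->.
- by apply: aeS h => x hx /hx ->.
Qed.
Lemma normc_Cint D u : measurable D -> cint D u ->
  normc (Cintegral D u) <= \int[mu]_(x in D) normc (u x).
Proof.
move=> mD hu; have [->|n0] := eqVneq (Cintegral D u) 0.
  by rewrite normc0; apply: Rintegral_ge0 => x _; exact: normc_ge0.
pose I := Cintegral D u; pose c := I^* / (normc I)%:C.
have nI : 0 < normc I by rewrite normc_gt0.
have nIC : (normc I)%:C != 0 :> C by rewrite -normc_gt0 normc_real normr_gt0 gt_eqF.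
have hc : c * I = (normc I)%:C.
  rewrite /c mulrAC [I^* * _]mulrC mulcJ expr2 rmorphM /= mulfK //.
have nc : normc c = 1.
  by rewrite /c normcM normcV normc_real normcJ ger0_norm ?normc_ge0 // divff // gt_eqF.
rewrite -/I -[normc I]/(Re (normc I)%:C) -hc -CintZ // /Cintegral /=.
apply: Rint_le0 => //.
- by apply: cint_re => //; exact: cintZ.
- exact: cint_norm.
- move=> x _; apply: le_trans (ler_norm _) _; apply: le_trans (Re_le_normc _) _.
  by rewrite normcM nc mul1r.
Qed.
Lemma cDCT_ae D (F : nat -> R -> C) (f : R -> C) g : measurable D -> (forall n, mcfun D (F n)) ->
  mcfun D f ->
  {ae mu, forall x, D x -> normc (F n x - f x) @[n --> \oo] --> 0} ->
  {ae mu, forall x n, D x -> normc (F n x) <= g x} -> rint D g ->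
  cint D f /\ normc (Cintegral D (F n) - Cintegral D f) @[n --> \oo] --> 0.
Proof.
move=> mD mF mf hF hg ig.
have [i1 h1] := @rDCT D (fun n x => Re (F n x)) (fun x => Re (f x)) g mD
  (fun n => (mF n).1) mf.1
  (aeS (fun x hx (Dx : D x) => proj1 ((ccvg_ReIm _ _).1 (hx Dx))) hF)
  (aeS (fun x hx n (Dx : D x) => le_trans (Re_le_normc _) (hx n Dx)) hg) ig.
have [i2 h2] := @rDCT D (fun n x => Im (F n x)) (fun x => Im (f x)) g mD
  (fun n => (mF n).2) mf.2
  (aeS (fun x hx (Dx : D x) => proj2 ((ccvg_ReIm _ _).1 (hx Dx))) hF)
  (aeS (fun x hx n (Dx : D x) => le_trans (Im_le_normc _) (hx n Dx)) hg) ig.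
split; first exact: cint_ReIm.
by apply/ccvg_ReIm.
Qed.
Lemma cDCT D (F : nat -> R -> C) (f : R -> C) g : measurable D -> (forall n, mcfun D (F n)) ->
  (forall x, D x -> normc (F n x - f x) @[n --> \oo] --> 0) ->
  (forall x n, D x -> normc (F n x) <= g x) -> rint D g ->
  cint D f /\ normc (Cintegral D (F n) - Cintegral D f) @[n --> \oo] --> 0.
Proof.
move=> mD mF hF hg ig; apply: cDCT_ae ig => //.
- exact: mc_lim hF.
- exact: aeT.
- by apply: aeT => x n; exact: hg.
Qed.

(** Real-valued counterparts of membership in L^2 and of the L^2 norm, related
    to them by [L2P] and [L2normE]: integrals of squares are added and
    compared more easily than extended real norms. *)
Definition sqint D u := mcfun D u /\ rint D (fun x => normc (u x) ^+ 2).
Definition sqnorm D u := \int[mu]_(x in D) (normc (u x) ^+ 2).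
Lemma en_ge0 D u : 0 <= sqnorm D u.
Proof. by apply: Rintegral_ge0 => x _; rewrite exprn_ge0 // normc_ge0. Qed.
Lemma L2normE D u : measurable D -> sqint D u ->
  L2norm D u = (Num.sqrt (sqnorm D u))%:E.
Proof.
move=> mD [m h]; rewrite /L2norm unlock.
rewrite (_ : (\int[mu]_x _)%E = (sqnorm D u)%:E); last first.
  rewrite /sqnorm EFin_Rint // [RHS]integral_mkcond; apply: eq_integral => x _.
  rewrite /patch; case: ifP => _ /=.
    by rewrite ger0_norm ?normc_ge0 // powR_mulrn ?normc_ge0.
  by rewrite normr0 powR0 ?pnatr_eq0.
by rewrite poweR_EFin powR12_sqrt // en_ge0.
Qed.
Lemma L2P D u : measurable D -> L2 D u <-> sqint D u.
Proof.
move=> mD; split=> [[m1 m2 h]|h]; last first.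
  by case: (h) => -[? ?] _; split => //; rewrite L2normE // ltry.
have mm : mcfun D u by split.
split=> //; apply: rint_ge0P => //; first by apply: mrX; exact: mc_norm.
  by move=> x _; rewrite exprn_ge0 // normc_ge0.
move: h; rewrite /L2norm unlock.
rewrite (_ : (\int[mu]_x _)%E = \int[mu]_(x in D) ((normc (u x) ^+ 2)%:E))%E; last first.
  rewrite [RHS]integral_mkcond; apply: eq_integral => x _.
  rewrite /patch; case: ifP => _ /=.
    by rewrite ger0_norm ?normc_ge0 // powR_mulrn ?normc_ge0.
  by rewrite normr0 powR0 ?pnatr_eq0.
case: (integral _ _ _) => [r _| |//]; first by rewrite ltry.
by rewrite poweRyr // invr_eq0 pnatr_eq0.
Qed.
End Integration.

(** * Square integrable functions *)
Section L2Tools.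
Context {R : realType}.
Local Notation C := R[i].
Local Notation mu := (@lebesgue_measure R).
Implicit Types (D : set R) (f g : R -> R) (u v : R -> C).
Lemma sq_le D u (H : R -> R) : measurable D -> mcfun D u ->
  (forall x, D x -> normc (u x) <= H x) -> rint D (fun x => H x ^+ 2) -> sqint D u.
Proof.
move=> mD mu0 h hH; split => //; apply: rint_le hH => //.
  by apply: mrX; exact: mc_norm.
move=> x Dx; rewrite ger0_norm ?exprn_ge0 ?normc_ge0 //.
by apply: lerXn2r; rewrite ?nnegrE ?normc_ge0 ?h // (le_trans (normc_ge0 _) (h _ Dx)).
Qed.
Lemma sq_le_c D u v : measurable D -> mcfun D u ->
  (forall x, D x -> normc (u x) <= normc (v x)) -> sqint D v -> sqint D u.
Proof. by move=> mD mu0 h [_ hv]; apply: sq_le hv. Qed.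
Lemma sq_ext D u v : measurable D -> (forall x, D x -> u x = v x) -> sqint D u -> sqint D v.
Proof.
move=> mD h hu; apply: sq_le_c (hu) => //; first by apply: mc_ext hu.1.
by move=> x /h ->.
Qed.
Lemma sqZ D (c : C) u : measurable D -> sqint D u -> sqint D (fun x => c * u x).
Proof.
move=> mD [m h]; split; first by apply: mcM => //; exact: mc_cst.
by apply: rint_ext (rintZ (normc c ^+ 2) mD h) => // x _; rewrite normcM exprMn.
Qed.

(** Expand the square and bound the cross term by [2 |a| |b| <= e |a|^2 + e^-1
    |b|^2].  The free weight [e] yields both the triangle inequality in L^2,
    at its optimum, and estimates with a constant close to one. *)
Lemma sqr_normcD (a b : C) (e : R) : 0 < e ->
  normc (a + b) ^+ 2 <= (1 + e) * normc a ^+ 2 + (1 + e^-1) * normc b ^+ 2.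
Proof.
move=> e0; have h : normc (a + b) ^+ 2 <= (normc a + normc b) ^+ 2.
  by apply: lerXn2r; rewrite ?nnegrE ?addr_ge0 ?normc_ge0 // normc_leD.
apply: le_trans h _; set x := normc a; set y := normc b.
rewrite -subr_ge0.
have -> : (1 + e) * x ^+ 2 + (1 + e^-1) * y ^+ 2 - (x + y) ^+ 2 =
  e * (x - e^-1 * y) ^+ 2.
  by field; rewrite gt_eqF.
by rewrite mulr_ge0 ?sqr_ge0 // ltW.
Qed.
Lemma sqD D u v : measurable D -> sqint D u -> sqint D v -> sqint D (fun x => u x + v x).
Proof.
move=> mD [m h] [m' h']; split; first exact: mcD.
apply: (@rint_le _ _ _ (fun x => (1 + 1) * normc (u x) ^+ 2 + (1 + 1^-1) * normc (v x) ^+ 2)) => //.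
- by meas.
- by move=> x _; rewrite ger0_norm ?exprn_ge0 ?normc_ge0 //; exact: sqr_normcD.
- by apply: rintD => //; exact: rintZ.
Qed.
Lemma sqN D u : measurable D -> sqint D u -> sqint D (fun x => - u x).
Proof.
by move=> mD h; apply: sq_ext (sqZ (-1) mD h) => // x _; rewrite mulN1r.
Qed.
Lemma sqB D u v : measurable D -> sqint D u -> sqint D v -> sqint D (fun x => u x - v x).
Proof. by move=> mD hu hv; apply: sqD => //; exact: sqN. Qed.
Lemma sqS D D' u : measurable D -> measurable D' -> D `<=` D' -> sqint D' u -> sqint D u.
Proof. by move=> mD mD' s [a b]; split; [exact: mcS a|exact: rintS b]. Qed.
Lemma sq_ae D u v : measurable D -> mcfun D v -> ae_eq mu D u v -> sqint D u -> sqint D v.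
Proof.
move=> mD mv h [m hu]; split => //; apply: rint_ae hu => //; first by meas.
by apply: aeS h => x hx /hx ->.
Qed.
Lemma en_le_eps D u v (e : R) : measurable D -> 0 < e -> sqint D u -> sqint D v ->
  sqnorm D (fun x => u x + v x) <= (1 + e) * sqnorm D u + (1 + e^-1) * sqnorm D v.
Proof.
move=> mD e0 hu hv; have := sqD mD hu hv; case: hu hv => [_ hu] [_ hv] [_ huv].
rewrite /sqnorm -!RintZ // -RintD //; try exact: rintZ.
apply: Rint_le0 => //; first by apply: rintD => //; exact: rintZ.
by move=> x _; exact: sqr_normcD.
Qed.
Lemma en_leD D u v : measurable D -> sqint D u -> sqint D v ->
  sqnorm D (fun x => u x + v x) <= 2 * sqnorm D u + 2 * sqnorm D v.
Proof.
by move=> mD hu hv; have := en_le_eps mD (@ltr01 R) hu hv; rewrite invr1.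
Qed.
Lemma en_ext D u v : (forall x, D x -> u x = v x) -> sqnorm D u = sqnorm D v.
Proof. by move=> h; apply: eq_Rintegral => x; rewrite inE => /h ->. Qed.
Lemma enC D u v : sqnorm D (fun x => u x - v x) = sqnorm D (fun x => v x - u x).
Proof. by apply: eq_Rintegral => x _; rewrite normc_distC. Qed.
Lemma enZ D (c : C) u : measurable D -> sqint D u ->
  sqnorm D (fun x => c * u x) = normc c ^+ 2 * sqnorm D u.
Proof.
move=> mD [_ h]; rewrite /sqnorm -RintZ //.
by apply: eq_Rintegral => x _; rewrite normcM exprMn.
Qed.
Lemma en_ae D u v : measurable D -> mcfun D u -> mcfun D v -> ae_eq mu D u v ->
  sqnorm D u = sqnorm D v.
Proof.
move=> mD hu hv h; apply: Rint_ae => //; try by meas.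
by apply: aeS h => x hx /hx ->.
Qed.
Lemma en_le D u v : measurable D -> sqint D u -> sqint D v ->
  (forall x, D x -> normc (u x) <= normc (v x)) -> sqnorm D u <= sqnorm D v.
Proof.
move=> mD [_ hu] [_ hv] h; apply: Rint_le0 => // x /h hx.
by apply: lerXn2r; rewrite ?nnegrE ?normc_ge0.
Qed.
Lemma en_S D D' u : measurable D -> measurable D' -> D `<=` D' -> sqint D' u ->
  sqnorm D u <= sqnorm D' u.
Proof.
move=> mD mD' s h; have h' := sqS mD mD' s h.
rewrite -lee_fin /sqnorm !EFin_Rint //; [|by case: h|by case: h'].
apply: ge0_subset_integral => //.
- by apply/measurable_EFinP; case: h => m _; meas.
- by move=> x _; rewrite lee_fin exprn_ge0 // normc_ge0.
Qed.
Lemma cint_mul D u v : measurable D -> sqint D u -> sqint D v -> cint D (fun x => u x * v x).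
Proof.
move=> mD [m h] [m' h'].
apply: (@cint_le _ _ _ (fun x => normc (u x) ^+ 2 + normc (v x) ^+ 2)) => //.
- by meas.
- move=> x _; rewrite normcM; set a := normc _; set b := normc _.
  have := sqr_ge0 (a - b); have := sqr_ge0 (a + b); nra.
- exact: rintD.
Qed.

(** The choice [e = sqrt b / sqrt a] makes both terms equal to [sqrt (a * b)];
    the degenerate cases [a = 0] and [b = 0] let [e] go to infinity or to
    zero. *)
Lemma CS_aux (a b c : R) : 0 <= a -> 0 <= b -> 0 <= c ->
  (forall e, 0 < e -> 2 * c <= e * a + e^-1 * b) -> c ^+ 2 <= a * b.
Proof.
move=> a0 b0 c0 h; have [ha|ha] := ltrP 0 a; last first.
  have a00 : a = 0 by apply/eqP; rewrite eq_le ha a0.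
  rewrite a00 mul0r; suff -> : c = 0 by rewrite expr0n.
  apply/eqP; rewrite eq_le c0 andbT; apply/ler_addgt0Pr => e e0; rewrite add0r.
  have e1 : 0 < (b + 1) / e by rewrite divr_gt0 // ltr_wpDl.
  have := h _ e1; rewrite a00 mulr0 add0r invf_div => h1.
  have h2 : e / (b + 1) * b <= e.
    by rewrite mulrAC ler_pdivrMr ?ltr_wpDl // ler_pM2l // lerDl.
  by have := le_trans h1 h2; lra.
have [hb|hb] := ltrP 0 b; last first.
  have b00 : b = 0 by apply/eqP; rewrite eq_le hb b0.
  rewrite b00 mulr0; suff -> : c = 0 by rewrite expr0n.
  apply/eqP; rewrite eq_le c0 andbT; apply/ler_addgt0Pr => e e0; rewrite add0r.
  have e1 : 0 < e / a by rewrite divr_gt0.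
  have := h _ e1; rewrite b00 mulr0 addr0 divfK ?gt_eqF // => h1; lra.
have e1 : 0 < Num.sqrt b / Num.sqrt a by rewrite divr_gt0 ?sqrtr_gt0.
have := h _ e1; set s := Num.sqrt a; set t := Num.sqrt b.
have hs : s ^+ 2 = a by rewrite sqr_sqrtr.
have ht : t ^+ 2 = b by rewrite sqr_sqrtr.
have s0 : 0 < s by rewrite sqrtr_gt0.
have t0 : 0 < t by rewrite sqrtr_gt0.
rewrite -hs -ht.
have -> : t / s * s ^+ 2 + (t / s)^-1 * t ^+ 2 = 2 * (s * t).
  by field; rewrite !gt_eqF.
rewrite ler_pM2l // => h1; rewrite -exprMn.
by apply: lerXn2r => //; rewrite nnegrE // mulr_ge0 // ltW.
Qed.
Lemma rint_mul D u v : measurable D -> sqint D u -> sqint D v ->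
  rint D (fun x => normc (u x) * normc (v x)).
Proof.
by move=> mD hu hv; have [_] := cint_mul mD hu hv; under eq_fun do rewrite normcM.
Qed.
Lemma CauchySchwarz_norm D u v : measurable D -> sqint D u -> sqint D v ->
  (\int[mu]_(x in D) (normc (u x) * normc (v x))) ^+ 2 <= sqnorm D u * sqnorm D v.
Proof.
move=> mD hu hv; apply: CS_aux; rewrite ?en_ge0 //.
  by apply: Rintegral_ge0 => x _; rewrite mulr_ge0 ?normc_ge0.
have hi := rint_mul mD hu hv; case: hu hv => [_ hu] [_ hv].
move=> e e0; rewrite /sqnorm -!RintZ // -RintD //; try exact: rintZ.
apply: Rint_le0 => //; try exact: rintZ.
  by apply: rintD => //; exact: rintZ.
move=> x _; set a := normc _; set b := normc _; rewrite -subr_ge0.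
have -> : e * a ^+ 2 + e^-1 * b ^+ 2 - 2 * (a * b) = e * (a - e^-1 * b) ^+ 2.
  by field; rewrite gt_eqF.
by rewrite mulr_ge0 ?sqr_ge0 // ltW.
Qed.
Lemma CauchySchwarz D u v : measurable D -> sqint D u -> sqint D v ->
  normc (Cintegral D (fun x => u x * v x)) ^+ 2 <= sqnorm D u * sqnorm D v.
Proof.
move=> mD hu hv; apply: le_trans (CauchySchwarz_norm mD hu hv).
apply: lerXn2r; rewrite ?nnegrE ?normc_ge0 //.
  by apply: Rintegral_ge0 => x _; rewrite mulr_ge0 ?normc_ge0.
apply: le_trans (normc_Cint mD (cint_mul mD hu hv)) _.
by under eq_Rintegral do rewrite normcM.
Qed.

(** Dominated convergence for [|F_n - f|^2], which is at most [4 H^2]. *)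
Lemma L2_DCT D (F : nat -> R -> C) (f : R -> C) (H : R -> R) : measurable D ->
  (forall n, mcfun D (F n)) ->
  (forall x, D x -> normc (F n x - f x) @[n --> \oo] --> 0) ->
  (forall n x, D x -> normc (F n x) <= H x) -> rint D (fun x => H x ^+ 2) ->
  sqint D f /\ sqnorm D (fun x => F n x - f x) @[n --> \oo] --> 0.
Proof.
move=> mD mF hF hH iH.
have mf : mcfun D f by exact: mc_lim hF.
have hf x : D x -> normc (f x) <= H x.
  move=> Dx; have h : normc (F n x) @[n --> \oo] --> normc (f x) by exact: ccvg_normc (hF x Dx).
  rewrite -(cvg_lim _ h) //; apply: limr_le; first by apply/cvg_ex; exists (normc (f x)).
  by apply: nearW => n; exact: hH.
split; first exact: sq_le hf iH.
have [_ h] : rint D (fun=> 0) /\ \int[mu]_(x in D) (normc (F n x - f x) ^+ 2) @[n --> \oo] -->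
    \int[mu]_(x in D) (0:R).
  apply: (@rDCT R D (fun n x => normc (F n x - f x) ^+ 2) (fun=> 0)
    (fun x => 4 * H x ^+ 2)) => //.
  - by move=> n; have := mF n => ?; meas.
  - apply: aeT => x Dx; have := hF x Dx => h; rewrite -[X in _ --> X](@mulr0 R 0).
    by under eq_fun do rewrite expr2; exact: cvgM.
  - apply: aeT => x n Dx; rewrite ger0_norm ?exprn_ge0 ?normc_ge0 //.
    have -> : 4 * H x ^+ 2 = (H x + H x) ^+ 2 by ring.
    apply: lerXn2r; rewrite ?nnegrE ?normc_ge0 //.
      by rewrite addr_ge0 // (le_trans (normc_ge0 _) (hH 0%N x Dx)).
    by apply: le_trans (normcB _ _) _; rewrite lerD ?hH ?hf.
  - exact: rintZ.
by move: h; rewrite Rintegral_cst // mul0r.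
Qed.
End L2Tools.

(** * Exponentials on the half line *)
Section Exponentials.
Context {R : realType}.
Local Notation C := R[i].
Local Notation mu := (@lebesgue_measure R).
Implicit Types (t c : R) (k : nat).
Lemma mRplus : measurable (Rplus : set R). Proof. exact: measurable_itv. Qed.
Lemma RplusP t : Rplus t <-> 0 <= t.
Proof. by rewrite /Rplus /= in_itv /= andbT. Qed.
Lemma exp_series_cvg (x : R) : (\sum_(k < n) x ^+ k / k`!%:R) @[n --> \oo] --> expR x.
Proof.
have := @is_cvg_series_exp_coeff R x; rewrite /expR /series /exp_coeff /=.
by under eq_fun do rewrite big_mkord.
Qed.
Lemma exp_series_le (x : R) n : 0 <= x -> \sum_(k < n) x ^+ k / k`!%:R <= expR x.
Proof.
move=> x0; rewrite -(cvg_lim _ (@exp_series_cvg x)) //.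
apply: limr_ge; first by apply/cvg_ex; exists (expR x); exact: exp_series_cvg.
near=> m; have nm : (n <= m)%N by near: m; exact: nbhs_infty_ge.
rewrite -!(big_mkord xpredT (fun k => x ^+ k / k`!%:R)).
rewrite [leRHS](@big_cat_nat _ _ _ n 0 m) //= lerDl sumr_ge0 // => i _.
by rewrite divr_ge0 ?exprn_ge0.
Unshelve. all: by end_near. Qed.
Lemma exp_series_norm_le (x : R) n : `|\sum_(k < n) x ^+ k / k`!%:R| <= expR `|x|.
Proof.
apply: le_trans (ler_norm_sum _ _ _) _.
apply: le_trans (exp_series_le n (normr_ge0 x)).
by apply: ler_sum => i _; rewrite normrM normrX normfV [`|_%:R|]ger0_norm.
Qed.

(** One term of the exponential series. *)
Lemma pow_le_exp (x : R) k : 0 <= x -> x ^+ k <= k`!%:R * expR x.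
Proof.
move=> x0; have := exp_series_le k.+1 x0; rewrite big_ord_recr /= => h.
rewrite mulrC -ler_pdivrMr ?ltr0n ?fact_gt0 //.
apply: le_trans h; rewrite lerDr sumr_ge0 // => i _.
by rewrite divr_ge0 ?exprn_ge0.
Qed.
Lemma int_expc c : 0 < c ->
  rint Rplus (fun t => expR (- (c * t))) /\ \int[mu]_(t in Rplus) expR (- (c * t)) = c^-1.
Proof.
move=> c0; have hd (x : R) : is_derive x (1:R) (fun t => - (c^-1 * expR (- (c * t)))) (expR (- (c * x))).
  by apply: is_derive_eq; rewrite /GRing.scale /=; field; rewrite gt_eqF.
have hI : (\int[mu]_(t in Rplus) (expR (- (c * t)))%:E = (c^-1)%:E)%E.
  rewrite /Rplus (@ge0_continuous_FTC2y _ _ (fun x => - (c^-1 * expR (- (c * x)))) _ 0).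
  - by rewrite mulr0 oppr0 expR0 mulr1 -EFinB sub0r opprK.
  - by move=> x _; exact: expR_ge0.
  - apply: continuous_subspaceT => x; apply: differentiable_continuous.
    by apply/derivable1_diffP.
  - rewrite -oppr0 -[X in - X](mulr0 c^-1); apply: cvgN; apply: cvgMr.
    rewrite (_ : (fun x => expR (- (c * x))) = (fun z => expR (- z)) \o (fun z => c * z)) //.
    apply: (@cvg_comp _ _ _ _ _ _ (pinfty_nbhs R)); last exact: cvgr_expR.
    exact: gt0_cvgMry.
  - by move=> x _; have [] := hd x.
  - have [/derivable1_diffP /differentiable_continuous h _] := hd 0; exact: cvg_at_right_filter h.
  - by move=> x _; rewrite derive1E; have := hd x => ?; rewrite derive_val.
have hr : rint Rplus (fun t => expR (- (c * t))).
  apply: rint_ge0P.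
  - exact: mRplus.
  - by meas.
  - by move=> x _; exact: expR_ge0.
  - by rewrite hI ltry.
by split => //; apply/EFin_inj; rewrite EFin_Rint //; exact: mRplus.
Qed.

(** Half of the exponential absorbs the power, by [pow_le_exp]; the other half
    is integrable. *)
Lemma rint_texp c k : 0 < c -> rint Rplus (fun t => t ^+ k * expR (- (c * t))).
Proof.
move=> c0; have c20 : 0 < c / 2 by rewrite divr_gt0.
have [h _] := int_expc c20.
apply: (@rint_le _ _ _ (fun t => k`!%:R * (c / 2) ^- k * expR (- (c / 2 * t)))) => //.
- exact: mRplus.
- by meas.
- move=> t /RplusP t0; rewrite ger0_norm ?mulr_ge0 ?exprn_ge0 ?expR_ge0 //.
  have -> : - (c * t) = - (c / 2 * t) - (c / 2 * t) by field.
  rewrite expRD mulrA ler_pM2r ?expR_gt0 // expRN ler_pdivrMr ?expR_gt0 //.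
  have := @pow_le_exp (c / 2 * t) k (mulr_ge0 (ltW c20) t0).
  rewrite exprMn => h1; rewrite mulrAC ler_pdivlMr ?exprn_gt0 // mulrC.
  exact: h1.
- by apply: rintZ => //; exact: mRplus.
Qed.
Lemma sq_texp c k : 0 < c -> sqint Rplus (fun t => (t ^+ k * expR (- (c * t)))%:C).
Proof.
move=> c0; split; first by meas.
have c20 : 0 < c * 2 by rewrite mulr_gt0.
apply: rint_ext (@rint_texp (c * 2) (k * 2) c20); first exact: mRplus.
move=> t _; rewrite normc_real real_normK ?num_real // exprMn exprM -expRM_natr.
by congr (_ * expR _); ring.
Qed.
End Exponentials.
#[global] Hint Resolve mRplus : core.

(** * Density of exponentials and of Laguerre functions *)
Section Density.
Import HBNNSimple.
Context {R : realType}.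
Local Notation C := R[i].
Local Notation mu := (@lebesgue_measure R).
Variable V : (R -> C) -> Prop.
Hypothesis V_lin : forall a f g, sqint Rplus f -> sqint Rplus g -> V f -> V g ->
  V (fun t => a * f t + g t).
Hypothesis V_dct : forall (u : nat -> R -> C) f (H : R -> R),
  (forall n, sqint Rplus (u n)) -> sqint Rplus f -> (forall n, V (u n)) ->
  rint Rplus (fun t => H t ^+ 2) ->
  (forall n t, 0 <= t -> normc (u n t) <= H t) ->
  (forall t, 0 <= t -> normc (u n t - f t) @[n --> \oo] --> 0) -> V f.
Let mP := @mRplus R.
Lemma dct_sq (u : nat -> R -> C) f (H : R -> R) :
  (forall n, sqint Rplus (u n)) -> (forall n, V (u n)) ->
  rint Rplus (fun t => H t ^+ 2) ->
  (forall n t, 0 <= t -> normc (u n t) <= H t) ->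
  (forall t, 0 <= t -> normc (u n t - f t) @[n --> \oo] --> 0) -> sqint Rplus f /\ V f.
Proof.
move=> su Vu iH h1 h2; have [sf _] : sqint Rplus f /\ sqnorm Rplus (fun x => u n x - f x) @[n --> \oo] --> 0.
  apply: L2_DCT iH => //.
  - by move=> n; case: (su n).
  - by move=> x /RplusP; exact: h2.
  - by move=> n x /RplusP; exact: h1.
by split => //; exact: V_dct h1 h2.
Qed.

(** For a class [V] closed under linear combinations and dominated limits,
    membership of the functions [e^{-mt}], or of the functions [t^k e^{-t}],
    already gives all of L^2.  Stated for a class rather than for a subspace,
    this is a principle of induction on square integrable functions: it serves
    for approximation and for identities between transforms alike. *)
Definition SV f := sqint Rplus f /\ V f.
Lemma SV_dct (u : nat -> R -> C) f (H : R -> R) : (forall n, SV (u n)) ->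
  rint Rplus (fun t => H t ^+ 2) ->
  (forall n t, 0 <= t -> normc (u n t) <= H t) ->
  (forall t, 0 <= t -> normc (u n t - f t) @[n --> \oo] --> 0) -> SV f.
Proof. by move=> h; apply: dct_sq => n; case: (h n). Qed.
Lemma SV_lin a f g : SV f -> SV g -> SV (fun t => a * f t + g t).
Proof.
move=> [sf vf] [sg vg]; split; last exact: V_lin.
by apply: sqD => //; exact: sqZ.
Qed.
Lemma SV_ext f g : (forall t, 0 <= t -> f t = g t) -> SV f -> SV g.
Proof.
move=> h [sf vf]; apply: (@SV_dct (fun=> f) g (fun t => normc (f t))) => //.
- by case: sf.
- by move=> t t0; rewrite h // subrr normc0; exact: cvg_cst.
Qed.
Lemma SV_0 f : SV f -> SV (fun=> 0).
Proof.
move=> h; apply: SV_ext (SV_lin (-1) h h) => t _.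
by rewrite mulN1r addNr.
Qed.
Lemma SV_Z a f : SV f -> SV (fun t => a * f t).
Proof.
move=> h; apply: SV_ext (SV_lin a h (SV_0 h)) => t _; exact: addr0.
Qed.
Lemma SV_D f g : SV f -> SV g -> SV (fun t => f t + g t).
Proof.
move=> h1 h2; apply: SV_ext (SV_lin 1 h1 h2) => t _; by rewrite mul1r.
Qed.
Lemma SV_B f g : SV f -> SV g -> SV (fun t => f t - g t).
Proof.
move=> h1 h2; apply: SV_ext (SV_lin (-1) h2 h1) => t _; by rewrite mulN1r addrC.
Qed.
Lemma SV_sum I (r : seq I) (F : I -> R -> C) f0 : SV f0 -> (forall i, SV (F i)) ->
  SV (fun t => \sum_(i <- r) F i t).
Proof.
move=> h0 h; elim: r => [|i r IH].
  by apply: SV_ext (SV_0 h0) => t _; rewrite big_nil.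
by apply: SV_ext (SV_D (h i) IH) => t _; rewrite big_cons.
Qed.
Section FromExp.
Hypothesis Vexp : forall m : nat, V (fun t => (expR (- (m.+1%:R * t)))%:C).
Lemma SV_exp m : SV (fun t => (expR (- (m.+1%:R * t)))%:C).
Proof.
split => //; apply: sq_ext (@sq_texp R m.+1%:R 0 _) => //.
by move=> t _; rewrite expr0 mul1r.
Qed.

(** The expression is an entire function of [e^{-t (n+1)}] without constant
    term, so its power series is a dominated limit of combinations of the
    exponentials. *)
Lemma SV_gumbel (b : R) (n : nat) :
  SV (fun t => (1 - expR (- expR (b - n.+1%:R * t)))%:C).
Proof.
pose u (m : nat) (t : R) : C :=
  \sum_(k < m) ((- (- expR b) ^+ k.+1 / k.+1`!%:R)%:C * (expR (- ((k.+1 * n.+1)%:R * t)))%:C).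
have uE m t : u m t = (- (\sum_(k < m) (- expR (b - n.+1%:R * t)) ^+ k.+1 / k.+1`!%:R))%:C.
  rewrite /u -sumrN rmorph_sum; apply: eq_bigr => k _ /=.
  rewrite -rmorphM /=; congr (_%:C); rewrite -[in RHS]mulNr mulrAC; congr (_ / _).
  rewrite mulNr; congr (- _).
  have -> : - expR (b - n.+1%:R * t) = (- expR b) * expR (- (n.+1%:R * t)) by rewrite expRD mulNr.
  by rewrite exprMn -expRM_natl natrM; congr (_ * expR _); ring.
set K := expR b * expR (expR b).
have iH : rint Rplus (fun t => (K * expR (- t)) ^+ 2).
  apply: rint_ext (rintZ (K ^+ 2) mP (int_expc (@ltr0n R 2)).1) => // t _.
  by rewrite [RHS]exprMn; congr (_ * _); rewrite -expRM_natl; congr expR; ring.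
apply: (@SV_dct u _ (fun t => K * expR (- t))) => //.
- move=> m; apply: (SV_sum _ (SV_exp 0)) => k; apply: SV_Z.
  have -> : (k.+1 * n.+1 = (k * n.+1 + n).+1)%N by rewrite mulSn addnC addnS.
  exact: SV_exp.
- move=> m t t0; rewrite uE normc_real normrN; set x := expR (b - _).
  have x0 : 0 <= x by exact: expR_ge0.
  apply: le_trans (ler_norm_sum _ _ _) _.
  apply: (@le_trans _ _ (\sum_(k < m) x * (x ^+ k / k`!%:R))).
    apply: ler_sum => k _; rewrite normrM normrX normrN normfV.
    rewrite !ger0_norm // exprS mulrA ler_pM2l ?expR_gt0 // ?mulr_gt0 ?exprn_gt0 ?expR_gt0 //.
    by rewrite lef_pV2 ?posrE ?ltr0n ?fact_gt0 // ler_nat leq_fact.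
  rewrite -mulr_sumr; apply: (@le_trans _ _ (x * expR x)).
    by rewrite ler_pM2l ?expR_gt0 // exp_series_le.
  rewrite /K mulrAC; apply: ler_pM; rewrite ?expR_ge0 // ?ler_expR.
    rewrite -expRD ler_expR lerD2l lerN2 -[leLHS]mul1r ler_wpM2r // ler1n //.
  by rewrite lerBlDr lerDl mulr_ge0.
- move=> t t0; under eq_fun => m do rewrite uE.
  apply: ccvg_real.
  set x := expR _; have -> : 1 - expR (- x) = - (expR (- x) - 1) by ring.
  apply: cvgN.
  have -> : (fun m : nat => \sum_(k < m) (- x) ^+ k.+1 / (k.+1)`!%:R) =
      (fun m => \sum_(k < m.+1) (- x) ^+ k / k`!%:R - 1).
    apply/funext => m; rewrite big_ord_recl expr0 fact0 divr1.
    by rewrite addrC addKr.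
  apply: cvgB; last exact: cvg_cst.
  have := @exp_series_cvg R (- x); rewrite -cvg_shiftS; exact.
Qed.

(** [1 - exp (- exp s)] tends to 1 as [s] tends to infinity and to 0 as [s]
    tends to minus infinity.  At [s = n^2 (a - t) + n] it therefore tends to
    the indicator of [t <= a], the added [n] settling the case [t = a]; the
    factor [n^2] makes [e^{a + 1 - t}] a common bound. *)
Lemma SV_step (a : R) : 0 <= a -> SV (fun t => (t <= a)%R%:R%:C).
Proof.
move=> a0.
(* The rate [n^2] must be a positive integer, whence the squares of [n.+1]. *)
pose e (n : nat) (t : R) := n.+1%:R ^+ 2 * a + n.+1%:R - n.+1%:R ^+ 2 * t : R.
have hn (n : nat) : exists m, (n.+1%:R ^+ 2 = m.+1%:R :> R).
  exists (n.+1 ^ 2).-1; rewrite -natrX prednK // expn_gt0 //.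
have iH : rint Rplus (fun t : R => (expR (a + 1) * expR (- t)) ^+ 2).
  apply: rint_ext (rintZ (expR (a + 1) ^+ 2) mP (int_expc (@ltr0n R 2)).1) => // t _.
  by rewrite [RHS]exprMn; congr (_ * _); rewrite -expRM_natl; congr expR; ring.
apply: (@SV_dct (fun n t => (1 - expR (- expR (e n t)))%:C) _ (fun t => expR (a + 1) * expR (- t))) => //.
- move=> n; have [m hm] := hn n.
  apply: SV_ext (SV_gumbel (n.+1%:R ^+ 2 * a + n.+1%:R) m) => t _.
  by rewrite /e hm.
- move=> n t t0; rewrite normc_real; set x := expR (e n t).
  have x0 : 0 <= x by exact: expR_ge0.
  have h0 : 0 <= 1 - expR (- x) by rewrite subr_ge0 expR_le1 oppr_le0.
  rewrite ger0_norm // -expRD.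
  have [ta|ta] := lerP t (a + 1).
    apply: (@le_trans _ _ 1); first by rewrite gerBl expR_ge0.
    by rewrite -[leLHS]expR0 ler_expR subr_ge0.
  apply: (@le_trans _ _ x); first by have := expR_ge1Dx (- x); lra.
  rewrite ler_expR /e.
  have n1 : 1 <= n.+1%:R :> R by rewrite ler1n.
  have : (n.+1%:R ^+ 2 - 1) * (a + 1 - t) <= 0.
    rewrite mulr_ge0_le0 // ?subr_ge0 ?exprn_ege1 // subr_le0; exact: ltW.
  have : n.+1%:R <= n.+1%:R ^+ 2 :> R by rewrite expr2 ler_peMl.
  nra.
- move=> t t0; apply: ccvg_real.
  have [ta|ta] := lerP t a => /=.
  + apply/cvgrPdist_le => eps eps0; near=> n.
    rewrite opprB addrC subrK ger0_norm ?expR_ge0 //.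
    have h1 : n.+1%:R <= expR (e n t).
      apply: le_trans (expR_ge1Dx _); rewrite /e.
      have : 0 <= n.+1%:R ^+ 2 * (a - t) by rewrite mulr_ge0 ?exprn_ge0 ?subr_ge0.
      by nra.
    have h2 : expR (e n t) <= expR (expR (e n t)) by have := expR_ge1Dx (expR (e n t)); lra.
    rewrite expRN; apply: (@le_trans _ _ n.+1%:R^-1).
      by rewrite lef_pV2 ?posrE ?expR_gt0 // (le_trans h1).
    by near: n; have := near_infty_natSinv_lt (PosNum eps0); apply: filterS => n /=; exact: ltW.
  + apply/cvgrPdist_le => eps eps0; near=> n.
    have h0 : 0 <= expR (e n t) by exact: expR_ge0.
    rewrite sub0r normrN ger0_norm ?subr_ge0 ?expR_le1 ?oppr_le0 //.
    apply: (@le_trans _ _ (expR (e n t))); first by have := expR_ge1Dx (- expR (e n t)); lra.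
    have hd : 0 < t - a by rewrite subr_gt0.
    have h1 : 2 / (t - a) <= n.+1%:R.
      near: n; have hh : \forall n \near \oo, 2 / (t - a) <= n%:R by exact: nbhs_infty_ger.
      by apply: filterS hh => n hn2; rewrite (le_trans hn2) // ler_nat.
    have h2 : 2 <= n.+1%:R * (t - a) by rewrite -ler_pdivrMr.
    have h3 : e n t <= - n.+1%:R.
      rewrite /e; have : n.+1%:R * 2 <= n.+1%:R * (n.+1%:R * (t - a)) by rewrite ler_pM2l.
      by nra.
    apply: (@le_trans _ _ (expR (- n.+1%:R))); first by rewrite ler_expR.
    rewrite expRN; apply: (@le_trans _ _ n.+1%:R^-1).
      rewrite lef_pV2 ?posrE ?expR_gt0 //; have := expR_ge1Dx (n.+1%:R : R); lra.
    by near: n; have := near_infty_natSinv_lt (PosNum eps0); apply: filterS => n /=; exact: ltW.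
Unshelve. all: by end_near. Qed.
Lemma SV_Z0 : SV (fun=> 0). Proof. exact: SV_0 (SV_exp 0). Qed.

(** The sets for which this holds form a Dynkin system, and the steps give the
    intervals.  Cutting at [N] keeps the functions square integrable. *)
Lemma SV_indic (N : nat) (E : set R) : measurable E ->
  SV (fun t => ((t \in E) && (t <= N%:R)%R)%:R%:C).
Proof.
pose H : set (set R) := [set A : set R | SV (fun t => ((t \in A) && (t <= N%:R)%R)%:R%:C)].
have iN : rint Rplus (fun t : R => ((t <= N%:R)%R%:R : R) ^+ 2).
  have [[_ h] _] := @SV_step N%:R (ler0n _ _).
  by apply: rint_ext h => // t _; rewrite normc_real ger0_norm.
have HT : H setT.
  by apply: SV_ext (SV_step (ler0n _ N)) => t _; rewrite in_setT.
have hl : lambda_system setT H.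
  split => // [A B AB HA HB|F ndF HF].
  - apply: SV_ext (SV_B HA HB) => t t0.
    rewrite in_setD -rmorphB /=; congr (_%:C).
    have h : t \in B -> t \in A by rewrite !inE; exact: AB.
    case hB : (t \in B) => /=; last by rewrite andbT subr0.
    by rewrite (h hB) andbF /= subrr.
  - apply: (@SV_dct (fun n t => ((t \in F n) && (t <= N%:R)%R)%:R%:C) _ (fun t => (t <= N%:R)%R%:R)) => //.
    + move=> n t t0; rewrite normc_real ger0_norm //.
      by case: (t \in F n) => //=; rewrite lexx.
    + move=> t t0; apply: ccvg_real; case: (lerP t N%:R) => tN; last first.
        by under eq_fun do rewrite andbF; rewrite andbF; exact: cvg_cst.
      rewrite andbT; have [[k _ hk]|hn] := pselect ((\bigcup_n F n) t).
        rewrite mem_set; last by exists k.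
        apply: cvg_near_cst; near=> n; rewrite andbT mem_set //.
        have kn : (k <= n)%N by near: n; exact: nbhs_infty_ge.
        by have /subsetPset := ndF _ _ kn; apply.
      rewrite memNset //; apply: cvg_near_cst; near=> n.
      by rewrite memNset // => hF; apply: hn; exists n.
have hG : @ocitv R `<=` H.
  move=> _ [[a b] _ <-] /=; rewrite /H /=.
  have st (c : R) : SV (fun t => ((t <= c)%R && (t <= N%:R)%R)%:R%:C).
    have [c0|c0] := lerP 0 c; last first.
      apply: SV_ext SV_Z0 => t t0.
      by rewrite leNgt (lt_le_trans c0 t0).
    have m0 : 0 <= Num.min c N%:R by rewrite le_min c0 ler0n.
    by apply: SV_ext (SV_step m0) => t t0; rewrite le_min.
  have [ab|ab] := lerP a b; last first.
    apply: SV_ext SV_Z0 => t t0; rewrite (_ : t \in _ = false) //.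
    by apply/negbTE/negP; rewrite inE /= in_itv /= => /andP[h1 h2]; have := lt_le_trans h1 h2; rewrite ltNge (ltW ab).
  apply: SV_ext (SV_B (st b) (st a)) => t t0; rewrite -rmorphB /=; congr (_%:C).
  rewrite mem_setE in_itv /=.
  case: (lerP t N%:R) => _; rewrite ?andbF ?andbT ?subrr //.
  case: (lerP t a) => ta /=; last by rewrite subr0.
  by rewrite (le_trans ta ab) subrr.
by move=> mE; exact: (lambda_system_subset (@ocitvI R) hl hG _ mE).
Unshelve. all: by end_near. Qed.
Lemma SV_nnsfun (h : {nnsfun R >-> R}) (N : nat) :
  SV (fun t => (h t * ((t <= N%:R)%R)%:R)%:C).
Proof.
have h0 : SV (fun t => \sum_(y <- finmap.enum_fset (fset_set (range h)))
   (y%:C * ((t \in h @^-1` [set y]) && (t <= N%:R)%R)%:R%:C)).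
  apply: (SV_sum _ SV_Z0) => y; apply: SV_Z; apply: SV_indic.
  exact: measurable_sfunP.
apply: SV_ext h0 => t t0; rewrite [in RHS](fimfunE h) fsbig_finite //=.
rewrite mulr_suml rmorph_sum /=; apply: eq_bigr => y _.
by rewrite indicE -mulrA -rmorphM /= -natrM mulnb.
Qed.
Lemma SV_ge0 (f : R -> R) : mrfun Rplus f -> (forall t, 0 <= t -> 0 <= f t) ->
  rint Rplus (fun t => f t ^+ 2) -> SV (fun t => (f t)%:C).
Proof.
move=> mf f0 hf; have mf' : measurable_fun Rplus (EFin \o f) by apply/measurable_EFinP.
pose h := nnsfun_approx mP mf'.
have hc t : 0 <= t -> h n t @[n --> \oo] --> f t.
  move=> /RplusP t0; have := @cvg_nnsfun_approx _ _ _ _ mP _ mf' _ _ t0.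
  have h0 : forall x, Rplus x -> (0 <= (EFin \o f) x)%E by move=> x /RplusP /f0 /=; rewrite lee_fin.
  by move=> /(_ h0) /fine_cvg.
have hle n t : 0 <= t -> h n t <= f t.
  move=> t0; rewrite -(cvg_lim _ (hc t t0)) //; apply: nondecreasing_cvgn_le.
    by move=> a b ab; have /lefP/(_ t) := nd_nnsfun_approx mP mf' ab.
  by apply/cvg_ex; exists (f t); exact: hc.
apply: (@SV_dct (fun n t => (h n t * ((t <= n%:R)%R)%:R)%:C) _ f) => //.
- by move=> n; exact: SV_nnsfun.
- move=> n t t0; rewrite normc_real ger0_norm ?mulr_ge0 //.
  by case: (t <= _); rewrite ?mulr1 ?mulr0 ?hle ?f0.
- move=> t t0; apply: ccvg_real; apply: cvg_trans (hc t t0).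
  apply: near_eq_cvg; near=> n.
  have -> : (t <= n%:R) by near: n; exact: nbhs_infty_ger.
  by rewrite mulr1.
Unshelve. all: by end_near. Qed.
Lemma SV_real (f : R -> R) : mrfun Rplus f ->
  rint Rplus (fun t => f t ^+ 2) -> SV (fun t => (f t)%:C).
Proof.
move=> mf hf.
apply: (@SV_ext (fun t => (Num.max (f t) 0)%:C - (Num.max (- f t) 0)%:C)).
  move=> t _; rewrite -rmorphB /=; congr (_%:C).
  by case: (lerP (f t) 0) => h; case: (lerP (- f t) 0) => h'; lra.
have hm (g : R -> R) : mrfun Rplus g -> rint Rplus (fun t => g t ^+ 2) -> SV (fun t => (Num.max (g t) 0)%:C).
  move=> mg hg; apply: SV_ge0.
  - by apply: measurable_maxr => //; exact: measurable_cst.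
  - by move=> t _; rewrite le_max lexx orbT.
  - apply: rint_le hg => //.
      by apply: mrX; apply: measurable_maxr => //; exact: measurable_cst.
    move=> t _; rewrite ger0_norm ?sqr_ge0 //; case: (lerP (g t) 0) => h //.
    by rewrite expr0n sqr_ge0.
apply: SV_B; apply: hm => //; first by meas.
by apply: rint_ext hf => // t _; rewrite sqrrN.
Qed.
Lemma SV_all (f : R -> C) : sqint Rplus f -> V f.
Proof.
move=> [[m1 m2] hf]; suff [] : SV f by [].
apply: (@SV_ext (fun t => 'i * (Im (f t))%:C + (Re (f t))%:C)).
  by move=> t _; rewrite addrC; apply/esym/complexE.
apply: SV_lin; apply: SV_real => //.
- apply: rint_le hf => //; first by meas.
  by move=> t _; rewrite ger0_norm ?sqr_ge0 // normcE2 lerDr sqr_ge0.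
- apply: rint_le hf => //; first by meas.
  by move=> t _; rewrite ger0_norm ?sqr_ge0 // normcE2 lerDl sqr_ge0.
Qed.
End FromExp.
Section FromLaguerre.
Hypothesis Vte : forall k : nat, V (fun t => (t ^+ k * expR (- t))%:C).

(** The rate is raised in steps of one half: expand [e^{-t/2}] in its power
    series, whose partial sums are dominated by [e^{t/2}], so that the
    products still decay at the rate [c - 1/2 > 0].  A step of size one would
    leave no decay in the bound when [c = 1]. *)
Lemma SV_rate (j k : nat) : SV (fun t => (t ^+ k * expR (- ((1 + j%:R / 2) * t)))%:C).
Proof.
elim: j k => [|j IH] k.
  apply: (@SV_ext (fun t => (t ^+ k * expR (- t))%:C)) => [t _|].
    by rewrite mul0r addr0 mul1r.
  split => //; apply: sq_ext (@sq_texp R 1 k ltr01) => // t _.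
  by rewrite mul1r.
set c := 1 + j%:R / 2 in IH *.
have c1 : 0 < c - 1 / 2.
  have : 0 <= j%:R / 2 :> R by rewrite divr_ge0.
  by rewrite /c; lra.
pose u (N : nat) (t : R) : C :=
  \sum_(i < N) (((-1 / 2) ^+ i / i`!%:R)%:C * (t ^+ (k + i) * expR (- (c * t)))%:C).
have uE N t : u N t = (t ^+ k * expR (- (c * t)) * \sum_(i < N) (- (t / 2)) ^+ i / i`!%:R)%:C.
  rewrite /u mulr_sumr rmorph_sum; apply: eq_bigr => i _ /=.
  rewrite -rmorphM /=; congr (_%:C); rewrite exprD.
  have -> : - (t / 2) = -1 / 2 * t by field.
  by rewrite [(_ * t) ^+ i]exprMn; ring.
apply: (@SV_dct u _ (fun t => t ^+ k * expR (- ((c - 1 / 2) * t)))).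
- by move=> N; apply: (SV_sum _ (IH 0)) => i; apply: SV_Z.
- have [_] := sq_texp k c1; apply: rint_ext => // t _.
  by rewrite normc_real real_normK ?num_real.
- move=> N t t0; rewrite uE normc_real normrM [`|_ * expR _|]ger0_norm ?mulr_ge0 ?exprn_ge0 ?expR_ge0 //.
  apply: (@le_trans _ _ (t ^+ k * expR (- (c * t)) * expR (t / 2))).
    rewrite ler_wpM2l ?mulr_ge0 ?exprn_ge0 ?expR_ge0 //.
    by apply: le_trans (exp_series_norm_le _ _) _; rewrite normrN ger0_norm // divr_ge0.
  by rewrite -mulrA -expRD ler_wpM2l ?exprn_ge0 // ler_expR; lra.
- move=> t t0; under eq_fun do rewrite uE.
  apply: ccvg_real.
  have -> : t ^+ k * expR (- ((1 + j.+1%:R / 2) * t)) = t ^+ k * expR (- (c * t)) * expR (- (t / 2)).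
    by rewrite -mulrA -expRD; congr (_ * expR _); rewrite /c -natr1; field.
  by apply: cvgM; [exact: cvg_cst|exact: exp_series_cvg].
Qed.
Lemma L2_dense (f : R -> C) : sqint Rplus f -> V f.
Proof.
apply: SV_all => m.
have h : SV (fun t => (expR (- (m.+1%:R * t)))%:C).
  apply: SV_ext (SV_rate m.*2 0) => t _.
  by rewrite expr0 mul1r -mul2n natrM -natr1; congr (_%:C); congr expR; field.
by case: h.
Qed.
End FromLaguerre.
End Density.

(** * Calculus for complex functions of a real variable *)
Section ComplexFTC.
Context {R : realType}.
Local Notation C := R[i].
Local Notation mu := (@lebesgue_measure R).

(** Differentiability in the real variable, part by part: this is what the
    real fundamental theorem of calculus needs. *)
Definition cder (H : R -> C) (x : R) (h : C) :=
  is_derive x (1:R) (fun t => Re (H t)) (Re h) /\ is_derive x (1:R) (fun t => Im (H t)) (Im h).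
Lemma FTC_real (F f : R -> R) (a b : R) : a < b ->
  (forall x, a <= x <= b -> is_derive x (1:R) F (f x)) ->
  (forall x, a <= x <= b -> {for x, continuous f}) ->
  rint `[a, b] f /\ \int[mu]_(x in `[a, b]) f x = F b - F a.
Proof.
move=> ab dF cf.
have cw : {within `[a, b], continuous f}.
  apply: continuous_in_subspaceT => x; rewrite inE /= in_itv /=; exact: cf.
have hi : rint `[a, b] f.
  by apply: continuous_compact_integrable => //; exact: segment_compact.
have cF x : a <= x <= b -> {for x, continuous F}.
  move=> /dF [dx _]; apply: differentiable_continuous; exact/derivable1_diffP.
split => //; apply/EFin_inj; rewrite EFin_Rint // EFinB.
apply: continuous_FTC2 => //.
- split.
  + by move=> x; rewrite in_itv /= => /andP[h1 h2]; have [] := dF x _; rewrite ?(ltW h1) ?(ltW h2).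
  + by apply: cvg_at_right_filter; apply: cF; rewrite lexx ltW.
  + by apply: cvg_at_left_filter; apply: cF; rewrite lexx ltW.
- move=> x; rewrite in_itv /= => /andP[h1 h2]; rewrite derive1E.
  by have [|_ ->//] := dF x _; rewrite (ltW h1) (ltW h2).
Qed.
Lemma CFTC (H h : R -> C) (a b : R) : a < b ->
  (forall x, a <= x <= b -> cder H x (h x)) ->
  (forall x, a <= x <= b -> {for x, continuous (fun t => Re (h t))}) ->
  (forall x, a <= x <= b -> {for x, continuous (fun t => Im (h t))}) ->
  cint `[a, b] h /\ Cintegral `[a, b] h = H b - H a.
Proof.
move=> ab dH c1 c2.
have [i1 e1] := FTC_real ab (fun x hx => proj1 (dH x hx)) c1.
have [i2 e2] := FTC_real ab (fun x hx => proj2 (dH x hx)) c2.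
split; first exact: cint_ReIm.
by apply: eqc; rewrite !cE /= ?e1 ?e2.
Qed.
Lemma cderZ H x h (c : C) : cder H x h -> cder (fun t => c * H t) x (c * h).
Proof.
case=> h1 h2; split.
- rewrite (_ : (fun t => _) = (fun t => Re c * Re (H t) - Im c * Im (H t))); last first.
    by apply/funext => t; rewrite cE.
  by apply: is_derive_eq; rewrite cE /GRing.scale /=.
- rewrite (_ : (fun t => _) = (fun t => Re c * Im (H t) + Im c * Re (H t))); last first.
    by apply/funext => t; rewrite cE.
  by apply: is_derive_eq; rewrite cE /GRing.scale /=.
Qed.
Lemma cderD H K x h k : cder H x h -> cder K x k -> cder (fun t => H t + K t) x (h + k).
Proof.
case=> h1 h2 [k1 k2]; split.
- rewrite (_ : (fun t => _) = (fun t => Re (H t) + Re (K t))); last first.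
    by apply/funext => t; rewrite cE.
  by apply: is_derive_eq; rewrite cE.
- rewrite (_ : (fun t => _) = (fun t => Im (H t) + Im (K t))); last first.
    by apply/funext => t; rewrite cE.
  by apply: is_derive_eq; rewrite cE.
Qed.
Lemma cderRM (p : R -> R) H x dp h : is_derive x (1:R) p dp -> cder H x h ->
  cder (fun t => (p t)%:C * H t) x (dp%:C * H x + (p x)%:C * h).
Proof.
move=> hp [h1 h2]; split.
- rewrite (_ : (fun t => _) = (fun t => p t * Re (H t))); last first.
    by apply/funext => t; rewrite !cE mul0r subr0.
  by apply: is_derive_eq; rewrite !cE /GRing.scale /=; ring.
- rewrite (_ : (fun t => _) = (fun t => p t * Im (H t))); last first.
    by apply/funext => t; rewrite !cE mul0r addr0.
  by apply: is_derive_eq; rewrite !cE /GRing.scale /=; ring.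
Qed.
Lemma cder_cexp (z : C) (x : R) : cder (fun t => cexp (t%:C * z)) x (z * cexp (x%:C * z)).
Proof.
split.
- rewrite (_ : (fun t => _) = (fun t => expR (t * Re z) * cos (t * Im z))); last first.
    by apply/funext => t; rewrite Re_cexp !cE !mul0r subr0 addr0.
  apply: is_derive_eq; rewrite !(Re_cexp, Im_cexp, cE) /GRing.scale /=.
  by rewrite !mul0r subr0 addr0; ring.
- rewrite (_ : (fun t => _) = (fun t => expR (t * Re z) * sin (t * Im z))); last first.
    by apply/funext => t; rewrite Im_cexp !cE !mul0r subr0 addr0.
  apply: is_derive_eq; rewrite !(Re_cexp, Im_cexp, cE) /GRing.scale /=.
  by rewrite !mul0r subr0 addr0; ring.
Qed.
Lemma cder_cst (c : C) x : cder (fun=> c) x 0.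
Proof. by split; rewrite cE; exact: is_derive_cst. Qed.
Lemma cder_cont H x h : cder H x h ->
  {for x, continuous (fun t => Re (H t))} /\ {for x, continuous (fun t => Im (H t))}.
Proof.
case=> -[d1 _] [d2 _]; split; apply: differentiable_continuous; exact/derivable1_diffP.
Qed.

(** The mean value inequality for curves in the plane, through [H 1 - H 0 =
    int_0^1 h]; it supplies the Taylor remainders below. *)
Lemma normc_FTC_le (H h : R -> C) (M : R) :
  (forall x, 0 <= x <= 1 -> cder H x (h x)) ->
  (forall x, 0 <= x <= 1 -> {for x, continuous (fun t => Re (h t))}) ->
  (forall x, 0 <= x <= 1 -> {for x, continuous (fun t => Im (h t))}) ->
  (forall x, 0 <= x <= 1 -> normc (h x) <= M) -> normc (H 1 - H 0) <= M.
Proof.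
move=> dH c1 c2 hM; have [i <-] := CFTC ltr01 dH c1 c2.
have m01 : measurable `[0:R, 1] by exact: measurable_itv.
apply: le_trans (normc_Cint m01 i) _.
have f01 : (mu `[0%R, 1%R] < +oo)%E by rewrite lebesgue_measure_itv /= lte01 ltry.
apply: (@le_trans _ _ (\int[mu]_(x in `[0:R, 1]) `|M|)).
  apply: Rint_le0 => //; [by case: i|exact: rint_cst_fin|].
  move=> x; rewrite /= in_itv /= => /hM /le_trans; apply; exact: ler_norm.
have e01 : fine (mu `[0%R, 1%R]) = 1 by rewrite lebesgue_measure_itv /= lte01 oppr0 adde0.
have -> : \int[mu]_(x in `[0:R, 1]) `|M| = `|M| * 1 by rewrite -[X in _ * X]e01; exact: Rintegral_cst.
rewrite mulr1.
have := hM 0; rewrite lexx ler01 => /(_ isT) h0.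
by rewrite ger0_norm // (le_trans (normc_ge0 _) h0).
Qed.
Lemma cexp_sub1 (z : C) : normc (cexp z - 1) <= normc z * expR (normc z).
Proof.
have d := fun x (_ : 0 <= x <= 1) => cder_cexp z x.
have d2 := fun x => cderZ z (cder_cexp z x).
have := @normc_FTC_le (fun t => cexp (t%:C * z)) (fun t => z * cexp (t%:C * z)) (normc z * expR (normc z)) d.
rewrite mul1r mul0r cexp0; apply.
- by move=> x _; have [] := cder_cont (d2 x).
- by move=> x _; have [] := cder_cont (d2 x).
- move=> x /andP[x0 x1]; rewrite normcM ler_wpM2l ?normc_ge0 // normc_cexp ler_expR.
  apply: le_trans (ler_norm _) _; apply: le_trans (Re_le_normc _) _.
  by rewrite normcM normc_real ger0_norm // ler_piMl // normc_ge0.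
Qed.

(** [normc_FTC_le] along the segment from 0 to [z], with [cexp_sub1] bounding
    the derivative. *)
Lemma cexp_sub1z (z : C) : normc (cexp z - 1 - z) <= normc z ^+ 2 * expR (normc z).
Proof.
have d := fun x => cderD (cder_cexp z x) (cderZ (- z) (cderRM (is_derive_id x (1:R)) (cder_cst 1 x))).
have d2 := fun x => cderD (cderZ z (cder_cexp z x)) (cder_cst (-z) x).
have := @normc_FTC_le (fun t => cexp (t%:C * z) + - z * (t%:C * 1)) (fun t => z * cexp (t%:C * z) + - z)
  (normc z ^+ 2 * expR (normc z)).
have -> : cexp (1%:C * z) + - z * (1%:C * 1) - (cexp (0%:C * z) + - z * (0%:C * 1)) = cexp z - 1 - z.
  by rewrite mul1r mul0r cexp0 !mulr1 mulr0 addr0 addrAC.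
apply.
- move=> x _; have := d x; rewrite mulr0 addr0 !mulr1.
  by [].
- by move=> x _; have [] := cder_cont (d2 x).
- by move=> x _; have [] := cder_cont (d2 x).
- move=> x /andP[x0 x1]; rewrite -[X in _ + X]mulr1 mulNr -mulrBr normcM expr2 -mulrA.
  rewrite ler_wpM2l ?normc_ge0 //; apply: le_trans (cexp_sub1 _) _.
  have h : normc (x%:C * z) <= normc z.
    by rewrite normcM normc_real ger0_norm // ler_piMl // normc_ge0.
  by apply: ler_pM; rewrite ?normc_ge0 ?expR_ge0 ?ler_expR.
Qed.
Section Translate.
Variable a : R.
Let tr : measurableTypeR R -> measurableTypeR R := fun x => x + a.
Let mt : measurable_fun setT tr.
Proof. by apply: (@mrD _ (measurableTypeR R)) => //; exact: measurable_cst. Qed.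
HB.instance Definition _ := isMeasurableFun.Build _ _ _ _ tr mt.

(** Both are measures that agree with the length on half-open intervals, hence
    equal by uniqueness of the extension. *)
Lemma lebesgue_translate (A : set R) : measurable A -> pushforward mu tr A = mu A.
Proof.
move=> mA; apply/esym/lebesgue_measure_unique => //= _ [[b c]] _ <- /=.
rewrite /pushforward (_ : _ @^-1` _ = `]b - a, c - a]%classic); last first.
  by apply/seteqP; split => x /=; rewrite !in_itv /= ltrBlDr lerBrDr.
rewrite !lebesgue_measure_itv /= !lte_fin ltrD2r; case: ifP => // _.
by rewrite -!EFinB; congr (_%:E); ring.
Qed.
Lemma ge0_int_translate (f : R -> R) : mrfun setT f -> (forall x, 0 <= f x) ->
  (\int[mu]_x (f (x + a))%:E = \int[mu]_x (f x)%:E)%E.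
Proof.
move=> mf f0.
have := @ge0_integral_pushforward _ _ (measurableTypeR R) (measurableTypeR R) R
  tr mt mu setT (fun x => (f x)%:E) measurableT.
rewrite preimage_setT => <- //; last 2 first.
- exact/measurable_EFinP.
- by move=> x _; rewrite lee_fin.
by apply: eq_measure_integral => A mA _; exact: lebesgue_translate.
Qed.
Lemma mr_translate (f : R -> R) : mrfun setT f -> mrfun setT (fun x : R => f (x + a)).
Proof.
move=> mf _ B mB; rewrite setTI.
have h : measurable (f @^-1` B) by rewrite -[X in measurable X]setTI; exact: mf.
have := mt measurableT h; rewrite setTI; exact.
Qed.
Lemma rint_translate (f : R -> R) : rint setT f ->
  rint setT (fun x => f (x + a)) /\ \int[mu]_x f (x + a) = \int[mu]_x f x.
Proof.
move=> hf; have mf := rint_meas hf.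
have h : rint setT (fun x => f (x + a)).
  apply/integrableP; split; first by apply/measurable_EFinP; exact: mr_translate.
  have /integrableP[_] := hf.
  rewrite /= -(@ge0_int_translate (fun x => `|f x|)) //.
  by apply: mr_norm.
split => //; congr fine.
have := @integral_pushforward _ _ (measurableTypeR R) (measurableTypeR R) R
  tr mt mu setT (fun x => (f x)%:E).
rewrite preimage_setT => <- //; last exact/measurable_EFinP.
by apply: eq_measure_integral => A mA _; exact: lebesgue_translate.
Qed.
End Translate.
Lemma cint_translate (a : R) (u : R -> C) : cint setT u ->
  cint setT (fun x => u (x + a)) /\ Cintegral setT (fun x => u (x + a)) = Cintegral setT u.
Proof.
move=> hu; have mT : measurable (setT : set R) by [].
have [a1 b1] := rint_translate a (cint_re mT hu).
have [a2 b2] := rint_translate a (cint_im mT hu).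
split; first exact: cint_ReIm.
by rewrite /Cintegral b1 b2.
Qed.
Definition cut (D : set R) (u : R -> C) : R -> C := fun t => if t \in D then u t else 0.
Lemma cut_in (D : set R) u t : D t -> cut D u t = u t.
Proof. by move=> Dt; rewrite /cut mem_set. Qed.
Lemma cut_notin (D : set R) u t : ~ D t -> cut D u t = 0.
Proof. by move=> Dt; rewrite /cut memNset. Qed.
Lemma Cint_cut (D : set R) u : Cintegral D u = Cintegral setT (cut D u).
Proof.
by rewrite /Cintegral; congr (_ +i* _); rewrite [LHS]Rintegral_mkcond; apply: eq_Rintegral => x _;
  rewrite /patch /cut; case: ifP.
Qed.
Lemma mc_cut (D : set R) u : measurable D -> mcfun D u -> mcfun setT (cut D u).
Proof.
move=> mD [a b]; split.
- move/(measurable_restrictT _ mD): a; apply: mr_ext => x _.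
  by rewrite /patch /cut; case: ifP.
- move/(measurable_restrictT _ mD): b; apply: mr_ext => x _.
  by rewrite /patch /cut; case: ifP.
Qed.
Lemma cint_cut (D : set R) u : measurable D -> cint D u <-> cint setT (cut D u).
Proof.
move=> mD; split.
- move=> [m h]; split; first exact: mc_cut.
  have := (integrable_mkcond (mu := mu) (EFin \o (fun x => normc (u x))) mD).1 h.
  apply: eq_integrable => // x _; rewrite /patch /cut /=; case: ifP => //= _.
  by rewrite expr0n /= addr0 sqrtr0.
- move=> h; apply: (@cint_ext _ D (cut D u)) => //.
    by move=> x Dx; exact: cut_in.
  by apply: cintS h.
Qed.
Lemma mc_translate (a : R) (u : R -> C) : mcfun setT u -> mcfun setT (fun x : R => u (x + a)).
Proof.
by case=> [h1 h2]; split; [exact: (mr_translate a h1)|exact: (mr_translate a h2)].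
Qed.
End ComplexFTC.
Lemma cvg_sqrt {R : realType} (T : Type) (F : set_system T) {FF : Filter F} (f : T -> R) (l : R) :
  f @ F --> l -> Num.sqrt (f x) @[x --> F] --> Num.sqrt l.
Proof. by move=> h; exact: (cvg_comp _ _ h (@sqrt_continuous R l)). Qed.

(** * The Laplace transform *)
Section Laplace.
Context {R : realType}.
Local Notation C := R[i].
Local Notation mu := (@lebesgue_measure R).
Local Notation P := (@Rplus R).
Implicit Types (f g : R -> C) (w : C).
Let mP := @mRplus R.
Local Notation s2p := ((Num.sqrt (2 * pi) : R)^-1%:C).
Definition exp_ker w : R -> C := fun t => cexp (- (w * t%:C)).
Lemma normc_ek w t : normc (exp_ker w t) = expR (- (Re w * t)).
Proof. by rewrite normc_cexp !cE mulr0 subr0. Qed.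
Lemma mc_ek D w : mcfun D (exp_ker w). Proof. by rewrite (_ : exp_ker w = fun t => cexp (- (w * t%:C))) //; meas. Qed.
Lemma sq_ek w : 0 < Re w -> sqint P (exp_ker w) /\ sqnorm P (exp_ker w) = (2 * Re w)^-1.
Proof.
move=> w0; have w20 : 0 < 2 * Re w by rewrite mulr_gt0.
have [h1 h2] := int_expc w20.
have e t : expR (- (2 * Re w * t)) = normc (exp_ker w t) ^+ 2.
  by rewrite normc_ek -expRM_natl; congr expR; ring.
split; first by split; [exact: mc_ek|apply: rint_ext h1 => // t _; rewrite e].
by rewrite /sqnorm -h2; apply: eq_Rintegral => t _; rewrite e.
Qed.
Lemma cint_lap f w : sqint P f -> 0 < Re w -> cint P (fun t => f t * exp_ker w t).
Proof. by move=> hf /sq_ek [h _]; exact: cint_mul. Qed.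
Lemma laplaceE f w : laplace f w = s2p * Cintegral P (fun t => f t * exp_ker w t).
Proof. by []. Qed.
Lemma lap_ext f g w : (forall t, 0 <= t -> f t = g t) -> laplace f w = laplace g w.
Proof. by move=> h; rewrite !laplaceE; congr (_ * _); apply: Cint_ext => t /RplusP /h ->. Qed.
Lemma lap_ae f g w : mcfun P f -> mcfun P g -> ae_eq mu P f g -> laplace f w = laplace g w.
Proof.
move=> hf hg h; rewrite !laplaceE; congr (_ * _); apply: Cint_ae => //.
- by have := @mc_ek P w => ?; meas.
- by have := @mc_ek P w => ?; meas.
- by apply: aeS h => x hx /hx ->.
Qed.
Lemma lap_lin a f g w : sqint P f -> sqint P g -> 0 < Re w ->
  laplace (fun t => a * f t + g t) w = a * laplace f w + laplace g w.
Proof.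
move=> hf hg w0; have h1 := cint_lap hf w0; have h2 := cint_lap hg w0.
rewrite !laplaceE mulrCA -mulrDr; congr (_ * _).
rewrite -CintZ // -CintD //; last exact: cintZ.
by apply: Cint_ext => t _; rewrite mulrDl mulrA.
Qed.
Lemma lap_Z a f w : sqint P f -> 0 < Re w -> laplace (fun t => a * f t) w = a * laplace f w.
Proof.
move=> hf w0; rewrite !laplaceE mulrCA; congr (_ * _).
rewrite -CintZ //; last exact: cint_lap.
by apply: Cint_ext => t _; rewrite mulrA.
Qed.
Lemma lap_B f g w : sqint P f -> sqint P g -> 0 < Re w ->
  laplace (fun t => f t - g t) w = laplace f w - laplace g w.
Proof.
move=> hf hg w0; rewrite addrC -mulN1r -lap_lin //.
by apply: lap_ext => t _; rewrite mulN1r addrC.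
Qed.
Lemma s2p_gt0 : 0 < (Num.sqrt (2 * pi) : R)^-1.
Proof. by rewrite invr_gt0 sqrtr_gt0 mulr_gt0 // pi_gt0. Qed.
Lemma s2p_sqr : ((Num.sqrt (2 * pi) : R)^-1) ^+ 2 = (2 * pi)^-1.
Proof. by rewrite exprVn sqr_sqrtr // mulr_ge0 // ltW // pi_gt0. Qed.
Lemma s2p_neq0 : s2p != 0.
Proof. by rewrite -normc_gt0 normc_real normr_gt0 gt_eqF // s2p_gt0. Qed.

(** Cauchy-Schwarz against the exponential kernel, whose squared norm is [(2
    Re w)^-1]. *)
Lemma lap_bound f w : sqint P f -> 0 < Re w ->
  normc (laplace f w) ^+ 2 <= (2 * pi)^-1 * (2 * Re w)^-1 * sqnorm P f.
Proof.
move=> hf w0; have [hk ek2] := sq_ek w0.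
rewrite laplaceE normcM exprMn normc_real ger0_norm ?(ltW s2p_gt0) // s2p_sqr -mulrA.
rewrite ler_wpM2l //; first by rewrite invr_ge0 mulr_ge0 // ltW // pi_gt0.
by rewrite mulrC -ek2; exact: CauchySchwarz.
Qed.
Lemma lap_dct (u : nat -> R -> C) f (H : R -> R) w : 0 < Re w ->
  (forall n, sqint P (u n)) -> sqint P f -> rint P (fun t => H t ^+ 2) ->
  (forall n t, 0 <= t -> normc (u n t) <= H t) ->
  (forall t, 0 <= t -> normc (u n t - f t) @[n --> \oo] --> 0) ->
  normc (laplace (u n) w - laplace f w) @[n --> \oo] --> 0.
Proof.
move=> w0 hu hf iH h1 h2.
have [_ he] : sqint P f /\ sqnorm P (fun x => u n x - f x) @[n --> \oo] --> 0.
  apply: L2_DCT iH => //.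
  - by move=> n; case: (hu n).
  - by move=> x /RplusP; exact: h2.
  - by move=> n x /RplusP; exact: h1.
pose k := (2 * pi)^-1 * (2 * Re w)^-1 : R.
have hs : Num.sqrt (k * sqnorm P (fun x => u n x - f x)) @[n --> \oo] --> 0.
  rewrite -[X in _ --> X](@sqrtr0 R) -[X in Num.sqrt X](mulr0 k).
  by apply: cvg_sqrt; apply: cvgM => //; exact: cvg_cst.
apply: ccvg_squeeze hs; apply: nearW => n.
rewrite -lap_B //; have h := lap_bound (sqB mP (hu n) hf) w0.
rewrite -[leLHS]ger0_norm ?normc_ge0 // -sqrtr_sqr ler_sqrt //.
by apply: le_trans h; rewrite exprn_ge0 // normc_ge0.
Qed.
End Laplace.

(** * Explicit transforms, shifts and holomorphy *)
Section HalfLine.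
Context {R : realType}.
Local Notation C := R[i].
Lemma cintB (D : set R) (u v : R -> C) : measurable D -> cint D u -> cint D v ->
  cint D (fun x => u x - v x).
Proof. by move=> mD hu hv; apply: cintD => //; exact: cintN. Qed.
Lemma cvg_mul0l (T : Type) (F : set_system T) {FF : Filter F} (c : R) (f : T -> R) :
  f @ F --> 0 -> c * f x @[x --> F] --> 0.
Proof. by move=> h; rewrite -[X in _ --> X](mulr0 c); apply: cvgM => //; exact: cvg_cst. Qed.
Lemma eqW (x y : R) : x = y -> x <= y. Proof. by move=> ->. Qed.
Local Notation mu := (@lebesgue_measure R).
Local Notation P := (@Rplus R).
Local Notation s2p := ((Num.sqrt (2 * pi) : R)^-1%:C).
Lemma Cint_exhaust (h : R -> C) : cint P h ->
  normc (Cintegral `[0, n%:R]%classic h - Cintegral P h) @[n --> \oo] --> 0.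
Proof.
move=> ih; have m0 (n : nat) : measurable (`[0, n%:R]%classic : set R) by exact: measurable_itv.
rewrite (Cint_cut P); under eq_fun do rewrite Cint_cut.
have sub (n : nat) : (`[0, n%:R]%classic : set R) `<=` P.
  by move=> t /=; rewrite in_itv /= => /andP[t0 _]; apply/RplusP.
have [] : cint setT (cut P h) /\
  normc (Cintegral setT (cut `[0, n%:R]%classic h) - Cintegral setT (cut P h)) @[n --> \oo] --> 0; last by [].
apply: (@cDCT R setT (fun n => cut `[0, n%:R]%classic h) (cut P h) (fun t => normc (cut P h t))) => //.
- move=> n; apply: mc_cut; first exact: m0.
  exact: (mcS (mRplus (R:=R)) (@sub n) (cint_meas ih)).
- move=> t _; have [t0|t0] := lerP 0 t.
    rewrite (cut_in _ ((RplusP t).2 t0)).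
    apply: cvg_near_cst; near=> n; rewrite cut_in ?subrr ?normc0 //=.
    by rewrite in_itv /= t0 /=; near: n; exact: nbhs_infty_ger.
  have nP : ~ P t by move=> /RplusP; rewrite leNgt t0.
  rewrite (cut_notin _ nP); apply: cvg_near_cst; near=> n.
  rewrite cut_notin ?subrr ?normc0 //; exact: contra_not (@sub n t) nP.
- move=> t n _; have [h1|h1] := pselect ((`[0, n%:R]%classic : set R) t).
    by rewrite (cut_in _ h1) (cut_in _ (@sub n t h1)).
  by rewrite (cut_notin _ h1) normc0 normc_ge0.
- by have [] := (cint_cut h (mRplus (R := R))).1 ih.
Unshelve. all: by end_near. Qed.
Lemma CFTCy (H h : R -> C) : cint P h ->
  (forall x, cder H x (h x)) -> (forall x, exists k, cder h x k) ->
  normc (H n%:R) @[n --> \oo] --> 0 -> Cintegral P h = - H 0.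
Proof.
move=> ih dH dh H0; apply: (ccvg_unique (Cint_exhaust ih)).
have hh : normc (H n.+1%:R) @[n --> \oo] --> 0.
  by have := H0; rewrite -(cvg_shiftS (fun n : nat => normc (H n%:R))).
rewrite -(cvg_shiftS (fun n : nat => normc (Cintegral `[0, n%:R]%classic h - - H 0))).
apply: cvg_trans hh; apply: near_eq_cvg; apply: nearW => n.
have n0 : 0 < n.+1%:R :> R by rewrite ltr0n.
have [|||_ e] := @CFTC R H h 0 n.+1%:R n0; last by rewrite /= e opprK subrK.
- by move=> x _; exact: dH.
- by move=> x _; have [k hk] := dh x; have [] := cder_cont hk.
- by move=> x _; have [k hk] := dh x; have [] := cder_cont hk.
Qed.
Lemma cder_ek (z : C) x : cder (exp_ker z) x (- z * exp_ker z x).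
Proof.
have e t : exp_ker z t = cexp (t%:C * - z) by rewrite /exp_ker mulrC mulrN.
rewrite e (_ : exp_ker z = fun t => cexp (t%:C * - z)); first exact: cder_cexp.
by apply/funext => t; exact: e.
Qed.
Lemma texp_cvg0 (c : R) k : 0 < c -> (n%:R ^+ k * expR (- (c * n%:R))) @[n --> \oo] --> (0 : R).
Proof.
move=> c0; have c20 : 0 < c / 2 by rewrite divr_gt0.
apply/cvgrPdist_le => e e0; near=> n.
have n0 : 0 < n%:R :> R by near: n; exact: nbhs_infty_gtr.
rewrite sub0r normrN ger0_norm ?mulr_ge0 ?exprn_ge0 ?expR_ge0 //.
have h1 := @pow_le_exp R (c * n%:R) k.+1 (mulr_ge0 (ltW c0) (ltW n0)).
rewrite expRN ler_pdivrMr ?expR_gt0 //.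
have h2 : k.+1`!%:R / c ^+ k.+1 / e <= n%:R by near: n; exact: nbhs_infty_ger.
rewrite ler_pdivrMr // ler_pdivrMr ?exprn_gt0 // in h2.
have h3 : n%:R ^+ k * n%:R * c ^+ k.+1 <= k.+1`!%:R * expR (c * n%:R).
  by rewrite -exprSr -exprMn [n%:R * c]mulrC.
have f0 : 0 < k.+1`!%:R :> R by rewrite ltr0n fact_gt0.
have p0 : 0 <= n%:R ^+ k :> R by exact: exprn_ge0.
rewrite -(ler_pM2l f0); apply: (@le_trans _ _ (e * (k.+1`!%:R * expR (c * n%:R)))); last by rewrite mulrCA.
apply: (@le_trans _ _ (e * (n%:R ^+ k * n%:R * c ^+ k.+1))); last by rewrite ler_pM2l.
apply: (@le_trans _ _ (n%:R * e * c ^+ k.+1 * n%:R ^+ k)); first by rewrite ler_wpM2r.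
by apply/eqW; ring.
Unshelve. all: by end_near. Qed.
Lemma cint_texp_ek (z : C) k : 0 < Re z -> cint P (fun t => (t ^+ k / k`!%:R)%:C * exp_ker z t).
Proof.
move=> z0; apply: (@cint_le _ _ _ (fun t => k`!%:R^-1 * (t ^+ k * expR (- (Re z * t))))) => //.
- by have := @mc_ek R P z => ?; meas.
- move=> t /RplusP t0; rewrite normcM normc_real normc_ek ger0_norm ?divr_ge0 ?exprn_ge0 //.
  by apply/eqW; ring.
- by apply: rintZ => //; exact: rint_texp.
Qed.

(** Induction on [k]: integration by parts, written as the fundamental theorem
    for [t^k e^{-zt}] on the half line. *)
Lemma int_texp_ek (z : C) k : 0 < Re z ->
  Cintegral P (fun t => (t ^+ k / k`!%:R)%:C * exp_ker z t) = z^-1 ^+ k.+1.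
Proof.
move=> z0; have nz : z != 0 by apply: contraTneq z0 => ->; rewrite ltxx.
have dpow (j : nat) (x : R) : is_derive x (1:R) (fun t => t ^+ j.+1 / j.+1`!%:R) (x ^+ j / j`!%:R).
  rewrite (_ : (fun t => _) = (fun t => (j.+1`!%:R)^-1 * t ^+ j.+1)); last first.
    by apply/funext => t; rewrite mulrC.
  have hX : is_derive x (1:R) (fun t => t ^+ j.+1) (j.+1%:R * x ^+ j).
    have := is_deriveX j.+1 (is_derive_id x (1:R)); rewrite exprfctE /= => h.
    by apply: (is_derive_eq h); rewrite /GRing.scale /= mulr1.
  apply: is_derive_eq; rewrite /GRing.scale /= factS natrM.
  have a0 : j.+1%:R != 0 :> R by rewrite pnatr_eq0.
  have b0 : j`!%:R != 0 :> R by rewrite pnatr_eq0 -lt0n fact_gt0.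
  move: a0 b0; set a := j.+1%:R; set b := j`!%:R.
  by move: a b (x ^+ j) => a b c a0 b0; field; rewrite a0 b0.
have ek0 : exp_ker z 0 = 1 by rewrite /exp_ker mulr0 oppr0 cexp0.
have norm_n (j n : nat) : normc ((n%:R ^+ j / j`!%:R)%:C * exp_ker z n%:R) = n%:R ^+ j * expR (- (Re z * n%:R)) * j`!%:R^-1.
  by rewrite normcM normc_real normc_ek ger0_norm ?divr_ge0 ?exprn_ge0 //; ring.
have lim0 j : normc ((n%:R ^+ j / j`!%:R)%:C * exp_ker z n%:R) @[n --> \oo] --> (0:R).
  under eq_fun do rewrite norm_n.
  have h : n%:R ^+ j * expR (- (Re z * n%:R)) / j`!%:R @[n --> \oo] --> (0:R) / j`!%:R.
    by apply: cvgM; [exact: texp_cvg0|exact: cvg_cst].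
  by rewrite mul0r in h.
have lim0' : normc (exp_ker z n%:R) @[n --> \oo] --> (0:R).
  by have := lim0 0%N; under eq_fun do rewrite expr0 fact0 divr1 mul1r.
elim: k => [|k IH].
  rewrite expr1 -[RHS]opprK.
  rewrite -[X in - X](_ : - z^-1 * exp_ker z 0 = _); last by rewrite ek0 mulr1.
  rewrite -(@CFTCy (fun t => - z^-1 * exp_ker z t) (exp_ker z)).
  - by apply: Cint_ext => t _; rewrite expr0 fact0 divr1 mul1r.
  - by apply: cint_ext (cint_texp_ek 0 z0) => // t _; rewrite expr0 fact0 divr1 mul1r.
  - by move=> x; have := cderZ (- z^-1) (cder_ek z x); rewrite mulrA mulrNN mulVf // mul1r.
  - by move=> x; exists (- z * exp_ker z x); exact: cder_ek.
  - under eq_fun do rewrite normcM.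
    exact: cvg_mul0l.
have h := @CFTCy (fun t => (t ^+ k.+1 / k.+1`!%:R)%:C * exp_ker z t)
   (fun t => (t ^+ k / k`!%:R)%:C * exp_ker z t + - z * ((t ^+ k.+1 / k.+1`!%:R)%:C * exp_ker z t)).
move: h; rewrite CintD //; last 2 first.
- exact: cint_texp_ek.
- by apply: cintZ => //; exact: cint_texp_ek.
rewrite CintZ ?IH //; last exact: cint_texp_ek.
rewrite expr0n /= mul0r mul0r oppr0 => /(_ _ _ _ (lim0 k.+1)) h.
have : z^-1 ^+ k.+1 + - z * Cintegral P (fun t => (t ^+ k.+1 / k.+1`!%:R)%:C * exp_ker z t) = 0.
  apply: h.
  - by apply: cintD => //; [|apply: cintZ => //]; exact: cint_texp_ek.
  - move=> x; have := cderRM (dpow k x) (cder_ek z x).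
    by rewrite [in X in _ -> X]mulrCA.
  - case: (k) => [|j] x.
      exists (- z * exp_ker z x + - z * ((x ^+ 0 / 0`!%:R)%:C * exp_ker z x + (x ^+ 1 / 1`!%:R)%:C * (- z * exp_ker z x))).
      apply: cderD; last by apply: cderZ; apply: cderRM => //; exact: cder_ek.
      have e : (fun t : R => (t ^+ 0 / 0`!%:R)%:C * exp_ker z t) = exp_ker z.
        by apply/funext => t; rewrite expr0 fact0 divr1 mul1r.
      by rewrite e; exact: cder_ek.
    eexists; exact: (cderD (cderRM (dpow j x) (cder_ek z x)) (cderZ (- z) (cderRM (dpow j.+1 x) (cder_ek z x)))).
move/eqP; rewrite mulNr subr_eq0 => /eqP e.
by apply: (mulfI nz); rewrite -e [z^-1 ^+ k.+2]exprS mulrA divff // mul1r.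
Qed.
Lemma lap_texp (w : C) k : 0 < Re (1 + w) ->
  laplace (fun t => (t ^+ k / k`!%:R * expR (- t))%:C) w = s2p * (1 + w)^-1 ^+ k.+1.
Proof.
move=> w0; rewrite laplaceE -int_texp_ek //; congr (_ * _).
apply: Cint_ext => t _; rewrite rmorphM /= -mulrA; congr (_ * _).
by rewrite -cexp_real -cexpD /exp_ker mulrDl mul1r opprD rmorphN.
Qed.
Lemma lap_exp (w : C) (c : R) : 0 < Re (c%:C + w) ->
  laplace (fun t => (expR (- (c * t)))%:C) w = s2p * (c%:C + w)^-1.
Proof.
move=> w0; rewrite laplaceE; congr (_ * _); rewrite -[RHS](int_texp_ek 0 w0).
apply: Cint_ext => t _; rewrite expr0 fact0 divr1 mul1r.
by rewrite -cexp_real -cexpD /exp_ker mulrDl opprD rmorphN rmorphM.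
Qed.

(** Translation of the variable; the cuts turn integrals over half lines into
    integrals over the line, which are translation invariant. *)
Lemma lap_shift (tau : R) (f : R -> C) (w : C) : 0 <= tau -> sqint P f -> 0 < Re w ->
  laplace (Defs.shift tau f) w = cexp (- (tau%:C * w)) * laplace f w.
Proof.
move=> t0 hf w0; rewrite !laplaceE mulrCA; congr (_ * _).
have ic := cint_lap hf w0; rewrite -CintZ //.
have ic2 : cint P (fun t => cexp (- (tau%:C * w)) * (f t * exp_ker w t)) by exact: cintZ.
rewrite Cint_cut [RHS]Cint_cut.
have [_ <-] := cint_translate (- tau) ((cint_cut _ (mRplus (R:=R))).1 ic2).
congr (Cintegral _ _); apply/funext => t; rewrite /Defs.shift.
have [ht|ht] := lerP tau t.
- rewrite cut_in; last by apply/RplusP; exact: le_trans ht.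
  rewrite cut_in; last by apply/RplusP; rewrite subr_ge0.
  rewrite mulrCA /exp_ker -cexpD; congr (_ * cexp _); first by rewrite ht.
  by rewrite rmorphB /= mulrBr; ring.
- rewrite [RHS]cut_notin; last by move=> /RplusP; rewrite subr_ge0 leNgt ht.
  by rewrite /cut; case: ifP => // _; rewrite leNgt ht /= mul0r.
Qed.
Lemma mr_fst (f : R -> R) : mrfun setT f -> mrfun setT (fun p : measurableTypeR R * measurableTypeR R => f p.1).
Proof. by move=> h; apply: (measurableT_comp h); exact: measurable_fst. Qed.
Lemma mr_snd (f : R -> R) : mrfun setT f -> mrfun setT (fun p : measurableTypeR R * measurableTypeR R => f p.2).
Proof. by move=> h; apply: (measurableT_comp h); exact: measurable_snd. Qed.
Lemma mc_fst (f : R -> C) : mcfun setT f -> mcfun setT (fun p : measurableTypeR R * measurableTypeR R => f p.1).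
Proof. by case=> h1 h2; split; [exact: (mr_fst h1)|exact: (mr_fst h2)]. Qed.
Lemma mc_snd (f : R -> C) : mcfun setT f -> mcfun setT (fun p : measurableTypeR R * measurableTypeR R => f p.2).
Proof. by case=> h1 h2; split; [exact: (mr_snd h1)|exact: (mr_snd h2)]. Qed.

(** The positive and the negative part have measurable integrals by Tonelli;
    their difference is the integral, under the convention for non-integrable
    sections as well. *)
Lemma mr_param (k : R -> R -> R) :
  mrfun setT (fun p : measurableTypeR R * measurableTypeR R => k p.1 p.2) ->
  mrfun setT (fun y => \int[mu]_x (k y x)).
Proof.
move=> mk; have mk' : measurable_fun setT (fun p : measurableTypeR R * measurableTypeR R => (k p.1 p.2)%:E).
  exact/measurable_EFinP.
rewrite (_ : (fun y => _) = (fun y => fine (\int[mu]_x ((fun p : measurableTypeR R * measurableTypeR R => (k p.1 p.2)%:E)^\+ (y, x))%E - \int[mu]_x ((fun p : measurableTypeR R * measurableTypeR R => (k p.1 p.2)%:E)^\- (y, x))%E)%E)); last first.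
  apply/funext => y; congr fine; rewrite integralE.
  by congr (_ - _)%E; apply: eq_integral => x _; rewrite ?funeposE ?funenegE.
apply: measurableT_comp; first exact: fine_measurable.
apply: emeasurable_funB.
- apply: (@measurable_fun_fubini_tonelli_F _ _ (measurableTypeR R) (measurableTypeR R) R mu).
  + exact: measurable_funepos.
  + by move=> x; exact: funepos_ge0.
- apply: (@measurable_fun_fubini_tonelli_F _ _ (measurableTypeR R) (measurableTypeR R) R mu).
  + exact: measurable_funeneg.
  + by move=> x; exact: funeneg_ge0.
Qed.
Lemma mc_param (k : R -> R -> C) :
  mcfun setT (fun p : measurableTypeR R * measurableTypeR R => k p.1 p.2) ->
  mcfun setT (fun y => Cintegral setT (k y)).
Proof.
by case=> h1 h2; split; [apply: (mr_param (k := fun y x => Re (k y x)))|apply: (mr_param (k := fun y x => Im (k y x)))].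
Qed.
Lemma mc_param_in (D : set R) (k : R -> R -> C) : measurable D ->
  mcfun setT (fun p : measurableTypeR R * measurableTypeR R => cut D (k p.1) p.2) ->
  mcfun setT (fun y => Cintegral D (k y)).
Proof.
move=> mD h; apply: mc_ext (mc_param (k := fun y => cut D (k y)) h) => y _.
by rewrite -Cint_cut.
Qed.
Lemma mc_cutM (D : set R) (f : R -> C) (g : R -> R -> C) : measurable D -> mcfun D f ->
  mcfun setT (fun p : measurableTypeR R * measurableTypeR R => g p.1 p.2) ->
  mcfun setT (fun y => Cintegral D (fun x => f x * g y x)).
Proof.
move=> mD mf mg; apply: mc_param_in => //.
apply: mc_ext (mcM (mc_snd (mc_cut mD mf)) mg) => p _.
by rewrite /cut; case: ifP => // _; rewrite mul0r.
Qed.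
Lemma mc_laplace (f : R -> C) (xi : R -> C) : mcfun P f -> mcfun setT xi ->
  mcfun setT (fun y => laplace f (xi y)).
Proof.
move=> mf mx; apply: mcM; first exact: mc_cst.
apply: mc_cutM => //; apply: mc_cexp; apply: mcN; apply: mcM; first exact: mc_fst.
by apply: mc_real; apply: (mr_snd (f := fun x => x)); exact: mr_id.
Qed.

(** A quadratic remainder is a difference quotient with a linear error. *)
Lemma analytic_bound (F : C -> C) (w l : C) (K d : R) : 0 < d ->
  (forall u, normc u < d -> normc (F (w + u) - F w - u * l) <= K * normc u ^+ 2) ->
  derivable (F : C^o -> C^o) w 1.
Proof.
move=> d0 h; apply/cvg_ex; exists l; apply/ccvgP.
have hn : normc u @[u --> (0 : C^o)^'] --> (0:R).
  have h0 : normc (u - 0) @[u --> (0 : C^o)^'] --> (0:R).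
    by apply/ccvgP; exact: cvg_within.
  by under eq_fun do rewrite -[X in normc X]subr0.
apply: (@ccvg_squeeze _ _ _ _ _ _ (fun u => K * normc u)); last first.
  exact: cvg_mul0l.
near=> u.
have u0 : u != 0 by near: u; exact: withinT.
have ud : normc u < d.
  by near: u; have /cvgrPdist_lt /(_ _ d0) := hn; apply: filterS => u; rewrite sub0r normrN ger0_norm ?normc_ge0.
have := h u ud; rewrite /= /GRing.scale /= mulr1 [u + w]addrC => h1.
have -> : u^-1 * (F (w + u) - F w) - l = u^-1 * (F (w + u) - F w - u * l).
  by field.
rewrite normcM normcV ler_pdivrMl ?normc_gt0 //.
by apply: le_trans h1 _; rewrite expr2; apply/eqW; ring.
Unshelve. all: by end_near. Qed.

(** Differentiate under the integral sign: the remainder of [cexp (- u t)] is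
    at most [|u|^2 t^2 e^{|u| t}].  With [|u| <= d = Re w / 4], it is absorbed
    by part of the decay [4 d] of the kernel, and [t^2 e^{-2dt}] is still
    square integrable. *)
Lemma laplace_analytic (f : R -> C) : sqint P f -> analytic_on Cplus (laplace f).
Proof.
move=> hf w; rewrite /Cplus /= => w0.
(* The decay rate is [4 d], of which [2 d] is kept. *)
pose d := Re w / 4; have d0 : 0 < d by rewrite divr_gt0.
have hk j : sqint P (fun t => (t ^+ j * expR (- (2 * d * t)))%:C) by apply: sq_texp; rewrite mulr_gt0.
have hm : sqint P (fun t => (t%:C) * exp_ker w t).
  apply: (sq_le_c _ _ _ (hk 1%N)) => //.
    by have := @mc_ek R P w => ?; meas.
  move=> t /RplusP t0; rewrite normcM !normc_real normc_ek normrM expr1 ler_wpM2l //.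
  rewrite ger0_norm ?expR_ge0 // ler_expR lerN2 ler_wpM2r // /d; lra.
have i1 := cint_mul (mRplus (R:=R)) hf hm.
pose K := (Num.sqrt (2 * pi) : R)^-1 * \int[mu]_(t in P) (normc (f t) * normc (t ^+ 2 * expR (- (2 * d * t)))%:C).
apply: (@analytic_bound _ w (- (s2p * Cintegral P (fun t => f t * (t%:C * exp_ker w t)))) K d d0) => u ud.
have wu0 : 0 < Re (w + u).
  rewrite cE; have := Re_le_normc u; rewrite ler_norml => /andP[h1 _].
  have : Re w = 4 * d by rewrite /d; field.
  by lra.
have -> : laplace f (w + u) - laplace f w - u * - (s2p * Cintegral P (fun t => f t * (t%:C * exp_ker w t))) =
  s2p * (Cintegral P (fun t => f t * exp_ker (w + u) t) - Cintegral P (fun t => f t * exp_ker w t) +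
         u * Cintegral P (fun t => f t * (t%:C * exp_ker w t))).
  by rewrite !laplaceE; ring.
have i2 := cint_lap hf w0; have i3 := cint_lap hf wu0.
rewrite -CintZ // -CintB // -CintD //; last 2 first.
- exact: cintB.
- by apply: cintZ.
rewrite normcM normc_real ger0_norm ?(ltW s2p_gt0) // /K -!mulrA ler_wpM2l ?(ltW s2p_gt0) //.
have i4 : cint P (fun t => f t * exp_ker (w + u) t - f t * exp_ker w t + u * (f t * (t%:C * exp_ker w t))).
  by apply: cintD => //; [exact: cintB|exact: cintZ].
have i5 := rint_mul (mRplus (R:=R)) hf (hk 2%N).
apply: le_trans (normc_Cint _ i4) _ => //.
rewrite mulrC -RintZ //; apply: Rint_le0 => //; [by case: i4|exact: rintZ|].
move=> t /RplusP t0.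
have -> : f t * exp_ker (w + u) t - f t * exp_ker w t + u * (f t * (t%:C * exp_ker w t)) =
   f t * exp_ker w t * (cexp (- (u * t%:C)) - 1 - (- (u * t%:C))).
  rewrite {1}/exp_ker mulrDl opprD cexpD -/(exp_ker w t); ring.
rewrite !normcM normc_ek.
apply: (@le_trans _ _ (normc (f t) * expR (- (Re w * t)) * ((normc u * t) ^+ 2 * expR (normc u * t)))).
  rewrite ler_wpM2l ?mulr_ge0 ?normc_ge0 ?expR_ge0 //.
  have := cexp_sub1z (- (u * t%:C)); rewrite normcN normcM normc_real [`|t|]ger0_norm //.
rewrite normc_real ger0_norm ?mulr_ge0 ?exprn_ge0 ?expR_ge0 //.
have -> : normc (f t) * expR (- (Re w * t)) * ((normc u * t) ^+ 2 * expR (normc u * t)) =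
  normc u ^+ 2 * (normc (f t) * (t ^+ 2 * (expR (- (Re w * t)) * expR (normc u * t)))) by ring.
rewrite ler_wpM2l ?exprn_ge0 ?normc_ge0 // ler_wpM2l ?normc_ge0 // ler_wpM2l ?exprn_ge0 //.
rewrite -expRD ler_expR.
have : normc u * t <= d * t by rewrite ler_wpM2r // ltW.
have : Re w = 4 * d by rewrite /d; field.
move=> ->; have : 0 <= d * t by rewrite mulr_ge0 // ltW.
lra.
Qed.
End HalfLine.

(** * The L^2 norm and a form of the Fatou lemma *)
Section Norms.
Context {R : realType}.
Local Notation C := R[i].
Local Notation mu := (@lebesgue_measure R).
Implicit Types (D : set R) (u v : R -> C).
Definition nrm D u := Num.sqrt (sqnorm D u).
Lemma nrm_ge0 D u : 0 <= nrm D u. Proof. exact: sqrtr_ge0. Qed.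
Lemma nrm_sqr D u : nrm D u ^+ 2 = sqnorm D u. Proof. by rewrite sqr_sqrtr // en_ge0. Qed.

(** [en_le_eps] at the optimal weight [e = B / A]. *)
Lemma nrm_leD D u v : measurable D -> sqint D u -> sqint D v ->
  nrm D (fun x => u x + v x) <= nrm D u + nrm D v.
Proof.
move=> mD hu hv; rewrite -(@ler_pXn2r _ 2) ?nnegrE ?addr_ge0 ?nrm_ge0 //.
have h e : 0 < e -> nrm D (fun x => u x + v x) ^+ 2 <= (1 + e) * nrm D u ^+ 2 + (1 + e^-1) * nrm D v ^+ 2.
  by move=> e0; rewrite !nrm_sqr; exact: en_le_eps.
set N := _ ^+ 2 in h *; set A := nrm D u in h *; set B := nrm D v in h *.
have A0 : 0 <= A by exact: nrm_ge0.
have B0 : 0 <= B by exact: nrm_ge0.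
have [a0|a0] := ltrP 0 A; last first.
  have -> : A = 0 by apply/eqP; rewrite eq_le A0 a0.
  rewrite add0r; apply/ler_addgt0Pr => e e0.
  have e1 : 0 < (B ^+ 2 + 1) / e by rewrite divr_gt0 // ltr_wpDl // exprn_ge0.
  apply: le_trans (h _ e1) _; have -> : A = 0 by apply/eqP; rewrite eq_le A0 a0.
  rewrite expr0n mulr0 add0r mulrDl mul1r lerD2l invf_div mulrAC ler_pdivrMr ?ltr_wpDl ?exprn_ge0 //.
  by rewrite ler_pM2l // lerDl.
have [b0|b0] := ltrP 0 B; last first.
  have B00 : B = 0 by apply/eqP; rewrite eq_le B0 b0.
  rewrite B00 addr0; apply/ler_addgt0Pr => e e0.
  have e1 : 0 < e / A ^+ 2 by rewrite divr_gt0 // exprn_gt0.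
  apply: le_trans (h _ e1) _; rewrite B00 expr0n mulr0 addr0 mulrDl mul1r divfK //.
  by rewrite gt_eqF // exprn_gt0.
have e1 : 0 < B / A by rewrite divr_gt0.
apply: le_trans (h _ e1) _; apply: eqW; field; by rewrite !gt_eqF.
Qed.
Lemma nrm_leB D u v : measurable D -> sqint D u -> sqint D v ->
  nrm D u <= nrm D v + nrm D (fun x => u x - v x).
Proof.
move=> mD hu hv; apply: le_trans (nrm_leD mD hv (sqB mD hu hv)).
by apply: eqW; congr Num.sqrt; apply: en_ext => x _; rewrite addrC subrK.
Qed.
Lemma nrmC D u v : nrm D (fun x => u x - v x) = nrm D (fun x => v x - u x).
Proof. by rewrite /nrm enC. Qed.

(** An integral bound passes to the pointwise limit; the limit may be
    infinite, which is how infinite values are excluded in [jensen]. *)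
Lemma fatou_bound_e D (F : nat -> R -> R) (f : R -> \bar R) (B : R) : measurable D ->
  (forall n, mrfun D (F n)) -> (forall n x, D x -> 0 <= F n x) ->
  (forall x, D x -> (F n x)%:E @[n --> \oo] --> f x) ->
  (\forall n \near \oo, rint D (F n) /\ \int[mu]_(x in D) F n x <= B) ->
  (\int[mu]_(x in D) f x <= B%:E)%E.
Proof.
move=> mD mF F0 hF hB.
have mFe n : measurable_fun D (fun x => (F n x)%:E) by apply/measurable_EFinP; exact: mF.
have h1 := @fatou _ _ R mu D mD (fun n x => (F n x)%:E) mFe (fun n x Dx => F0 n x Dx).
have h2 : (limn_einf (fun n => \int[mu]_(x in D) (F n x)%:E)%E <= B%:E)%E.
  rewrite limn_einf_lim; apply: lime_le; first exact: is_cvg_einfs.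
  have [N _ hN] := hB; apply: nearW => n.
  apply: (@le_trans _ _ (\int[mu]_(x in D) (F (maxn n N) x)%:E)%E).
    apply: ereal_inf_lbound; exists (maxn n N) => //=; exact: leq_maxl.
  have [i1 i2] := hN (maxn n N) (leq_maxr _ _).
  by rewrite -EFin_Rint // lee_fin.
apply: le_trans h2; apply: le_trans h1.
have -> // : (\int[mu]_(x in D) f x = \int[mu]_(x in D) limn_einf (fun n => (F n x)%:E))%E.
by apply: eq_integral => x; rewrite inE => /hF /cvg_limn_einf_sup [-> _].
Qed.
Lemma mr_patch0 D (N : set R) (f : R -> R) : measurable N -> mrfun D f ->
  mrfun D (fun x => f x * (x \notin N)%:R).
Proof.
move=> mN mf; apply: mrM => //.
have : mrfun D (\1_(~` N) : R -> R) by apply: measurable_indic; exact: measurableC.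
by apply: mr_ext => x _; rewrite indicE in_setC.
Qed.

(** The almost everywhere version, with integrability of the limit as part of
    the conclusion: it is the usual way of showing that a limit is integrable
    below. *)
Lemma fatou_bound D (F : nat -> R -> R) (f : R -> R) (B : R) : measurable D ->
  (forall n, mrfun D (F n)) -> (forall n x, D x -> 0 <= F n x) -> mrfun D f ->
  {ae mu, forall x, D x -> F n x @[n --> \oo] --> f x} ->
  (\forall n \near \oo, rint D (F n) /\ \int[mu]_(x in D) F n x <= B) ->
  rint D f /\ \int[mu]_(x in D) f x <= B.
Proof.
move=> mD mF F0 mf [N [mN N0 hN]] hB.
pose F' n x := F n x * (x \notin N)%:R; pose f' x := f x * (x \notin N)%:R.
have aeN (g : R -> R) : ae_eq mu D g (fun x => g x * (x \notin N)%:R).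
  exists N; split => // x; apply: contra_notP => xN _; rewrite memNset ?mulr1 //.
have hc x : D x -> F' n x @[n --> \oo] --> f' x.
  move=> Dx; rewrite /F' /f'; case: (boolP (x \in N)) => xN /=.
    by under eq_fun do rewrite mulr0; rewrite mulr0; exact: cvg_cst.
  under eq_fun do rewrite mulr1; rewrite mulr1.
  move: Dx; apply: contrapT => h; move: xN; rewrite notin_setE; apply; exact: hN.
have mF' n : mrfun D (F' n) by apply: mr_patch0 => //; exact: mF.
have mf' : mrfun D f' by exact: mr_patch0.
have F'0 n x : D x -> 0 <= F' n x by move=> Dx; rewrite mulr_ge0 // F0.
have f'0 x : D x -> 0 <= f' x.
  move=> Dx; rewrite -(cvg_lim _ (hc x Dx)) //; apply: limr_ge.
    by apply/cvg_ex; exists (f' x); exact: hc.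
  by apply: nearW => n; exact: F'0.
have [i1 i2] : rint D f' /\ \int[mu]_(x in D) f' x <= B.
  apply: rint_ge0B => //; apply: (@fatou_bound_e D F') => //.
  - move=> x Dx; apply/cvg_EFin; last exact: hc.
    by apply: nearW.
  - apply: filterS hB => n [h1 h2]; split; first exact: (rint_ae mD (mF' n) (aeN (F n)) h1).
    by rewrite -(Rint_ae mD (mF n) (mF' n) (aeN (F n))).
split.
  apply: rint_ae i1 => //; apply: aeS (aeN f) => x h Dx; by rewrite /f' -h.
by rewrite (Rint_ae mD mf mf' (aeN f)).
Qed.
Lemma rint_reflect (f : R -> R) : rint setT f ->
  rint setT (fun x => f (- x)) /\ \int[mu]_x f (- x) = \int[mu]_x f x.
Proof.
move=> hf; have mf := rint_meas hf.
have mt : measurable_fun setT (-%R : measurableTypeR R -> measurableTypeR R).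
  by apply: (@mrN _ (measurableTypeR R)); exact: measurable_id.
have mN : mrfun setT (fun x : R => f (- x)).
  move=> _ B mB; rewrite setTI.
  have h : measurable (f @^-1` B) by rewrite -[X in measurable X]setTI; exact: mf.
  by have := mt measurableT _ h; rewrite setTI; exact.
have eqm (g : R -> \bar R) : (\int[pushforward mu (-%R : _ -> measurableTypeR R)]_x g x = \int[mu]_x g x)%E.
  by apply: eq_measure_integral => A mA _; exact: lebesgue_measureN.
have h : rint setT (fun x => f (- x)).
  apply/integrableP; split; first exact/measurable_EFinP.
  have /integrableP[_] := hf.
  have := @ge0_integral_pushforward _ _ (measurableTypeR R) (measurableTypeR R) R
    -%R mt mu setT (fun x => `|(f x)%:E|)%E measurableT.
  rewrite preimage_setT eqm => -> //.
  by apply/measurable_EFinP; apply: mr_norm.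
split => //; congr fine.
have := @integral_pushforward _ _ (measurableTypeR R) (measurableTypeR R) R
  -%R mt mu setT (fun x => (f x)%:E).
rewrite preimage_setT eqm => -> //; exact/measurable_EFinP.
Qed.
Lemma Rint_odd (f : R -> R) : rint setT f -> (forall x, f (- x) = - f x) -> \int[mu]_x f x = 0.
Proof.
move=> hf ho; have [_ h] := rint_reflect hf.
have : \int[mu]_x f (- x) = - \int[mu]_x f x.
  by under eq_Rintegral do rewrite ho; rewrite -mulN1r -RintZ //; apply: eq_Rintegral => x _; rewrite mulN1r.
by rewrite h => /eqP; rewrite -subr_eq0 opprK -mulr2n mulrn_eq0 /= => /eqP.
Qed.

(** The primitive is [atan (y / a)]. *)
Lemma int_cauchy (a : R) : 0 < a ->
  rint setT (fun y => a / (a ^+ 2 + y ^+ 2)) /\ \int[mu]_y (a / (a ^+ 2 + y ^+ 2)) = pi.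
Proof.
move=> a0; have p0 (y : R) : 0 < a ^+ 2 + y ^+ 2.
  by rewrite ltr_pwDl ?exprn_gt0 ?sqr_ge0.
have f0 (y : R) : 0 <= a / (a ^+ 2 + y ^+ 2) by rewrite divr_ge0 // ltW.
have hd (y : R) : is_derive y (1:R) (fun t => atan (t / a)) (a / (a ^+ 2 + y ^+ 2)).
  apply: is_derive_eq; rewrite /GRing.scale /= mulr1.
  by field; rewrite !gt_eqF //=; have := p0 y; rewrite addrC.
have cf : continuous (fun y : R => a / (a ^+ 2 + y ^+ 2)).
  move=> y; apply: cvgM; first exact: cvg_cst.
  apply: cvgV; first by rewrite gt_eqF.
  by apply: cvgD; [exact: cvg_cst|apply: cvgM; exact: cvg_id].
have e1 : (\int[mu]_(x in `[0%R, +oo[) (a / (a ^+ 2 + x ^+ 2))%:E = (pi / 2)%:E)%E.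
  rewrite (@ge0_continuous_FTC2y _ _ (fun t => atan (t / a)) _ (pi / 2)).
  - by rewrite mul0r atan0 sube0.
  - by move=> x _.
  - exact: continuous_subspaceT.
  - apply: (@cvg_comp _ _ _ (fun t : R => t / a) atan _ (pinfty_nbhs R)); last exact: cvgy_atan.
    apply: gt0_cvgMly => //; rewrite invr_gt0 //.
  - by move=> x _; have [] := hd x.
  - have [/derivable1_diffP /differentiable_continuous h _] := hd 0; exact: cvg_at_right_filter h.
  - by move=> x _; rewrite derive1E; have [_ ->] := hd x.
have e2 : (\int[mu]_x (a / (a ^+ 2 + x ^+ 2))%:E = pi%:E)%E.
  rewrite ge0_symfun_integralT //; last by move=> x /=; rewrite sqrrN.
  rewrite (_ : [set x | 0 <= x] = `[0, +oo[%classic); last by apply/seteqP; split => x /=; rewrite in_itv /= andbT.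
  by rewrite e1 -EFinM; congr (_%:E); field.
have hr : rint setT (fun y => a / (a ^+ 2 + y ^+ 2)).
  by apply: rint_ge0P => //; [exact: continuous_measurable_fun|rewrite e2 ltry].
by split => //; apply/EFin_inj; rewrite EFin_Rint.
Qed.
End Norms.

(** * The Plancherel theorem on vertical lines *)
Section Plancherel.
Context {R : realType}.
Local Notation C := R[i].
Local Notation mu := (@lebesgue_measure R).
Local Notation P := (@Rplus R).
Local Notation s2p := ((Num.sqrt (2 * pi) : R)^-1%:C).
Implicit Types (p q : {poly C}).
Lemma normc_sum2 (I : Type) (r : seq I) (u : I -> C) :
  normc (\sum_(i <- r) u i) ^+ 2 = \sum_(i <- r) \sum_(j <- r) Re (u i * (u j)^*).
Proof.
have ReS (J : Type) (s : seq J) (v : J -> C) : Re (\sum_(i <- s) v i) = \sum_(i <- s) Re (v i).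
  by elim/big_ind2: _ => // a b c e <- <-; rewrite cE.
rewrite -[LHS](Re_real (normc _ ^+ 2)) -mulcJ mulr_suml ReS; apply: eq_bigr => i _.
by rewrite rmorph_sum mulr_sumr ReS.
Qed.

(** The combinations of the functions [e^{-mt}] with [m] positive, encoded by
    polynomials so that approximants are easy to combine. *)
Definition exp_poly p : R -> C := fun t => (expR (- t))%:C * p.[(expR (- t))%:C].
Lemma gpE p t : exp_poly p t = \sum_(i < size p) p`_i * (expR (- (i.+1%:R * t)))%:C.
Proof.
rewrite /exp_poly horner_coef mulr_sumr; apply: eq_bigr => i _.
rewrite mulrCA; congr (_ * _); rewrite -rmorphXn -rmorphM /=; congr (_%:C).
by rewrite -expRM_natl -expRD -natr1; congr expR; ring.
Qed.
Lemma sq_expm (m : nat) : sqint P (fun t => (expR (- (m.+1%:R * t)))%:C).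
Proof.
apply: sq_ext (@sq_texp R m.+1%:R 0 _) => //.
by move=> t _; rewrite expr0 mul1r.
Qed.
Lemma sq_sum D (I : Type) (r : seq I) (F : I -> R -> C) : measurable D ->
  (forall i, sqint D (F i)) -> sqint D (fun x => \sum_(i <- r) F i x).
Proof.
move=> mD h; elim: r => [|i r IH].
  apply: (@sq_ext _ _ (fun=> 0)) => //; first by move=> x _; rewrite big_nil.
  split; first exact: mc_cst.
  by apply: rint_ext (rint0 mD) => // x _; rewrite normc0 expr0n.
by apply: sq_ext (sqD mD (h i) IH) => // x _; rewrite big_cons.
Qed.
Lemma sq_gp p : sqint P (exp_poly p).
Proof.
apply: (@sq_ext _ _ (fun t => \sum_(i < size p) p`_i * (expR (- (i.+1%:R * t)))%:C)) => //.
  by move=> t _; rewrite gpE.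
by apply: sq_sum => // i; apply: sqZ => //; exact: sq_expm.
Qed.

(** Being approximable is closed under linear combinations and dominated
    limits. *)
Lemma gp_dense (h : R -> C) : sqint P h ->
  forall e : R, 0 < e -> exists p, sqnorm P (fun t => h t - exp_poly p t) <= e.
Proof.
pose V (f : R -> C) := forall e : R, 0 < e -> exists p, sqnorm P (fun t => f t - exp_poly p t) <= e.
apply: (@SV_all R V).
- move=> a f g sf sg Vf Vg e e0.
  have k0 : 0 < 2 * (normc a ^+ 2 + 1) by rewrite mulr_gt0 // ltr_wpDl // exprn_ge0 // normc_ge0.
  have e1 : 0 < e / 2 / (2 * (normc a ^+ 2 + 1)) by rewrite !divr_gt0.
  have e2 : 0 < e / 4 by rewrite divr_gt0.
  have [p hp] := Vf _ e1; have [q hq] := Vg _ e2; exists (a *: p + q).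
  rewrite (_ : sqnorm _ _ = sqnorm P (fun t => a * (f t - exp_poly p t) + (g t - exp_poly q t))); last first.
    by apply: en_ext => t _; rewrite /exp_poly hornerD hornerZ; ring.
  have sp := sqB (mRplus (R:=R)) sf (sq_gp p); have sq' := sqB (mRplus (R:=R)) sg (sq_gp q).
  apply: le_trans (en_leD _ (sqZ _ _ sp) sq') _ => //.
  rewrite enZ //.
  have h1 : 2 * (normc a ^+ 2 * sqnorm P (fun x : R => f x - exp_poly p x)) <= e / 2.
    rewrite ler_pdivlMr // in hp; apply: le_trans hp.
    rewrite [leRHS]mulrC mulrA ler_wpM2r ?en_ge0 // ler_pM2l // lerDl //.
  have -> : e = e / 2 + 2 * (e / 4) by field.
  by rewrite lerD // ler_pM2l.
- move=> u f H su sf Vu iH h1 h2 e e0.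
  have [_ he] : sqint P f /\ sqnorm P (fun x => u n x - f x) @[n --> \oo] --> 0.
    apply: L2_DCT iH => //.
    + by move=> n; case: (su n).
    + by move=> x /RplusP; exact: h2.
    + by move=> n x /RplusP; exact: h1.
  have e4 : 0 < e / 4 by rewrite divr_gt0.
  have [N _ /(_ N (leqnn N)) hN] := (cvgrPdist_le _ _).1 he _ e4.
  rewrite sub0r normrN ger0_norm ?en_ge0 // in hN.
  have [p hp] := Vu N _ e4; exists p.
  rewrite (_ : sqnorm _ _ = sqnorm P (fun t => (f t - u N t) + (u N t - exp_poly p t))); last first.
    by apply: en_ext => t _; rewrite addrA subrK.
  apply: le_trans (en_leD _ (sqB _ sf (su N)) (sqB _ (su N) (sq_gp p))) _ => //.
  rewrite enC; have -> : e = 2 * (e / 4) + 2 * (e / 4) by field.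
  by rewrite lerD // ler_pM2l.
- move=> m e e0; exists 'X^m.
  rewrite (_ : sqnorm _ _ = 0) ?ltW //.
  rewrite (_ : sqnorm _ _ = sqnorm P (fun=> 0)); last first.
    apply: en_ext => t _; rewrite /exp_poly hornerXn -rmorphXn -rmorphM /= -rmorphB /=.
    rewrite (_ : _ - _ = 0) //; apply/eqP; rewrite subr_eq0; apply/eqP.
    by rewrite -expRM_natl -expRD -natr1; congr expR; ring.
  have e1 : \int[mu]_(t in P) (0:R) = 0 by rewrite /Rintegral integral0.
  by rewrite -[RHS]e1; apply: eq_Rintegral => t _; rewrite normc0 expr0n.
Qed.
Definition vline (h : R -> C) (x y : R) : C := laplace h (x +i* y).
Definition damp (x : R) (h : R -> C) : R -> C := fun t => (expR (- (x * t)))%:C * h t.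
Lemma sq_damp x h : 0 <= x -> sqint P h -> sqint P (damp x h).
Proof.
move=> x0 hh; apply: sq_le_c (hh) => //.
  by have [m _] := hh; rewrite /damp; meas.
move=> t /RplusP t0; rewrite normcM normc_real ger0_norm ?expR_ge0 //.
by rewrite ler_piMl ?normc_ge0 // -[leRHS]expR0 ler_expR oppr_le0 mulr_ge0.
Qed.
Lemma en_damp x h : 0 <= x -> sqint P h -> sqnorm P (damp x h) <= sqnorm P h.
Proof.
move=> x0 hh; apply: en_le => //; first exact: sq_damp.
move=> t /RplusP t0; rewrite normcM normc_real ger0_norm ?expR_ge0 //.
by rewrite ler_piMl ?normc_ge0 // -[leRHS]expR0 ler_expR oppr_le0 mulr_ge0.
Qed.
Lemma mc_vl h x : mcfun P h -> mcfun setT (vline h x).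
Proof.
move=> mh; apply: mc_laplace => //; apply: mc_pair; [exact: mr_cst|exact: mr_id].
Qed.

(** Partial fractions: the even part is a sum of two Cauchy densities, and the
    odd part integrates to zero. *)
Lemma int_pair (a b : R) (c : C) : 0 < a -> 0 < b ->
  let f := fun y : R => Re (c * ((a +i* y)^-1 * ((b +i* y)^-1)^*)) in
  rint setT f /\ \int[mu]_y f y = Re c * (2 * pi / (a + b)).
Proof.
move=> a0 b0 f.
have pa (y : R) : a ^+ 2 + y ^+ 2 != 0 by rewrite gt_eqF // ltr_pwDl ?exprn_gt0 ?sqr_ge0.
have pb (y : R) : b ^+ 2 + y ^+ 2 != 0 by rewrite gt_eqF // ltr_pwDl ?exprn_gt0 ?sqr_ge0.
have pab : a + b != 0 by rewrite gt_eqF // addr_gt0.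
pose g1 (y : R) := (a + b)^-1 * (a / (a ^+ 2 + y ^+ 2) + b / (b ^+ 2 + y ^+ 2)).
pose g2 (y : R) := (y * (a - b)) / ((a ^+ 2 + y ^+ 2) * (b ^+ 2 + y ^+ 2)).
have fE y : f y = Re c * g1 y - Im c * g2 y.
  rewrite /f /g1 /g2 !cE; move: (pa y) (pb y) => pa' pb'; by field; rewrite pab pa' pb'.
have [ia ea] := int_cauchy a0; have [ib eb] := int_cauchy b0.
have i1 : rint setT g1 by apply: rintZ => //; exact: rintD.
have e1 : \int[mu]_y g1 y = 2 * pi / (a + b).
  by rewrite /g1 RintZ //; [rewrite RintD // ea eb; field|exact: rintD].
have i2 : rint setT g2.
  apply: (@rint_le _ _ _ (fun y => `|a - b| / a / b * (a / (a ^+ 2 + y ^+ 2) + b / (b ^+ 2 + y ^+ 2)))) => //.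
  - by rewrite /g2; meas.
  - move=> y _; rewrite /g2 normrM normrM normfV [in leLHS]normrM.
    have qa : 0 < a ^+ 2 + y ^+ 2 by rewrite ltr_pwDl ?exprn_gt0 ?sqr_ge0.
    have qb : 0 < b ^+ 2 + y ^+ 2 by rewrite ltr_pwDl ?exprn_gt0 ?sqr_ge0.
    rewrite (gtr0_norm qa) (gtr0_norm qb).
    have -> : `|a - b| / a / b * (a / (a ^+ 2 + y ^+ 2) + b / (b ^+ 2 + y ^+ 2)) =
      `|a - b| * (((a + b) / (a * b)) * (a * b + y ^+ 2) / ((a ^+ 2 + y ^+ 2) * (b ^+ 2 + y ^+ 2))).
      by field; rewrite pa pb !gt_eqF.
    set Q := (a ^+ 2 + y ^+ 2) * _; have Q0 : 0 < Q by exact: mulr_gt0.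
    rewrite [X in X / Q]mulrC -!mulrA ler_wpM2l // !mulrA ler_pM2r ?invr_gt0 //.
    rewrite mulrAC ler_pdivlMr ?mulr_gt0 //.
    have y2 : y ^+ 2 = `|y| ^+ 2 by rewrite real_normK ?num_real.
    rewrite y2; set z := `|y|; have z0 : 0 <= z by exact: normr_ge0.
    have := mulr_gt0 a0 b0; have := sqr_ge0 (a - z); have := sqr_ge0 (b - z).
    nra.
  - by apply: rintZ => //; exact: rintD.
have e2 : \int[mu]_y g2 y = 0.
  by apply: Rint_odd => // y; rewrite /g2 sqrrN !mulNr.
have i3 : rint setT (fun y => Re c * g1 y - Im c * g2 y) by apply: rintB => //; exact: rintZ.
split; first by apply: rint_ext i3 => // y _; rewrite fE.
rewrite (_ : Rintegral _ _ _ = \int[mu]_y (Re c * g1 y - Im c * g2 y)); last first.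
  by apply: eq_Rintegral => y _; exact: fE.
have j1 : rint setT (fun y => Re c * g1 y) by exact: rintZ.
have j2 : rint setT (fun y => Im c * g2 y) by exact: rintZ.
have z1 : \int[mu]_y (Re c * g1 y) = Re c * \int[mu]_y g1 y by exact: RintZ.
have z2 : \int[mu]_y (Im c * g2 y) = Im c * \int[mu]_y g2 y by exact: RintZ.
by rewrite RintB // z1 z2 e1 e2 mulr0 subr0.
Qed.
Lemma vl_gp p x y : 0 <= x -> vline (exp_poly p) x y = s2p * \sum_(i < size p) p`_i * ((i.+1%:R + x) +i* y)^-1.
Proof.
move=> x0; rewrite /vline laplaceE.
have re0 (i : nat) : 0 < Re (i.+1%:R%:C + (x +i* y)) by rewrite !cE ltr_wpDr.
have hi (i : nat) : cint P (fun t => (expR (- (i.+1%:R * t)))%:C * exp_ker (x +i* y) t).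
  apply: cint_ext (cint_texp_ek 0 (re0 i)) => // t _.
  by rewrite expr0 fact0 divr1 mul1r -cexp_real -cexpD /exp_ker mulrDl opprD rmorphN rmorphM.
congr (_ * _).
rewrite (_ : Cintegral _ _ = Cintegral P (fun t => \sum_(i < size p) p`_i * ((expR (- (i.+1%:R * t)))%:C * exp_ker (x +i* y) t))); last first.
  by apply: Cint_ext => t _; rewrite gpE mulr_suml; apply: eq_bigr => i _; rewrite mulrA.
rewrite Cint_sum //; last by move=> i; exact: cintZ.
apply: eq_bigr => i _; rewrite CintZ //; congr (_ * _).
apply: (mulfI s2p_neq0); rewrite -laplaceE lap_exp //; congr (_ * _ ^-1).
by apply: eqc; rewrite !cE // add0r.
Qed.

(** Both sides expand into double sums over the coefficients, and [int_pair]
    matches them term by term: [int e^{-(a+b)t} dt = (a + b)^-1]. *)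
Lemma plancherel_gp p x : 0 <= x ->
  sqint setT (vline (exp_poly p) x) /\ sqnorm setT (vline (exp_poly p) x) = sqnorm P (damp x (exp_poly p)).
Proof.
move=> x0; pose a (i : nat) := i.+1%:R + x : R.
have a0 i : 0 < a i by rewrite ltr_wpDr.
have e1 y : normc (vline (exp_poly p) x y) ^+ 2 = (2 * pi)^-1 * \sum_(i < size p) \sum_(j < size p)
   Re (p`_i * (p`_j)^* * ((a i +i* y)^-1 * ((a j +i* y)^-1)^*)).
  rewrite vl_gp // normcM exprMn normc_real ger0_norm ?(ltW s2p_gt0) // s2p_sqr; congr (_ * _).
  rewrite normc_sum2; apply: eq_bigr => i _; apply: eq_bigr => j _; congr Re.
  by rewrite rmorphM /=; ring.
have hi (i j : 'I_(size p)) := int_pair (p`_i * (p`_j)^*) (a0 i) (a0 j).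
have i1 : rint setT (fun y => (2 * pi)^-1 * \sum_(i < size p) \sum_(j < size p)
   Re (p`_i * (p`_j)^* * ((a i +i* y)^-1 * ((a j +i* y)^-1)^*))).
  apply: rintZ => //; apply: rint_sum => // i; apply: rint_sum => // j.
  by case: (hi i j).
split.
  split; first by apply: mc_vl; case: (sq_gp p).
  by apply: rint_ext i1 => // y _; rewrite e1.
rewrite /sqnorm (_ : Rintegral _ _ _ = \int[mu]_y ((2 * pi)^-1 * \sum_(i < size p) \sum_(j < size p)
   Re (p`_i * (p`_j)^* * ((a i +i* y)^-1 * ((a j +i* y)^-1)^*)))); last first.
  by apply: eq_Rintegral => y _; rewrite e1.
rewrite RintZ //; last first.
  by apply: rint_sum => // i; apply: rint_sum => // j; case: (hi i j).
rewrite Rint_sum //; last by move=> i; apply: rint_sum => // j; case: (hi i j).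
have e2 t : normc (damp x (exp_poly p) t) ^+ 2 = \sum_(i < size p) \sum_(j < size p)
   Re (p`_i * (p`_j)^*) * expR (- ((a i + a j) * t)).
  rewrite /damp gpE mulr_sumr normc_sum2; apply: eq_bigr => i _; apply: eq_bigr => j _.
  have -> : (expR (- (x * t)))%:C * (p`_i * (expR (- (i.+1%:R * t)))%:C) *
     ((expR (- (x * t)))%:C * (p`_j * (expR (- (j.+1%:R * t)))%:C))^* =
     p`_i * (p`_j)^* * (expR (- ((a i + a j) * t)))%:C.
    have cj (A B : R) (z : C) : (A%:C * (z * B%:C))^* = A%:C * (z^* * B%:C).
      by apply: eqc; rewrite !cE; ring.
    rewrite [X in _ * X = _]cj.
    have -> : (expR (- ((a i + a j) * t)))%:C = (expR (- (x * t)))%:C * (expR (- (i.+1%:R * t)))%:C * ((expR (- (x * t)))%:C * (expR (- (j.+1%:R * t)))%:C).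
      by rewrite -!rmorphM /= -!expRD /a; congr (_%:C); congr expR; ring.
    by ring.
  by rewrite [in LHS]cE Re_real Im_real mulr0 subr0.
have hj (i j : nat) : rint P (fun t => Re (p`_i * (p`_j)^*) * expR (- ((a i + a j) * t))).
  by apply: rintZ => //; have [] := int_expc (addr_gt0 (a0 i) (a0 j)).
rewrite (_ : \int[mu]_(t in P) _ = \int[mu]_(t in P) (\sum_(i < size p) \sum_(j < size p)
   Re (p`_i * (p`_j)^*) * expR (- ((a i + a j) * t)))); last first.
  by apply: eq_Rintegral => t _; rewrite e2.
rewrite Rint_sum //; last by move=> i; apply: rint_sum => // j.
rewrite mulr_sumr; apply: eq_bigr => i _.
rewrite Rint_sum //; last by move=> j; case: (hi i j).
rewrite Rint_sum // mulr_sumr; apply: eq_bigr => j _.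
have [_ ->] := hi i j; have [ie ee] := int_expc (addr_gt0 (a0 i) (a0 j)).
rewrite RintZ // ee.
have p0 : pi != 0 :> R by rewrite gt_eqF // pi_gt0.
have q0 : a i + a j != 0 by rewrite gt_eqF // addr_gt0.
have e3 (u v A : R) : u != 0 -> v != 0 -> (2 * u)^-1 * (A * (2 * u / v)) = A / v.
  by move=> u0 v0; field; rewrite u0 v0.
exact: e3.
Qed.
Lemma gp_seq (h : R -> C) : sqint P h -> exists p : nat -> {poly C},
  forall n, nrm P (fun t => h t - exp_poly (p n) t) <= n.+1%:R^-1.
Proof.
move=> hh; have e0 (n : nat) : 0 < (n.+1%:R^-1 : R) ^+ 2 by rewrite exprn_gt0 // invr_gt0.
have [p hp] := choice (fun n => gp_dense hh (e0 n)).
exists p => n; rewrite -(@ler_pXn2r _ 2) ?nnegrE ?nrm_ge0 ?invr_ge0 //.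
by rewrite nrm_sqr.
Qed.
Lemma vlB h g x y : sqint P h -> sqint P g -> 0 < x -> vline (fun t => h t - g t) x y = vline h x y - vline g x y.
Proof. by move=> hh hg x0; rewrite /vline lap_B. Qed.
Lemma dampB h g x t : damp x (fun t => h t - g t) t = damp x h t - damp x g t.
Proof. by rewrite /damp mulrBr. Qed.
Lemma nrm_damp x h : 0 <= x -> sqint P h -> nrm P (damp x h) <= nrm P h.
Proof. by move=> x0 hh; rewrite ler_sqrt ?en_ge0 // en_damp. Qed.
Lemma invn_cvg0 : (n.+1%:R^-1 : R) @[n --> \oo] --> 0.
Proof. exact: cvg_harmonic. Qed.

(** The upper bound passes from the dense exponential polynomials to all
    functions by Fatou, as the transforms converge pointwise.  Applied to
    differences, the bound shows that the transforms converge in norm as well,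
    and equality follows. *)
Lemma plancherel (h : R -> C) x : sqint P h -> 0 < x ->
  sqint setT (vline h x) /\ nrm setT (vline h x) = nrm P (damp x h).
Proof.
move=> hh x0; have le (k : R -> C) : sqint P k -> sqint setT (vline k x) /\ nrm setT (vline k x) <= nrm P (damp x k).
  move=> hk; have [p hp] := gp_seq hk.
  have mk : mcfun setT (vline k x) by apply: mc_vl; case: hk.
  have sd := sq_damp (ltW x0) hk.
  have hd n : nrm P (damp x (exp_poly (p n))) <= nrm P (damp x k) + n.+1%:R^-1.
    have s1 := sq_damp (ltW x0) (sq_gp (p n)).
    apply: le_trans (nrm_leB _ s1 sd) _ => //; rewrite lerD2l; apply: le_trans (hp n).
    rewrite nrmC; apply: le_trans (nrm_damp (ltW x0) (sqB _ hk (sq_gp (p n)))) => //.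
    by apply: eqW; congr Num.sqrt; apply: en_ext => t _; rewrite dampB.
  have hB (d : R) : 0 < d -> rint setT (fun y => normc (vline k x y) ^+ 2) /\
      \int[mu]_y (normc (vline k x y) ^+ 2) <= (nrm P (damp x k) + d) ^+ 2.
    move=> d0; apply: (@fatou_bound _ _ (fun n y => normc (vline (exp_poly (p n)) x y) ^+ 2)) => //.
    - by move=> n; apply: mrX; apply: mc_norm; apply: mc_vl; case: (sq_gp (p n)).
    - by move=> n y _; rewrite exprn_ge0 // normc_ge0.
    - by apply: mrX; apply: mc_norm.
    - apply: aeT => y _; apply: (cvgM (f := fun n => normc (vline (exp_poly (p n)) x y))); apply: ccvg_normc;
      pose K := Num.sqrt ((2 * pi)^-1 * (2 * x)^-1) : R;
      (apply: (@ccvg_squeeze _ _ _ _ _ _ (fun n => K * n.+1%:R^-1)); last by [exact: cvg_mul0l invn_cvg0]);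
      apply: nearW => n; rewrite -vlB //; try exact: sq_gp;
      have h1 := lap_bound (sqB (mRplus (R:=R)) (sq_gp (p n)) hk) (w := x +i* y) x0;
      rewrite -(@ler_pXn2r _ 2) ?nnegrE ?normc_ge0 ?mulr_ge0 ?sqrtr_ge0 ?invr_ge0 //;
      (apply: le_trans h1 _); rewrite exprMn sqr_sqrtr ?mulr_ge0 ?invr_ge0 ?mulr_ge0 ?pi_ge0 ?(ltW x0) //;
      rewrite ler_wpM2l ?mulr_ge0 ?invr_ge0 ?mulr_ge0 ?pi_ge0 ?(ltW x0) // -nrm_sqr;
      rewrite ler_pXn2r ?nnegrE ?nrm_ge0 ?invr_ge0 //; by rewrite nrmC.
    - near=> n; have [[_ s1] s2] := plancherel_gp (p n) (ltW x0); split => //.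
      rewrite -/(sqnorm setT (vline (exp_poly (p n)) x)) s2 -nrm_sqr ler_pXn2r ?nnegrE ?addr_ge0 ?nrm_ge0 ?(ltW d0) //.
      apply: le_trans (hd n) _; rewrite lerD2l.
      by near: n; have := near_infty_natSinv_lt (PosNum d0); apply: filterS => n /=; exact: ltW.
  have sk : sqint setT (vline k x) by split => //; have [] := hB 1 ltr01.
  split => //; apply/ler_addgt0Pr => e e0.
  rewrite -(@ler_pXn2r _ 2) ?nnegrE ?addr_ge0 ?nrm_ge0 ?(ltW e0) // nrm_sqr.
  by have [] := hB e e0.
have [sh hle] := le h hh; split => //; apply/eqP; rewrite eq_le hle /=.
have [p hp] := gp_seq hh; have sd := sq_damp (ltW x0) hh.
apply/ler_addgt0Pr => e e0; have e20 : 0 < e / 2 by rewrite divr_gt0.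
have [n hn] : exists n, (n.+1%:R^-1 : R) <= e / 2.
  by have [N _ /(_ N (leqnn N)) /= hN] := near_infty_natSinv_lt (PosNum e20); exists N; exact: ltW.
have s1 := sq_damp (ltW x0) (sq_gp (p n)).
have [s2 e2] := plancherel_gp (p n) (ltW x0).
have d1 : nrm P (fun t => damp x h t - damp x (exp_poly (p n)) t) <= e / 2.
  apply: le_trans hn; apply: le_trans (hp n).
  apply: le_trans (nrm_damp (ltW x0) (sqB _ hh (sq_gp (p n)))) => //.
  by apply: eqW; congr Num.sqrt; apply: en_ext => t _; rewrite dampB.
have d2 : nrm setT (fun y => vline (exp_poly (p n)) x y - vline h x y) <= e / 2.
  have [_ h1] := le _ (sqB (mRplus (R:=R)) (sq_gp (p n)) hh).
  apply: le_trans d1; rewrite [leRHS]nrmC; apply: le_trans (le_trans h1 _).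
    by apply: eqW; congr Num.sqrt; apply: en_ext => y _; rewrite vlB //; exact: sq_gp.
  by apply: eqW; congr Num.sqrt; apply: en_ext => t _; rewrite dampB.
have h3 := nrm_leB (mRplus (R:=R)) sd s1.
have h4 := nrm_leB (measurableT) s2 sh.
have h5 : nrm setT (vline (exp_poly (p n)) x) = nrm P (damp x (exp_poly (p n))) by rewrite /nrm e2.
apply: le_trans h3 _; rewrite -h5; apply: le_trans (lerD h4 d1) _.
rewrite -addrA lerD2l; apply: le_trans (lerD d2 (lexx _)) _.
by rewrite -splitr.
Unshelve. all: by end_near. Qed.
End Plancherel.

(** * The Poisson integral and the maximal function *)
Section Poisson.
Context {R : realType}.
Local Notation C := R[i].
Local Notation mu := (@lebesgue_measure R).
Local Notation P := (@Rplus R).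
Local Notation s2p := ((Num.sqrt (2 * pi) : R)^-1%:C).
Lemma Rint_ext (D : set R) (f g : R -> R) : (forall x, D x -> f x = g x) ->
  \int[mu]_(x in D) f x = \int[mu]_(x in D) g x.
Proof. by move=> h; apply: eq_Rintegral => x; rewrite inE; exact: h. Qed.

(** The Poisson kernel of the right half plane at distance [x] from the
    boundary. *)
Definition poisson_ker (x s : R) : R := pi^-1 * (x / (x ^+ 2 + s ^+ 2)).
Lemma pk_den (x s : R) : 0 < x -> 0 < x ^+ 2 + s ^+ 2.
Proof. by move=> x0; rewrite ltr_pwDl ?exprn_gt0 ?sqr_ge0. Qed.
Lemma pk_ge0 x s : 0 < x -> 0 <= poisson_ker x s.
Proof. by move=> x0; rewrite /poisson_ker mulr_ge0 ?invr_ge0 ?pi_ge0 // divr_ge0 ?(ltW (pk_den _ x0)) ?ltW. Qed.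
Lemma pk_le x s (r : R) : 0 < x -> 0 < r -> r ^+ 2 <= x ^+ 2 + s ^+ 2 -> poisson_ker x s <= x / r ^+ 2.
Proof.
move=> x0 r0 h; rewrite /poisson_ker.
have h1 : x / (x ^+ 2 + s ^+ 2) <= x / r ^+ 2.
  by rewrite ler_wpM2l ?(ltW x0) // lef_pV2 ?posrE ?exprn_gt0 ?pk_den.
apply: le_trans h1; rewrite ler_piMl ?divr_ge0 ?(ltW (pk_den _ x0)) ?(ltW x0) //.
by rewrite invf_le1 ?pi_gt0 // (le_trans _ (pi_ge2 R)) // ler1n.
Qed.
Lemma int_pk (x : R) : 0 < x -> rint setT (poisson_ker x) /\ \int[mu]_s poisson_ker x s = 1.
Proof.
move=> x0; have [h e] := int_cauchy x0; split; first exact: rintZ.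
by rewrite /poisson_ker RintZ // e mulVf // gt_eqF // pi_gt0.
Qed.

(** Partial fractions in [u^2], which require [x] and [c] to differ. *)
Lemma int_two_cauchy_neq (x c : R) : 0 < x -> 0 < c -> x != c ->
  \int[mu]_u (poisson_ker x u * (c / (c ^+ 2 + u ^+ 2))) = (x + c)^-1.
Proof.
move=> x0 c0 xc; have [ix ex] := int_cauchy x0; have [ic ec] := int_cauchy c0.
have p0 : pi != 0 :> R by rewrite gt_eqF // pi_gt0.
have d0 : c ^+ 2 - x ^+ 2 != 0.
  by rewrite subr_sqr mulf_neq0 ?subr_eq0 1?eq_sym // eq_sym gt_eqF // addr_gt0.
pose k := (pi * (c ^+ 2 - x ^+ 2))^-1.
have e1 u : poisson_ker x u * (c / (c ^+ 2 + u ^+ 2)) =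
    k * c * (x / (x ^+ 2 + u ^+ 2)) - k * x * (c / (c ^+ 2 + u ^+ 2)).
  have := pk_den u x0; have := pk_den u c0; rewrite /poisson_ker /k => h1 h2.
  by move: (pi : R) p0 => p p0; field; rewrite p0 d0 !gt_eqF.
rewrite (Rint_ext (fun u _ => e1 u)).
have z1 : \int[mu]_u (k * c * (x / (x ^+ 2 + u ^+ 2))) = k * c * pi by rewrite -ex; exact: RintZ.
have z2 : \int[mu]_u (k * x * (c / (c ^+ 2 + u ^+ 2))) = k * x * pi by rewrite -ec; exact: RintZ.
rewrite RintB ?z1 ?z2 //; try exact: rintZ.
have s0 : x + c != 0 by rewrite gt_eqF // addr_gt0.
have xc0 : c - x != 0 by rewrite subr_eq0 eq_sym.
by rewrite /k subr_sqr; move: (pi : R) p0 => p p0; field; rewrite p0 xc0 addrC [c + x]addrC s0.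
Qed.

(** The confluent case is the limit [c_n -> c] with [c_n > c]. *)
Lemma int_two_cauchy (x c : R) : 0 < x -> 0 < c ->
  \int[mu]_u (poisson_ker x u * (c / (c ^+ 2 + u ^+ 2))) = (x + c)^-1.
Proof.
move=> x0 c0; have [xc|] := eqVneq x c; last exact: int_two_cauchy_neq.
pose cn (n : nat) : R := c + n.+1%:R^-1.
have cn0 n : c < cn n by rewrite ltrDl invr_gt0.
have cnc : cn n @[n --> \oo] --> c.
  by rewrite -[X in _ --> X]addr0; apply: cvgD; [exact: cvg_cst|exact: invn_cvg0].
have [ix ex] := int_pk x0.
have h1 : \int[mu]_u (poisson_ker x u * (cn n / ((cn n) ^+ 2 + u ^+ 2))) @[n --> \oo] -->
    \int[mu]_u (poisson_ker x u * (c / (c ^+ 2 + u ^+ 2))).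
  apply: (proj2 (@rDCT _ setT _ _ (fun u => c^-1 * poisson_ker x u) _ _ _ _ _ _)) => //.
  - by move=> n; rewrite /poisson_ker; meas.
  - by rewrite /poisson_ker; meas.
  - apply: aeT => u _; apply: cvgM; first exact: cvg_cst.
    apply: cvgM => //; apply: cvgV; first by rewrite gt_eqF // pk_den.
    by apply: cvgD; [apply: (cvgM (f := cn)) | exact: cvg_cst].
  - apply: aeT => u n _; have cp : 0 < cn n by exact: lt_trans (cn0 n).
    rewrite normrM (ger0_norm (pk_ge0 _ x0)) mulrC ler_wpM2r ?pk_ge0 //.
    rewrite ger0_norm ?divr_ge0 ?(ltW (pk_den _ cp)) ?(ltW cp) // ler_pdivrMr ?pk_den //.
    rewrite mulrC ler_pdivlMr // expr2.
    by rewrite (le_trans (ler_wpM2l (ltW cp) (ltW (cn0 n)))) // lerDl sqr_ge0.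
  - exact: rintZ.
apply: (cvg_unique _ h1) => //.
rewrite (_ : (fun n => _) = (fun n => (x + cn n)^-1)).
  apply: cvgV; first by rewrite gt_eqF // addr_gt0.
  by apply: cvgD => //; exact: cvg_cst.
apply/funext => n; apply: int_two_cauchy_neq => //; first exact: lt_trans (cn0 n).
by rewrite xc lt_eqF.
Qed.
Lemma Cint_pk_cauchy (x c : R) : 0 < x -> 0 < c ->
  Cintegral setT (fun u => (poisson_ker x u)%:C * (c +i* u)^-1) = ((x + c)^-1)%:C.
Proof.
move=> x0 c0; apply: eqc.
  rewrite [LHS]/= [RHS]/= -int_two_cauchy //; apply: eq_Rintegral => u _.
  by rewrite /= mul0r subr0.
rewrite [LHS]/= [RHS]/=; apply: Rint_odd; last first.
  by move=> u; rewrite /= !mul0r !addr0 /poisson_ker sqrrN !mulNr !mulrN.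
have [ip _] := int_pk x0; apply: (@rint_le _ _ _ (fun u => c^-1 * poisson_ker x u)) => //.
- by rewrite /poisson_ker; meas.
- move=> u _; rewrite /= mul0r addr0 normrM (ger0_norm (pk_ge0 _ x0)) mulrC.
  rewrite ler_wpM2r ?pk_ge0 // normrN normrM normfV (gtr0_norm (pk_den u c0)).
  rewrite ler_pdivrMr ?pk_den // mulrC ler_pdivlMr //.
  have -> : u ^+ 2 = `|u| ^+ 2 by rewrite real_normK ?num_real.
  by have := normr_ge0 u; have := sqr_ge0 (c - `|u|); nra.
- exact: rintZ.
Qed.
Lemma vl_bounded (h : R -> C) (x y : R) : sqint P h -> 0 < x ->
  normc (vline h x y) <= Num.sqrt ((2 * pi)^-1 * (2 * x)^-1 * sqnorm P h).
Proof.
move=> hh x0; rewrite -(@ler_pXn2r _ 2) ?nnegrE ?normc_ge0 ?sqrtr_ge0 //.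
rewrite (le_trans (lap_bound (w := x +i* y) hh x0)) // sqr_sqrtr //.
by rewrite !mulr_ge0 ?en_ge0 ?invr_ge0 ?mulr_ge0 ?pi_ge0 ?(ltW x0).
Qed.
Lemma cint_pk_vl (h : R -> C) (x x' y : R) : sqint P h -> 0 < x -> 0 < x' ->
  cint setT (fun s => (poisson_ker x s)%:C * vline h x' (s + y)).
Proof.
move=> hh x0 x'0; pose K := Num.sqrt ((2 * pi)^-1 * (2 * x')^-1 * sqnorm P h).
have [ip _] := int_pk x0.
apply: (@cint_le _ _ _ (fun s => K * poisson_ker x s)) => //.
- apply: mcM; first by apply: mc_real; rewrite /poisson_ker; meas.
  by apply: mc_translate; apply: mc_vl; case: hh.
- move=> s _; rewrite normcM normc_real ger0_norm ?pk_ge0 // mulrC.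
  by rewrite ler_wpM2r ?pk_ge0 // vl_bounded.
- exact: rintZ.
Qed.

(** For exponentials this is the integral of a product of two Cauchy
    densities.  Both sides are linear and pass to dominated limits, so
    [SV_all] gives the general case. *)
Lemma poisson0 (h : R -> C) : sqint P h -> forall x' x : R, 0 < x' -> 0 < x ->
  laplace h (x' + x)%:C = Cintegral setT (fun s => (poisson_ker x s)%:C * vline h x' s).
Proof.
have ci (f : R -> C) (x' x : R) : sqint P f -> 0 < x' -> 0 < x -> cint setT (fun s => (poisson_ker x s)%:C * vline f x' s).
  by move=> hf x0 x1; apply: cint_ext (cint_pk_vl 0 hf x1 x0) => // s _; rewrite addr0.
move: h; apply: SV_all.
- move=> a f g hf hg Vf Vg x' x x'0 x0.
  rewrite lap_lin //; last by rewrite cE addr_gt0.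
  rewrite Vf // Vg // -CintZ //; last exact: ci.
  rewrite -CintD //; [|by apply: cintZ => //; exact: ci|exact: ci].
  by apply: Cint_ext => s _; rewrite /vline lap_lin // !mulrDr; ring.
- move=> u f H su hf Vu iH h1 h2 x' x x'0 x0; have [ip _] := int_pk x0.
  have h3 := lap_dct (w := (x' + x)%:C) (addr_gt0 x'0 x0) su hf iH h1 h2.
  have uH n : sqnorm P (u n) <= \int[mu]_(t in P) (H t ^+ 2).
    have [_ sun] := su n; apply: Rint_le0 => // t /RplusP t0.
    by apply: lerXn2r; rewrite ?nnegrE ?normc_ge0 ?h1 // (le_trans (normc_ge0 _) (h1 n _ t0)).
  pose K := Num.sqrt ((2 * pi)^-1 * (2 * x')^-1 * \int[mu]_(t in P) (H t ^+ 2)).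
  have h4 : normc (Cintegral setT (fun s => (poisson_ker x s)%:C * vline (u n) x' s) -
      Cintegral setT (fun s => (poisson_ker x s)%:C * vline f x' s)) @[n --> \oo] --> 0.
    apply: (proj2 (@cDCT _ setT _ _ (fun s => K * poisson_ker x s) _ _ _ _ _)) => //.
    + by move=> n; case: (ci (u n) x' x (su n) x'0 x0).
    + move=> s _; apply: ccvgM; first exact: ccvg_cst.
      exact: lap_dct iH h1 h2.
    + move=> s n _; rewrite normcM normc_real ger0_norm ?pk_ge0 // mulrC.
      rewrite ler_wpM2r ?pk_ge0 // (le_trans (vl_bounded _ _ _)) // ler_wsqrtr //.
      by rewrite ler_wpM2l // mulr_ge0 ?invr_ge0 ?mulr_ge0 ?pi_ge0 ?(ltW x'0).
    + exact: rintZ.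
  apply: ccvg_unique h3 _.
  rewrite (_ : (fun n => _) = (fun n => normc (Cintegral setT (fun s => (poisson_ker x s)%:C * vline (u n) x' s) -
      Cintegral setT (fun s => (poisson_ker x s)%:C * vline f x' s)))) //.
  by apply/funext => n; rewrite Vu.
- move=> m x' x x'0 x0; have m0 : 0 < m.+1%:R + x' by rewrite ltr_wpDl.
  rewrite lap_exp; last by rewrite !cE !addr_gt0.
  rewrite (_ : Cintegral _ _ = Cintegral setT (fun u => s2p * ((poisson_ker x u)%:C * ((m.+1%:R + x') +i* u)^-1))); last first.
    apply: Cint_ext => s _; rewrite /vline lap_exp; last by rewrite !cE.
    by rewrite mulrCA; congr (_ * (_ * _^-1)); apply: eqc; rewrite !cE // add0r.
  rewrite CintZ //.
    rewrite Cint_pk_cauchy //; congr (_ * _); rewrite fmorphV /=; congr (_^-1).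
    by rewrite -rmorphD /=; congr (_%:C); ring.
  have [ip _] := int_pk x0; apply: (@cint_le _ _ _ (fun u => (m.+1%:R + x')^-1 * poisson_ker x u)) => //.
  + apply: mcM; first by apply: mc_real; rewrite /poisson_ker; meas.
    by apply: mcV; apply: mc_pair; [exact: mr_cst|exact: mr_id].
  + move=> u _; rewrite normcM normc_real ger0_norm ?pk_ge0 // mulrC ler_wpM2r ?pk_ge0 //.
    rewrite normcV lef_pV2 ?posrE //; first by rewrite (le_trans _ (Re_le_normc _)) //= ler_norm.
    by rewrite normc_gt0; apply/eqP => /(congr1 (@complex.Re R)) /=; apply/eqP; rewrite gt_eqF.
  + exact: rintZ.
Qed.

(** Modulating [h] by [e^{-iyt}] translates its transform by [y], which
    reduces the claim to points of the real axis. *)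
Lemma poisson (h : R -> C) (x' x y : R) : sqint P h -> 0 < x' -> 0 < x ->
  vline h (x' + x) y = Cintegral setT (fun s => (poisson_ker x s)%:C * vline h x' (s + y)).
Proof.
move=> hh x'0 x0; pose g (t : R) := h t * exp_ker (0 +i* y) t.
have e (a b : R) : laplace g (a +i* b) = vline h a (b + y).
  rewrite /vline !laplaceE; congr (_ * _); apply: Cint_ext => t _.
  rewrite /g /exp_ker -mulrA -cexpD; congr (_ * cexp _); apply: eqc; rewrite /=; ring.
have hg : sqint P g.
  apply: sq_le_c (hh) => //; first by case: hh => m _; apply: mcM => //; exact: mc_ek.
  by move=> t _; rewrite normcM normc_ek cE mul0r oppr0 expR0 mulr1.
transitivity (laplace g ((x' + x) +i* 0)); first by rewrite e add0r.
transitivity (Cintegral setT (fun s => (poisson_ker x s)%:C * vline g x' s)); first exact: (poisson0 hg x'0 x0).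
by apply: Cint_ext => s _; rewrite [X in _ * X]e.
Qed.

(** The Poisson kernel is a probability density, so this is Cauchy-Schwarz. *)
Lemma poisson_sq (h : R -> C) (x' x y : R) : sqint P h -> 0 < x' -> 0 < x ->
  rint setT (fun s => poisson_ker x s * normc (vline h x' (s + y)) ^+ 2) /\
  normc (vline h (x' + x) y) ^+ 2 <= \int[mu]_s (poisson_ker x s * normc (vline h x' (s + y)) ^+ 2).
Proof.
move=> hh x'0 x0; have [ip ep] := int_pk x0.
have mpk : mrfun setT (poisson_ker x) by rewrite /poisson_ker; meas.
have mv : mcfun setT (fun s : R => vline h x' (s + y)) by apply: mc_translate; apply: mc_vl; case: hh.
pose q s := Num.sqrt (poisson_ker x s).
have q2 s : q s ^+ 2 = poisson_ker x s by rewrite sqr_sqrtr // pk_ge0.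
have mq : mrfun setT q by exact: mr_sqrt.
have su : sqint setT (fun s => (q s)%:C).
  split; first exact: mc_real.
  by apply: rint_ext ip => // s _; rewrite normc_real real_normK ?num_real.
pose K := Num.sqrt ((2 * pi)^-1 * (2 * x')^-1 * sqnorm P h).
have sv : sqint setT (fun s => (q s)%:C * vline h x' (s + y)).
  apply: (@sq_le _ _ _ (fun s => K * q s)) => //.
  - by apply: mcM => //; exact: mc_real.
  - move=> s _; rewrite normcM normc_real ger0_norm ?sqrtr_ge0 // mulrC.
    by rewrite ler_wpM2r ?sqrtr_ge0 // vl_bounded.
  - by apply: rint_ext (rintZ (K ^+ 2) _ ip) => // s _; rewrite exprMn q2.
have e2 s : normc ((q s)%:C * vline h x' (s + y)) ^+ 2 = poisson_ker x s * normc (vline h x' (s + y)) ^+ 2.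
  by rewrite normcM exprMn normc_real real_normK ?num_real // q2.
split; first by case: sv => _; apply: rint_ext => // s _; rewrite e2.
rewrite poisson //.
rewrite (_ : Cintegral _ _ = Cintegral setT (fun s => (q s)%:C * ((q s)%:C * vline h x' (s + y)))); last first.
  by apply: Cint_ext => s _; rewrite mulrA -rmorphM -expr2 q2.
apply: le_trans (CauchySchwarz measurableT su sv) _.
rewrite (_ : sqnorm setT (fun s => (q s)%:C) = 1); last first.
  by rewrite -ep; apply: eq_Rintegral => s _; rewrite normc_real real_normK ?num_real.
by rewrite mul1r; apply: eqW; apply: eq_Rintegral => s _; rewrite e2.
Qed.

(** The kernel is at most [x^-1] everywhere and at most [x / r^2] at distance
    [r]; the dyadic balls of radius [4 x 2^k] turn this into a sum of
    averages.  The centre may be displaced by [2 x], which is what cones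
    require. *)
Lemma pk_dyadic (x y y' s : R) N : 0 < x -> `|y' - y| < 2 * x ->
  poisson_ker x (s - y') <= \sum_(k < N) (x * 4 ^+ k)^-1 * (`|y - s| < 4 * x * 2 ^+ k)%R%:R + (x * 4 ^+ N)^-1.
Proof.
move=> x0 hy; elim: N => [|N IH].
  rewrite big_ord0 add0r expr0 mulr1; apply: le_trans (@pk_le _ _ x _ _ _) _ => //.
    by rewrite lerDl sqr_ge0.
  by rewrite expr2 invfM mulrA divff ?mul1r // gt_eqF.
have p4 k : 0 < x * 4 ^+ k :> R by rewrite mulr_gt0 // exprn_gt0.
rewrite big_ord_recr /=; have [h|h] := ltP.
  by rewrite mulr1; apply: (le_trans IH); rewrite lerDl invr_ge0 ltW.
rewrite mulr0 addr0; have r0 : 0 < x * 2 ^+ N.+1 :> R by rewrite mulr_gt0 // exprn_gt0.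
apply: (@le_trans _ _ (x * 4 ^+ N.+1)^-1); last first.
  by rewrite lerDr sumr_ge0 // => k _; rewrite mulr_ge0 ?invr_ge0 ?(ltW (p4 _)).
apply: le_trans (@pk_le _ _ (x * 2 ^+ N.+1) _ _ _) _ => //.
  rewrite -[leLHS]add0r lerD ?sqr_ge0 //; rewrite -[leRHS]real_normK ?num_real //.
  rewrite lerXn2r ?nnegrE ?(ltW r0) //.
  have h1 : `|y - s| <= `|s - y'| + `|y' - y|.
    by rewrite distrC (le_trans _ (ler_normD _ _)) // addrA subrK.
  have h2 : 1 <= 2 ^+ N :> R by rewrite exprn_ege1 // ler1n.
  move: h h1 hy; rewrite exprS; set A := 2 ^+ N in h2 *.
  set u := `|_|; set v := `|_|; set w := `|_|; nra.
rewrite exprMn -exprM mulnC exprM [2 ^+ 2](_ : _ = 4); last by ring.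
by rewrite expr2 -mulrA invfM mulrA divff ?mul1r // gt_eqF.
Qed.
Lemma HL_ball (g : R -> R) y r (M : R) : rint setT g -> (forall s, 0 <= g s) -> 0 < r ->
  (HL_maximal g y <= M%:E)%E ->
  rint setT (fun s => (`|y - s| < r)%R%:R * g s) /\ \int[mu]_s ((`|y - s| < r)%R%:R * g s) <= 2 * r * M.
Proof.
move=> ig g0 r0 hM; have mb : measurable (ball y r) by exact: measurable_ball.
have mi : mrfun setT (fun s : R => (`|y - s| < r)%R%:R * g s).
  apply: mrM; last exact: rint_meas.
  rewrite (_ : (fun s => _) = \1_(ball y r)); first exact: measurable_indic.
  apply/funext => s; rewrite indicE; congr (nat_of_bool _)%:R.
  by apply/idP/idP => [h|]; [rewrite inE|rewrite inE].
apply: rint_ge0B => //; first by move=> s _; rewrite mulr_ge0.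
have h : (iavg g (ball y r) <= M%:E)%E.
  by apply: le_trans hM; apply: ereal_sup_ubound; exists r => //=; rewrite in_itv /= r0.
have e : (\int[mu]_s ((`|y - s| < r)%R%:R * g s)%:E = \int[mu]_(s in ball y r) `|(g s)%:E|)%E.
  rewrite [RHS]integral_mkcond; apply: eq_integral => s _; rewrite patchE.
  case: ifPn; first by rewrite inE /ball /= => ->; rewrite mul1r ger0_norm.
  move=> hs; rewrite (_ : (`|y - s| < r) = false) ?mul0r //; apply/negbTE; apply: contra hs => hs.
  by rewrite inE.
rewrite e; move: h; rewrite /iavg lebesgue_measure_ball ?(ltW r0) //=.
rewrite (_ : r *+ 2 = 2 * r); last by rewrite mulr_natl.
have p0 : 0 < 2 * r by rewrite mulr_gt0.
rewrite inver (gt_eqF p0).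
set I := (\int[_]_(_ in _) _)%E; have I0 : (0 <= I)%E by apply: integral_ge0 => s _; rewrite lee_fin.
case: I I0 => [i| |] // I0.
  by rewrite -EFinM !lee_fin mulrC ler_pdivrMr // => h; rewrite mulrC.
by rewrite mulry gtr0_sg ?invr_gt0 // mul1e.
Qed.

(** The [k]-th term of [pk_dyadic] contributes at most [8 M 2^-k], with sum
    [16 M]; the remainder tends to zero as [N] grows. *)
Lemma poisson_HL (g : R -> R) x y y' (M : R) : rint setT g -> (forall s, 0 <= g s) -> 0 < x ->
  `|y' - y| < 2 * x -> (HL_maximal g y <= M%:E)%E ->
  rint setT (fun s => poisson_ker x s * g (s + y')) -> \int[mu]_s (poisson_ker x s * g (s + y')) <= 16 * M.
Proof.
move=> ig g0 x0 hy hM ip.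
have e : \int[mu]_s (poisson_ker x s * g (s + y')) = \int[mu]_s (poisson_ker x (s - y') * g s).
  have [_ <-] := rint_translate (- y') ip.
  by apply: eq_Rintegral => s _; rewrite subrK.
have ip' : rint setT (fun s => poisson_ker x (s - y') * g s).
  by have [h _] := rint_translate (- y') ip; apply: rint_ext h => // s _; rewrite subrK.
rewrite e; clear e; pose G := \int[mu]_s g s.
have G0 : 0 <= G by apply: Rintegral_ge0 => s _.
have M0 : 0 <= M.
  have [_ h] := HL_ball ig g0 (@ltr01 R) hM.
  have h0 : 0 <= \int[mu]_s ((`|y - s| < 1)%R%:R * g s) by apply: Rintegral_ge0 => s _; rewrite mulr_ge0.
  by have := le_trans h0 h; rewrite mulr1 pmulr_rge0.
have p4 k : 0 < x * 4 ^+ k :> R by rewrite mulr_gt0 // exprn_gt0.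
have hN N : \int[mu]_s (poisson_ker x (s - y') * g s) <= 16 * M + (x * 4 ^+ N)^-1 * G.
  pose r (k : nat) := 4 * x * 2 ^+ k; have r0 k : 0 < r k by rewrite !mulr_gt0 // exprn_gt0.
  have hk k := HL_ball ig g0 (r0 k) hM.
  pose f s := \sum_(k < N) (x * 4 ^+ k)^-1 * ((`|y - s| < r k)%R%:R * g s) + (x * 4 ^+ N)^-1 * g s.
  have i1 : rint setT (fun s => \sum_(k < N) (x * 4 ^+ k)^-1 * ((`|y - s| < r k)%R%:R * g s)).
    by apply: rint_sum => // k; apply: rintZ => //; case: (hk k).
  have i2 : rint setT (fun s => (x * 4 ^+ N)^-1 * g s) by exact: rintZ.
  apply: (@le_trans _ _ (\int[mu]_s f s)).
    apply: Rint_le0 => //; first exact: rintD.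
    move=> s _; rewrite /f (le_trans (ler_wpM2r (g0 s) (pk_dyadic s N x0 hy))) // mulrDl mulr_suml.
    by rewrite lerD2r; apply: ler_sum => k _; rewrite mulrA.
  rewrite RintD // RintZ // lerD2r Rint_sum //; last by move=> k; apply: rintZ => //; case: (hk k).
  apply: (@le_trans _ _ (\sum_(k < N) 8 * M * (2 ^+ k)^-1)).
    apply: ler_sum => k _; have [h1 h2] := hk k; rewrite RintZ //.
    apply: le_trans (ler_wpM2l _ h2) _; first by rewrite invr_ge0 ltW.
    rewrite /r (_ : 4 ^+ k = 2 ^+ k * 2 ^+ k :> R); last by rewrite -exprMn; congr (_ ^+ _); ring.
    have a0 : 2 ^+ k != 0 :> R by rewrite expf_neq0.
    by apply: eqW; field; rewrite a0 gt_eqF.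
  rewrite -mulr_sumr.
  have -> : \sum_(k < N) (2 ^+ k : R)^-1 = 2 - 2 * (2 ^+ N)^-1.
    elim: N {f i1 i2} => [|N IH]; first by rewrite big_ord0 expr0; field.
    rewrite big_ord_recr IH /= exprS; have a0 : 2 ^+ N != 0 :> R by rewrite expf_neq0.
    by field.
  have q0 : 0 <= (2 ^+ N : R)^-1 by rewrite invr_ge0 exprn_ge0.
  have := mulr_ge0 M0 q0; nra.
apply/ler_addgt0Pr => d d0.
have h4 : ((x * 4 ^+ N)^-1 * G) @[N --> \oo] --> 0.
  rewrite -[X in _ --> X](mul0r G); apply: cvgM; last exact: cvg_cst.
  rewrite (_ : (fun N => _) = (fun N => x^-1 * (4^-1 : R) ^+ N)).
    by apply: cvg_mul0l; apply: cvg_expr; rewrite ger0_norm // invf_lt1 // ltr1n.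
  by apply/funext => N; rewrite invfM exprVn.
have [N _ /(_ N (leqnn N)) h5] := (cvgrPdist_le _ _).1 h4 _ d0.
apply: le_trans (hN N) _; rewrite lerD2l; apply: le_trans h5.
by rewrite sub0r normrN ler_norm.
Qed.
End Poisson.

(** * Limits in cones *)
Section Cone.
Context {R : realType}.
Local Notation C := R[i].
Local Notation mu := (@lebesgue_measure R).
Local Notation P := (@Rplus R).
Local Notation s2p := ((Num.sqrt (2 * pi) : R)^-1%:C).

(** The points whose cone, with vertex at height [x0] and aperture two, meets
    the region where the transform is larger than [e].  Aperture two rather
    than one leaves room for non-strict inequalities in [clim]. *)
Definition cone_exceeds (h : R -> C) (x0 e : R) : set R :=
  [set y | exists x y', [/\ x0 < x, `|y' - y| < 2 * (x - x0) & e < normc (vline h x y')]].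
Lemma open_cone h x0 e : open (cone_exceeds h x0 e).
Proof.
move=> y [x [y' [hx hy he]]].
have d0 : 0 < 2 * (x - x0) - `|y' - y| by rewrite subr_gt0.
exists (2 * (x - x0) - `|y' - y|) => //= z; rewrite /ball_ => hz; exists x, y'; split => //.
have h1 : `|y' - z| <= `|y' - y| + `|y - z| by rewrite (le_trans _ (ler_normD _ _)) // addrA subrK.
by apply: (le_lt_trans h1); rewrite addrC -ltrBrDr.
Qed.
Lemma mcone h x0 e : measurable (cone_exceeds h x0 e).
Proof. by apply: open_measurable; exact: open_cone. Qed.

(** A value larger than [e] at height [x > x0] forces the maximal function of
    [|vline h x0|^2] above [e^2 / 16], by [poisson_sq] and [poisson_HL].  The
    maximal inequality, with its constant 3, and the Plancherel theorem at
    height [x0] conclude. *)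
Lemma weak_type1 (h : R -> C) (x0 e : R) : sqint P h -> 0 < x0 -> 0 < e ->
  (mu (cone_exceeds h x0 e) <= (48 / e ^+ 2 * sqnorm P h)%:E)%E.
Proof.
move=> hh x00 e0; have [[mv iv] nv] := plancherel hh x00.
pose g s := normc (vline h x0 s) ^+ 2.
have g0 s : 0 <= g s by rewrite exprn_ge0 // normc_ge0.
have ig : rint setT g by [].
have lg : locally_integrable setT g by apply: open_integrable_locally => //; exact: openT.
have c0 : 0 < e ^+ 2 / 16 by rewrite divr_gt0 // exprn_gt0.
(* [16 M] with [M = e^2 / 16] is [e^2]. *)
have sub : cone_exceeds h x0 e `<=` [set y | ((e ^+ 2 / 16)%:E < HL_maximal g y)%E].
  move=> y [x [y' [hx hy he]]] /=; rewrite ltNge; apply/negP => hM.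
  have xx : 0 < x - x0 by rewrite subr_gt0.
  have [i1 h1] := poisson_sq y' hh x00 xx.
  have h2 := poisson_HL ig g0 xx hy hM i1.
  have h3 := le_trans h1 h2.
  move: h3; rewrite mulrCA divff // mulr1 addrC subrK leNgt => /negP; apply.
  by rewrite ltrXn2r // ?nnegrE ?normc_ge0 ?(ltW e0) //.
have mH : measurable [set y | ((e ^+ 2 / 16)%:E < HL_maximal g y)%E].
  rewrite (_ : [set y | _] = setT `&` HL_maximal g @^-1` `](e ^+ 2 / 16)%:E, +oo[%classic).
    by apply: measurable_HL_maximal => //; exact: emeasurable_itv.
  by apply/seteqP; split => y /=; rewrite in_itv /= andbT //; case.
apply: le_trans (le_measure mu _ _ sub) _; rewrite ?inE //; first exact: mcone.
apply: le_trans (maximal_inequality lg c0) _.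
rewrite (_ : (\int[_]_(y in _) _)%E = (sqnorm setT (vline h x0))%:E); last first.
  rewrite /sqnorm EFin_Rint //; apply: eq_integral => y _.
  by rewrite gee0_abs // lee_fin.
rewrite -EFinM lee_fin -nrm_sqr nv nrm_sqr.
have -> : 3 / (e ^+ 2 / 16) = 48 / e ^+ 2 by rewrite invf_div mulrA -natrM.
by rewrite ler_wpM2l ?divr_ge0 ?exprn_ge0 ?(ltW e0) // en_damp // ltW.
Qed.

(** The sets at height [x0] increase to this one as [x0] decreases to zero,
    and the bound is uniform in [x0]. *)
Lemma weak_type (h : R -> C) (e : R) : sqint P h -> 0 < e ->
  (mu (cone_exceeds h 0 e) <= (48 / e ^+ 2 * sqnorm P h)%:E)%E.
Proof.
move=> hh e0; pose F (n : nat) := cone_exceeds h n.+1%:R^-1 e.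
have eF : cone_exceeds h 0 e = \bigcup_n F n.
  apply/seteqP; split => y.
    move=> [x [y' [hx hy he]]]; rewrite subr0 in hy.
    have d0 : 0 < x - `|y' - y| / 2 by rewrite subr_gt0 ltr_pdivrMr // mulrC.
    have [N _ /(_ N (leqnn N)) /= hN] := near_infty_natSinv_lt (PosNum d0).
    exists N => //; exists x, y'; split => //.
      by apply: lt_le_trans hN _; rewrite gerBl divr_ge0.
    by move: hN => /=; rewrite ltrBrDl -ltrBrDr ltr_pdivrMr // mulrC.
  move=> [n _ [x [y' [hx hy he]]]]; have n0 : 0 < n.+1%:R^-1 :> R by rewrite invr_gt0.
  exists x, y'; split => //; first exact: lt_trans hx.
  by apply: lt_trans hy _; rewrite ltr_pM2l // subr0 gtrBl.
have mF n : measurable (F n) by exact: mcone.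
have hF : {homo F : n m / (n <= m)%N >-> (n <= m)%O}.
  move=> n m nm; apply/subsetPset => y [x [y' [hx hy he]]].
  have h1 : m.+1%:R^-1 <= n.+1%:R^-1 :> R by rewrite lef_pV2 ?posrE // ler_nat.
  exists x, y'; split => //; first exact: le_lt_trans hx.
  by apply: lt_le_trans hy _; rewrite ler_pM2l // lerD2l lerN2.
have hc := @nondecreasing_cvg_mu _ _ _ mu F mF (bigcup_measurable (fun n _ => mF n)) hF.
rewrite eF -(cvg_lim _ hc) //; apply: lime_le; first by apply/cvg_ex; eexists; exact: hc.
by apply: nearW => n /=; apply: weak_type1 => //; rewrite invr_gt0.
Qed.
Lemma mr_step (D : set R) (T : R) : mrfun D (fun t : R => (t <= T)%R%:R : R).
Proof.
rewrite (_ : (fun t => _) = \1_(`]-oo, T]%classic)).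
  by apply: measurable_indic; exact: measurable_itv.
apply/funext => t; rewrite indicE; congr (nat_of_bool _)%:R.
by apply/idP/idP => [h|/set_mem]; [apply/mem_set|]; rewrite /= in_itv.
Qed.
Lemma sq_step (T : R) : sqint P (fun t => (t <= T)%R%:R%:C).
Proof.
have m1 : mrfun P (fun t : R => (t <= T)%R%:R : R) by exact: mr_step.
split; first exact: mc_real.
apply: (@rint_le _ _ _ (fun t => expR T * expR (- (1 * t)))) => //.
- by apply: mrX; apply: mc_norm; exact: mc_real.
- move=> t _; rewrite normc_real real_normK ?num_real // -expRD mul1r.
  have [tT|tT] := leP t T; last by rewrite expr0n normr0 expR_ge0.
  by rewrite expr1n normr1 -[leLHS]expR0 ler_expR subr_ge0.
- by apply: rintZ => //; have [] := int_expc (@ltr01 R).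
Qed.
Section Compact.
Variables (h : R -> C) (T : R).
Hypotheses (hh : sqint P h) (hs : forall t, T < t -> h t = 0).
Lemma rint_compact : rint P (fun t => normc (h t)).
Proof.
have s1 := sq_step T.
have := rint_mul (mRplus (R:=R)) s1 hh; apply: rint_ext => // t _.
rewrite normc_real; have [tT|tT] := leP t T; first by rewrite normr1 mul1r.
by rewrite hs // normc0 mulr0.
Qed.
Lemma normc_ek_le w t : 0 <= t -> t <= T -> normc (exp_ker w t) <= expR (T * normc w).
Proof.
move=> t0 tT; rewrite normc_ek ler_expR; apply: (@le_trans _ _ (normc w * t)); last first.
  by rewrite mulrC ler_wpM2r ?normc_ge0.
by rewrite -mulNr ler_wpM2r // (le_trans _ (Re_le_normc _)) // -normrN ler_norm.
Qed.
Lemma cint_compact w : cint P (fun t => h t * exp_ker w t).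
Proof.
apply: (@cint_le _ _ _ (fun t => expR (T * normc w) * normc (h t))) => //.
- by apply: mcM; [case: hh|exact: mc_ek].
- move=> t /RplusP t0; rewrite normcM mulrC; have [tT|tT] := leP t T.
    by rewrite ler_wpM2r ?normc_ge0 // normc_ek_le.
  by rewrite hs // normc0 !mulr0.
- by apply: rintZ => //; exact: rint_compact.
Qed.

(** A bounded support makes the transform entire; a Lipschitz bound near each
    point is all that is used. *)
Lemma lap_compact_lip (w0 : C) : exists K, forall u, normc u <= 1 ->
  normc (laplace h (w0 + u) - laplace h w0) <= K * normc u.
Proof.
pose I := \int[mu]_(t in P) normc (h t).
exists (normc s2p * (expR (T * normc w0) * (T * expR T) * I)) => u u1.
rewrite !laplaceE -mulrBr -CintB //; try exact: cint_compact.
rewrite normcM -!mulrA; apply: ler_wpM2l; first exact: normc_ge0.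
apply: le_trans (normc_Cint _ _) _ => //; first by apply: cintB => //; exact: cint_compact.
rewrite !mulrA [leRHS]mulrAC /I -RintZ //; last exact: rint_compact.
apply: Rint_le0 => //.
- by apply: cint_norm; apply: cintB => //; exact: cint_compact.
- by apply: rintZ => //; exact: rint_compact.
move=> t /RplusP t0; have [tT|tT] := leP t T; last by rewrite hs // !mul0r subr0 normc0 mulr0.
rewrite -mulrBr normcM mulrC ler_wpM2r ?normc_ge0 //.
have -> : exp_ker (w0 + u) t - exp_ker w0 t = exp_ker w0 t * (cexp (- (u * t%:C)) - 1).
  by rewrite /exp_ker mulrBr mulr1 -cexpD mulrDl opprD.
rewrite normcM -!mulrA; apply: ler_pM; rewrite ?normc_ge0 ?normc_ek_le //.
apply: le_trans (cexp_sub1 _) _; rewrite normcN normcM normc_real (ger0_norm t0).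
have -> : T * (expR T * normc u) = normc u * T * expR T by ring.
have nu := normc_ge0 u; apply: ler_pM; rewrite ?mulr_ge0 ?expR_ge0 //; first exact: ler_wpM2l.
by rewrite ler_expR (le_trans _ tT) // ler_piMl.
Qed.
End Compact.
Definition trunc (T : R) (h : R -> C) : R -> C := fun t => if t <= T then h t else 0.
Lemma trunc_le (T : R) h t : normc (trunc T h t) <= normc (h t).
Proof. by rewrite /trunc; case: ifP => // _; rewrite normc0 normc_ge0. Qed.
Lemma mc_trunc (T : R) h : mcfun P h -> mcfun P (trunc T h).
Proof.
move=> mh; have m1 : mrfun P (fun t : R => (t <= T)%R%:R : R) by exact: mr_step.
apply: (@mc_ext _ _ _ P (fun t : R => ((t <= T)%R%:R)%:C * h t)).
  by move=> t _; rewrite /trunc; case: (t <= T); rewrite ?mul1r ?mul0r.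
by apply: mcM => //; exact: mc_real.
Qed.
Lemma sq_trunc (T : R) h : sqint P h -> sqint P (trunc T h).
Proof.
move=> hh; apply: sq_le_c (hh) => //; first by apply: mc_trunc; case: hh.
by move=> t _; exact: trunc_le.
Qed.
Lemma trunc_supp (T : R) h t : T < t -> trunc T h t = 0.
Proof. by move=> tT; rewrite /trunc leNgt tT. Qed.
Lemma trunc_cvgn h : sqint P h -> sqnorm P (fun t => trunc n%:R h t - h t) @[n --> \oo] --> 0.
Proof.
move=> hh; apply: (proj2 (@L2_DCT R P _ _ (fun t => normc (h t)) _ _ _ _ _)) => //.
- by move=> n; case: (sq_trunc n%:R hh).
- move=> t _; apply: (@ccvg_squeeze _ _ _ _ _ _ (fun=> 0)); last exact: cvg_cst.
  near=> n; rewrite /trunc ifT ?subrr ?normc0 //.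
  by near: n; exact: nbhs_infty_ger.
- by move=> n t _; exact: trunc_le.
- by case: hh.
Unshelve. all: by end_near. Qed.
Lemma trunc_mono (T S : R) h : sqint P h -> T <= S ->
  sqnorm P (fun t => trunc S h t - h t) <= sqnorm P (fun t => trunc T h t - h t).
Proof.
move=> hh TS; apply: en_le => //; try by apply: sqB => //; exact: sq_trunc.
move=> t _; rewrite /trunc; case: (leP t T) => [tT|tT].
  by rewrite (le_trans tT TS).
by case: ifP => // _; rewrite ?subrr normc0 normc_ge0.
Qed.
Lemma trunc_cvg h (e : R) : sqint P h -> 0 < e ->
  \forall T \near +oo, sqnorm P (fun t => trunc T h t - h t) <= e.
Proof.
move=> hh e0; have [N _ /(_ N (leqnn N)) hN] := (cvgrPdist_le _ _).1 (trunc_cvgn hh) _ e0.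
rewrite sub0r normrN ger0_norm ?en_ge0 // in hN.
near=> T; apply: le_trans (trunc_mono hh _) hN.
by near: T; exact: nbhs_pinfty_ge.
Unshelve. all: by end_near. Qed.

(** The limit at [iy] in the cone of aperture one. *)
Definition clim (F : C -> C) (y : R) (l : C) := forall e, 0 < e ->
  exists2 d, 0 < d & forall x y', 0 < x < d -> `|y' - y| <= x -> normc (F (x +i* y') - l) <= e.
Definition small_osc (F : C -> C) (y e : R) := exists2 d, 0 < d &
  forall x y' z z', 0 < x < d -> 0 < z < d -> `|y' - y| <= x -> `|z' - y| <= z ->
    normc (F (x +i* y') - F (z +i* z')) <= e.
Lemma clim_horiz F y l : clim F y l -> normc (F (x +i* y) - l) @[x --> 0^'+] --> 0.
Proof.
move=> hl; apply/cvgrPdist_le => e e0; have [d d0 hd] := hl _ e0; near=> x.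
rewrite sub0r normrN ger0_norm ?normc_ge0 //; apply: hd; last by rewrite subrr normr0.
by apply/andP; split; near: x; [exact: nbhs_right_gt|exact: nbhs_right_lt].
Unshelve. all: by end_near. Qed.
Lemma clim_bdry F y l : clim F y l -> bdry_Cplus F y = l.
Proof. by move=> h; apply: ccvg_lim; exact: clim_horiz. Qed.
Lemma right_cauchy (f : R -> C) :
  (forall e, 0 < e -> exists2 d, 0 < d & exists c, forall x, 0 < x < d -> normc (f x - c) <= e) ->
  exists l, normc (f x - l) @[x --> 0^'+] --> 0.
Proof.
move=> hf; have cau (p : C -> R) : (forall a b, `|p a - p b| <= normc (a - b)) ->
    cvg (p (f x) @[x --> 0^'+]).
  move=> hp; apply/cauchy_cvgP; apply: cauchy_exP => e e0.
  have e2 : 0 < e / 2 by rewrite divr_gt0.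
  have [d d0 [c hd]] := hf _ e2; exists (p c).
  suff hn : \forall x \near (0:R)^'+, `|p c - p (f x)| < e by exact: hn.
  near=> x; apply: le_lt_trans (hp _ _) _.
  apply: (@le_lt_trans _ _ (e / 2)); last by rewrite ltr_pdivrMr // ltr_pMr // ltr1n.
  rewrite normc_distC; apply: hd.
  by apply/andP; split; near: x; [exact: nbhs_right_gt|exact: nbhs_right_lt].
have c1 : cvg (Re (f x) @[x --> 0^'+]).
  by apply: (cau (@complex.Re R)) => a b; have := Re_le_normc (a - b); rewrite !cE.
have c2 : cvg (Im (f x) @[x --> 0^'+]).
  by apply: (cau (@complex.Im R)) => a b; have := Im_le_normc (a - b); rewrite !cE.
by exists ((lim (Re (f x) @[x --> 0^'+])) +i* (lim (Im (f x) @[x --> 0^'+]))); apply/ccvg_ReIm; split.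
Unshelve. all: by end_near. Qed.

(** The Cauchy criterion on the horizontal line gives the limit, and the
    oscillation bound extends it to the cone. *)
Lemma osc_clim F y : (forall k : nat, small_osc F y k.+1%:R^-1) -> exists l, clim F y l.
Proof.
move=> ho; have ho' e : 0 < e -> small_osc F y e.
  move=> e0; have [N _ /(_ N (leqnn N)) /= hN] := near_infty_natSinv_lt (PosNum e0).
  have [d d0 hd] := ho N; exists d => // x y' z z' h1 h2 h3 h4.
  by apply: le_trans (hd _ _ _ _ h1 h2 h3 h4) _; exact: ltW.
have [l hl] : exists l, normc (F (x +i* y) - l) @[x --> 0^'+] --> 0.
  apply: right_cauchy => e e0; have [d d0 hd] := ho' e e0; exists d => //.
  exists (F ((d / 2) +i* y)) => x hx; apply: hd; rewrite ?subrr ?normr0 ?divr_ge0 ?(ltW d0) //.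
    by rewrite divr_gt0 //= ltr_pdivrMr // ltr_pMr // ltr1n.
  by case/andP: hx => /ltW.
exists l => e e0; have e2 : 0 < e / 2 by rewrite divr_gt0.
have [d d0 hd] := ho' _ e2; exists d => // x y' hx hy.
have [z [hz hz2]] : exists z, 0 < z < d /\ normc (F (z +i* y) - l) <= e / 2.
  near (0:R)^'+ => z; exists z; split.
    by apply/andP; split; near: z; [exact: nbhs_right_gt|exact: nbhs_right_lt].
  suff : `|0 - normc (F (z +i* y) - l)| <= e / 2 by rewrite sub0r normrN ger0_norm ?normc_ge0.
  by near: z; exact: (cvgrPdist_le _ _).1 hl _ e2.
rewrite (_ : _ - l = (F (x +i* y') - F (z +i* y)) + (F (z +i* y) - l)); last by rewrite addrA subrK.
apply: le_trans (normc_leD _ _) _; rewrite [e]splitr lerD //.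
by apply: hd => //; rewrite subrr normr0; case/andP: hz => /ltW.
Unshelve. all: by end_near. Qed.

(** Split [h] into a truncation and a tail.  The transform of the truncation
    is continuous up to the axis, so the oscillation in the cone is due to the
    tail, whose transform exceeds a given bound only on a set of small
    measure, by [weak_type]. *)
Lemma fatou_cone (h : R -> C) : sqint P h -> {ae mu, forall y, exists l, clim (laplace h) y l}.
Proof.
move=> hh; suff H (k : nat) : mu.-negligible [set y | ~ small_osc (laplace h) y k.+1%:R^-1].
  apply: negligibleS (negligible_bigcup H) => y /= hy; apply: contrapT => hn; apply: hy.
  by apply: osc_clim => k; apply: contrapT => hk; apply: hn; exists k.
(* Four error terms: two points, each with a truncation and a tail. *)
pose e : R := k.+1%:R^-1 / 4; have e0 : 0 < e by rewrite divr_gt0 // invr_gt0.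
pose tl (n : nat) t := trunc n%:R h t - h t.
have st n : sqint P (tl n) by apply: sqB => //; exact: sq_trunc.
(* The exceptional set is null, being contained in sets of measure at most
   [48 / e^2] times the squared norms of the tails. *)
pose U := \bigcap_n cone_exceeds (tl n) 0 e.
have mU : measurable U by apply: bigcap_measurable => // n _; exact: mcone.
exists U; split => //; last first.
  move=> y hy n _; apply: contrapT => hU; apply: hy.
  have hU' x y' : 0 < x -> `|y' - y| <= x -> normc (vline (tl n) x y') <= e.
    move=> x0 hx; rewrite leNgt; apply/negP => he; apply: hU; exists x, y'; split => //.
    by apply: le_lt_trans hx _; rewrite subr0 ltr_pMl // ltr1n.
  have [K hK] := @lap_compact_lip (trunc n%:R h) n%:R (sq_trunc _ hh) (@trunc_supp _ h) (0 +i* y).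
  have K0 : 0 <= `|K| + 1 by rewrite addr_ge0.
  pose d := Num.min (2^-1) (e / (2 * (`|K| + 1))).
  have d0 : 0 < d by rewrite lt_min invr_gt0 ltr0n /= divr_gt0 // mulr_gt0 // ltr_wpDl.
  have near1 x y' : 0 < x < d -> `|y' - y| <= x ->
      normc (laplace (trunc n%:R h) (x +i* y') - laplace (trunc n%:R h) (0 +i* y)) <= e.
    case/andP => x0 xd hx; have -> : x +i* y' = (0 +i* y) + (x +i* (y' - y)).
      by apply: eqc; rewrite !cE ?add0r // addrC subrK.
    have nu : normc (x +i* (y' - y)) <= 2 * x.
      apply: le_trans (normc_le_ReIm _) _; rewrite /= gtr0_norm // mulr_natl mulr2n lerD2l //.
    move: xd; rewrite lt_min => /andP[x1 x2].
    have nu1 : normc (x +i* (y' - y)) <= 1 by apply: le_trans nu _; rewrite mulrC -ler_pdivlMr // div1r ltW.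
    apply: le_trans (hK _ nu1) _.
    apply: (@le_trans _ _ ((`|K| + 1) * (2 * x))).
      apply: ler_pM => //; rewrite ?normc_ge0 //.
        by have := normc_ge0 (laplace (trunc n%:R h) (0 +i* y + 1) - laplace (trunc n%:R h) (0 +i* y)); have := hK 1; rewrite normc1 mulr1 => /(_ (lexx _)) h1 h2; exact: le_trans h1.
      by rewrite (le_trans (ler_norm _)) // lerDl.
    have -> : (`|K| + 1) * (2 * x) = x * (2 * (`|K| + 1)) by ring.
    by rewrite -ler_pdivlMr ?(ltW x2) // mulr_gt0 // ltr_wpDl.
  exists d => // x y' z z' hx hz hy hz'.
  have x0 : 0 < x by case/andP: hx. have z0 : 0 < z by case/andP: hz.
  have ex (a b : R) : 0 < a -> laplace h (a +i* b) = laplace (trunc n%:R h) (a +i* b) - vline (tl n) a b.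
    by move=> a0; rewrite /vline /tl lap_B ?opprB ?[_ + (_ - _)]addrC ?subrK //; exact: sq_trunc.
  rewrite !ex //; set A := laplace _ _; set B := vline _ _ _; set A' := laplace _ _; set B' := vline _ _ _.
  have h1 := near1 _ _ hx hy; have h2 := near1 _ _ hz hz'.
  have h3 := hU' _ _ x0 hy; have h4 := hU' _ _ z0 hz'.
  set L := laplace _ (0 +i* y) in h1 h2.
  have -> : A - B - (A' - B') = (A - L) - (A' - L) - (B - B') by ring.
  apply: le_trans (normcB _ _) _.
  have h5 := normcB (A - L) (A' - L); have h6 := normcB B B'.
  have -> : k.+1%:R^-1 = e + e + (e + e) by rewrite /e; field; rewrite nat1r pnatr_eq0.
  apply: lerD; first by apply: le_trans h5 _; exact: lerD.
  by apply: le_trans h6 _; exact: lerD.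
apply/eqP; rewrite eq_le measure_ge0 andbT.
have hc : (48 / e ^+ 2 * sqnorm P (tl n))%:E @[n --> \oo] --> (0:R)%:E.
  apply: cvg_EFin; first by apply: nearW.
  by apply: cvg_mul0l; exact: trunc_cvgn.
have -> : (0 : \bar R)%E = (0:R)%:E by [].
rewrite -(cvg_lim _ hc) //; apply: lime_ge; first by apply/cvg_ex; eexists; exact: hc.
apply: nearW => n; apply: le_trans (weak_type (st n) e0).
by apply: le_measure; rewrite ?inE //; [exact: mcone|exact: bigcap_inf].
Qed.
End Cone.

(** * Boundary functions *)
Section Boundary.
Context {R : realType}.
Local Notation C := R[i].
Local Notation mu := (@lebesgue_measure R).
Local Notation P := (@Rplus R).
Lemma analytic_ccont (F : C -> C) (U : set C) w (T : Type) (FF : set_system T) {ff : Filter FF} (p : T -> C) :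
  analytic_on U F -> U w -> normc (p x - w) @[x --> FF] --> 0 -> normc (F (p x) - F w) @[x --> FF] --> 0.
Proof.
move=> hF Uw hp; apply/ccvgP.
have h1 : {for (w : C^o), continuous (F : C^o -> C^o)}.
  by apply: differentiable_continuous; apply/derivable1_diffP; exact: hF.
have hp' : (p : T -> C^o) @ FF --> (w : C^o) by apply/ccvgP.
exact: cvg_comp hp' h1.
Qed.
Lemma ccvgB (T : Type) (FF : set_system T) {ff : Filter FF} (f g : T -> C) (l m : C) :
  normc (f x - l) @[x --> FF] --> 0 -> normc (g x - m) @[x --> FF] --> 0 ->
  normc (f x - g x - (l - m)) @[x --> FF] --> 0.
Proof.
move=> h1 h2; apply: (ccvgD h1).
rewrite (_ : (fun x => _) = (fun x => normc (g x - m))) //.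
by apply/funext => x; rewrite -opprD normcN.
Qed.
Lemma rat_near (x d : R) : 0 < d -> exists q : rat, `|ratr q - x| < d.
Proof.
move=> d0; have h : x - d < x + d by rewrite ltrD2l gtrN.
have [q] := rat_in_itvoo h; rewrite in_itv /= => /andP[h1 h2]; exists q.
by rewrite ltr_norml ltrBrDr ltrBlDr addrC h1 addrC.
Qed.
Lemma invn_at_right : (n.+1%:R^-1 : R) @[n --> \oo] --> (0:R)^'+.
Proof.
move=> A [d /= d0 hd]; have [N _ hN] := near_infty_natSinv_lt (PosNum d0).
exists N => // n /hN /= h; apply: hd => /=; last by rewrite invr_gt0.
by rewrite /ball_ /= sub0r normrN gtr0_norm // invr_gt0.
Qed.

(** The Cauchy criterion, tested at rational points, describes the set where
    the limit exists by countably many measurable conditions; on that set the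
    limit is a limit of a sequence of measurable functions, and outside it the
    value is a constant. *)
Lemma mc_right_lim (f : R -> R -> C) (B : R -> C) (c : C) :
  (forall y x, 0 < x < 1 -> normc (f t y - f x y) @[t --> x] --> 0) ->
  (forall x, 0 < x < 1 -> mcfun setT (f x)) ->
  (forall y l, normc (f x y - l) @[x --> 0^'+] --> 0 -> B y = l) ->
  (forall y, (forall l, ~ (normc (f x y - l) @[x --> 0^'+] --> 0)) -> B y = c) -> mcfun setT B.
Proof.
move=> cf mf hB hB'; pose a (m : nat) : R := m.+1%:R^-1; have a0 m : 0 < a m by rewrite invr_gt0.
have a1 m : a m <= 1 by rewrite invf_le1 // ler1n.
have aS m : a m.+1 < 1 by rewrite invf_lt1 // ltr1n.
(* [bad k m q]: at the rational [q < a m], the value is farther than [a k] from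
   the one at the reference point [a m.+1]. *)
pose bad k m (q : rat) : set R := [set y | 0 < (ratr q : R) < a m /\ a k < normc (f (ratr q) y - f (a m.+1) y)].
pose E : set R := \bigcap_k \bigcup_m ~` (\bigcup_q bad k m q).
have mE : measurable E.
  apply: bigcapT_measurable => k; apply: bigcupT_measurable => m; apply: measurableC.
  apply: bigcupT_measurable_rat => q; have [hq|hq] := boolP (0 < (ratr q : R) < a m); last first.
    rewrite (_ : bad _ _ _ = set0) //; apply/seteqP; split => // y [h _]; by rewrite h in hq.
  have [q0 qa] := andP hq.
  have m1 : mrfun setT (fun y : R => normc (f (ratr q) y - f (a m.+1) y)).
    apply: mc_norm; apply: mcD; first by apply: mf; rewrite q0 (lt_le_trans qa).
    by apply: mcN; apply: mf; rewrite a0 aS.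
  rewrite (_ : bad _ _ _ = setT `&` (fun y : R => normc (f (ratr q) y - f (a m.+1) y)) @^-1` `]a k, +oo[%classic).
    by apply: m1 => //; exact: measurable_itv.
  apply/seteqP; split => y /=; rewrite /bad /= in_itv /= andbT; first by case.
  by case.
have hE y : E y -> exists l, normc (f x y - l) @[x --> 0^'+] --> 0.
  move=> Ey; apply: right_cauchy => e e0.
  have [k _ /(_ k (leqnn k)) /= hk] := near_infty_natSinv_lt (PosNum e0).
  have [m _ hm] := Ey k I; exists (a m) => //; exists (f (a m.+1) y) => x /andP[x0 xa].
  apply/ler_addgt0Pr => d d0.
  have hc : normc (f t y - f x y) @[t --> x] --> 0 by apply: cf; rewrite x0 (lt_le_trans xa).
  have [r /= r0 hr] := (cvgrPdist_le _ _).1 hc _ d0.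
  have [q hq] := @rat_near x (Num.min r (Num.min x (a m - x))) ltac:(by rewrite !lt_min r0 x0 subr_gt0).
  move: hq; rewrite !lt_min => /and3P[q1 q2 q3].
  have hq : 0 < (ratr q : R) < a m.
    move: q2 q3; rewrite !ltr_norml => /andP[q2 _] /andP[_ q3].
    by move: q2 q3; rewrite ltrBrDr addNr ltrD2r => -> ->.
  have h1 : normc (f (ratr q) y - f (a m.+1) y) <= a k.
    by rewrite leNgt; apply/negP => h; apply: hm; exists q.
  have h2 : normc (f (ratr q) y - f x y) <= d.
    have hb : ball_ [eta Num.Def.normr] x r (ratr q) by rewrite /ball_ /= distrC.
    by have := hr _ hb; rewrite /= sub0r normrN ger0_norm ?normc_ge0.
  have -> : f x y - f (a m.+1) y = (f (ratr q) y - f (a m.+1) y) - (f (ratr q) y - f x y).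
    by ring.
  apply: le_trans (normcB _ _) _; apply: lerD => //; apply: le_trans h1 _; exact: ltW.
have hE' y : ~ E y -> forall l, ~ (normc (f x y - l) @[x --> 0^'+] --> 0).
  move=> nE l hl; apply: nE => k _.
  have ak : 0 < a k / 2 by rewrite divr_gt0.
  have := (cvgrPdist_le _ _).1 hl _ ak => -[d /= d0 hd].
  have [m _ /(_ m (leqnn m)) /= hm] := near_infty_natSinv_lt (PosNum d0).
  exists m => // -[q _ [/andP[q0 qa]]]; apply/negP; rewrite -leNgt.
  have n1 (x : R) : 0 < x -> x < d -> normc (f x y - l) <= a k / 2.
    move=> x0 xd; have hb : ball_ [eta Num.Def.normr] 0 d x by rewrite /ball_ /= sub0r normrN gtr0_norm.
    by have := hd _ hb x0; rewrite sub0r normrN ger0_norm ?normc_ge0.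
  have am : a m.+1 < d by apply: le_lt_trans hm; rewrite lef_pV2 ?posrE // ler_nat.
  rewrite (_ : _ - f (a m.+1) y = (f (ratr q) y - l) - (f (a m.+1) y - l)); last by ring.
  apply: le_trans (normcB _ _) _; rewrite [a k]splitr lerD // n1 //.
  by apply: lt_trans hm.
have EE : setT = E `|` ~` E by rewrite setUv.
have m1 : mcfun E B.
  apply: (@mc_lim _ _ _ E (fun n y => f (a n.+1) y)) => //.
    by move=> n; apply: mcS (mf (a n.+1) _) => //; rewrite a0 aS.
  move=> y /hE[l hl]; rewrite (hB y l hl).
  have h : a n.+1 @[n --> \oo] --> (0:R)^'+.
    move=> A [d /= d0 hd]; have [N _ hN] := near_infty_natSinv_lt (PosNum d0).
    exists N => // n /= Nn; apply: hd => //=; rewrite /ball_ /= sub0r normrN gtr0_norm //.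
    exact: (hN n.+1 (leqW Nn)).
  exact: cvg_comp h hl.
have m2 : mcfun (~` E) B.
  by apply: (@mc_ext _ _ _ _ (fun=> c)); [move=> y /hE' h; rewrite (hB' y h)|exact: mc_cst].
by split; rewrite EE; (apply/measurable_funU => //; [exact: measurableC|]);
  split; [exact: m1.1|exact: m2.1|exact: m1.2|exact: m2.2].
Qed.
Lemma mc_bdry (F : C -> C) : analytic_on Cplus F ->
  (forall x : R, 0 < x -> mcfun setT (fun y : R => F (x +i* y))) -> mcfun setT (bdry_Cplus F).
Proof.
move=> aF mF; apply: (@mc_right_lim (fun x y => F (x +i* y)) _ (point : C^o)).
- move=> y x /andP[x0 _].
  apply: (@analytic_ccont _ _ (x +i* y) _ _ _ (fun t => t +i* y) aF) => //.
  rewrite (_ : (fun t => _) = (fun t => `|t - x|)); last first.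
    by apply/funext => t; rewrite -normc_real; congr normc; apply: eqc; rewrite !cE // subrr.
  apply/cvgrPdist_le => e' e'0; exists e' => //= t; rewrite /ball_ /= => ht.
  by rewrite sub0r normrN normr_id distrC ltW.
- by move=> x /andP[x0 _]; exact: mF.
- by move=> y l hl; rewrite /bdry_Cplus (ccvg_lim hl).
- move=> y h; rewrite /bdry_Cplus dvgP // => hc; apply: (h (lim ((F (x +i* y) : C^o) @[x --> 0^'+]))).
  by apply/ccvgP.
Qed.
Local Notation B h := (bdry_Cplus (laplace h)).
Lemma mc_bdry_lap h : sqint P h -> mcfun setT (B h).
Proof.
move=> hh; apply: mc_bdry; first exact: laplace_analytic.
by move=> x x0; apply: mc_vl; case: hh.
Qed.
Lemma bdry_ae (h : R -> C) : sqint P h ->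
  {ae mu, forall y, normc (laplace h (x +i* y) - B h y) @[x --> 0^'+] --> 0}.
Proof.
move=> hh; apply: aeS (fatou_cone hh) => y [l hl].
by rewrite (clim_bdry hl); exact: clim_horiz.
Qed.

(** Fatou along [x = 1/n], with the Plancherel theorem as the uniform bound. *)
Lemma bdry_le (h : R -> C) : sqint P h -> sqint setT (B h) /\ nrm setT (B h) <= nrm P h.
Proof.
move=> hh; have [i1 h1] : rint setT (fun y => normc (B h y) ^+ 2) /\ \int[mu]_y (normc (B h y) ^+ 2) <= sqnorm P h.
  have i0 n : 0 < n.+1%:R^-1 :> R by rewrite invr_gt0.
  apply: (@fatou_bound _ _ (fun n y => normc (vline h n.+1%:R^-1 y) ^+ 2)) => //.
  - by move=> n; apply: mrX; apply: mc_norm; apply: mc_vl; case: hh.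
  - by move=> n y _; rewrite exprn_ge0 // normc_ge0.
  - by apply: mrX; apply: mc_norm; exact: mc_bdry_lap.
  - apply: aeS (bdry_ae hh) => y hy _.
    have h1 : normc (vline h n.+1%:R^-1 y - B h y) @[n --> \oo] --> 0 by exact: cvg_comp invn_at_right hy.
    by apply: (cvgM (f := fun n => normc (vline h n.+1%:R^-1 y))); exact: ccvg_normc h1.
  - apply: nearW => n; have [[_ s1] s2] := plancherel hh (i0 n); split => //.
    rewrite -/(sqnorm setT (vline h n.+1%:R^-1)) -nrm_sqr s2 nrm_sqr; apply: en_damp => //.
split; first by split => //; exact: mc_bdry_lap.
by rewrite ler_sqrt ?en_ge0.
Qed.
Lemma lap_damp (x : R) (h : R -> C) w : laplace (damp x h) w = laplace h (w + x%:C).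
Proof.
rewrite !laplaceE; congr (_ * _); apply: Cint_ext => t _.
rewrite /damp /exp_ker mulrAC mulrC; congr (_ * _); rewrite -cexp_real -cexpD; congr cexp.
by rewrite mulrDl opprD addrC rmorphN rmorphM.
Qed.
Lemma lap_horiz (h : R -> C) (x y : R) : sqint P h -> 0 < x -> normc (laplace h ((t + x) +i* y) - laplace h (x +i* y)) @[t --> 0^'+] --> 0.
Proof.
move=> hh x0; apply: (@analytic_ccont _ _ (x +i* y) _ _ _ (fun t => (t + x) +i* y) (laplace_analytic hh)) => //.
rewrite (_ : (fun t => _) = (fun t => `|t|)); last first.
  by apply/funext => t; rewrite -normc_real; congr normc; apply: eqc; rewrite !cE ?subrr // addrK.
apply/cvgrPdist_le => e e0; near=> t; rewrite sub0r normrN normr_id gtr0_norm.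
  by near: t; exact: nbhs_right_le.
by near: t; exact: nbhs_right_gt.
Unshelve. all: by end_near. Qed.

(** Damping by [e^{-xt}] translates the transform by [x], so the boundary
    function of the damped function is a value inside the half plane. *)
Lemma bdry_damp (x : R) (h : R -> C) (y : R) : sqint P h -> 0 < x -> B (damp x h) y = vline h x y.
Proof.
move=> hh x0; apply: ccvg_lim.
rewrite (_ : (fun t => _) = (fun t => normc (laplace h ((t + x) +i* y) - laplace h (x +i* y)))); first exact: lap_horiz.
by apply/funext => t; rewrite lap_damp; congr (normc (laplace h _ - _)); apply: eqc; rewrite !cE // addr0.
Qed.
Lemma bdry_B f g : sqint P f -> sqint P g ->
  {ae mu, forall y, B (fun t => f t - g t) y = B f y - B g y}.
Proof.
move=> hf hg; apply: ae2 (bdry_ae hf) (bdry_ae hg) => y h1 h2; apply: ccvg_lim.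
have h3 := ccvgB h1 h2; have {h3} h3 : normc (laplace f (x +i* y) - laplace g (x +i* y) - (B f y - B g y)) @[x --> 0^'+] --> 0 by exact: h3.
apply: cvg_trans h3; apply: near_eq_cvg; near=> x.
rewrite lap_B //=; by near: x; exact: nbhs_right_gt.
Unshelve. all: by end_near. Qed.
Lemma damp_cvg (h : R -> C) (e : R) : sqint P h -> 0 < e ->
  exists2 x : R, 0 < x & nrm P (fun t => damp x h t - h t) <= e.
Proof.
move=> hh e0; have [_ hc] : sqint P h /\ sqnorm P (fun t => damp n.+1%:R^-1 h t - h t) @[n --> \oo] --> 0.
  apply: (@L2_DCT R P _ _ (fun t => normc (h t))) => //.
  - by move=> n; apply: (sq_damp _ hh).1; rewrite invr_ge0.
  - move=> t _; rewrite /damp.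
    have h1 : normc ((expR (- (n.+1%:R^-1 * t)))%:C - (1:R)%:C) @[n --> \oo] --> 0.
      apply: ccvg_real; rewrite -[X in _ --> X]expR0.
      apply: continuous_cvg; first exact: continuous_expR.
      rewrite -[X in _ --> X]oppr0; apply: cvgN; rewrite -[X in _ --> X](mul0r t).
      by apply: cvgM; [exact: invn_cvg0|exact: cvg_cst].
    have h2 : normc ((expR (- (n.+1%:R^-1 * t)))%:C * h t - (1:R)%:C * h t) @[n --> \oo] --> 0.
      by apply: ccvgM => //; exact: ccvg_cst.
    by move: h2; rewrite (_ : (1:R)%:C * h t = h t) //; exact: mul1r.
  - move=> n t /RplusP t0; rewrite normcM normc_real ger0_norm ?expR_ge0 //.
    by rewrite ler_piMl ?normc_ge0 // -[leRHS]expR0 ler_expR oppr_le0 mulr_ge0 ?invr_ge0.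
  - by case: hh.
have e2 : 0 < e ^+ 2 by rewrite exprn_gt0.
have [N _ /(_ N (leqnn N)) hN] := (cvgrPdist_le _ _).1 hc _ e2.
exists N.+1%:R^-1; first by rewrite invr_gt0.
rewrite sub0r normrN ger0_norm ?en_ge0 // in hN.
by rewrite -(@ler_pXn2r _ 2) ?nnegrE ?nrm_ge0 ?(ltW e0) // nrm_sqr.
Qed.
Lemma nrm_ae D u v : measurable D -> mcfun D u -> mcfun D v -> ae_eq mu D u v -> nrm D u = nrm D v.
Proof. by move=> *; congr Num.sqrt; exact: en_ae. Qed.
Lemma bdry_B_le f g : sqint P f -> sqint P g -> nrm setT (fun y => B f y - B g y) <= nrm P (fun t => f t - g t).
Proof.
move=> hf hg; have hfg := sqB (mRplus (R:=R)) hf hg; have [s1 h1] := bdry_le hfg.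
rewrite (_ : nrm setT _ = nrm setT (B (fun t => f t - g t))) //; apply: nrm_ae => //.
- by apply: mcD; [|apply: mcN]; exact: mc_bdry_lap.
- exact: mc_bdry_lap.
- by apply: aeS (bdry_B hf hg) => y hy _.
Qed.

(** For a damped function, boundary function and vertical line coincide, so
    equality is the Plancherel theorem; damping is a small perturbation in
    norm, on both sides by [bdry_B_le]. *)
Lemma bdry_iso (h : R -> C) : sqint P h -> nrm setT (B h) = nrm P h.
Proof.
move=> hh; have [s1 h1] := bdry_le hh; apply/eqP; rewrite eq_le h1 /=.
apply/ler_addgt0Pr => e e0; have e2 : 0 < e / 2 by rewrite divr_gt0.
have [x x0 hx] := damp_cvg hh e2; have sd := sq_damp (ltW x0) hh.
have [s2 h2] := bdry_le sd; have [s3 h3] := plancherel hh x0.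
have h4 : nrm setT (B (damp x h)) = nrm P (damp x h).
  by rewrite -h3; congr Num.sqrt; apply: en_ext => y _; rewrite bdry_damp.
have h5 := nrm_leB (mRplus (R:=R)) hh sd.
have h6 := nrm_leB measurableT s2 s1; have h7 := bdry_B_le sd hh.
have h8 : nrm P (fun t => h t - damp x h t) <= e / 2 by rewrite nrmC.
rewrite h4 in h6; apply: (le_trans h5); apply: (le_trans (lerD h6 h8)).
rewrite [in leRHS](splitr e) [leRHS]addrA; apply: lerD => //.
by rewrite lerD2l; exact: le_trans h7 hx.
Qed.

(** The Plancherel theorem on the line of abscissa one gives [e^{-t} (f - g) =
    0] in L^2. *)
Lemma laplace_inj f g : sqint P f -> sqint P g -> (forall w, Cplus w -> laplace f w = laplace g w) -> ae_eq mu P f g.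
Proof.
move=> hf hg h; have hfg := sqB (mRplus (R:=R)) hf hg; have [_ e1] := plancherel hfg (@ltr01 R).
have e2 : sqnorm P (damp 1 (fun t => f t - g t)) = 0.
  rewrite -nrm_sqr -e1 nrm_sqr -[RHS](_ : sqnorm setT (fun=> 0) = 0); last first.
    by rewrite /sqnorm /Rintegral (eq_integral (fun=> 0%E)) ?integral0 // => y _; rewrite normc0 expr0n.
  by apply: en_ext => y _; rewrite vlB // /vline h ?subrr //= /Cplus /=.
have [m1 i1] := sq_damp (@ler01 R) hfg.
have : ae_eq mu P (EFin \o (fun t => normc (damp 1 (fun t => f t - g t) t) ^+ 2)) (cst 0%E).
  apply: (proj1 (@ae_eq_integral_abs _ _ R mu P (@mRplus R) _ _)); first by apply/measurable_EFinP; apply: mrX; exact: mc_norm.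
  rewrite -[RHS](_ : (sqnorm P (damp 1 (fun t => f t - g t)))%:E = 0%E); last by rewrite e2.
  rewrite /sqnorm EFin_Rint //; apply: eq_integral => t _ /=.
  by rewrite ger0_norm // exprn_ge0 // normc_ge0.
apply: aeS => t ht Pt; have /= := ht Pt => -[] /eqP; rewrite sqrf_eq0 normc_eq0 mulf_eq0.
case/orP => [|]; last by rewrite subr_eq0 => /eqP.
by rewrite -normc_eq0 normc_real normr_eq0 gt_eqF // expR_gt0.
Qed.
End Boundary.

(** * Fourier inversion in the mean *)
Section Inversion.
Context {R : realType}.
Local Notation C := R[i].
Local Notation mu := (@lebesgue_measure R).
Local Notation P := (@Rplus R).
Local Notation s2p := ((Num.sqrt (2 * pi) : R)^-1%:C).
Local Notation B h := (bdry_Cplus (laplace h)).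
Local Notation RR := (measurableTypeR R * measurableTypeR R)%type.
Implicit Types (D : set R) (u v G : R -> C) (N T : R).
Lemma rFubini (k : R -> R -> R) (a b : R -> R) :
  mrfun setT (fun p : RR => k p.1 p.2) ->
  (forall t, mrfun setT (k t)) -> (forall y, mrfun setT (k^~ y)) ->
  (forall t y, `|k t y| <= a t * b y) -> rint setT a -> rint setT b ->
  \int[mu]_t \int[mu]_y k t y = \int[mu]_y \int[mu]_t k t y.
Proof.
move=> mk mk1 mk2 hk ia ib.
have i1 t : rint setT (k t).
  by apply: (@rint_le _ _ _ (fun y => a t * b y)) => //; exact: rintZ.
have i2 y : rint setT (k^~ y).
  apply: (@rint_le _ _ _ (fun t => b y * a t)) => //; last exact: rintZ.
  by move=> t _; rewrite mulrC.
have mf : measurable_fun setT (fun p : RR => (k p.1 p.2)%:E) by exact/measurable_EFinP.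
have hf : (mu \x mu)%E.-integrable setT (fun p : RR => (k p.1 p.2)%:E).
  apply/(@integrable12ltyP _ _ (measurableTypeR R) (measurableTypeR R) R mu mu) => //.
  have e1 t : (\int[mu]_y `|(k t y)%:E| = (\int[mu]_y `|k t y|)%:E)%E.
    by rewrite EFin_Rint //; exact: rint_norm.
  under eq_integral do rewrite e1.
  have i3 : rint setT (fun t => (\int[mu]_y b y) * a t) by exact: rintZ.
  have m3 : mrfun setT (fun t => \int[mu]_y `|k t y|).
    by apply: mr_param; exact: mr_norm.
  have i4 : rint setT (fun t => \int[mu]_y `|k t y|).
    apply: rint_le i3 => // t _; rewrite ger0_norm; last by apply: Rintegral_ge0.
    rewrite mulrC -RintZ //; apply: Rint_le0 => //; [exact: rint_norm|exact: rintZ].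
  by rewrite -EFin_Rint // ltry.
have := @Fubini _ _ (measurableTypeR R) (measurableTypeR R) R mu mu _ hf => /= h.
transitivity (fine (\int[mu]_x \int[mu]_y (k x y)%:E)%E).
  by congr fine; apply: eq_integral => t _; rewrite EFin_Rint.
by rewrite h; congr fine; apply: eq_integral => y _; rewrite EFin_Rint.
Qed.
Lemma cFubini (k : R -> R -> C) (a b : R -> R) :
  mcfun setT (fun p : RR => k p.1 p.2) ->
  (forall t, mcfun setT (k t)) -> (forall y, mcfun setT (k^~ y)) ->
  (forall t y, normc (k t y) <= a t * b y) -> rint setT a -> rint setT b ->
  Cintegral setT (fun t => Cintegral setT (k t)) = Cintegral setT (fun y => Cintegral setT (k^~ y)).
Proof.
move=> [m1 m2] mk1 mk2 hk ia ib; apply: eqc.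
- apply: (@rFubini (fun t y => Re (k t y)) a b m1 _ _ _ ia ib).
  + by move=> t; case: (mk1 t).
  + by move=> y; case: (mk2 y).
  + by move=> t y; apply: le_trans (hk t y); exact: Re_le_normc.
- apply: (@rFubini (fun t y => Im (k t y)) a b m2 _ _ _ ia ib).
  + by move=> t; case: (mk1 t).
  + by move=> y; case: (mk2 y).
  + by move=> t y; apply: le_trans (hk t y); exact: Im_le_normc.
Qed.
Local Notation I N := (`[(- N)%R, N%R]%classic : set R).
Lemma mI (N : R) : measurable (I N). Proof. exact: measurable_itv. Qed.
Hint Extern 0 (measurable (I _)) => exact: mI : core.

(** The truncated inverse Fourier integral. *)
Definition cut_inverse N (G : R -> C) t : C := s2p * Cintegral (I N) (fun y => G y * cexp (0 +i* (y * t))).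
Lemma rint_I (N : R) G : sqint setT G -> rint (I N) (fun y => normc (G y)).
Proof.
move=> hG; have s1 : sqint (I N) (fun=> 1).
  split; first exact: mc_cst.
  apply: (@rint_bounded _ _ _ 1) => //.
    by rewrite lebesgue_measure_itv /= lte_fin; case: ifP => _; rewrite ?ltry // -EFinB ltry.
  by move=> y _; rewrite normc1 expr1n normr1.
have := rint_mul (mI N) s1 (sqS (mI N) measurableT (@subsetT _ _) hG).
by apply: rint_ext => // y _; rewrite normc1 mul1r.
Qed.
Lemma cint_cut_inverse N G t : sqint setT G -> cint (I N) (fun y => G y * cexp (0 +i* (y * t))).
Proof.
move=> hG; apply: (cint_le _ _ _ (rint_I N hG)) => //.
  apply: mcM; first by apply: mcS hG.1.
  by apply: mc_cexp; apply: mc_pair; [exact: mr_cst|apply: mrM; [exact: mr_id|exact: mr_cst]].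
by move=> y _; rewrite normcM normc_ei mulr1.
Qed.
Lemma cut_inverse_bounded N G t : sqint setT G -> normc (cut_inverse N G t) <= normc s2p * \int[mu]_(y in I N) normc (G y).
Proof.
move=> hG; rewrite normcM ler_wpM2l ?normc_ge0 //.
apply: le_trans (normc_Cint _ (cint_cut_inverse N t hG)) _ => //.
by apply: eqW; apply: Rint_ext => y _; rewrite normcM normc_ei mulr1.
Qed.
Lemma mc_cut_inverse N G : sqint setT G -> mcfun setT (cut_inverse N G).
Proof.
move=> hG; apply: mcM; first exact: mc_cst.
apply: mc_cutM => //; first by apply: mcS hG.1.
apply: mc_cexp; apply: mc_pair; first exact: mr_cst.
by apply: mrM; [exact: measurable_snd|exact: measurable_fst].
Qed.
Lemma cut_inverse_B N G H t : sqint setT G -> sqint setT H -> cut_inverse N (fun y => G y - H y) t = cut_inverse N G t - cut_inverse N H t.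
Proof.
move=> hG hH; rewrite /cut_inverse -mulrBr -CintB //; try exact: cint_cut_inverse.
by congr (_ * _); apply: Cint_ext => y _; rewrite mulrBl.
Qed.
Lemma bdry_compact (g : R -> C) T y : sqint P g -> (forall t, T < t -> g t = 0) ->
  B g y = laplace g (0 +i* y).
Proof.
move=> hg hs; have [K hK] := lap_compact_lip hg hs (0 +i* y); apply: ccvg_lim.
apply: (@ccvg_squeeze _ _ _ _ _ _ (fun x => K * x)); last first.
  by apply: cvg_mul0l; apply: cvg_at_right_filter; exact: cvg_id.
near=> x; have x0 : 0 < x by near: x; exact: nbhs_right_gt.
have := hK (x%:C); rewrite normc_real gtr0_norm // => /(_ _).
rewrite (_ : x +i* y = (0 +i* y) + x%:C); last by apply: eqc; rewrite !cE ?add0r ?addr0.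
by apply; near: x; apply: nbhs_right_le; exact: ltr01.
Unshelve. all: by end_near. Qed.

(** The truncated inverse transform is dual to the transform: exchange two
    integrals, which converge absolutely because [g] is integrable and [[-N,
    N]] is bounded. *)
Lemma cut_inverse_dual N G (g : R -> C) : sqint setT G -> sqint P g -> rint P (fun t => normc (g t)) ->
  Cintegral P (fun t => cut_inverse N G t * (g t)^*) = Cintegral (I N) (fun y => G y * (laplace g (0 +i* y))^*).
Proof.
move=> hG hg ig.
pose u := cut P (fun t => (g t)^*); pose v := cut (I N) G.
have mu' : mcfun setT u by apply: mc_cut => //; apply: mc_conj; case: hg.
have mv : mcfun setT v by apply: mc_cut => //; apply: mcS hG.1.
pose k t y := s2p * u t * v y * cexp (0 +i* (y * t)).
have mE1 t : mcfun setT (fun y : R => cexp (0 +i* (y * t))).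
  by apply: mc_cexp; apply: mc_pair; [exact: mr_cst|apply: mrM; [exact: mr_id|exact: mr_cst]].
have mE2 y : mcfun setT (fun t : R => cexp (0 +i* (y * t))).
  by apply: mc_cexp; apply: mc_pair; [exact: mr_cst|apply: mrM; [exact: mr_cst|exact: mr_id]].
have mE3 : mcfun setT (fun p : RR => cexp (0 +i* (p.2 * p.1))).
  apply: mc_cexp; apply: mc_pair; first exact: mr_cst.
  by apply: mrM; [exact: measurable_snd|exact: measurable_fst].
have iu' : cint setT u.
  apply: (proj1 (@cint_cut R P (fun t => (g t)^*) (mRplus (R:=R)))); split.
    by apply: mc_conj; case: hg.
  by apply: rint_ext ig => // t _; rewrite normcJ.
have iu : cint setT (fun t => s2p * u t) by exact: cintZ.
have iv : cint setT v.
  apply: (proj1 (@cint_cut R (I N) G (mI N))); split; last exact: rint_I.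
  by apply: mcS hG.1.
transitivity (Cintegral setT (fun t => Cintegral setT (k t))).
  rewrite Cint_cut; apply: Cint_ext => t _.
  rewrite (_ : Cintegral setT (k t) = u t * cut_inverse N G t).
    by rewrite /u /cut; case: ifP => _; [exact: mulrC|exact: (esym (mul0r _))].
  transitivity ((s2p * u t) * Cintegral (I N) (fun y => G y * cexp (0 +i* (y * t)))); last first.
    by rewrite /cut_inverse mulrCA -mulrA mulrCA.
  rewrite -(CintZ (s2p * u t) (mI N) (cint_cut_inverse N t hG)).
  rewrite [RHS]Cint_cut; apply: Cint_ext => y _; rewrite /k /v /cut; case: ifP => _.
    by rewrite !mulrA.
  by rewrite mulr0 mul0r.
have f1 : mcfun setT (fun p : RR => k p.1 p.2).
  apply: mcM; last exact: mE3.
  apply: mcM; last exact: (mc_snd mv).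
  by apply: mcM; [exact: mc_cst|exact: (mc_fst mu')].
have f2 t : mcfun setT (k t).
  apply: mcM; last exact: mE1.
  by apply: mcM; [exact: mc_cst|exact: mv].
have f3 y : mcfun setT (k^~ y).
  apply: mcM; last exact: mE2.
  by apply: mcM; [apply: mcM; [exact: mc_cst|exact: mu']|exact: mc_cst].
have f4 t y : normc (k t y) <= normc (s2p * u t) * normc (v y).
  by rewrite /k normcM normc_ei mulr1 normcM.
rewrite (cFubini f1 f2 f3 f4 (cint_norm iu) (cint_norm iv)).
rewrite [RHS]Cint_cut; apply: Cint_ext => y _.
have cj : (laplace g (0 +i* y))^* = s2p * Cintegral setT (fun t => u t * cexp (0 +i* (y * t))).
  have ik : cint P (fun t => g t * exp_ker (0 +i* y) t).
    split; first by apply: mcM; [case: hg|exact: mc_ek].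
    by apply: rint_ext ig => // t _; rewrite normcM normc_ek /= mul0r oppr0 expR0 mulr1.
  have cjr (r : R) (z : C) : (r%:C * z)^* = r%:C * z^* by apply: eqc; rewrite !cE; ring.
  have cjM (a b : C) : (a * b)^* = a^* * b^* by apply: eqc; rewrite !cE; ring.
  transitivity (s2p * Cintegral P (fun t => (g t * exp_ker (0 +i* y) t)^*)).
    by rewrite laplaceE cjr (Cint_conj (mRplus (R:=R)) ik).
  rewrite Cint_cut; congr (_ * _).
  apply: Cint_ext => t _; rewrite /u /cut; case: ifP => _; last by rewrite mul0r.
  rewrite cjM; congr (_ * _); apply: (etrans (esym (cexp_conj _))); congr cexp.
  by apply: eqc; rewrite /=; ring.
have i1 : cint setT (fun t => u t * cexp (0 +i* (y * t))).
  split; first exact: mcM.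
  by case: iu' => _; apply: rint_ext => // t _; rewrite normcM normc_ei mulr1.
rewrite /cut; case: ifP => yI; last first.
  by rewrite -(Cint0 (measurableT : measurable (setT : set R))); apply: Cint_ext => t _; rewrite /k /v /cut yI mulr0 mul0r.
rewrite [X in _ = _ * X]cj -!CintZ //; last exact: cintZ.
by apply: Cint_ext => t _; rewrite /k /v /cut yI; ring.
Qed.
Lemma sq_cut_inverse_trunc N G T : sqint setT G -> sqint P (trunc T (cut_inverse N G)).
Proof.
move=> hG; have mt : mcfun P (cut_inverse N G) by apply: mcS (mc_cut_inverse N hG).
pose K := normc s2p * \int[mu]_(y in I N) normc (G y).
apply: (@sq_le _ _ _ (fun t => K * normc ((t <= T)%R%:R%:C : C))) => //; first exact: mc_trunc.
  move=> t _; rewrite /trunc; case: (t <= T); last by rewrite normc0 mulr0.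
  by rewrite normc1 mulr1; exact: cut_inverse_bounded.
have [_ h] := sq_step (R:=R) T.
apply: rint_ext (rintZ (K ^+ 2) (mRplus (R:=R)) h) => //.
by move=> t _; rewrite [RHS]exprMn.
Qed.
Lemma Re_Cint D u : Re (Cintegral D u) = \int[mu]_(t in D) Re (u t). Proof. by []. Qed.
Lemma nrm_CS D u v : measurable D -> sqint D u -> sqint D v ->
  normc (Cintegral D (fun x => u x * v x)) <= nrm D u * nrm D v.
Proof.
move=> mD hu hv; rewrite -(@ler_pXn2r _ 2) ?nnegrE ?normc_ge0 ?mulr_ge0 ?nrm_ge0 //.
by rewrite exprMn !nrm_sqr; exact: CauchySchwarz.
Qed.
Lemma sq_conj D u : measurable D -> sqint D u -> sqint D (fun x => (u x)^*).
Proof.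
move=> mD [m i]; split; first exact: mc_conj.
by apply: rint_ext i => // x _; rewrite normcJ.
Qed.
Lemma nrm_conj D u : nrm D (fun x => (u x)^*) = nrm D u.
Proof. by congr Num.sqrt; apply: Rint_ext => x _; rewrite normcJ. Qed.
Lemma nrm_S D D' u : measurable D -> measurable D' -> D `<=` D' -> sqint D' u -> nrm D u <= nrm D' u.
Proof. by move=> mD mD' s hu; rewrite ler_sqrt ?en_ge0 // en_S. Qed.
Lemma en_Re D u : sqnorm D u = Re (Cintegral D (fun x => u x * (u x)^*)).
Proof. by rewrite Re_Cint; apply: Rint_ext => x _; rewrite mulcJ. Qed.

(** Test the duality with a truncation of the function itself: its squared
    norm is at most the norm of [G] times the norm of its transform, and the
    latter is its own norm, by [bdry_iso].  Divide, and let the truncation go. *)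
Lemma cut_inverse_le N G : sqint setT G -> sqint P (cut_inverse N G) /\ nrm P (cut_inverse N G) <= nrm (I N) G.
Proof.
move=> hG; have sI := sqS (mI N) measurableT (@subsetT _ _) hG.
have ht T : sqnorm P (trunc T (cut_inverse N G)) <= sqnorm (I N) G.
  set g := trunc T (cut_inverse N G); have hg : sqint P g by exact: sq_cut_inverse_trunc.
  have gs t : T < t -> g t = 0 by exact: trunc_supp.
  have sB : sqint (I N) (B g) by apply: sqS (mI N) measurableT (@subsetT _ _) (bdry_le hg).1.
  (* Where [g] is not zero it is the function itself. *)
  have e1 : sqnorm P g = Re (Cintegral P (fun t => cut_inverse N G t * (g t)^*)).
    rewrite en_Re !Re_Cint; apply: Rint_ext => t _; rewrite /g /trunc; case: ifP => // _.
    by rewrite mul0r rmorph0 mulr0.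
  have h1 : sqnorm P g <= nrm (I N) G * nrm P g.
    rewrite e1 cut_inverse_dual //; last exact: rint_compact gs.
    apply: le_trans (ler_norm _) _; apply: le_trans (Re_le_normc _) _.
    rewrite (_ : Cintegral _ _ = Cintegral (I N) (fun y => G y * (B g y)^*)); last first.
      by apply: Cint_ext => y _; rewrite (bdry_compact _ hg gs).
    apply: le_trans (nrm_CS _ sI (sq_conj _ sB)) _ => //.
    rewrite ler_wpM2l ?nrm_ge0 // nrm_conj -(bdry_iso hg); apply: nrm_S => //.
    exact: (bdry_le hg).1.
  rewrite -!nrm_sqr; rewrite ler_pXn2r ?nnegrE ?nrm_ge0 //.
  have [n0|n0] := eqVneq (nrm P g) 0; first by rewrite n0 nrm_ge0.
  have np : 0 < nrm P g by rewrite lt_def n0 nrm_ge0.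
  by move: h1; rewrite -nrm_sqr expr2 ler_pM2r.
have mt : mcfun P (cut_inverse N G) by apply: mcS (mc_cut_inverse N hG).
have [i1 h1] : rint P (fun t => normc (cut_inverse N G t) ^+ 2) /\ \int[mu]_(t in P) (normc (cut_inverse N G t) ^+ 2) <= sqnorm (I N) G.
  apply: (@fatou_bound _ _ (fun n t => normc (trunc n%:R (cut_inverse N G) t) ^+ 2)) => //.
  - by move=> n; apply: mrX; apply: mc_norm; exact: mc_trunc.
  - by move=> n t _; rewrite exprn_ge0 // normc_ge0.
  - by apply: mrX; exact: mc_norm.
  - apply: aeT => t _; apply: cvg_near_cst; near=> n; rewrite /trunc ifT //.
    by near: n; exact: nbhs_infty_ger.
  - by apply: nearW => n; split; [case: (sq_cut_inverse_trunc N n%:R hG)|exact: ht].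
by split => //; rewrite ler_sqrt ?en_ge0.
Unshelve. all: by end_near. Qed.
Lemma en_sub D u v : measurable D -> sqint D u -> sqint D v ->
  sqnorm D (fun x => u x - v x) = sqnorm D u - 2 * Re (Cintegral D (fun x => u x * (v x)^*)) + sqnorm D v.
Proof.
move=> mD hu hv; have huv := cint_mul mD hu (sq_conj mD hv).
have i3 := cint_re mD huv; case: (hu) (hv) => _ i1 [_ i2].
rewrite Re_Cint /sqnorm -RintZ // -RintB //; last exact: rintZ.
rewrite -RintD //; last by apply: rintB => //; exact: rintZ.
by apply: Rint_ext => x _; rewrite !normcE2 !cE; ring.
Qed.
Lemma en_cvg_I G : sqint setT G -> forall e : R, 0 < e -> \forall N \near +oo, sqnorm setT G - sqnorm (I N) G <= e.
Proof.
move=> hG e e0; case: (hG) => mG iG.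
have mono (N M : R) : N <= M -> sqnorm (I N) G <= sqnorm (I M) G.
  move=> NM; apply: en_S => //; last by apply: sqS hG.
  move=> y /=; rewrite !in_itv /= => /andP[h1 h2].
  by rewrite (le_trans _ h1) ?lerN2 // (le_trans h2).
have eI N : sqnorm (I N) G = \int[mu]_y (normc (cut (I N) G y) ^+ 2).
  rewrite /sqnorm /Rintegral integral_mkcond; congr fine; apply: eq_integral => y _.
  by rewrite patchE /cut; case: ifP => // _; rewrite normc0 expr0n.
have [_ hc] : rint setT (fun y => normc (G y) ^+ 2) /\ \int[mu]_y (normc (cut (I n%:R) G y) ^+ 2) @[n --> \oo] --> sqnorm setT G.
  apply: (@rDCT _ setT (fun n y => normc (cut (I n%:R) G y) ^+ 2) _ (fun y => normc (G y) ^+ 2)) => //.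
  - by move=> n; apply: mrX; apply: mc_norm; apply: mc_cut => //; apply: mcS mG.
  - by apply: mrX; exact: mc_norm.
  - apply: aeT => y _; apply: cvg_near_cst; near=> n; rewrite cut_in //= in_itv /= -ler_norml.
    by near: n; exact: nbhs_infty_ger.
  - apply: aeT => y n _; rewrite ger0_norm ?exprn_ge0 ?normc_ge0 //.
    by rewrite /cut; case: ifP => // _; rewrite normc0 expr0n exprn_ge0 // normc_ge0.
have [n _ /(_ n (leqnn n)) hn] := (cvgrPdist_le _ _).1 hc _ e0.
near=> N; have h : sqnorm (I n%:R) G <= sqnorm (I N) G.
  by apply: mono; near: N; exact: nbhs_pinfty_ge.
apply: le_trans (le_trans (ler_norm _) hn); rewrite -eI lerD2l lerN2 //.
Unshelve. all: by end_near. Qed.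

(** For a truncation [g] of [h], expand the square of [cut_inverse N (B g) -
    g]: by [cut_inverse_dual] the cross term is the squared norm of [B g] on [[-N, N]],
    which also bounds the first term, so the whole is at most the squared norm
    of [B g] outside [[-N, N]].  Replacing [h] by [g] costs little, uniformly
    in [N], by [cut_inverse_le] and the isometry. *)
Lemma inversion (h : R -> C) (e : R) : sqint P h -> 0 < e ->
  \forall N \near +oo, nrm P (fun t => cut_inverse N (B h) t - h t) <= e.
Proof.
move=> hh e0; have e4 : 0 < (e / 3) ^+ 2 by rewrite exprn_gt0 // divr_gt0.
have [T hT] : exists T, nrm P (fun t => trunc T h t - h t) <= e / 3.
  near (+oo : set_system R) => T; exists T.
  rewrite -(@ler_pXn2r _ 2) ?nnegrE ?nrm_ge0 ?divr_ge0 ?(ltW e0) // nrm_sqr.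
  by near: T; exact: trunc_cvg.
set g := trunc T h in hT; have hg : sqint P g by exact: sq_trunc.
have gs t : T < t -> g t = 0 by exact: trunc_supp.
have [sB _] := bdry_le hg; have [sBh _] := bdry_le hh.
near=> N.
have [s1 _] := cut_inverse_le N sB; have [s2 _] := cut_inverse_le N sBh.
have sD : sqint setT (fun y => B h y - B g y) by exact: sqB.
have [s3 h3] := cut_inverse_le N sD.
have h5 : nrm P (fun t => cut_inverse N (B g) t - g t) <= e / 3.
  rewrite -(@ler_pXn2r _ 2) ?nnegrE ?nrm_ge0 ?divr_ge0 ?(ltW e0) // nrm_sqr en_sub // cut_inverse_dual //; last exact: rint_compact gs.
  rewrite (_ : Cintegral _ _ = Cintegral (I N) (fun y => B g y * (B g y)^*)); last first.
    by apply: Cint_ext => y _; rewrite (bdry_compact _ hg gs).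
  rewrite -en_Re; have h4 : sqnorm P (cut_inverse N (B g)) <= sqnorm (I N) (B g).
    by have [_ h'] := cut_inverse_le N sB; rewrite -!nrm_sqr ler_pXn2r ?nnegrE ?nrm_ge0.
  have h6 : sqnorm setT (B g) - sqnorm (I N) (B g) <= (e / 3) ^+ 2 by near: N; exact: en_cvg_I.
  rewrite -(nrm_sqr P g) -(bdry_iso hg) nrm_sqr; lra.
have h6 : nrm P (fun t => cut_inverse N (B h) t - cut_inverse N (B g) t) <= e / 3.
  rewrite (_ : nrm _ _ = nrm P (cut_inverse N (fun y => B h y - B g y))); last first.
    by congr Num.sqrt; apply: Rint_ext => t _; rewrite cut_inverse_B.
  apply: (le_trans h3); apply: le_trans (nrm_S (mI N) measurableT (@subsetT _ _) sD) _.
  apply: le_trans (bdry_B_le hh hg) _; by rewrite nrmC.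
have -> : nrm P (fun t => cut_inverse N (B h) t - h t) =
    nrm P (fun t => (cut_inverse N (B h) t - cut_inverse N (B g) t) + ((cut_inverse N (B g) t - g t) + (g t - h t))).
  have tele (a b c d : C) : a - d = (a - b) + ((b - c) + (c - d)) by ring.
  by congr Num.sqrt; apply: Rint_ext => t _; rewrite -tele.
apply: le_trans (nrm_leD _ (sqB _ s2 s1) (sqD _ (sqB _ s1 hg) (sqB _ hg hh))) _ => //.
have -> : e = e / 3 + (e / 3 + e / 3) by field.
apply: lerD => //; apply: le_trans (nrm_leD _ (sqB _ s1 hg) (sqB _ hg hh)) _ => //.
exact: lerD.
Unshelve. all: by end_near. Qed.
End Inversion.

(** * The Schwarz kernel on the circle *)
Section Disk.
Context {R : realType}.
Local Notation C := R[i].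
Local Notation mu := (@lebesgue_measure R).
Local Notation T := (`[0, 2 * pi]%classic : set R).
Local Notation ei x := (cexp (0 +i* x)).
Lemma mT : measurable T. Proof. exact: measurable_itv. Qed.
Hint Resolve mT : core.
Lemma muT : mu T = (2 * pi)%:E.
Proof. by rewrite lebesgue_measure_itv /= lte_fin mulr_gt0 ?pi_gt0 // oppr0 adde0. Qed.
Lemma muT_fin : (mu T < +oo)%E. Proof. by rewrite muT ltry. Qed.
Lemma pi2_gt0 : 0 < 2 * pi :> R. Proof. by rewrite mulr_gt0 // pi_gt0. Qed.
Lemma pi2_neq0 : 2 * pi != 0 :> R. Proof. by rewrite gt_eqF // pi2_gt0. Qed.
Lemma rintT_bd (f : R -> R) (M : R) : mrfun T f -> (forall x, `|f x| <= M) -> rint T f.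
Proof. by move=> mf h; exact: (rint_bounded (M := M) mT muT_fin mf (fun x _ => h x)). Qed.
Lemma cintT_bd (f : R -> C) (M : R) : mcfun T f -> (forall x, normc (f x) <= M) -> cint T f.
Proof.
move=> mf h; split => //; apply: (@rintT_bd _ M); first exact: mc_norm.
by move=> x; rewrite ger0_norm ?normc_ge0.
Qed.
Lemma rintT_cst (c : R) : rint T (fun=> c).
Proof. by apply: (@rintT_bd _ `|c|) => //; exact: mr_cst. Qed.
Lemma RintT_cst (c : R) : \int[mu]_(x in T) c = 2 * pi * c.
Proof.
rewrite /Rintegral integral_cst; last exact: mT.
transitivity (fine (c%:E * (2 * pi)%:E)%E); last by rewrite /= mulrC.
by congr (fine (_ * _)%E); exact: muT.
Qed.
Lemma mc_ei D : mcfun D (fun x : R => ei x).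
Proof. by apply: mc_cexp; apply: mc_pair; [exact: mr_cst|exact: mr_id]. Qed.
Lemma ei_neq0 (x : R) : ei x != 0. Proof. exact: cexp_neq0. Qed.
Lemma eiV (x : R) : (ei x)^-1 = (conjc (ei x)).
Proof.
apply: (mulfI (ei_neq0 x)); rewrite mulfV ?ei_neq0 //.
by have := mulcJ (ei x); rewrite normc_ei expr1n => ->.
Qed.
Lemma ei_pow (k : nat) (x : R) : (ei x) ^+ k = cexp (x%:C * (0 +i* k%:R)).
Proof.
rewrite -cexpMn; congr cexp; apply: eqc; elim: k => [|k IH].
- by rewrite mulr0n /= !mulr0 subr0.
- by rewrite mulrS Re_add IH /= !mulr0 !mul0r !subr0 addr0.
- by rewrite mulr0n /= mulr0 mul0r addr0.
- by rewrite mulrS Im_add IH /= !mul0r !addr0 -natr1; ring.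
Qed.
Lemma int_ei (k : nat) : (0 < k)%N -> Cintegral T (fun x => (ei x) ^+ k) = 0.
Proof.
move=> k0; pose z : C := 0 +i* k%:R.
have z0 : z != 0.
  apply/eqP => /(congr1 (@complex.Im R)) /= /eqP; by rewrite pnatr_eq0 eqn0Ngt k0.
have hd x : cder (fun t : R => z^-1 * cexp (t%:C * z)) x (cexp (x%:C * z)).
  have := cderZ z^-1 (cder_cexp z x); by rewrite mulKf.
have [_ h] := @CFTC R (fun t : R => z^-1 * cexp (t%:C * z)) (fun t : R => cexp (t%:C * z)) 0 (2 * pi) pi2_gt0
  (fun x _ => hd x) (fun x _ => (cder_cont (cder_cexp z x)).1) (fun x _ => (cder_cont (cder_cexp z x)).2).
rewrite (_ : Cintegral _ _ = Cintegral T (fun t : R => cexp (t%:C * z))); last first.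
  by apply: Cint_ext => x _; rewrite ei_pow.
rewrite h mul0r cexp0 -mulrBr (_ : cexp _ = 1) ?subrr ?mulr0 //.
rewrite -(ei_pow k (2 * pi)) (_ : ei (2 * pi) = 1) ?expr1n //.
by apply: eqc; rewrite /= expR0 mul1r mulrC mulr_natr ?cos2pi ?sin2pi.
Qed.
Lemma int_eiJ (k : nat) : (0 < k)%N -> Cintegral T (fun x => (conjc (ei x)) ^+ k) = 0.
Proof.
move=> k0; have ci : cint T (fun x => (ei x) ^+ k).
  apply: (@cintT_bd _ 1); first by apply: mcX; exact: mc_ei.
  by move=> x; rewrite normc_exp normc_ei expr1n.
have e := Cint_conj mT ci; rewrite int_ei // in e.
rewrite -[RHS](_ : conjc (0 : C) = 0); last by apply: eqc; rewrite !cE ?oppr0.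
rewrite -e; apply: Cint_ext => x _.
have cjX (a : C) n : conjc (a ^+ n) = (conjc a) ^+ n.
  elim: n => [|n IH]; first by apply: eqc; rewrite !expr0 !cE ?oppr0.
  by rewrite !exprS -IH; apply: eqc; rewrite !cE; ring.
by rewrite -cjX.
Qed.

(** The Schwarz kernel, with the trigonometric sums that approximate it: [(1 +
    q) / (1 - q) = 1 + 2 (q + q^2 + ...)] at [q = z e^{-ix}]. *)
Definition schwarz_ker (z : C) (x : R) : C := (ei x + z) / (ei x - z).
Lemma ei_sub_ge (z : C) (x : R) : 1 - normc z <= normc (ei x - z).
Proof. by rewrite -(normc_ei x); exact: normc_lerB. Qed.
Lemma ei_sub_neq0 (z : C) (x : R) : normc z < 1 -> ei x - z != 0.
Proof. by move=> z1; rewrite -normc_gt0; apply: lt_le_trans (ei_sub_ge z x); rewrite subr_gt0. Qed.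
Lemma mc_sk D z : mcfun D (schwarz_ker z).
Proof.
apply: mcM; first by apply: mcD; [exact: mc_ei|exact: mc_cst].
by apply: mcV; apply: mcD; [exact: mc_ei|apply: mcN; exact: mc_cst].
Qed.
Lemma sk_bound z x : normc z < 1 -> normc (schwarz_ker z x) <= 2 / (1 - normc z).
Proof.
move=> z1; rewrite /schwarz_ker normcM normcV; apply: ler_pM; rewrite ?normc_ge0 ?invr_ge0 ?normc_ge0 //.
  by apply: le_trans (normc_leD _ _) _; rewrite normc_ei (_ : 2 = 1 + 1 :> R) ?lerD2l ?ltW.
by rewrite lef_pV2 ?posrE ?ei_sub_ge ?subr_gt0 // normc_gt0 ei_sub_neq0.
Qed.
Definition schwarz_sum (z : C) n (x : R) : C := 1 + 2 * \sum_(j < n) (z * (conjc (ei x))) ^+ j.+1.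
Lemma sk_skn z n x : normc z < 1 ->
  schwarz_ker z x - schwarz_sum z n x = 2 * (z * (conjc (ei x))) ^+ n.+1 * (ei x / (ei x - z)).
Proof.
move=> z1; have d0 := ei_sub_neq0 x z1; have e0 := ei_neq0 x.
rewrite /schwarz_sum -eiV; set e := ei x in d0 e0 *; set q := z * e^-1.
have q1 : 1 - q != 0.
  rewrite /q; have -> : 1 - z * e^-1 = (e - z) / e by rewrite mulrBl mulfV.
  by rewrite mulf_neq0 // invr_eq0.
have -> : \sum_(j < n) q ^+ j.+1 = (q - q ^+ n.+1) / (1 - q).
  elim: n => [|n IH]; first by rewrite big_ord0 expr1 subrr mul0r.
  by rewrite big_ord_recr /= IH !exprS; field.
have ez : z = q * e by rewrite /q mulfVK.
have d1 : e - q * e != 0 by rewrite -ez.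
have -> : schwarz_ker z x = (1 + q) / (1 - q).
  by rewrite /schwarz_ker -/e ez; field; rewrite q1 d1.
have -> : e / (e - z) = (1 - q)^-1.
  by rewrite ez; field; rewrite q1 d1.
by field.
Qed.
Lemma sk_skn_le z n x : normc z < 1 -> normc (schwarz_ker z x - schwarz_sum z n x) <= 2 / (1 - normc z) * normc z ^+ n.
Proof.
move=> z1; rewrite sk_skn // !normcM normc_exp normcM normcJ normc_ei mulr1 mul1r normcV.
have p : 0 < 1 - normc z by rewrite subr_gt0.
have -> : normc (2 : C) = 2.
  by rewrite (_ : (2 : C) = (2 : R)%:C) ?normc_real ?ger0_norm // rmorph_nat.
rewrite [leRHS]mulrAC; apply: ler_pM; rewrite ?mulr_ge0 ?exprn_ge0 ?invr_ge0 ?normc_ge0 //.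
  by rewrite ler_pM2l // exprS ler_piMl ?exprn_ge0 ?normc_ge0 // ltW.
by rewrite lef_pV2 ?posrE ?ei_sub_ge // normc_gt0 ei_sub_neq0.
Qed.
Lemma skn_cvg z x : normc z < 1 -> normc (schwarz_sum z n x - schwarz_ker z x) @[n --> \oo] --> 0.
Proof.
move=> z1; apply: (@ccvg_squeeze _ _ _ _ _ _ (fun n => 2 / (1 - normc z) * normc z ^+ n)); last first.
  by apply: cvg_mul0l; apply: cvg_expr; rewrite ger0_norm ?normc_ge0.
by apply: nearW => n; rewrite normc_distC sk_skn_le.
Qed.
Lemma skn_bound z n x : normc z < 1 -> normc (schwarz_sum z n x) <= 4 / (1 - normc z).
Proof.
move=> z1; have p : 0 < 1 - normc z by rewrite subr_gt0.
rewrite (_ : schwarz_sum z n x = schwarz_ker z x - (schwarz_ker z x - schwarz_sum z n x)); last by rewrite subKr.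
apply: le_trans (normcB _ _) _.
have -> : 4 / (1 - normc z) = 2 / (1 - normc z) + 2 / (1 - normc z) by field; rewrite gt_eqF.
apply: lerD; first exact: sk_bound.
apply: le_trans (sk_skn_le _ _ z1) _; rewrite ler_piMr ?divr_ge0 ?(ltW p) //.
by rewrite exprn_ile1 ?normc_ge0 // ltW.
Qed.

(** The approximating sums converge uniformly for [|z| < 1].  The hypothesis
    asks for an eventually constant value, as only finitely many frequencies
    of a trigonometric polynomial survive. *)
Lemma Cint_sk_lim (z : C) (u : R -> C) (l : C) : normc z < 1 -> cint T u ->
  (\forall n \near \oo, Cintegral T (fun x => schwarz_sum z n x * u x) = l) -> Cintegral T (fun x => schwarz_ker z x * u x) = l.
Proof.
move=> z1 hu hl; have mu' := cint_meas hu.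
have [_ h] : cint T (fun x => schwarz_ker z x * u x) /\
    normc (Cintegral T (fun x => schwarz_sum z n x * u x) - Cintegral T (fun x => schwarz_ker z x * u x)) @[n --> \oo] --> 0.
  apply: (@cDCT _ T _ _ (fun x => 4 / (1 - normc z) * normc (u x))) => //.
  - move=> n; apply: mcM => //; apply: mcD; first exact: mc_cst.
    apply: mcM; first exact: mc_cst.
    apply: mc_sum => j; apply: mcX; apply: mcM; first exact: mc_cst.
    by apply: mc_conj; exact: mc_ei.
  - by move=> x _; apply: ccvgM; [exact: skn_cvg|exact: ccvg_cst].
  - by move=> x n _; rewrite normcM ler_wpM2r ?normc_ge0 ?skn_bound.
  - by apply: rintZ => //; case: hu.
apply: esym; apply: ccvg_unique h.
apply: cvg_near_cst; apply: filterS hl => n ->; by rewrite subrr normc0.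
Qed.
Lemma cint_eipow (j k : nat) : cint T (fun x => (conjc (ei x)) ^+ j * (ei x) ^+ k).
Proof.
apply: (@cintT_bd _ 1).
  by apply: mcM; apply: mcX; [apply: mc_conj|]; exact: mc_ei.
by move=> x; rewrite normcM !normc_exp normcJ normc_ei !expr1n mul1r.
Qed.
Lemma eiJK (x : R) : (conjc (ei x)) * ei x = 1.
Proof. by rewrite -eiV mulVf // ei_neq0. Qed.
Lemma int_eiei (j k : nat) : Cintegral T (fun x => (conjc (ei x)) ^+ j * (ei x) ^+ k) =
  if j == k then (2 * pi)%:C else 0.
Proof.
have [jk|kj|->] := ltngtP j k.
- rewrite -[RHS](@int_ei (k - j)%N) ?subn_gt0 //; apply: Cint_ext => x _.
  by rewrite -{1}(subnK (ltnW jk)) exprD mulrCA -exprMn eiJK expr1n mulr1.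
- rewrite -[RHS](@int_eiJ (j - k)%N) ?subn_gt0 //; apply: Cint_ext => x _.
  by rewrite -{1}(subnK (ltnW kj)) exprD -mulrA -exprMn eiJK expr1n mulr1.
- rewrite -[RHS](_ : Cintegral T (fun=> (1:R)%:C) = _); last by rewrite Cint_real RintT_cst mulr1.
  by apply: Cint_ext => x _; rewrite -exprMn eiJK expr1n.
Qed.
Lemma skn_int (z : C) (n k : nat) : Cintegral T (fun x => schwarz_sum z n x * (ei x) ^+ k) =
  (if k == 0%N then (2 * pi)%:C else 2 * ((if (k <= n)%N then z ^+ k else 0) * (2 * pi)%:C)).
Proof.
rewrite (_ : Cintegral _ _ = Cintegral T (fun x => (conjc (ei x)) ^+ 0 * (ei x) ^+ k +
    \sum_(j < n) (2 * z ^+ j.+1) * ((conjc (ei x)) ^+ j.+1 * (ei x) ^+ k))); last first.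
  apply: Cint_ext => x _; rewrite /schwarz_sum mulrDl mulr_sumr mulr_suml expr0; congr (_ + _).
  by apply: eq_bigr => j _; rewrite exprMn !mulrA.
have ci (j : nat) : cint T (fun x => (2 * z ^+ j.+1) * ((conjc (ei x)) ^+ j.+1 * (ei x) ^+ k)).
  by apply: cintZ => //; exact: cint_eipow.
rewrite CintD //; [|exact: cint_eipow|by apply: cint_sum].
rewrite int_eiei Cint_sum //.
under eq_bigr => j _ do rewrite (CintZ _ mT (cint_eipow _ _)) int_eiei.
case: k ci => [|k] ci /=.
  by rewrite big1 ?addr0 // => j _; rewrite mulr0.
rewrite add0r; have [kn|kn] := ltnP k n.
  rewrite (bigD1 (Ordinal kn)) //= eqxx big1 ?addr0 ?mulrA // => j jk.
  by rewrite eqSS ifN ?mulr0 //; apply: contra jk => /eqP e; apply/eqP/val_inj.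
rewrite mul0r mulr0 big1 // => j _; rewrite eqSS ifN ?mulr0 //.
by rewrite neq_ltn (leq_trans (ltn_ord j) kn).
Qed.
Lemma skn_intJ (z : C) (n k : nat) : (0 < k)%N -> Cintegral T (fun x => schwarz_sum z n x * (conjc (ei x)) ^+ k) = 0.
Proof.
move=> k0; rewrite (_ : Cintegral _ _ = Cintegral T (fun x => (conjc (ei x)) ^+ k * (ei x) ^+ 0 +
    \sum_(j < n) (2 * z ^+ j.+1) * ((conjc (ei x)) ^+ (j.+1 + k) * (ei x) ^+ 0))); last first.
  apply: Cint_ext => x _; rewrite /schwarz_sum mulrDl mulr_sumr mulr_suml expr0 mul1r mulr1; congr (_ + _).
  by apply: eq_bigr => j _; rewrite exprMn mulr1 exprD !mulrA.
have ci (j : nat) : cint T (fun x => (2 * z ^+ j.+1) * ((conjc (ei x)) ^+ (j.+1 + k) * (ei x) ^+ 0)).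
  by apply: cintZ => //; exact: cint_eipow.
rewrite CintD //; [|exact: cint_eipow|by apply: cint_sum].
rewrite int_eiei Cint_sum // (negbTE (lt0n_neq0 k0)) add0r big1 // => j _.
by rewrite CintZ //; [rewrite int_eiei /= mulr0|exact: cint_eipow].
Qed.

(** The real part is half of [(a e^{ix})^k] plus its conjugate; the kernel has
    no positive frequencies, so it kills the conjugate part and picks twice
    [z^k] from the other. *)
Lemma schwarz_mono (z a : C) (k : nat) : normc z < 1 -> (0 < k)%N ->
  Cintegral T (fun x => schwarz_ker z x * (Re ((a * ei x) ^+ k))%:C) = (2 * pi)%:C * (a * z) ^+ k.
Proof.
move=> z1 k0; apply: Cint_sk_lim => //.
  apply: cint_real; apply: (@rintT_bd _ (normc a ^+ k)).
    apply: mc_re; apply: mcX; apply: mcM; [exact: mc_cst|exact: mc_ei].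
  by move=> x; apply: le_trans (Re_le_normc _) _; rewrite normc_exp normcM normc_ei mulr1.
near=> n.
have cs j x : normc (schwarz_sum z j x) <= 4 / (1 - normc z) by exact: skn_bound.
have msk : mcfun T (schwarz_sum z n).
  apply: mcD; first exact: mc_cst.
  apply: mcM; first exact: mc_cst.
  apply: mc_sum => j; apply: mcX; apply: mcM; first exact: mc_cst.
  by apply: mc_conj; exact: mc_ei.
have c1 : cint T (fun x => schwarz_sum z n x * (ei x) ^+ k).
  apply: (@cintT_bd _ (4 / (1 - normc z))); first by apply: mcM => //; apply: mcX; exact: mc_ei.
  by move=> x; rewrite normcM normc_exp normc_ei expr1n mulr1.
have c2 : cint T (fun x => schwarz_sum z n x * (conjc (ei x)) ^+ k).
  apply: (@cintT_bd _ (4 / (1 - normc z))); first by apply: mcM => //; apply: mcX; apply: mc_conj; exact: mc_ei.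
  by move=> x; rewrite normcM normc_exp normcJ normc_ei expr1n mulr1.
have cjX (b : C) m : conjc (b ^+ m) = (conjc b) ^+ m.
  elim: m => [|m IH]; first by apply: eqc; rewrite !expr0 !cE ?oppr0.
  by rewrite !exprS -IH; apply: eqc; rewrite !cE; ring.
rewrite (_ : Cintegral _ _ = Cintegral T (fun x => (2^-1 * a ^+ k) * (schwarz_sum z n x * (ei x) ^+ k) +
    (2^-1 * (conjc a) ^+ k) * (schwarz_sum z n x * (conjc (ei x)) ^+ k))); last first.
  apply: Cint_ext => x _.
  have -> : (Re ((a * ei x) ^+ k))%:C = 2^-1 * ((a * ei x) ^+ k + conjc ((a * ei x) ^+ k)).
    have h (w : C) : (Re w)%:C = 2^-1 * (w + conjc w).
      have t2 : (2 : C) != 0 by rewrite pnatr_eq0.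
      apply: (mulfI t2); rewrite mulVKf // mulr_natl; apply: eqc; rewrite !cE; ring.
    exact: h.
  rewrite cjX (_ : conjc (a * ei x) = (conjc a) * (conjc (ei x))); last by apply: eqc; rewrite !cE; ring.
  by rewrite !exprMn; ring.
rewrite CintD ?CintZ //; try exact: cintZ.
rewrite skn_int skn_intJ // (negbTE (lt0n_neq0 k0)) mulr0 addr0 ifT; last first.
  by near: n; exact: nbhs_infty_ge.
rewrite exprMn; have t2 : (2 : C) != 0 by rewrite pnatr_eq0.
by field.
Unshelve. all: by end_near. Qed.
Lemma schwarz_cst (z : C) (c : R) : normc z < 1 ->
  Cintegral T (fun x => schwarz_ker z x * c%:C) = (2 * pi)%:C * c%:C.
Proof.
move=> z1; apply: Cint_sk_lim => //; first by apply: cint_real; exact: rintT_cst.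
apply: nearW => n; rewrite (_ : Cintegral _ _ = Cintegral T (fun x => c%:C * (schwarz_sum z n x * (ei x) ^+ 0))); last first.
  by apply: Cint_ext => x _; rewrite expr0 mulr1 mulrC.
rewrite CintZ //; first by rewrite skn_int /= mulrC.
apply: (@cintT_bd _ (4 / (1 - normc z))).
  apply: mcM; last by apply: mcX; exact: mc_ei.
  apply: mcD; first exact: mc_cst.
  apply: mcM; first exact: mc_cst.
  apply: mc_sum => j; apply: mcX; apply: mcM; first exact: mc_cst.
  by apply: mc_conj; exact: mc_ei.
by move=> x; rewrite expr0 mulr1; exact: skn_bound.
Qed.
End Disk.

(** * Logarithms of linear factors *)
Section LogPoly.
Context {R : realType}.
Local Notation C := R[i].
Local Notation mu := (@lebesgue_measure R).
Local Notation T := (`[0, 2 * pi]%classic : set R).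
Local Notation ei x := (cexp (0 +i* x)).
Hint Resolve mT : core.
Lemma isd_eq (f : R -> R) (x a b : R) : is_derive x (1:R) f a -> a = b -> is_derive x (1:R) f b.
Proof. by move=> h <-. Qed.
Lemma cder_chain (H : R -> C) x h : cder H x h -> cder (fun t => cexp (H t)) x (h * cexp (H x)).
Proof.
case=> hr hi; have d1 := is_derive1_comp (is_derive_expR (Re (H x))) hr.
have d2 := is_derive1_comp (is_derive_cos (Im (H x))) hi.
have d3 := is_derive1_comp (is_derive_sin (Im (H x))) hi.
split.
- apply: (isd_eq (is_deriveM d1 d2)).
  by rewrite !(Re_cexp, Im_cexp, cE) /GRing.scale /=; ring.
- apply: (isd_eq (is_deriveM d1 d3)).
  by rewrite !(Re_cexp, Im_cexp, cE) /GRing.scale /=; ring.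
Qed.
Lemma cderM (H K : R -> C) x h k : cder H x h -> cder K x k ->
  cder (fun t => H t * K t) x (h * K x + H x * k).
Proof.
move=> [hr hi] [kr ki]; split.
- rewrite (_ : (fun t => _) = (fun t => Re (H t)) * (fun t => Re (K t)) - (fun t => Im (H t)) * (fun t => Im (K t))).
    by apply: (isd_eq (is_deriveB (is_deriveM hr kr) (is_deriveM hi ki))); rewrite !cE /GRing.scale /=; ring.
  by apply/funext => t; rewrite cE.
- rewrite (_ : (fun t => _) = (fun t => Re (H t)) * (fun t => Im (K t)) + (fun t => Im (H t)) * (fun t => Re (K t))).
    by apply: (isd_eq (is_deriveD (is_deriveM hr ki) (is_deriveM hi kr))); rewrite !cE /GRing.scale /=; ring.
  by apply/funext => t; rewrite cE.
Qed.

(** Working with partial sums of [- log (1 - u)] and their exponentials avoids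
    a complex logarithm: [cexp (log_sum N u) * (1 - u)] tends to 1. *)
Definition log_sum N (u : C) : C := \sum_(k < N) u ^+ k.+1 / k.+1%:R.
Lemma LN0 N : log_sum N 0 = 0.
Proof. by rewrite /log_sum big1 // => k _; rewrite exprS !mul0r. Qed.
Lemma normc_nat (n : nat) : normc (n%:R : C) = n%:R.
Proof. by rewrite (_ : (n%:R : C) = (n%:R : R)%:C) ?normc_real ?ger0_norm // rmorph_nat. Qed.
Lemma log_sum_bound N u : normc u < 1 -> normc (log_sum N u) <= (1 - normc u)^-1.
Proof.
move=> u1; apply: le_trans (normc_sum _ _ _) _.
apply: (@le_trans _ _ (\sum_(k < N) normc u ^+ k)).
  apply: ler_sum => k _; rewrite normcM normcV normc_nat normc_exp exprS.
  rewrite ler_pdivrMr ?ltr0n // mulrC ler_wpM2l ?exprn_ge0 ?normc_ge0 //.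
  by rewrite (le_trans (ltW u1)) // ler1n.
have d0 : 0 < 1 - normc u by rewrite subr_gt0.
have -> : \sum_(k < N) normc u ^+ k = (1 - normc u ^+ N) / (1 - normc u).
  elim: N => [|N IH]; first by rewrite big_ord0 expr0 subrr mul0r.
  by rewrite big_ord_recr IH /= exprS; field; rewrite gt_eqF.
by rewrite ler_pdivrMr // mulVf ?gt_eqF // gerBl exprn_ge0 // normc_ge0.
Qed.
Lemma cder_pow (u : C) k x : cder (fun s : R => (s%:C * u) ^+ k.+1) x (k.+1%:R * u * (x%:C * u) ^+ k).
Proof.
have d1 : cder (fun s : R => s%:C * u) x u.
  by have := cderRM (is_derive_id x (1:R)) (cder_cst u x); rewrite mulr0 addr0 mul1r.
elim: k => [|k IH]; first by rewrite expr0 mulr1 mul1r.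
have := cderM d1 IH; under eq_fun do rewrite -exprS.
by congr cder; rewrite exprS -[k.+2%:R]natr1; ring.
Qed.
Lemma cder_log_sum N (u : C) x : cder (fun s : R => log_sum N (s%:C * u)) x (u * \sum_(k < N) (x%:C * u) ^+ k).
Proof.
elim: N => [|N IH].
  rewrite big_ord0 mulr0 (_ : (fun s => _) = fun=> 0); first exact: cder_cst.
  by apply/funext => s; rewrite /log_sum big_ord0.
rewrite (_ : (fun s => _) = (fun s : R => log_sum N (s%:C * u) + N.+1%:R^-1 * (s%:C * u) ^+ N.+1)); last first.
  by apply/funext => s; rewrite /log_sum big_ord_recr /= [X in _ + X]mulrC.
have := cderD IH (cderZ (N.+1%:R^-1) (cder_pow u N x)).
by rewrite big_ord_recr /= mulrDr !mulrA mulVf ?pnatr_eq0 // mul1r.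
Qed.

(** The derivative of [exp (log_sum N (s u)) (1 - s u)] in [s] is [- u (s u)^N
    exp (log_sum N (s u))], because [1 - s u] times the derivative of
    [log_sum] is a geometric sum that telescopes. *)
Lemma log_sum_est N (u : C) : normc u < 1 ->
  normc (cexp (log_sum N u) * (1 - u) - 1) <= normc u ^+ N * expR ((1 - normc u)^-1).
Proof.
move=> u1; case: N => [|N].
  rewrite /log_sum big_ord0 cexp0 mul1r expr0 mul1r addrAC subrr add0r normcN.
  rewrite (le_trans (ltW u1)) // -[leLHS]expR0 ler_expR invr_ge0 subr_ge0 ltW //.
pose h (s : R) := - u * (s%:C * u) ^+ N.+1 * cexp (log_sum N.+1 (s%:C * u)).
pose H (s : R) := cexp (log_sum N.+1 (s%:C * u)) * (1 - s%:C * u).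
have dl x : cder (fun s : R => 1 - s%:C * u) x (- u).
  have := cderD (cder_cst 1 x) (cderZ (-1) (cderRM (is_derive_id x (1:R)) (cder_cst u x))).
  by rewrite mulr0 addr0 add0r mul1r mulN1r; under eq_fun do rewrite mulN1r.
have dH x : cder H x (h x).
  have := cderM (cder_chain (cder_log_sum N.+1 u x)) (dl x); congr cder.
  rewrite /h; set q := x%:C * u; set E := cexp _.
  have -> : u * (\sum_(k < N.+1) q ^+ k) * E * (1 - q) + E * - u = u * E * ((\sum_(k < N.+1) q ^+ k) * (1 - q) - 1) by ring.
  rewrite (_ : (\sum_(k < N.+1) q ^+ k) * (1 - q) = 1 - q ^+ N.+1); first by ring.
  elim: N.+1 => [|m IH]; first by rewrite big_ord0 mul0r expr0 subrr.
  by rewrite big_ord_recr /= mulrDl IH exprS; ring.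
have ch x : cder h x _ := cderM (cderZ (- u) (cder_pow u N x)) (cder_chain (cder_log_sum N.+1 u x)).
have := @normc_FTC_le R H h (normc u ^+ N.+1 * expR ((1 - normc u)^-1)) (fun x _ => dH x)
  (fun x _ => (cder_cont (ch x)).1) (fun x _ => (cder_cont (ch x)).2).
rewrite {1}/H {1}/H !mul1r !mul0r LN0 cexp0 subr0 mulr1; apply.
move=> x /andP[x0 x1]; have xu : normc (x%:C * u) <= normc u.
  by rewrite normcM normc_real ger0_norm // ler_piMl ?normc_ge0.
have xu1 := le_lt_trans xu u1.
rewrite /h !normcM normcN -mulrA; apply: le_trans (_ : 1 * (normc u ^+ N.+1 * expR ((1 - normc u)^-1)) <= _); last by rewrite mul1r.
apply: ler_pM; rewrite ?mulr_ge0 ?normc_ge0 //; first exact: ltW.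
apply: ler_pM; rewrite ?normc_ge0 //.
  by rewrite normc_exp; apply: lerXn2r; rewrite ?nnegrE ?normc_ge0.
rewrite normc_cexp ler_expR; apply: le_trans (le_trans (ler_norm _) (Re_le_normc _)) _.
apply: le_trans (log_sum_bound _ xu1) _.
by rewrite lef_pV2 ?posrE ?subr_gt0 // lerD2l lerN2.
Qed.
Lemma log_sum_cvg (u : C) : normc u < 1 -> normc (cexp (log_sum N u) * (1 - u) - 1) @[N --> \oo] --> 0.
Proof.
move=> u1; apply: (@ccvg_squeeze _ _ _ _ _ _ (fun N => expR ((1 - normc u)^-1) * normc u ^+ N)); last first.
  by apply: cvg_mul0l; apply: cvg_expr; rewrite ger0_norm ?normc_ge0.
by apply: nearW => N; rewrite [leRHS]mulrC log_sum_est.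
Qed.
Lemma one_sub_neq0 (u : C) : normc u < 1 -> 1 - u != 0.
Proof.
move=> u1; rewrite subr_eq0; apply: contraTneq u1 => <-.
by rewrite normc1 ltxx.
Qed.
Lemma ReLN_cvg (u : C) : normc u < 1 -> - Re (log_sum N u) @[N --> \oo] --> ln (normc (1 - u)).
Proof.
move=> u1; have n0 : 0 < normc (1 - u) by rewrite normc_gt0 one_sub_neq0.
have h : expR (Re (log_sum N u)) * normc (1 - u) @[N --> \oo] --> (1 : R).
  rewrite (_ : (fun N => _) = (fun N => normc (cexp (log_sum N u) * (1 - u)))).
    by rewrite -[X in _ --> X](@normc1 R); apply: ccvg_normc; exact: log_sum_cvg.
  by apply/funext => N; rewrite normcM normc_cexp.
have h2 : expR (Re (log_sum N u)) @[N --> \oo] --> (normc (1 - u))^-1.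
  have h3 : expR (Re (log_sum N u)) * normc (1 - u) / normc (1 - u) @[N --> \oo] --> 1 / normc (1 - u).
    by apply: cvgM => //; exact: cvg_cst.
  rewrite mul1r in h3; apply: cvg_trans h3; apply: near_eq_cvg; apply: nearW => N /=.
  by rewrite mulfK // gt_eqF.
have i0 : 0 < (normc (1 - u))^-1 by rewrite invr_gt0.
have h4 : ln (expR (Re (log_sum N u))) @[N --> \oo] --> ln ((normc (1 - u))^-1).
  exact: (continuous_cvg _ (continuous_ln i0) h2).
rewrite lnV ?posrE // in h4.
have h5 : Re (log_sum N u) @[N --> \oo] --> - ln (normc (1 - u)).
  by apply: cvg_trans h4; apply: near_eq_cvg; apply: nearW => N /=; rewrite expRK.
by rewrite -[X in _ --> X]opprK; exact: cvgN.
Qed.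

(** The log-modulus on the circle of the normalised linear factor [1 - a z]. *)
Definition log_factor (a : C) (x : R) : R := ln (normc (1 - a * ei x)).
Lemma mr_lfun D a : mrfun D (log_factor a).
Proof.
apply: mr_ln; apply: mc_norm; apply: mcD; first exact: mc_cst.
by apply: mcN; apply: mcM; [exact: mc_cst|exact: mc_ei].
Qed.
Lemma ln_abs_le (y : R) : 0 < y -> `|ln y| <= y + y^-1.
Proof.
move=> y0; have h1 := ln_sublinear y0.
have i0 : 0 < y^-1 by rewrite invr_gt0.
have := ln_sublinear i0; rewrite lnV ?posrE // => h2.
by rewrite ler_norml; apply/andP; split; lra.
Qed.
Lemma normc_aei (a : C) (x : R) : normc (a * ei x) = normc a.
Proof. by rewrite normcM normc_ei mulr1. Qed.
Lemma rint_lfun_lt (a : C) : normc a < 1 -> rint T (log_factor a).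
Proof.
move=> a1; have d0 : 0 < 1 - normc a by rewrite subr_gt0.
apply: (@rintT_bd _ _ (2 + (1 - normc a)^-1)); first exact: mr_lfun.
move=> x; have h1 : 1 - normc a <= normc (1 - a * ei x).
  by rewrite -(normc_aei a x) -{1}(@normc1 R); exact: normc_lerB.
have h0 := lt_le_trans d0 h1; apply: le_trans (ln_abs_le h0) _; apply: lerD.
  apply: le_trans (normcB _ _) _; rewrite normc1 normc_aei (_ : 2 = 1 + 1 :> R) // lerD2l ltW //.
by rewrite lef_pV2 ?posrE.
Qed.
Definition schwarz_int (z : C) (u : R -> R) : C := (2 * pi)^-1%:C * Cintegral T (fun x => schwarz_ker z x * (u x)%:C).
Lemma cint_sk (z : C) (u : R -> R) : normc z < 1 -> rint T u -> cint T (fun x => schwarz_ker z x * (u x)%:C).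
Proof.
move=> z1 hu; apply: (@cint_le _ _ _ (fun x => 2 / (1 - normc z) * `|u x|)) => //.
- by apply: mcM; [exact: mc_sk|apply: mc_real; exact: rint_meas].
- by move=> x _; rewrite normcM normc_real ler_wpM2r // sk_bound.
- by apply: rintZ => //; exact: rint_norm.
Qed.
Lemma pi2C_neq0 : ((2 * pi)%:C : C) != 0.
Proof. by rewrite -normc_eq0 normc_real normr_eq0 pi2_neq0. Qed.
Lemma schwarz_int_cvg (z : C) (F : nat -> R -> R) (f g : R -> R) : normc z < 1 ->
  (forall n, mrfun T (F n)) -> mrfun T f -> rint T g ->
  {ae mu, forall x, T x -> F n x @[n --> \oo] --> f x} ->
  {ae mu, forall x n, T x -> `|F n x| <= g x} ->
  normc (schwarz_int z (F n) - schwarz_int z f) @[n --> \oo] --> 0.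
Proof.
move=> z1 mF mf ig hF hg.
have [_ h] := @cDCT_ae R T (fun n x => schwarz_ker z x * (F n x)%:C) (fun x => schwarz_ker z x * (f x)%:C) (fun x => 2 / (1 - normc z) * g x) mT
  (fun n => mcM (mc_sk T z) (mc_real (mF n))) (mcM (mc_sk T z) (mc_real mf))
  (aeS (fun x hx (Tx : T x) => ccvgM (@ccvg_cst R _ _ _ (schwarz_ker z x)) (ccvg_real (hx Tx))) hF)
  (aeS (fun x hx n (Tx : T x) => eq_ind_r (fun v => v <= 2 / (1 - normc z) * g x)
     (ler_pM (normc_ge0 _) (normr_ge0 _) (sk_bound x z1) (hx n Tx)) (etrans (normcM _ _) (congr1 _ (normc_real _)))) hg)
  (rintZ _ mT ig).
by apply: ccvgM => //; exact: ccvg_cst.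
Qed.
Lemma schwarz_int_log_sum (z a : C) N : normc z < 1 -> normc a < 1 ->
  schwarz_int z (fun x => Re (log_sum N (a * ei x))) = log_sum N (a * z).
Proof.
move=> z1 a1; rewrite /schwarz_int.
have e1 x : Re (log_sum N (a * ei x)) = \sum_(k < N) k.+1%:R^-1 * Re ((a * ei x) ^+ k.+1).
  rewrite /log_sum; elim: N => [|N IH]; first by rewrite !big_ord0.
  rewrite !big_ord_recr /= Re_add IH; congr (_ + _).
  by rewrite mulrC -(rmorph_nat (real_complex R)) -fmorphV /= Re_mul Re_real Im_real mul0r subr0.
have ck (k : nat) : cint T (fun x => schwarz_ker z x * (Re ((a * ei x) ^+ k.+1))%:C).
  apply: cint_sk => //; apply: (@rintT_bd _ _ (normc a ^+ k.+1)).
    apply: mc_re; apply: mcX; apply: mcM; [exact: mc_cst|exact: mc_ei].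
  by move=> x; apply: le_trans (Re_le_normc _) _; rewrite normc_exp normc_aei.
rewrite (_ : Cintegral _ _ = Cintegral T (fun x => \sum_(k < N) k.+1%:R^-1 * (schwarz_ker z x * (Re ((a * ei x) ^+ k.+1))%:C))); last first.
  apply: Cint_ext => x _; rewrite e1 rmorph_sum mulr_sumr; apply: eq_bigr => k _.
  by rewrite rmorphM fmorphV rmorph_nat /= mulrCA.
rewrite Cint_sum //; last by move=> k; exact: cintZ.
rewrite mulr_sumr; apply: eq_bigr => k _; rewrite CintZ // schwarz_mono //.
rewrite fmorphV /=; have := pi2C_neq0; set p := (_%:C) => p0.
by rewrite mulrCA mulKf // mulrC.
Qed.
Lemma mr_ReLN (D : set R) N (a : C) : mrfun D (fun x : R => Re (log_sum N (a * ei x))).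
Proof.
apply: mc_re; apply: mc_sum => k; apply: mcM; last exact: mc_cst.
by apply: mcX; apply: mcM; [exact: mc_cst|exact: mc_ei].
Qed.

(** The Schwarz integral of the partial sums is evaluated by [schwarz_mono];
    exponentiate, and pass to the limit on both sides. *)
Lemma schwarz_lt (z a : C) : normc z < 1 -> normc a < 1 -> cexp (schwarz_int z (log_factor a)) = 1 - a * z.
Proof.
move=> z1 a1; have az1 : normc (a * z) < 1.
  by rewrite normcM (le_lt_trans _ a1) // ler_piMr ?normc_ge0 // ltW.
have h1 : normc (schwarz_int z (fun x => - Re (log_sum N (a * ei x))) - schwarz_int z (log_factor a)) @[N --> \oo] --> 0.
  apply: (@schwarz_int_cvg z _ _ (fun=> (1 - normc a)^-1)) => //.
  - by move=> N; apply: mrN; exact: mr_ReLN.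
  - exact: mr_lfun.
  - exact: rintT_cst.
  - by apply: aeT => x _; apply: ReLN_cvg; rewrite normc_aei.
  - apply: aeT => x N _; rewrite normrN; apply: le_trans (Re_le_normc _) _.
    by rewrite -(normc_aei a x); apply: log_sum_bound; rewrite normc_aei.
have e1 N : schwarz_int z (fun x => - Re (log_sum N (a * ei x))) = - log_sum N (a * z).
  rewrite -(schwarz_int_log_sum N z1 a1) /schwarz_int -mulrN -CintN //.
    by congr (_ * _); apply: Cint_ext => x _; rewrite rmorphN mulrN.
  apply: cint_sk => //; apply: (@rintT_bd _ _ (1 - normc a)^-1); first exact: mr_ReLN.
  move=> x; apply: le_trans (Re_le_normc _) _.
  by rewrite -(normc_aei a x); apply: log_sum_bound; rewrite normc_aei.
have h2 : normc (cexp (schwarz_int z (fun x => - Re (log_sum N (a * ei x)))) * (cexp (log_sum N (a * z)) * (1 - a * z)) - cexp (schwarz_int z (log_factor a)) * 1) @[N --> \oo] --> 0.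
  by apply: ccvgM; [exact: ccvg_cexp|exact: log_sum_cvg].
rewrite mulr1 in h2; apply: ccvg_unique h2 _.
apply: cvg_near_cst; apply: nearW => N.
by rewrite e1 mulrA cexpN mulVf ?cexp_neq0 // mul1r subrr normc0.
Qed.
Lemma sk0 x : schwarz_ker (0 : C) x = 1.
Proof. by rewrite /schwarz_ker addr0 subr0 mulfV // cexp_neq0. Qed.
Lemma mean_of_SI0 (u : R -> R) (c : R) : cexp (schwarz_int 0 u) = (expR c)%:C -> \int[mu]_(x in T) u x = 2 * pi * c.
Proof.
rewrite /schwarz_int (_ : Cintegral _ _ = (\int[mu]_(x in T) u x)%:C); last first.
  by rewrite -Cint_real; apply: Cint_ext => x _; rewrite sk0 mul1r.
rewrite -rmorphM /= cexp_real => /(congr1 (@complex.Re R)) /= /expR_inj <-.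
by rewrite mulVKf // pi2_neq0.
Qed.
Lemma mean_lt (a : C) : normc a < 1 -> \int[mu]_(x in T) log_factor a x = 0.
Proof.
move=> a1; rewrite (@mean_of_SI0 _ 0) ?mulr0 // schwarz_lt ?normc0 ?ltr01 //.
by rewrite mulr0 subr0 expR0.
Qed.

(** At most two angles in [[0, 2 pi]] have a given cosine. *)
Lemma ae_neq (a : C) : {ae mu, forall x, T x -> 1 - a * ei x != 0}.
Proof.
have [->|a0] := eqVneq a 0; first by apply: aeT => x _; rewrite mul0r subr0 oner_neq0.
pose t0 := acos (Re a^-1).
exists ([set t0] `|` [set (2 * pi - t0)%R]); split.
- by apply: measurableU; exact: measurable_set1.
- have z1 (c : R) : mu [set c] = 0%E by exact: lebesgue_measure_set1.
  apply/eqP; rewrite eq_le measure_ge0 andbT.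
  apply: (@le_trans _ _ (mu [set t0] + mu [set (2 * pi - t0)%R])%E).
    by apply: measureU2; exact: measurable_set1.
  by rewrite !z1 adde0.
move=> x /= hx; have {hx} [Tx e] : T x /\ ei x = a^-1.
  have [Tx|nT] := pselect (T x); last by exfalso; apply: hx => /nT.
  split => //; apply: (mulfI a0); rewrite mulfV //; apply: contrapT => hn; apply: hx => _.
  by rewrite subr_eq0; apply/eqP => e; apply: hn.
have ec : cos x = Re a^-1 by rewrite -e /= expR0 mul1r.
move: Tx; rewrite /= in_itv /= => /andP[x0 x2].
have [xp|xp] := leP x pi.
  by left; rewrite /t0 -ec cosK // in_itv /= x0 xp.
right; rewrite /t0 -ec -(_ : cos (2 * pi - x) = cos x); last first.
  by rewrite mulr_natl cosB cos2pi sin2pi mul1r mul0r addr0.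
rewrite cosK; first by rewrite subKr.
by rewrite in_itv /= subr_ge0 x2 /= lerBlDr mulr_natl mulr2n lerD2l ltW.
Qed.
Definition radius_seq (n : nat) : R := 1 - n.+2%:R^-1.
Lemma rn_bounds n : 0 < radius_seq n < 1.
Proof. by rewrite /radius_seq subr_gt0 invf_lt1 ?ltr0n // ltr1n gtrBl invr_gt0 ltr0n. Qed.
Lemma rn_cvg : radius_seq n @[n --> \oo] --> (1:R).
Proof.
rewrite -[X in _ --> X]subr0; apply: cvgB; first exact: cvg_cst.
by have := @invn_cvg0 R; rewrite -(cvg_shiftS (fun n => n.+1%:R^-1 : R)).
Qed.
Lemma lfun_cvg (a : C) x : 1 - a * ei x != 0 -> log_factor ((radius_seq n)%:C * a) x @[n --> \oo] --> log_factor a x.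
Proof.
move=> h0; have n0 : 0 < normc (1 - a * ei x) by rewrite normc_gt0.
apply: (continuous_cvg _ (continuous_ln n0)); apply: ccvg_normc.
apply: ccvgB; first exact: ccvg_cst.
apply: ccvgM; last exact: ccvg_cst.
rewrite -{2}[a]mul1r; apply: ccvgM; last exact: ccvg_cst.
exact: ccvg_real rn_cvg.
Qed.

(** The lower bound says that moving [a] radially inwards cannot bring [1 - a
    e^{ix}] closer to zero by more than a factor two, and so gives a
    dominating function for the logarithms. *)
Lemma shrink_le (a : C) (r x : R) : 0 < r < 1 -> normc a <= 1 ->
  normc (1 - a * ei x) / 2 <= normc (1 - r%:C * a * ei x) <= 2.
Proof.
case/andP=> r0 r1 a1; have nb : normc (a * ei x) <= 1 by rewrite normc_aei.
rewrite -mulrA; set b := a * ei x in nb *.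
have nrb : normc (r%:C * b) <= r by rewrite normcM normc_real gtr0_norm // ler_piMr // ltW.
apply/andP; split.
  rewrite ler_pdivrMr // mulr_natr mulr2n.
  have h1 : normc (1 - b) <= normc (1 - r%:C * b) + normc (r%:C * b - b).
    by rewrite (le_trans _ (normc_leD _ _)) // addrA subrK.
  apply: le_trans h1 _; rewrite lerD2l.
  have -> : r%:C * b - b = (r - 1)%:C * b by rewrite rmorphB mulrBl mul1r.
  rewrite normcM normc_real distrC gtr0_norm ?subr_gt0 //.
  apply: (@le_trans _ _ (1 - r)); first by rewrite ler_piMr // subr_ge0 ltW.
  apply: le_trans (_ : 1 - normc (r%:C * b) <= _); first by rewrite lerD2l lerN2.
  by rewrite -{1}(@normc1 R); exact: normc_lerB.
apply: le_trans (normcB _ _) _; rewrite normc1 (_ : 2 = 1 + 1 :> R) // lerD2l.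
exact: le_trans nrb (ltW r1).
Qed.
Lemma rn_a_lt (a : C) n : normc a <= 1 -> normc ((radius_seq n)%:C * a) < 1.
Proof.
move=> a1; have /andP[r0 r1] := rn_bounds n.
by rewrite normcM normc_real gtr0_norm // (le_lt_trans _ r1) // ler_piMr // ltW.
Qed.
Lemma lfun_le2 (b : C) x : normc b < 1 -> log_factor b x <= ln 2.
Proof.
move=> b1; have h0 : 0 < normc (1 - b * ei x) by rewrite normc_gt0 one_sub_neq0 // normc_aei.
rewrite ler_ln ?posrE //; apply: le_trans (normcB _ _) _.
by rewrite normc1 normc_aei (_ : 2 = 1 + 1 :> R) // lerD2l ltW.
Qed.

(** The nonnegative functions [ln 2 - log_factor (r a)] all have the integral
    [2 pi ln 2], as the mean of [log_factor] vanishes inside the disk; Fatou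
    bounds the limit. *)
Lemma rint_lfun (a : C) : normc a <= 1 -> rint T (log_factor a).
Proof.
move=> a1; have hb n := rn_a_lt n a1.
have [h _] : rint T (fun x => ln 2 - log_factor a x) /\ \int[mu]_(x in T) (ln 2 - log_factor a x) <= 2 * pi * ln 2.
  apply: (@fatou_bound _ _ (fun n x => ln 2 - log_factor ((radius_seq n)%:C * a) x)) => //.
  - by move=> n; apply: mrD; [exact: mr_cst|apply: mrN; exact: mr_lfun].
  - by move=> n x _; rewrite subr_ge0 lfun_le2.
  - by apply: mrD; [exact: mr_cst|apply: mrN; exact: mr_lfun].
  - apply: aeS (ae_neq a) => x hx Tx; apply: cvgB; first exact: cvg_cst.
    by apply: lfun_cvg; exact: hx.
  - apply: nearW => n; have i1 := rint_lfun_lt (hb n); split.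
      by apply: rintB => //; exact: rintT_cst.
    by rewrite RintB ?RintT_cst ?mean_lt ?subr0 //; exact: rintT_cst.
apply: rint_ext (rintB mT (rintT_cst (ln 2)) h) => // x _; by rewrite subKr.
Qed.

(** The limit of [schwarz_lt] along radii tending to one, dominated by [ln 2 +
    |log_factor a|] thanks to [shrink_le]. *)
Lemma schwarz_factor (z a : C) : normc z < 1 -> normc a <= 1 -> cexp (schwarz_int z (log_factor a)) = 1 - a * z.
Proof.
move=> z1 a1; have hb n := rn_a_lt n a1.
have h1 : normc (schwarz_int z (log_factor ((radius_seq n)%:C * a)) - schwarz_int z (log_factor a)) @[n --> \oo] --> 0.
  apply: (@schwarz_int_cvg z _ _ (fun x => ln 2 + `|log_factor a x|)) => //.
  - by move=> n; exact: mr_lfun.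
  - exact: mr_lfun.
  - by apply: rintD => //; [exact: rintT_cst|apply: rint_norm; exact: rint_lfun].
  - by apply: aeS (ae_neq a) => x hx Tx; apply: lfun_cvg; exact: hx.
  - apply: aeS (ae_neq a) => x hx n Tx.
    have l2 : 0 <= ln 2 :> R by rewrite ln_ge0 // ler1n.
    have n0 : 0 < normc (1 - a * ei x) by rewrite normc_gt0 hx.
    have /andP[h2 h3] := shrink_le x (rn_bounds n) a1.
    have m0 : 0 < normc (1 - (radius_seq n)%:C * a * ei x) by apply: lt_le_trans h2; rewrite divr_gt0.
    have d2 : 0 < normc (1 - a * ei x) / 2 by rewrite divr_gt0.
    rewrite /log_factor ler_norml; apply/andP; split; last first.
      by apply: le_trans (_ : ln 2 <= _); [rewrite ler_ln ?posrE|rewrite lerDl].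
    apply: le_trans (_ : ln (normc (1 - a * ei x) / 2) <= _); last by rewrite ler_ln ?posrE.
    rewrite ln_div ?posrE // opprD addrC lerD2r lerNl.
    by rewrite -normrN ler_norm.
have h2 : normc (cexp (schwarz_int z (log_factor ((radius_seq n)%:C * a))) - cexp (schwarz_int z (log_factor a))) @[n --> \oo] --> 0 by exact: ccvg_cexp.
apply: ccvg_unique h2 _.
rewrite (_ : (fun n => _) = (fun n => normc ((1 - (radius_seq n)%:C * (a * z)) - (1 - a * z)))).
  apply: ccvgB; first exact: ccvg_cst.
  rewrite -{2}[a * z]mul1r; apply: ccvgM; last exact: ccvg_cst.
  exact: ccvg_real rn_cvg.
by apply/funext => n; rewrite schwarz_lt // mulrA.
Qed.
Lemma mean_lfun (a : C) : normc a <= 1 -> \int[mu]_(x in T) log_factor a x = 0.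
Proof.
move=> a1; rewrite (@mean_of_SI0 _ 0) ?mulr0 // schwarz_factor ?normc0 ?ltr01 //.
by rewrite mulr0 subr0 expR0.
Qed.
End LogPoly.

(** * Polynomials without zeros in the disk are outer *)
Section OuterPoly.
Context {R : realType}.
Local Notation C := R[i].
Local Notation mu := (@lebesgue_measure R).
Local Notation T := (`[0, 2 * pi]%classic : set R).
Local Notation ei x := (cexp (0 +i* x)).
Hint Resolve mT : core.
Implicit Types (p q : {poly C}).
Definition log_abs p (x : R) : R := ln (normc p.[ei x]).
Lemma mc_horner D p : mcfun D (fun x : R => p.[ei x]).
Proof.
apply: (@mc_ext _ _ _ _ (fun x : R => \sum_(i < size p) p`_i * (ei x) ^+ i)).
  by move=> x _; rewrite horner_coef.
by apply: mc_sum => i; apply: mcM; [exact: mc_cst|apply: mcX; exact: mc_ei].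
Qed.
Lemma mr_log_abs D p : mrfun D (log_abs p).
Proof. by apply: mr_ln; apply: mc_norm; exact: mc_horner. Qed.
Lemma mrT_log_abs p : mrfun T (log_abs p). Proof. exact: mr_log_abs. Qed.

(** The second condition is needed to split logarithms of products, as [ln 0 =
    0] by convention. *)
Definition logint p := rint T (log_abs p) /\ {ae mu, forall x, T x -> p.[ei x] != 0}.
Lemma log_abs_M p q : logint p -> logint q ->
  logint (p * q) /\ ae_eq mu T (log_abs (p * q)) (fun x => log_abs p x + log_abs q x).
Proof.
move=> [ip np] [iq nq]; have h : ae_eq mu T (fun x => log_abs p x + log_abs q x) (log_abs (p * q)).
  apply: ae2 np nq => x hp hq Tx; have p0 := hp Tx; have q0 := hq Tx.
  by rewrite /log_abs hornerM normcM lnM ?posrE ?normc_gt0.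
split; last by apply: aeS h => x hx Tx; rewrite hx.
split; first by apply: (rint_ae (f := fun x => log_abs p x + log_abs q x)) => //; [exact: mr_log_abs|exact: rintD].
by apply: ae2 np nq => x hp hq Tx; rewrite hornerM mulf_neq0 ?hp ?hq.
Qed.
Lemma schwarz_int_ae z (u v : R -> R) : mrfun T u -> mrfun T v -> ae_eq mu T u v -> schwarz_int z u = schwarz_int z v.
Proof.
move=> hu hv h; congr (_ * _); apply: Cint_ae => //.
- by apply: mcM; [exact: mc_sk|exact: mc_real].
- by apply: mcM; [exact: mc_sk|exact: mc_real].
- by apply: aeS h => x hx Tx; rewrite hx.
Qed.
Lemma schwarz_int_D z (u v : R -> R) : normc z < 1 -> rint T u -> rint T v ->
  schwarz_int z (fun x => u x + v x) = schwarz_int z u + schwarz_int z v.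
Proof.
move=> z1 hu hv; rewrite /schwarz_int -mulrDr -CintD //; try exact: cint_sk.
by congr (_ * _); apply: Cint_ext => x _; rewrite rmorphD mulrDr.
Qed.
Lemma schwarz_int_cst z (c : R) : normc z < 1 -> schwarz_int z (fun=> c) = c%:C.
Proof. by move=> z1; rewrite /schwarz_int schwarz_cst // fmorphV /= mulKf // pi2C_neq0. Qed.
Lemma logint_cst (c : C) : c != 0 -> logint c%:P.
Proof.
move=> c0; split; last by apply: aeT => x _; rewrite hornerC.
by apply: rint_ext (rintT_cst (ln (normc c))) => // x _; rewrite /log_abs hornerC.
Qed.
Lemma root_factor (e r : C) : r != 0 -> e - r = - r * (1 - r^-1 * e).
Proof. by move=> r0; field. Qed.
Lemma log_abs_ge1 (r : C) : 1 <= normc r ->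
  ae_eq mu T (fun x => ln (normc r) + log_factor r^-1 x) (log_abs ('X - r%:P)).
Proof.
move=> r1; have r0 : r != 0 by rewrite -normc_gt0 (lt_le_trans ltr01).
apply: aeS (ae_neq r^-1) => x hx Tx; rewrite /log_abs /log_factor !hornerE.
rewrite (root_factor (ei x) r0).
by rewrite normcM normcN lnM ?posrE ?normc_gt0 // hx.
Qed.

(** On the circle [|e^{ix} - r| = |1 - r^* e^{ix}|]: a root inside the disk
    may be reflected, which turns the factor into one without zeros in the
    disk. *)
Lemma log_abs_lt1 (r : C) x : log_abs ('X - r%:P) x = log_factor (conjc r) x.
Proof.
rewrite /log_abs /log_factor !hornerE; congr ln.
rewrite -(normcJ (1 - _)).
have -> : conjc (1 - conjc r * ei x) = 1 - r * conjc (ei x) by apply: eqc; rewrite !cE; ring.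
have -> : ei x - r = ei x * (1 - r * conjc (ei x)).
  by rewrite mulrBr mulr1 mulrCA [ei x * _]mulrC eiJK mulr1.
by rewrite normcM normc_ei mul1r.
Qed.
Lemma normcV_le1 (r : C) : 1 <= normc r -> normc r^-1 <= 1.
Proof. by move=> r1; rewrite normcV invf_le1 // (lt_le_trans ltr01). Qed.
Lemma logint_root (r : C) : r != 0 -> logint ('X - r%:P).
Proof.
move=> r0; have [r1|r1] := ltP (normc r) 1.
  split.
    have rj : normc (conjc r) <= 1 by rewrite normcJ ltW.
    by apply: rint_ext (rint_lfun rj) => // x _; rewrite log_abs_lt1.
  apply: aeT => x _; rewrite !hornerE; exact: ei_sub_neq0.
split.
  apply: (rint_ae (f := fun x => ln (normc r) + log_factor r^-1 x)) => //.
  - exact: mr_log_abs.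
  - exact: log_abs_ge1.
  apply: rintD => //; first exact: rintT_cst.
  by apply: rint_lfun; exact: normcV_le1.
apply: aeS (ae_neq r^-1) => x hx Tx; rewrite !hornerE.
rewrite (root_factor (ei x) r0).
by rewrite mulf_neq0 ?oppr_eq0 // hx.
Qed.

(** Equality for a root outside the disk; for a root inside, the mean is zero
    and [ln |r|] is negative. *)
Lemma mean_root (r : C) : r != 0 -> 2 * pi * ln (normc r) <= \int[mu]_(x in T) log_abs ('X - r%:P) x.
Proof.
move=> r0; have [r1|r1] := ltP (normc r) 1.
  rewrite (Rint_ext (g := log_factor (conjc r))); last by move=> x _; rewrite log_abs_lt1.
  have rj : normc (conjc r) <= 1 by rewrite normcJ ltW.
  rewrite (mean_lfun rj) pmulr_rle0 ?pi2_gt0 //.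
  by apply: ln_le0; exact: ltW.
have mr1 : mrfun T (fun x => ln (normc r) + log_factor r^-1 x) by apply: mrD; [exact: mr_cst|exact: mr_lfun].
rewrite -(Rint_ae mT mr1 (mrT_log_abs _) (log_abs_ge1 r1)).
rewrite RintD //; [|exact: rintT_cst|by apply: rint_lfun; exact: normcV_le1].
by rewrite RintT_cst mean_lfun ?addr0 // normcV_le1.
Qed.

(** Multiply the inequality for single roots over the factorisation. *)
Lemma jensen_poly p : p.[0] != 0 -> logint p /\ 2 * pi * ln (normc p.[0]) <= \int[mu]_(x in T) log_abs p x.
Proof.
have [rs ->] := closed_field_poly_normal p; set c := lead_coef p; rewrite -mul_polyC.
elim: rs => [|r rs IH].
  rewrite big_nil mulr1 hornerC => c0; split; first exact: logint_cst.
  rewrite (Rint_ext (g := fun=> ln (normc c))); last by move=> x _; rewrite /log_abs hornerC.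
  by rewrite RintT_cst.
rewrite big_cons mulrCA hornerM mulf_eq0 negb_or => /andP[h1 q0]; have [h2 h3] := IH q0.
have r0 : r != 0 by move: h1; rewrite !hornerE oppr_eq0.
have l1 := logint_root r0; have [l2 e2] := log_abs_M l1 h2; split => //.
rewrite (Rint_ae mT (mrT_log_abs _) (mrD (mrT_log_abs _) (mrT_log_abs _)) e2).
rewrite RintD //; [|by case: l1|by case: h2].
rewrite normcM lnM ?posrE ?normc_gt0 // mulrDr; apply: lerD => //.
by have := mean_root r0; rewrite !hornerE normcN.
Qed.

(** Multiply the formula for single factors over the factorisation: every root
    [r] has [|r| >= 1], and [z - r = - r (1 - r^-1 z)]. *)
Lemma schwarz_poly p : p != 0 -> (forall z, normc z < 1 -> p.[z] != 0) ->
  logint p /\ exists2 l, normc l = 1 & forall z, normc z < 1 -> p.[z] = l * cexp (schwarz_int z (log_abs p)).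
Proof.
have [rs ->] := closed_field_poly_normal p; set c := lead_coef p; rewrite -mul_polyC.
elim: rs => [|r rs IH].
  rewrite big_nil mulr1 => c0 _; have {}c0 : c != 0 by move: c0; rewrite polyC_eq0.
  have n0 : 0 < normc c by rewrite normc_gt0.
  split; first exact: logint_cst.
  exists (c / (normc c)%:C).
    by rewrite normcM normcV normc_real gtr0_norm // mulfV // gt_eqF.
  have hae : ae_eq mu T (log_abs c%:P) (fun=> ln (normc c)).
    by apply: aeT => x _; rewrite /log_abs hornerC.
  move=> z z1; rewrite hornerC (schwarz_int_ae z (mrT_log_abs _) (@mr_cst _ _ _ T _) hae) schwarz_int_cst //.
  by rewrite cexp_real lnK ?posrE // mulfVK // -normc_eq0 normc_real gtr0_norm // gt_eqF.
rewrite big_cons mulrCA mulf_eq0 negb_or => /andP[_ q0] hz.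
have [|h2 [l l1 hl]] := IH q0.
  by move=> z z1; have := hz z z1; rewrite hornerM mulf_eq0 negb_or => /andP[].
have r1 : 1 <= normc r.
  rewrite leNgt; apply/negP => r1; have := hz r r1.
  by rewrite hornerM hornerXsubC subrr mul0r eqxx.
have n0 : 0 < normc r by rewrite (lt_le_trans ltr01).
have r0 : r != 0 by rewrite -normc_gt0.
have lr := logint_root r0; have [l2 e2] := log_abs_M lr h2; split => //.
exists (- r / (normc r)%:C * l).
  by rewrite normcM normcM normcV normcN normc_real gtr0_norm // mulfV ?gt_eqF // mul1r.
move=> z z1; rewrite (schwarz_int_ae z (mrT_log_abs _) (mrD (mrT_log_abs _) (mrT_log_abs _)) e2).
rewrite schwarz_int_D //; [|by case: lr|by case: h2].
have mr1 : mrfun T (fun x => ln (normc r) + log_factor r^-1 x) by apply: mrD; [exact: mr_cst|exact: mr_lfun].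
rewrite cexpD hornerM hl // -(schwarz_int_ae z mr1 (mrT_log_abs _) (log_abs_ge1 r1)).
rewrite schwarz_int_D //; [|exact: rintT_cst|by apply: rint_lfun; exact: normcV_le1].
rewrite schwarz_int_cst // cexpD schwarz_factor ?normcV_le1 // cexp_real lnK ?posrE // hornerXsubC.
have nC : (normc r)%:C != 0 :> C by rewrite -normc_eq0 normc_real gtr0_norm // gt_eqF.
by set E := cexp _; field; rewrite nC r0.
Qed.
Lemma at_left1 (T' : Type) (G : set_system T') (f : R -> T') :
  (f r @[r --> 1^'-] --> G) <-> (f (1 - t) @[t --> 0^'+] --> G).
Proof.
have h1 : (1 - t : R) @[t --> (0:R)^'+] --> (1:R)^'-.
  move=> A [d /= d0 hd]; exists d => //= t; rewrite /ball_ /= sub0r normrN => td t0.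
  by apply: hd => /=; [rewrite /ball_ /= subKr|rewrite gtrBl].
have h2 : (1 - r : R) @[r --> (1:R)^'-] --> (0:R)^'+.
  move=> A [d /= d0 hd]; exists d => //= r; rewrite /ball_ /= => td r1.
  by apply: hd => /=; [rewrite /ball_ /= sub0r normrN|rewrite subr_gt0].
split => h; first exact: cvg_comp h1 h.
have := cvg_comp _ _ h2 h; apply: cvg_trans; apply: near_eq_cvg; apply: nearW => r /=.
by rewrite subKr.
Qed.
Lemma disk_radial (r x : R) : 0 <= r < 1 -> unit_disk (r%:C * ei x).
Proof.
case/andP=> r0 r1; suff : normc (r%:C * ei x) < 1 by [].
by rewrite normcM normc_ei mulr1 normc_real ger0_norm.
Qed.
Lemma bdry_disk_ext (G H : C -> C) x : (forall z, unit_disk z -> G z = H z) -> bdry_disk G x = bdry_disk H x.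
Proof.
move=> e; rewrite /bdry_disk.
have h : (\forall r \near (1:R)^'-, G (r%:C * ei x) = H (r%:C * ei x)).
  near=> r; apply: e; apply: disk_radial; apply/andP; split.
    by near: r; apply: nbhs_left_ge; exact: ltr01.
  by near: r; apply: nbhs_left_lt.
have e1 := near_eq_cvg h; have e2 := near_eq_cvg (filterS (fun r e => esym e) h).
have eF : ((G (r%:C * ei x) : C^o) @[r --> (1:R)^'-]) = ((H (r%:C * ei x) : C^o) @[r --> (1:R)^'-]).
  by apply/seteqP; split; [exact: e1|exact: e2].
by rewrite eF.
Unshelve. all: by end_near. Qed.
Lemma H2_disk_ext (G H : C -> C) : (forall z, unit_disk z -> G z = H z) -> H2_disk G -> H2_disk H.
Proof.
move=> e [aG [a [ca hs]]]; split; last first.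
  by exists a; split; [exact: ca|move=> z z1; have := hs z z1; rewrite (e z z1)].
move=> z z1; apply: near_eq_derivable (aG z z1).
have hd : 0 < 1 - normc z by rewrite subr_gt0.
exists (1 - normc z)%:C => /=; first by rewrite ltcR.
move=> w; rewrite /ball_ /= normc_norm ltcR => hw; apply: e.
suff : normc w < 1 by [].
have h := normc_leD (w - z) z; rewrite subrK normc_distC in h.
by apply: le_lt_trans h _; rewrite -ltrBrDr.
Qed.
Lemma outer_disk_ext (G H : C -> C) : (forall z, unit_disk z -> G z = H z) -> outer_disk G -> outer_disk H.
Proof.
move=> e [hG [z z1 Gz] [l l1 hl]]; split; first exact: H2_disk_ext hG.
  by exists z => //; rewrite -e.
exists l; first exact: l1.
move=> w w1; rewrite -(e w w1) (hl w w1) (@Cint_ext _ _ _ (fun x => schwarz_ker w x * (ln (normc (bdry_disk H x)))%:C)) //.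
by move=> x _; rewrite (bdry_disk_ext _ e).
Qed.
Lemma derivable_horner p (z : C) : derivable ((fun w => p.[w]) : C^o -> C^o) z 1.
Proof.
suff [l [K hK]] : exists l K, forall u, normc u < 1 -> normc (p.[z + u] - p.[z] - u * l) <= K * normc u ^+ 2.
  exact: (analytic_bound ltr01 hK).
elim/poly_ind: p => [|p c [l [K hK]]].
  by exists 0, 0 => u _; rewrite !horner0 mulr0 !subr0 normc0 mul0r.
exists (l * z + p.[z]), (K * (normc z + 1) + normc l) => u u1; rewrite !(hornerD, hornerMX, hornerC).
have -> : p.[z + u] * (z + u) + c - (p.[z] * z + c) - u * (l * z + p.[z]) =
  (p.[z + u] - p.[z] - u * l) * (z + u) + u ^+ 2 * l by ring.
apply: le_trans (normc_leD _ _) _; rewrite (normcM _ (z + u)) (normcM (u ^+ 2)) normc_exp mulrDl [normc l * _]mulrC lerD2r mulrAC.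
apply: ler_pM; rewrite ?normc_ge0 //; first exact: hK.
by apply: le_trans (normc_leD _ _) _; rewrite lerD2l ltW.
Qed.
Lemma ccvg_horner (T' : Type) (F : set_system T') {FF : Filter F} p (f : T' -> C) (l : C) :
  normc (f x - l) @[x --> F] --> 0 -> normc (p.[f x] - p.[l]) @[x --> F] --> 0.
Proof.
move=> h; elim/poly_ind: p => [|p c IH].
  by under eq_fun do rewrite horner0; rewrite horner0; exact: ccvg_cst.
under eq_fun do rewrite !hornerE.
by apply: ccvgD; [exact: ccvgM|exact: ccvg_cst].
Qed.
Lemma bdry_disk_poly p x : bdry_disk (fun z => p.[z]) x = p.[ei x].
Proof.
apply: ccvg_lim; apply: ccvg_horner; rewrite -{2}[ei x]mul1r; apply: ccvgM; last exact: ccvg_cst.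
apply: (@ccvg_real R _ (1^'-)); apply: cvg_at_left_filter; exact: cvg_id.
Qed.
Lemma H2_disk_poly p : H2_disk (fun z => p.[z]).
Proof.
split; first by move=> z _; exact: derivable_horner.
exists (fun n => p`_n); split.
  apply/cvg_ex; exists (series (fun n => normc p`_n ^+ 2) (size p)).
  apply: cvg_near_cst; near=> n; have hn : (size p <= n)%N by near: n; exact: nbhs_infty_ge.
  rewrite /series /= (big_cat_nat _ hn) //= [X in _ + X]big1_seq ?addr0 // => i.
  by rewrite mem_index_iota => /andP[_ /andP[h _]]; rewrite nth_default // normc0 expr0n.
move=> z _; apply: cvg_near_cst; near=> n; have hn : (size p <= n)%N by near: n; exact: nbhs_infty_ge.
rewrite /series /= (big_cat_nat _ hn) //= [X in _ + X]big1_seq ?addr0; last first.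
  by move=> i; rewrite mem_index_iota => /andP[_ /andP[h _]]; rewrite nth_default // mul0r.
by rewrite big_mkord horner_coef.
Unshelve. all: by end_near. Qed.

(** The boundary function of a polynomial is its restriction to the circle, so
    the definition is [schwarz_poly]. *)
Lemma outer_poly p : (forall z, normc z < 1 -> p.[z] != 0) -> outer_disk (fun z => p.[z]).
Proof.
move=> hz; have z01 : normc (0 : C) < 1 by rewrite normc0 ltr01.
have p0 : p != 0 by apply: contraTneq (hz 0 z01) => ->; rewrite horner0 eqxx.
split; [exact: H2_disk_poly|by exists 0 => //; exact: hz|].
have [_ [l l1 hl]] := schwarz_poly p0 hz; exists l => // z z1.
rewrite hl //; congr (_ * cexp (_ * _)); apply: Cint_ext => x _.
by rewrite bdry_disk_poly.
Qed.
End OuterPoly.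

(** * Integrability of the log-modulus *)
Section Jensen.
Context {R : realType}.
Local Notation C := R[i].
Local Notation mu := (@lebesgue_measure R).
Local Notation T := (`[0, 2 * pi]%classic : set R).
Local Notation ei x := (cexp (0 +i* x)).
Hint Resolve mT : core.
Definition radial (G : C -> C) (x : R) (l : C) := normc (G (r%:C * ei x) - l) @[r --> 1^'-] --> 0.
Lemma radial_bdry G x l : radial G x l -> bdry_disk G x = l.
Proof. exact: ccvg_lim. Qed.
Lemma radial0 (G : C -> C) x l : radial G x l <-> normc (G ((1 - t)%:C * ei x) - l) @[t --> 0^'+] --> 0.
Proof. exact: (at_left1 _ (fun r => normc (G (r%:C * ei x) - l))). Qed.

(** Radial limits reduce to one-sided limits at zero, where [mc_right_lim]
    applies. *)
Lemma mc_bdry_disk (G : C -> C) : analytic_on unit_disk G -> mcfun setT (bdry_disk G).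
Proof.
move=> aG; apply: (@mc_right_lim R (fun t x => G ((1 - t)%:C * ei x)) _ (point : C^o)).
- move=> y x /andP[x0 x1].
  have ud : unit_disk ((1 - x)%:C * ei y) by apply: disk_radial; rewrite subr_ge0 (ltW x1) /= gtrBl.
  apply: (@analytic_ccont _ _ _ _ _ _ _ (fun t => (1 - t)%:C * ei y) aG ud).
  apply: ccvgM; last exact: ccvg_cst.
  by apply: ccvg_real; apply: cvgB; [exact: cvg_cst|exact: cvg_id].
- move=> x /andP[x0 x1].
  have ct (y : R) : normc (G ((1 - x)%:C * ei y') - G ((1 - x)%:C * ei y)) @[y' --> y] --> 0.
    have ud : unit_disk ((1 - x)%:C * ei y) by apply: disk_radial; rewrite subr_ge0 (ltW x1) /= gtrBl.
    apply: (@analytic_ccont _ _ _ _ _ _ _ (fun y' => (1 - x)%:C * ei y') aG ud).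
    apply: ccvgM; first exact: ccvg_cst.
    apply: ccvg_cexp; apply/ccvg_ReIm; split; first exact: cvg_cst.
    exact: cvg_id.
  split; apply: continuous_measurable_fun => y; have [h1 h2] := (ccvg_ReIm _ _).1 (ct y).
    exact: h1.
  exact: h2.
- by move=> y l /radial0 /radial_bdry.
- move=> y h; rewrite /bdry_disk dvgP // => hc; apply: (h (lim ((G (r%:C * ei y) : C^o) @[r --> 1^'-]))).
  by apply/radial0; apply/ccvgP.
Qed.
Definition trig_poly (b : nat -> C) N (x : R) : C := \sum_(k < N) b k * (ei x) ^+ k.
Lemma mc_trig D b N : mcfun D (trig_poly b N).
Proof. by apply: mc_sum => k; apply: mcM; [exact: mc_cst|apply: mcX; exact: mc_ei]. Qed.
Lemma trig_le b N x : normc (trig_poly b N x) <= \sum_(k < N) normc (b k).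
Proof.
apply: le_trans (normc_sum _ _ _) _; apply: ler_sum => k _.
by rewrite normcM normc_exp normc_ei expr1n mulr1.
Qed.
Lemma cint_trig b N k : cint T (fun x => trig_poly b N x * conjc (ei x) ^+ k).
Proof.
apply: (@cintT_bd _ _ (\sum_(k < N) normc (b k))).
  by apply: mcM; [exact: mc_trig|apply: mcX; apply: mc_conj; exact: mc_ei].
by move=> x; rewrite normcM normc_exp normcJ normc_ei expr1n mulr1 trig_le.
Qed.
Lemma parseval b N : rint T (fun x => normc (trig_poly b N x) ^+ 2) /\
  \int[mu]_(x in T) (normc (trig_poly b N x) ^+ 2) = 2 * pi * \sum_(k < N) normc (b k) ^+ 2.
Proof.
elim: N => [|N [IH1 IH2]].
  rewrite big_ord0 mulr0; have e x : normc (trig_poly b 0 x) ^+ 2 = 0 by rewrite /trig_poly big_ord0 normc0 expr0n.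
  split; first by apply: rint_ext (rint0 mT) => // x _; rewrite e.
  by rewrite (Rint_ext (fun x _ => e x)) RintT_cst mulr0.
have e x : normc (trig_poly b N.+1 x) ^+ 2 = (normc (trig_poly b N x) ^+ 2 +
    normc (b N) ^+ 2) + 2 * Re (conjc (b N) * (trig_poly b N x * conjc (ei x) ^+ N)).
  rewrite {1}/trig_poly big_ord_recr /= -/(trig_poly b N x); set u := trig_poly b N x.
  have cX : conjc (ei x) ^+ N = conjc ((ei x) ^+ N).
    elim: {IH1 IH2 u} N => [|m IH]; first by apply: eqc; rewrite !expr0 !cE ?oppr0.
    by rewrite !exprS IH; apply: eqc; rewrite !cE; ring.
  rewrite cX; have : normc ((ei x) ^+ N) ^+ 2 = 1 by rewrite normc_exp normc_ei expr1n expr1n.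
  set w := (ei x) ^+ N; have -> : normc (b N) ^+ 2 = normc (b N * w) ^+ 2 by rewrite normcM exprMn normc_exp normc_ei !expr1n mulr1.
  by move=> _; rewrite !normcE2 !cE; ring.
have c1 : cint T (fun x => conjc (b N) * (trig_poly b N x * conjc (ei x) ^+ N)).
  by apply: cintZ => //; exact: cint_trig.
have i1 := cint_re mT c1.
have z : \int[mu]_(x in T) Re (conjc (b N) * (trig_poly b N x * conjc (ei x) ^+ N)) = 0.
  rewrite -Re_Cint CintZ //; last exact: cint_trig.
  rewrite (_ : Cintegral T _ = 0); first by rewrite mulr0.
  rewrite (_ : Cintegral _ _ = Cintegral T (fun x => \sum_(k < N) b k * (conjc (ei x) ^+ N * (ei x) ^+ k))); last first.
    by apply: Cint_ext => x _; rewrite /trig_poly mulr_suml; apply: eq_bigr => k _; rewrite -mulrA [_ ^+ k * _]mulrC.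
  rewrite Cint_sum //; last by move=> k; apply: cintZ => //; exact: cint_eipow.
  apply: big1 => k _; rewrite (CintZ _ mT (cint_eipow _ _)) int_eiei ifN ?mulr0 //.
  by rewrite neq_ltn ltn_ord orbT.
have i2 : rint T (fun x => normc (trig_poly b N x) ^+ 2 + normc (b N) ^+ 2) by apply: rintD => //; exact: rintT_cst.
have i3 : rint T (fun x => 2 * Re (conjc (b N) * (trig_poly b N x * conjc (ei x) ^+ N))) by exact: rintZ.
split; first by apply: rint_ext (rintD mT i2 i3) => // x _; rewrite e.
rewrite (Rint_ext (fun x _ => e x)) (RintD mT i2 i3) (RintZ 2 mT i1) z mulr0 addr0.
have -> : 2 * pi * \sum_(k < N.+1) normc (b k) ^+ 2 = 2 * pi * (\sum_(k < N) normc (b k) ^+ 2) + 2 * pi * normc (b N) ^+ 2.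
  by rewrite -mulrDr; congr (_ * _); exact: big_ord_recr.
rewrite -IH2 -RintT_cst; exact: RintD mT IH1 (rintT_cst _).
Qed.
Section Coef.
Variables (G : C -> C) (a : nat -> C).
Hypothesis ca : cvgn (series (fun n => normc (a n) ^+ 2)).
Hypothesis ha : forall z, unit_disk z -> series (fun n => a n * z ^+ n : C^o) @ \oo --> (G z : C^o).
Definition sumsq := lim (series (fun n => normc (a n) ^+ 2) @ \oo).
Lemma sumsq_ge N : \sum_(k < N) normc (a k) ^+ 2 <= sumsq.
Proof.
rewrite -(big_mkord xpredT (fun k => normc (a k) ^+ 2)).
apply: (@nondecreasing_cvgn_le _ (series (fun n => normc (a n) ^+ 2))) => //.
by apply/nondecreasing_seqP => n; rewrite /series /= big_nat_recr //= lerDl exprn_ge0 // normc_ge0.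
Qed.
Lemma sumsq_ge0 : 0 <= sumsq.
Proof. by have := sumsq_ge 0; rewrite big_ord0. Qed.
Lemma coef_le n : normc (a n) <= Num.sqrt sumsq.
Proof.
rewrite -(@ler_pXn2r _ 2) ?nnegrE ?normc_ge0 ?sqrtr_ge0 // sqr_sqrtr ?sumsq_ge0 //.
apply: le_trans (sumsq_ge n.+1); rewrite big_ord_recr /= lerDr.
by apply: sumr_ge0 => k _; rewrite exprn_ge0 // normc_ge0.
Qed.
Lemma ha' z : normc z < 1 -> normc (\sum_(k < n) a k * z ^+ k - G z) @[n --> \oo] --> 0.
Proof.
move=> z1; have /ccvgP := ha z1; apply: cvg_trans; apply: near_eq_cvg; apply: nearW => n /=.
by rewrite /series /= big_mkord.
Qed.

(** The coefficients are bounded by the norm, so the tail is dominated by a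
    geometric series. *)
Lemma tail_le z N : normc z < 1 ->
  normc (G z - \sum_(k < N) a k * z ^+ k) <= Num.sqrt sumsq * normc z ^+ N / (1 - normc z).
Proof.
move=> z1; have d0 : 0 < 1 - normc z by rewrite subr_gt0.
have h m : normc (\sum_(k < N + m) a k * z ^+ k - \sum_(k < N) a k * z ^+ k) <=
    Num.sqrt sumsq * (normc z ^+ N - normc z ^+ (N + m)) / (1 - normc z).
  elim: m => [|m IH]; first by rewrite addn0 !subrr normc0 mulr0 mul0r.
  rewrite addnS big_ord_recr /= addrAC; apply: le_trans (normc_leD _ _) _.
  have -> : Num.sqrt sumsq * (normc z ^+ N - normc z ^+ (N + m).+1) / (1 - normc z) =
    Num.sqrt sumsq * (normc z ^+ N - normc z ^+ (N + m)) / (1 - normc z) + Num.sqrt sumsq * normc z ^+ (N + m).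
    by rewrite exprS; field; rewrite gt_eqF.
  by apply: lerD => //; rewrite normcM normc_exp ler_wpM2r ?exprn_ge0 ?normc_ge0 // coef_le.
have hc : normc (\sum_(k < N + m) a k * z ^+ k - \sum_(k < N) a k * z ^+ k) @[m --> \oo] -->
    normc (G z - \sum_(k < N) a k * z ^+ k).
  apply: ccvg_normc; apply: ccvgB; last exact: ccvg_cst.
  have := ha' z1; rewrite -(cvg_shiftn N (fun n => normc (\sum_(k < n) a k * z ^+ k - G z))).
  by apply: cvg_trans; apply: near_eq_cvg; apply: nearW => n /=; rewrite addnC.
rewrite -(cvg_lim _ hc) //; apply: limr_le; first by apply/cvg_ex; eexists; exact: hc.
apply: nearW => m; apply: le_trans (h m) _.
rewrite ler_pM2r ?invr_gt0 // ler_wpM2l ?sqrtr_ge0 // gerBl.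
by rewrite exprn_ge0 // normc_ge0.
Qed.
Lemma taylor_coef0 : a 0%N = G 0.
Proof.
have z1 : normc (0 : C) < 1 by rewrite normc0 ltr01.
have e n : (0 < n)%N -> \sum_(k < n) a k * (0 : C) ^+ k = a 0%N.
  case: n => // n _; rewrite big_ord_recl /= expr0 mulr1 big1 ?addr0 // => k _.
  by rewrite exprS mul0r mulr0.
apply: ccvg_unique (ha' z1); apply: cvg_near_cst; near=> n.
have n0 : (0 < n)%N by near: n; exact: nbhs_infty_gt.
by rewrite e // subrr normc0.
Unshelve. all: by end_near. Qed.
End Coef.
Lemma ln_le_sqr (y : R) : 0 <= y -> ln y <= y ^+ 2.
Proof.
move=> y0; have [y1|y1] := leP y 1.
  by apply: le_trans (ln_le0 y1) _; rewrite exprn_ge0.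
apply: le_trans (ltW (ln_sublinear (lt_trans ltr01 y1))) _.
by rewrite expr2 ler_peMr // ltW.
Qed.
Lemma rn_left : radius_seq n @[n --> \oo] --> (1:R)^'-.
Proof.
move=> A [d /= d0 hd]; have [N _ hN] := near_infty_natSinv_lt (PosNum d0).
exists N => // n /= Nn; apply: hd => /=; last by have /andP[] := @rn_bounds R n.
rewrite /ball_ /= /radius_seq subKr gtr0_norm ?invr_gt0 //.
exact: (hN n.+1 (leqW Nn)).
Qed.

(** Approximate [G] on the circle of radius [r_n] by its Taylor polynomials
    [q_n], which have the same value at the origin.  By [jensen_poly], by
    Parseval and by [ln y <= y^2], the nonnegative functions [|q_n|^2 - ln
    |q_n|] have bounded integrals; they converge to [|g|^2 - ln |g|] almost
    everywhere.  Fatou gives integrability of the limit, and shows that the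
    set where [g] vanishes, on which the limit is infinite, is null. *)
Lemma jensen (G : C -> C) (g : R -> C) : H2_disk G -> G 0 != 0 -> mcfun T g ->
  {ae mu, forall x, T x -> radial G x (g x)} ->
  rint T (fun x => ln (normc (g x))) /\ {ae mu, forall x, T x -> g x != 0}.
Proof.
move=> [_ [a [ca ha]]] G0 mg hg; set M := Num.sqrt (sumsq a).
have hN n : exists N, (0 < N)%N /\ M * radius_seq n ^+ N / (1 - radius_seq n) <= n.+1%:R^-1 :> R.
  have /andP[r0 r1] := @rn_bounds R n; have d0 : 0 < 1 - radius_seq n :> R by rewrite subr_gt0.
  have hc : M / (1 - radius_seq n) * radius_seq n ^+ N @[N --> \oo] --> (0:R).
    by apply: cvg_mul0l; apply: cvg_expr; rewrite gtr0_norm.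
  have e0 : 0 < n.+1%:R^-1 :> R by rewrite invr_gt0.
  have [N _ hN] := (cvgrPdist_le _ _).1 hc _ e0; exists N.+1; split => //.
  have := hN N.+1 (leqnSn N); rewrite sub0r normrN mulrAC => h.
  exact: le_trans (ler_norm _) h.
have [Nn hNn] := choice hN.
pose b n k := a k * (radius_seq n)%:C ^+ k.
pose q n : {poly C} := \poly_(k < Nn n) b n k.
have qE n x : (q n).[ei x] = trig_poly (b n) (Nn n) x by rewrite /q horner_poly.
have rz n x : normc ((radius_seq n)%:C * ei x) = radius_seq n :> R.
  by have /andP[r0 _] := @rn_bounds R n; rewrite normcM normc_ei mulr1 normc_real gtr0_norm.
have happ n x : normc (G ((radius_seq n)%:C * ei x) - (q n).[ei x]) <= n.+1%:R^-1.
  have z1 : normc ((radius_seq n)%:C * ei x) < 1 by rewrite rz; have /andP[] := @rn_bounds R n.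
  have := tail_le ca ha (Nn n) z1; rewrite rz => h.
  apply: le_trans (hNn n).2; apply: le_trans h; apply: eqW; congr (normc (_ - _)).
  by rewrite qE /trig_poly; apply: eq_bigr => k _; rewrite /b exprMn mulrA.
have q0 n : (q n).[0] = G 0.
  by rewrite horner_coef0 coef_poly (hNn n).1 /b expr0 mulr1 (taylor_coef0 ha).
have jq n : logint (q n) /\ 2 * pi * ln (normc (G 0)) <= \int[mu]_(x in T) log_abs (q n) x.
  by rewrite -(q0 n); apply: jensen_poly; rewrite q0.
have pq n : rint T (fun x => normc (q n).[ei x] ^+ 2) /\ \int[mu]_(x in T) (normc (q n).[ei x] ^+ 2) <= 2 * pi * sumsq a.
  have [i1 e1] := parseval (b n) (Nn n); split; first by apply: rint_ext i1 => // x _; rewrite qE.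
  rewrite (Rint_ext (g := fun x => normc (trig_poly (b n) (Nn n) x) ^+ 2)); last by move=> x _; rewrite qE.
  rewrite e1 ler_pM2l ?pi2_gt0 //; apply: le_trans (sumsq_ge ca (Nn n)); apply: ler_sum => k _.
  have /andP[r0 r1] := @rn_bounds R n; apply: lerXn2r; rewrite ?nnegrE ?normc_ge0 //.
  rewrite /b normcM normc_exp normc_real gtr0_norm // ler_piMr ?normc_ge0 //.
  by rewrite exprn_ile1 // ltW.
(* Nonnegative by [ln_le_sqr]. *)
pose F n x := normc (q n).[ei x] ^+ 2 - log_abs (q n) x.
have F0 n x : 0 <= F n x by rewrite subr_ge0 ln_le_sqr // normc_ge0.
pose B := 2 * pi * sumsq a - 2 * pi * ln (normc (G 0)).
have iF n : rint T (F n) /\ \int[mu]_(x in T) F n x <= B.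
  have [i1 h1] := pq n; have [[i2 _] h2] := jq n; split; first exact: rintB.
  by rewrite RintB // lerB.
have mF n : mrfun T (F n) by case: (iF n) => /rint_meas.
have hq : {ae mu, forall x, T x -> normc ((q n).[ei x] - g x) @[n --> \oo] --> 0}.
  apply: aeS hg => x hx Tx; have h1 := hx Tx.
  have h2 : normc (G ((radius_seq n)%:C * ei x) - g x) @[n --> \oo] --> 0 by exact: cvg_comp rn_left h1.
  apply: (@ccvg_squeeze _ _ _ _ _ _ (fun n => n.+1%:R^-1 + normc (G ((radius_seq n)%:C * ei x) - g x))).
    apply: nearW => n; apply: le_trans (lerD (happ n x) (lexx _)).
    rewrite -[X in _ <= X + _]normc_distC; apply: le_trans (normc_leD _ _).
    by rewrite addrA subrK.
  by rewrite -[X in _ --> X](addr0 0); apply: cvgD => //; exact: invn_cvg0.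
have hq0 : {ae mu, forall x, forall n, T x -> (q n).[ei x] != 0}.
  by apply: ae_foralln => n; case: (jq n) => -[].
have ng : {ae mu, forall x, T x -> g x != 0}.
  have [N [mN N0 hN']] : {ae mu, forall x, T x -> normc ((q n).[ei x] - g x) @[n --> \oo] --> 0 /\ forall n, (q n).[ei x] != 0}.
    by apply: ae2 hq hq0 => x h1 h2 Tx; split; [exact: h1|move=> n; exact: h2].
  (* [D0] is the zero set of [g], minus the exceptional set: there the functions
   [F n] tend to infinity. *)
  pose D0 : set R := T `&` (fun x => normc (g x)) @^-1` [set 0] `\` N.
  have mD0 : measurable D0.
    by apply: measurableD => //; apply: (mc_norm mg) => //; exact: measurable_set1.
  have D0T : D0 `<=` T by move=> x [[]].
  suff z : mu D0 = 0%E.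
    exists (D0 `|` N); split; [exact: measurableU|by rewrite measureU0|].
    move=> x hx; have [xN|xN] := pselect (N x); first by right.
    left; split => //; have [Tx|nT] := pselect (T x); last by exfalso; apply: hx => /nT.
    split => //=; apply: contrapT => h; apply: hx => _; apply/eqP => gx.
    by apply: h; rewrite gx normc0.
  pose F' n x := F n x * (x \in D0)%:R.
  pose f' : R -> \bar R := (cst +oo%E) \_ D0.
  have mI' : mrfun T (fun x => (x \in D0)%:R : R).
    rewrite (_ : (fun x => _) = \1_D0); first exact: measurable_indic.
    by apply/funext => x; rewrite indicE.
  have hb : (\int[mu]_(x in T) f' x <= B%:E)%E.
    apply: (@fatou_bound_e _ T F').
    - by [].
    - by move=> n; apply: mrM.
    - by move=> n x _; rewrite mulr_ge0.
    - move=> x Tx; rewrite /F' /f' patchE; case: ifPn => xD; last first.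
        by under eq_fun do rewrite mulr0; exact: cvg_cst.
      under eq_fun do rewrite mulr1; move: xD; rewrite inE => -[[_ /= gx] xN].
      have [h1 h2] : normc ((q n).[ei x] - g x) @[n --> \oo] --> 0 /\ forall n, (q n).[ei x] != 0.
        by apply: contrapT => h; apply: xN; apply: hN' => h3; apply: h; exact: h3.
      have h3 : normc (q n).[ei x] @[n --> \oo] --> normc (g x) by exact: ccvg_normc h1.
      rewrite gx in h3.
      apply/cvgeyPge => A; have e0 := expR_gt0 (- A).
      have [N1 _ hN1] := (cvgrPdist_le _ _).1 h3 _ e0; exists N1 => // n Nn'.
      have := hN1 n Nn'; rewrite /= sub0r normrN ger0_norm ?normc_ge0 // => hn; rewrite lee_fin.
      have n0 : 0 < normc (q n).[ei x] by rewrite normc_gt0.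
      have : log_abs (q n) x <= - A by rewrite -(expRK (- A)) ler_ln ?posrE ?expR_gt0.
      rewrite lerNr => hl; apply: le_trans hl _; rewrite lerDr.
      by rewrite exprn_ge0 // normc_ge0.
    - apply: nearW => n; have [i1 h1] := iF n.
      have i2 : rint T (F' n).
        apply: rint_le i1 => //; first by apply: mrM.
        by move=> x _; rewrite /F'; case: (x \in D0); rewrite ?mulr1 ?mulr0 ?normr0 // ger0_norm.
      split => //; apply: le_trans h1; apply: Rint_le0 => // x _.
      by rewrite /F'; case: (x \in D0); rewrite ?mulr1 ?mulr0.
  rewrite /f' -integral_mkcondr integral_cst in hb; last by apply: measurableI.
  move: hb; rewrite (_ : T `&` D0 = D0); last by apply/setIidr.
  have [//|nz] := eqVneq (mu D0) 0%E.
  have p : (0 < mu D0)%E by rewrite lt0e nz measure_ge0.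
  by rewrite gt0_mulye // leye_eq.
split => //.
have mln : mrfun T (fun x => ln (normc (g x))) by apply: mr_ln; exact: mc_norm.
have m2 : mrfun T (fun x => normc (g x) ^+ 2) by apply: mrX; exact: mc_norm.
have [i1 _] : rint T (fun x => normc (g x) ^+ 2) /\ \int[mu]_(x in T) (normc (g x) ^+ 2) <= 2 * pi * sumsq a.
  apply: (@fatou_bound _ _ (fun n x => normc (q n).[ei x] ^+ 2)) => //.
  - by move=> n; case: (pq n) => /rint_meas.
  - by move=> n x _; rewrite exprn_ge0 // normc_ge0.
  - apply: aeS hq => x hx Tx; have h := ccvg_normc (hx Tx).
    by apply: (cvgM (f := fun n => normc (q n).[ei x])); exact: h.
  - by apply: nearW => n; exact: pq.
have [i2 _] : rint T (fun x => normc (g x) ^+ 2 - ln (normc (g x))) /\ \int[mu]_(x in T) (normc (g x) ^+ 2 - ln (normc (g x))) <= B.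
  apply: (@fatou_bound _ _ F) => //; first by apply: mrD => //; exact: mrN.
  - apply: ae2 hq ng => x hx gx Tx; have h := ccvg_normc (hx Tx).
    have n0 : 0 < normc (g x) by rewrite normc_gt0 gx.
    apply: cvgB; last by apply: (continuous_cvg _ (continuous_ln n0)); exact: h.
    by apply: (cvgM (f := fun n => normc (q n).[ei x])); exact: h.
  - by apply: nearW => n; exact: iF.
by apply: rint_ext (rintB mT i1 i2) => // x _; rewrite subKr.
Qed.
End Jensen.

(** * Change of variables between the circle and the line *)
Section Cayley.
Context {R : realType}.
Local Notation C := R[i].
Local Notation mu := (@lebesgue_measure R).
Local Notation T := (`[0, 2 * pi]%classic : set R).
Local Notation ei x := (cexp (0 +i* x)).
Hint Resolve mT : core.

(** The derivative of the change of variables, up to sign. *)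
Definition jac (y : R) : R := 2 / (1 + y ^+ 2).

(** The angle in [[0, 2 pi]] of the point of the circle that the Cayley
    transform associates with [iy]; the two cases are the two halves of the
    circle, and [theta] is decreasing on each. *)
Definition theta (y : R) : R := if y <= 0 then - (2 * atan y) else 2 * pi - 2 * atan y.
Lemma jac_den (y : R) : 0 < 1 + y ^+ 2.
Proof. by rewrite ltr_pwDl ?ltr01 ?sqr_ge0. Qed.
Lemma jac_ge0 y : 0 <= jac y.
Proof. by rewrite divr_ge0 // ltW // jac_den. Qed.
Lemma int_jac : rint setT jac /\ \int[mu]_y jac y = 2 * pi.
Proof.
have [h1 h2] := @int_cauchy R 1 ltr01.
have e y : jac y = 2 * (1 / (1 ^+ 2 + y ^+ 2)) by rewrite /jac expr1n mul1r.
split; first by apply: rint_ext (rintZ 2 measurableT h1) => // y _; rewrite e.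
rewrite (Rint_ext (fun y _ => e y)) -h2; exact: RintZ.
Qed.
Lemma mr_le (D : set R) (d : R) : mrfun D (fun y : R => (d <= y)%R%:R : R).
Proof.
rewrite (_ : (fun y => _) = \1_(`[d, +oo[%classic : set R)); first exact: measurable_indic.
by apply/funext => y; rewrite indicE mem_setE in_itv /= andbT.
Qed.
Lemma ray_jac (d : R) : rint setT (fun y => (d <= y)%R%:R * jac y) /\
  \int[mu]_y ((d <= y)%R%:R * jac y) = pi - 2 * atan d.
Proof.
have [ij _] := int_jac; have mj := rint_meas ij.
have r1 : rint setT (fun y => (d <= y)%R%:R * jac y).
  apply: rint_le ij => //; first by apply: mrM; [apply: mr_le|].
  move=> y _; have h := jac_ge0 y.
  by case: (d <= y); rewrite ?mul1r ?mul0r ?normr0 // ger0_norm.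
split => //.
have cj : continuous jac.
  move=> y; apply: cvgM; first exact: cvg_cst.
  apply: cvgV; first by rewrite gt_eqF // jac_den.
  by apply: cvgD; [exact: cvg_cst|apply: cvgM; exact: cvg_id].
have hd (y : R) : is_derive y (1:R) (fun t => 2 * atan t) (jac y).
  by apply: is_derive_eq; rewrite /GRing.scale /=.
transitivity (\int[mu]_(x in `[d, +oo[) jac x).
  rewrite [RHS]Rintegral_mkcond; apply: eq_Rintegral => y _.
  by rewrite patchE mem_setE in_itv /= andbT; case: (d <= y); rewrite ?mul1r ?mul0r.
rewrite (@Rintegral_ge0_continuous_FTC2y _ jac (fun t => 2 * atan t) d pi) //.
- by move=> x _; exact: jac_ge0.
- exact: continuous_subspaceT.
- rewrite [X in _ --> X](_ : pi = 2 * (pi / 2)); last by field.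
  by apply: cvgMr; exact: cvgy_atan.
- by have [/derivable1_diffP /differentiable_continuous h _] := hd d; exact: cvg_at_right_filter h.
- by move=> x _; rewrite derive1E; have [_ ->] := hd x.
Qed.
Lemma ray_jac0 : rint setT (fun y => (0 < y)%R%:R * jac y) /\
  \int[mu]_y ((0 < y)%R%:R * jac y) = pi.
Proof.
have [h1 h2] := ray_jac 0; have m1 := rint_meas h1.
have m2 : mrfun setT (fun y : R => (0 < y)%R%:R * jac y).
  apply: mrM; last by have [/rint_meas] := int_jac.
  rewrite (_ : (fun y => _) = \1_(`]0, +oo[%classic : set R)); first exact: measurable_indic.
  by apply/funext => y; rewrite indicE mem_setE in_itv andbT.
have e : ae_eq mu setT (fun y => (0 <= y)%R%:R * jac y) (fun y => (0 < y)%R%:R * jac y).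
  exists [set 0]; split; [exact: measurable_set1|exact: lebesgue_measure_set1|].
  move=> y h; apply/eqP; have [//|y0] := eqVneq y 0; exfalso; apply: h => _.
  by rewrite lt_neqAle eq_sym y0.
split; first exact: rint_ae e h1.
by rewrite -(Rint_ae measurableT m1 m2 e) h2 atan0 mulr0 subr0.
Qed.
Lemma theta_T y : T (theta y).
Proof.
rewrite /= in_itv /= /theta; have p0 := @pi_gt0 R.
have h1 := atan_gtNpi2 y; have h2 := atan_ltpi2 y.
case: (leP y 0) => y0.
  have := le_atan y0; rewrite atan0 => h; apply/andP; split; lra.
have := le_atan (ltW y0); rewrite atan0 => h; apply/andP; split; lra.
Qed.
Lemma mr_theta : mrfun setT theta.
Proof.
apply: (@mr_ext _ _ _ _ (fun y => - (2 * atan y) + 2 * pi * (1 - (0 <= - y)%R%:R))).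
  move=> y _; rewrite oppr_ge0 /theta; case: (y <= 0) => /=; ring.
have ma : mrfun setT (@atan R).
  by apply: continuous_measurable_fun => y; exact: continuous_atan.
apply: mrD; first by apply: mrN; apply: mrM; [exact: mr_cst|].
apply: mrM; first exact: mr_cst.
apply: mrD; first exact: mr_cst.
apply: mrN; apply: (@measurable_comp _ _ _ _ _ _ setT (fun y : R => (0 <= y)%R%:R : R) setT (fun y : R => - y)) => //.
  exact: mr_le.
by apply: mrN; exact: mr_id.
Qed.
Lemma tan_lt (x : R) : - (pi / 2) < x < pi / 2 -> atan (tan x) = x.
Proof. by move=> h; rewrite tanK // in_itv. Qed.
Lemma lt_atanE (x y : R) : (atan x < atan y) = (x < y).
Proof.
apply/idP/idP; last exact: lt_atan.
by apply: contraTT; rewrite -!leNgt; exact: le_atan.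
Qed.
Lemma le_atanE (x y : R) : (atan x <= atan y) = (x <= y).
Proof. by rewrite !leNgt lt_atanE. Qed.

(** The preimage of an initial segment of angles is an interval ending at 0,
    or else the half line [y <= 0] together with a ray; [jac] has the
    primitive [2 atan]. *)
Lemma theta_ray (c : R) : rint setT (fun y => (theta y <= c)%R%:R * jac y) /\
  \int[mu]_y ((theta y <= c)%R%:R * jac y) = Num.max 0 (Num.min c (2 * pi)).
Proof.
have p0 := @pi_gt0 R; have [ij ej] := int_jac; have [i0 e0] := ray_jac0.
have th y : 0 <= theta y <= 2 * pi by have := theta_T y; rewrite /= in_itv.
have [c0|c0] := ltP c 0.
  have e y : (theta y <= c)%R%:R * jac y = 0.
    have /andP[h _] := th y; rewrite leNgt (lt_le_trans c0 h) /= mul0r //.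
  split; first by apply: rint_ext (rint0 measurableT) => // y _; rewrite e.
  rewrite (Rint_ext (g := fun=> 0)); last (by move=> y _; exact: e); rewrite Rintegral_cst //= mul0r max_l // ge_min ltW //.
rewrite max_r; last by rewrite le_min c0 /=; lra.
have [c2|c2] := leP (2 * pi) c.
  have e y : (theta y <= c)%R%:R * jac y = jac y.
    by have /andP[_ h] := th y; rewrite (le_trans h c2) mul1r.
  split; first by apply: rint_ext ij => // y _; rewrite e.
  by rewrite (Rint_ext (fun y _ => e y)) ej.
have [cp|cp] := ltP c pi.
  have [i1 e1] := ray_jac (tan (- (c / 2))).
  have ta : atan (tan (- (c / 2))) = - (c / 2) by apply: tan_lt; apply/andP; split; lra.
  have t0 : tan (- (c / 2)) <= 0 by rewrite -le_atanE ta atan0; lra.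
  have e y : (theta y <= c)%R%:R * jac y =
      (tan (- (c / 2)) <= y)%R%:R * jac y - (0 < y)%R%:R * jac y.
    rewrite -mulrBl; congr (_ * _); rewrite /theta; case: (leP y 0) => y0.
      rewrite subr0 -(le_atanE _ y) ta; congr (_%:R); congr nat_of_bool.
      by apply/idP/idP; lra.
    rewrite (le_trans t0 (ltW y0)) subrr leNgt.
    by have := atan_ltpi2 y => h; have -> : c < 2 * pi - 2 * atan y by lra.
  split; first by apply: rint_ext (rintB measurableT i1 i0) => // y _; rewrite e.
  rewrite (Rint_ext (fun y _ => e y)) (RintB measurableT i1 i0) e1 e0 ta; lra.
have b1 (y : R) : 0 < y -> c < 2 * pi - 2 * atan y <-> atan y < pi - c / 2 by move=> _; split; lra.
have [cp'|cp'] := eqVneq c pi.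
  have e y : (theta y <= c)%R%:R * jac y = jac y - (0 < y)%R%:R * jac y.
    rewrite -{2}[jac y]mul1r -mulrBl; congr (_ * _); rewrite /theta; case: (leP y 0) => y0.
      have h := atan_gtNpi2 y; rewrite subr0; have -> : - (2 * atan y) <= c by lra.
      by [].
    have h := atan_ltpi2 y; rewrite leNgt subrr; have -> : c < 2 * pi - 2 * atan y by lra.
    by [].
  split; first by apply: rint_ext (rintB measurableT ij i0) => // y _; rewrite e.
  rewrite (Rint_ext (fun y _ => e y)) (RintB measurableT ij i0) ej e0; lra.
have {}cp : pi < c by rewrite lt_neqAle eq_sym cp' cp.
have [i1 e1] := ray_jac (tan (pi - c / 2)).
have ta : atan (tan (pi - c / 2)) = pi - c / 2 by apply: tan_lt; apply/andP; split; lra.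
have t0 : 0 < tan (pi - c / 2) by rewrite -lt_atanE ta atan0; lra.
have e y : (theta y <= c)%R%:R * jac y =
    (jac y - (0 < y)%R%:R * jac y) + (tan (pi - c / 2) <= y)%R%:R * jac y.
  rewrite -{2}[jac y]mul1r -mulrBl -mulrDl; congr (_ * _); rewrite /theta; case: (leP y 0) => y0.
    have h := atan_gtNpi2 y; have -> : - (2 * atan y) <= c by lra.
    by rewrite leNgt (le_lt_trans y0 t0) /= subr0 addr0.
  rewrite subrr add0r -(le_atanE _ y) ta; congr (_%:R); congr nat_of_bool.
  by apply/idP/idP; lra.
have i2 := rintB measurableT ij i0.
split; first by apply: rint_ext (rintD measurableT i2 i1) => // y _; rewrite e.
rewrite (Rint_ext (fun y _ => e y)) (RintD measurableT i2 i1) (RintB measurableT ij i0) ej e0 e1 ta; lra.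
Qed.

(** The change of variables formula for [f], with integrability on both sides,
    as a predicate on [f] to be propagated from intervals to all integrable
    functions. *)
Definition cov (f : R -> R) := [/\ rint T f, rint setT (fun y => f (theta y) * jac y) &
  \int[mu]_y (f (theta y) * jac y) = \int[mu]_(x in T) f x].
Lemma cov_ext f g : (forall x, T x -> f x = g x) -> cov f -> cov g.
Proof.
move=> e [h1 h2 h3]; split; first exact: rint_ext h1.
  by apply: rint_ext h2 => // y _; rewrite e //; exact: theta_T.
rewrite -(Rint_ext e) -h3; apply: Rint_ext => y _; rewrite e //; exact: theta_T.
Qed.
Lemma covD f g : cov f -> cov g -> cov (fun x => f x + g x).
Proof.
move=> [h1 h2 h3] [k1 k2 k3]; split; first exact: rintD.
  by apply: rint_ext (rintD measurableT h2 k2) => // y _; rewrite mulrDl.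
rewrite (RintD mT h1 k1) -h3 -k3 -(RintD measurableT h2 k2).
by apply: Rint_ext => y _; rewrite mulrDl.
Qed.
Lemma covZ (c : R) f : cov f -> cov (fun x => c * f x).
Proof.
move=> [h1 h2 h3]; split; first exact: rintZ.
  by apply: rint_ext (rintZ c measurableT h2) => // y _; rewrite mulrA.
rewrite (RintZ c mT h1) -h3 -(RintZ c measurableT h2).
by apply: Rint_ext => y _; rewrite mulrA.
Qed.
Lemma covB f g : cov f -> cov g -> cov (fun x => f x - g x).
Proof.
move=> hf hg; apply: cov_ext (covD hf (covZ (-1) hg)) => x _; ring.
Qed.
Lemma mr_comp_theta (f : R -> R) : mrfun T f -> mrfun setT (fun y => f (theta y)).
Proof.
move=> mf; apply: (@measurable_comp _ _ _ _ _ _ T f setT theta) => //.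
- by move=> _ [y _ <-]; exact: theta_T.
- exact: mr_theta.
Qed.

(** Dominated convergence on the circle and, once Fatou has shown that the
    limit is integrable, on the line too. *)
Lemma cov_lim (u : nat -> R -> R) f : (forall n, cov (u n)) -> mrfun T f ->
  (forall n x, T x -> 0 <= u n x <= f x) -> rint T f ->
  (forall x, T x -> u n x @[n --> \oo] --> f x) -> cov f.
Proof.
move=> hu mf hb rf hc; have mj : mrfun setT jac by have [/rint_meas] := int_jac.
have mu' n : mrfun T (u n) by case: (hu n) => /rint_meas.
have mF n : mrfun setT (fun y => u n (theta y) * jac y) by case: (hu n) => _ /rint_meas.
have mG : mrfun setT (fun y => f (theta y) * jac y) by apply: mrM => //; exact: mr_comp_theta.
have hl y : u n (theta y) * jac y @[n --> \oo] --> f (theta y) * jac y.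
  by apply: cvgM; [apply: hc; exact: theta_T|exact: cvg_cst].
have [i2 _] : rint setT (fun y => f (theta y) * jac y) /\
    \int[mu]_y (f (theta y) * jac y) <= \int[mu]_(x in T) f x.
  apply: (@fatou_bound _ setT (fun n y => u n (theta y) * jac y)) => //.
  - move=> n y _; have /andP[h _] := hb n _ (theta_T y).
    by rewrite mulr_ge0 // jac_ge0.
  - by apply: aeT => y _; exact: hl.
  - apply: nearW => n; have [h1 h2 ->] := hu n; split => //.
    by apply: Rint_le0 => // x Tx; have /andP[] := hb n x Tx.
have [_ l1] : rint setT (fun y => f (theta y) * jac y) /\
    \int[mu]_y (u n (theta y) * jac y) @[n --> \oo] --> \int[mu]_y (f (theta y) * jac y).
  apply: (@rDCT _ setT _ _ (fun y => f (theta y) * jac y)) => //.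
  - by apply: aeT => y _; exact: hl.
  - apply: aeT => y n _; have /andP[h h'] := hb n _ (theta_T y).
    have p : 0 <= u n (theta y) * jac y by exact: mulr_ge0 h (jac_ge0 y).
    by rewrite (ger0_norm p); exact: ler_wpM2r (jac_ge0 y) _ _ h'.
have [_ l2] : rint T f /\ \int[mu]_(x in T) u n x @[n --> \oo] --> \int[mu]_(x in T) f x.
  apply: (@rDCT _ T _ _ f) => //.
  - by apply: aeT => x Tx; exact: hc.
  - by apply: aeT => x n Tx; have /andP[h h'] := hb n x Tx; rewrite ger0_norm.
split => //; have e : (fun n => \int[mu]_y (u n (theta y) * jac y)) = (fun n => \int[mu]_(x in T) u n x).
  by apply/funext => n; case: (hu n).
by move: l1; rewrite e => l1; rewrite -(cvg_lim _ l1) // (cvg_lim _ l2).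
Qed.
Lemma cov_ray (c : R) : cov (fun x => (x <= c)%R%:R).
Proof.
have [h1 h2] := theta_ray c.
have p2 : 0 < 2 * pi :> R := @pi2_gt0 R.
have r1 : rint T (fun x => (x <= c)%R%:R) by apply: (@rintT_bd _ _ 1); [exact: mr_step|move=> x; rewrite normr_nat; case: (x <= c)].
split => //; rewrite h2.
transitivity (fine (mu (`[0, Num.min c (2 * pi)]%classic : set R))).
  rewrite lebesgue_measure_itv /= lte_fin; case: ltP => h /=.
    by rewrite subr0.
  by [].
rewrite /Rintegral; congr fine; rewrite -[LHS]/(mu (`[0, Num.min c (2 * pi)]%classic)).
transitivity (mu ((`]-oo, c]%classic : set R) `&` T)).
  congr (mu _); apply/seteqP; split => x /=; rewrite !in_itv /= le_min; last by move=> [-> /andP[-> ->]].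
  by move=> /andP[-> /andP[-> ->]].
rewrite -integral_indic //; apply: eq_integral => x _.
by rewrite indicE mem_setE in_itv.
Qed.
Lemma cov0 : cov (fun=> 0).
Proof. by apply: cov_ext (covZ 0 (cov_ray 0)) => x _; rewrite mul0r. Qed.
Lemma cov_sum I (r : seq I) (F : I -> R -> R) : (forall i, cov (F i)) -> cov (fun x => \sum_(i <- r) F i x).
Proof.
move=> h; elim: r => [|i r IH]; first by apply: cov_ext cov0 => x _; rewrite big_nil.
by apply: cov_ext (covD (h i) IH) => x _; rewrite big_cons.
Qed.
Lemma mr_mem (D E : set R) : measurable E -> mrfun D (fun x => (x \in E)%:R : R).
Proof.
move=> mE; rewrite (_ : (fun x => _) = \1_E); first exact: measurable_indic.
by apply/funext => x; rewrite indicE.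
Qed.

(** A Dynkin system that contains the intervals, by [cov_ray]. *)
Lemma cov_indic (E : set R) : measurable E -> cov (fun x => (x \in E)%:R).
Proof.
pose H : set (set R) := [set A : set R | measurable A /\ cov (fun x => (x \in A)%:R)].
have HT : H setT.
  split => //; apply: cov_ext (cov_ray (2 * pi)) => x; rewrite /= in_itv /= in_setT.
  by case/andP => _ ->.
have hl : lambda_system setT H.
  split => // [A B AB [mA HA] [mB HB]|F ndF HF].
  - split; first exact: measurableD.
    apply: cov_ext (covB HA HB) => x _; rewrite in_setD.
    have h : x \in B -> x \in A by rewrite !inE; exact: AB.
    case hB : (x \in B) => /=; last by rewrite andbT subr0.
    by rewrite (h hB) subrr.
  - have mU : measurable (\bigcup_n F n) by apply: bigcup_measurable => n _; case: (HF n).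
    split => //; apply: (@cov_lim (fun n x => (x \in F n)%:R)).
    + by move=> n; case: (HF n).
    + exact: mr_mem.
    + move=> n x _; rewrite ler0n /= ler_nat; case hx : (x \in F n) => //.
      by rewrite mem_set //; exists n => //; rewrite -inE.
    + apply: (@rintT_bd _ _ 1); first exact: mr_mem.
      by move=> x; rewrite normr_nat; case: (x \in _).
    + move=> x _; have [[k _ hk]|hn] := pselect ((\bigcup_n F n) x).
        rewrite mem_set; last by exists k.
        apply: cvg_near_cst; near=> n; rewrite mem_set //.
        have kn : (k <= n)%N by near: n; exact: nbhs_infty_ge.
        by have /subsetPset := ndF _ _ kn; apply.
      rewrite memNset //; apply: cvg_near_cst; near=> n.
      by rewrite memNset // => hF; apply: hn; exists n.
have hG : @ocitv R `<=` H.
  move=> _ [[a b] _ <-] /=; split; first exact: measurable_itv.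
  have [ab|ab] := lerP a b; last first.
    apply: cov_ext cov0 => x _; rewrite (_ : x \in _ = false) //.
    by apply/negbTE/negP; rewrite inE /= in_itv /= => /andP[h1 h2]; have := lt_le_trans h1 h2; rewrite ltNge (ltW ab).
  apply: cov_ext (covB (cov_ray b) (cov_ray a)) => x _.
  rewrite mem_setE in_itv /=; case: (lerP x a) => xa /=; last by rewrite subr0.
  by rewrite (le_trans xa ab) subrr.
by move=> mE; have [] := lambda_system_subset (@ocitvI R) hl hG _ mE.
Unshelve. all: by end_near. Qed.
Import HBNNSimple.
Lemma cov_nnsfun (h : {nnsfun R >-> R}) : cov h.
Proof.
have h0 : cov (fun x => \sum_(y <- finmap.enum_fset (fset_set (range h))) (y * (x \in h @^-1` [set y])%:R)).
  apply: cov_sum => y; apply: covZ; apply: cov_indic; exact: measurable_sfunP.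
apply: cov_ext h0 => x _; rewrite [in RHS](fimfunE h) fsbig_finite //=.
Qed.
Lemma cov_ge0 (f : R -> R) : rint T f -> (forall x, T x -> 0 <= f x) -> cov f.
Proof.
move=> rf f0; have mf := rint_meas rf.
have mf' : measurable_fun T (EFin \o f) by apply/measurable_EFinP.
pose h := nnsfun_approx mT mf'.
have hc x : T x -> h n x @[n --> \oo] --> f x.
  move=> Tx; have := @cvg_nnsfun_approx _ _ _ _ mT _ mf' _ _ Tx.
  have h0 : forall x, T x -> (0 <= (EFin \o f) x)%E by move=> z /f0 /=; rewrite lee_fin.
  by move=> /(_ h0) /fine_cvg.
apply: (@cov_lim (fun n => h n)) => //; first by move=> n; exact: cov_nnsfun.
move=> n x Tx; apply/andP; split => //; rewrite -(cvg_lim _ (hc x Tx)) //.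
apply: nondecreasing_cvgn_le.
  by move=> a b ab; have /lefP/(_ x) := nd_nnsfun_approx mT mf' ab.
by apply/cvg_ex; exists (f x); exact: hc.
Qed.
Lemma cov_real (f : R -> R) : rint T f -> cov f.
Proof.
move=> rf; have hm (g : R -> R) : rint T g -> cov (fun x => Num.max (g x) 0).
  move=> rg; apply: cov_ge0; last by move=> x _; rewrite le_max lexx orbT.
  apply: rint_le (rint_norm rg) => //.
    by apply: measurable_maxr; [exact: rint_meas|exact: measurable_cst].
  by move=> x _; rewrite ger0_norm ?le_max ?lexx ?orbT // ge_max normr_ge0 ler_norm.
apply: cov_ext (covB (hm _ rf) (hm _ (rintN mT rf))) => x _.
by case: (lerP (f x) 0) => h; case: (lerP (- f x) 0) => h'; lra.
Qed.
Lemma cov_complex (f : R -> C) : cint T f -> cint setT (fun y => f (theta y) * (jac y)%:C) /\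
  Cintegral setT (fun y => f (theta y) * (jac y)%:C) = Cintegral T f.
Proof.
move=> hf; have [_ r1 r2] := cov_real (cint_re mT hf); have [_ i1 i2] := cov_real (cint_im mT hf).
have eR y : Re (f (theta y) * (jac y)%:C) = Re (f (theta y)) * jac y by rewrite !cE; ring.
have eI y : Im (f (theta y) * (jac y)%:C) = Im (f (theta y)) * jac y by rewrite !cE; ring.
split.
  apply: cint_ReIm => //; first by apply: rint_ext r1 => // y _; rewrite eR.
  by apply: rint_ext i1 => // y _; rewrite eI.
rewrite /Cintegral -r2 -i2; congr (_ +i* _); apply: Rint_ext => y _; [exact: eR|exact: eI].
Qed.
End Cayley.

(** * Outer functions of the disk and of the half plane *)
Section Transfer.
Context {R : realType}.
Local Notation C := R[i].
Local Notation mu := (@lebesgue_measure R).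
Local Notation P := (@Rplus R).
Local Notation T := (`[0, 2 * pi]%classic : set R).
Local Notation ei x := (cexp (0 +i* x)).
Hint Resolve mT : core.
Lemma Re_i : Re ('i : C) = 0. Proof. by []. Qed.
Lemma Im_i : Im ('i : C) = 1. Proof. by []. Qed.
Definition cE1 := (@Re_1 R, @Im_1 R, Re_i, Im_i, @cE R).

(** The inverse Cayley transform in terms of the angle; a left inverse of
    [theta]. *)
Definition eta (x : R) : R := - (sin (x / 2) / cos (x / 2)).
Definition cay (y : R) : C := (1 +i* (- y)) / (1 +i* y).
Lemma cay_den (y : R) : (1 +i* y : C) != 0.
Proof. by apply/eqP => /(congr1 (@complex.Re R)) /= /eqP; rewrite oner_eq0. Qed.
Lemma ei_eta x : cos (x / 2) != 0 -> ei x = cay (eta x).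
Proof.
move=> c0; apply: (canRL (mulfK (cay_den _))).
have s2 : sin (x / 2) ^+ 2 = 1 - cos (x / 2) ^+ 2 by have := cos2Dsin2 (x / 2); lra.
have ex : x = (x / 2) *+ 2 by rewrite mulr2n; field.
have ec : cos x = 1 - 2 * sin (x / 2) ^+ 2.
  by rewrite {1}ex cos_mulr2n s2; ring.
have es : sin x = 2 * (sin (x / 2) * cos (x / 2)) by rewrite {1}ex sin_mulr2n; ring.
have -> : ei x = cos x +i* sin x by apply: eqc; rewrite /= expR0 mul1r.
apply: eqc; rewrite !cE1 /eta ec es.
  by field.
by rewrite s2; field.
Qed.
Lemma theta_eta (y : R) : cos (theta y / 2) != 0 /\ eta (theta y) = y.
Proof.
have c0 : cos (atan y) != 0 by rewrite cos_atan invr_eq0 gt_eqF // sqrtr_gt0 jac_den.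
have ty : sin (atan y) / cos (atan y) = y by have := atanK y.
rewrite /eta /theta; case: (leP y 0) => y0.
  have -> : - (2 * atan y) / 2 = - atan y by field.
  by rewrite cosN sinN; split => //; rewrite mulNr opprK.
have -> : (2 * pi - 2 * atan y) / 2 = - atan y + pi by field.
by rewrite cosDpi sinDpi cosN sinN; split; rewrite ?oppr_eq0 // opprK invrN mulrN opprK.
Qed.
Lemma ei_theta y : ei (theta y) = cay y.
Proof. by have [h1 h2] := theta_eta y; rewrite ei_eta // h2. Qed.
Lemma mr_eta D : mrfun D eta.
Proof.
have m2 : mrfun D (fun x : R => x / 2) by apply: mrM; [exact: mr_id|exact: mr_cst].
by apply: mrN; apply: mrM; [exact: mr_sin|apply: mrV; exact: mr_cos].
Qed.
Lemma Rint_ind (D E : set R) : measurable D -> measurable E -> (mu D < +oo)%E ->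
  \int[mu]_(x in D) (x \in E)%:R = 0 -> mu (E `&` D) = 0%E.
Proof.
move=> mD mE fD h; have r1 : rint D (fun x => (x \in E)%:R).
  apply: (@rint_bounded _ _ _ 1) => //; first exact: mr_mem.
  by move=> x _; rewrite normr_nat; case: (x \in E).
have := EFin_Rint mD r1; rewrite h => e.
rewrite -(@integral_indic _ _ _ mu D mD E mE); apply: etrans (esym e); apply: eq_integral => x _.
by rewrite indicE.
Qed.

(** Null sets of the line correspond to null sets of the circle, by the change
    of variables for indicators; the angle [pi] corresponds to the point at
    infinity. *)
Lemma ae_pull (Q : R -> Prop) : {ae mu, forall y, Q y} ->
  {ae mu, forall x, T x -> cos (x / 2) != 0 /\ Q (eta x)}.
Proof.
move=> [N [mN N0 hN]]; pose E := eta @^-1` N.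
have mE : measurable E by rewrite -[E]setTI; apply: mr_eta.
have z : \int[mu]_(x in T) (x \in E)%:R = 0.
  have [_ i1 <-] := cov_indic mE.
  have e : ae_eq mu setT (fun y => (theta y \in E)%:R * jac y) (fun=> 0).
    exists N; split => // y h; apply: contrapT => yN; apply: h => _ /=.
    by rewrite memNset ?mul0r // /E /=; have [_ ->] := theta_eta y.
  by rewrite (Rint_ae measurableT (rint_meas i1) (@mr_cst _ _ _ setT _) e) Rintegral_cst //= mul0r.
have z0 := Rint_ind mT mE (muT_fin (R := R)) z.
exists (E `&` T `|` [set pi]); split.
- by apply: measurableU; [exact: measurableI|exact: measurable_set1].
- by rewrite measureU0; [exact: z0|exact: measurableI|exact: measurable_set1|exact: lebesgue_measure_set1].
move=> x h; have [xp|xp] := eqVneq x pi; first by right.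
have [Tx|nT] := pselect (T x); last by exfalso; apply: h => /nT.
left; split => //; apply: contrapT => nE; apply: h => _; split; last first.
  by apply: contrapT => nQ; apply: nE; apply: hN.
apply/eqP => c0; move: xp; apply/negP/negPn/eqP.
have : x / 2 = pi / 2.
  have p0 := @pi_gt0 R; move: Tx; rewrite /= in_itv /= => /andP[x0 x2].
  apply: cos_inj; rewrite ?in_itv /= ?c0 ?cos_pihalf //; apply/andP; split; lra.
by move/(congr1 ( *%R^~ 2)); rewrite !divfK.
Qed.

(** The converse to [ae_pull]; it uses that [jac] is positive. *)
Lemma ae_push (Q : R -> Prop) : {ae mu, forall x, T x -> Q x} -> {ae mu, forall y, Q (theta y)}.
Proof.
move=> [N [mN N0 hN]].
have z : \int[mu]_y ((theta y \in N)%:R * jac y) = 0.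
  have [i1 _ ->] := cov_indic mN.
  have e : ae_eq mu T (fun x : R => (x \in N)%:R : R) (fun=> 0).
    exists N; split => // x h; apply: contrapT => xN; apply: h => _ /=.
    by rewrite memNset.
  by rewrite (Rint_ae mT (rint_meas i1) (@mr_cst _ _ _ T _) e) RintT_cst mulr0.
have [_ i2 _] := cov_indic mN; have := EFin_Rint measurableT i2; rewrite z => /esym e.
have p y : 0 <= (theta y \in N)%:R * jac y by rewrite mulr_ge0 // jac_ge0.
have : ae_eq mu setT (fun y => ((theta y \in N)%:R * jac y)%:E) (cst 0%E).
  have mf := rint_meas i2.
  apply/(@ae_eq_integral_abs _ _ _ mu setT measurableT); first by apply/measurable_EFinP; exact: mf.
  rewrite -[RHS]e; apply: eq_integral => y _.
  by rewrite /= ger0_norm.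
apply: aeS => y /(_ I) [] h; apply: contrapT => nQ.
have yN : theta y \in N by rewrite inE; apply: hN => /(_ (theta_T y)).
by move: h; rewrite yN mul1r; apply/eqP; rewrite gt_eqF // divr_gt0 // jac_den.
Qed.
Lemma ReIm_quot (p y : R) : let w : C := (p +i* y) / (1 +i* (p * y)) in
  Re w = p * (1 + y ^+ 2) / (1 + p ^+ 2 * y ^+ 2) /\ Im w = (y - p ^+ 2 * y) / (1 + p ^+ 2 * y ^+ 2).
Proof.
have q0 : 1 + p ^+ 2 * y ^+ 2 != 0 by rewrite -exprMn gt_eqF // jac_den.
move=> w; rewrite /w !cE1; split; rewrite expr1n exprMn; field; rewrite exprMn; exact: q0.
Qed.

(** The image of a radius: at [r] it is a point [w] with [|Im w - y| <= p |y|
    Re w], where [p = (1 - r) / (1 + r)] tends to zero.  So the curve ends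
    inside every cone at [iy], although it is not horizontal. *)
Lemma cay_radial (y r : R) : 0 < r < 1 ->
  let z := r%:C * cay y in let w := (1 - z) / (1 + z) in
  let p := (1 - r) / (1 + r) in
  [/\ 0 < Re w, Im w - y = - (p * y * Re w) & Re w <= p * (1 + y ^+ 2)].
Proof.
move=> /andP[r0 r1] z w p; have p0 : 0 < p by rewrite divr_gt0 //; lra.
have j0 := jac_den y.
have q0 : 0 < 1 + p ^+ 2 * y ^+ 2.
  by rewrite -exprMn ltr_pwDl ?ltr01 ?sqr_ge0.
have ew : w = (p +i* y) / (1 +i* (p * y)).
  apply: (canRL (mulfK (cay_den _))).
  have a0 := cay_den y; have r10 : (1 + r)%:C != 0 :> C by rewrite -normc_eq0 normc_real gtr0_norm ?gt_eqF //; lra.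
  have b0 : (1 +i* y) + r%:C * (1 +i* (- y)) != 0 :> C.
    by apply/eqP => /(congr1 (@complex.Re R)); rewrite !cE1 => h; move: h; nra.
  have e1 : (1 +i* (p * y) : C) = ((1 +i* y) + r%:C * (1 +i* (- y))) / (1 + r)%:C.
    apply: (canRL (mulfK r10)); apply: eqc; rewrite !cE1 /p; field; rewrite gt_eqF //; lra.
  have e2 : (p +i* y : C) = ((1 +i* y) - r%:C * (1 +i* (- y))) / (1 + r)%:C.
    have pE : p * (1 + r) = 1 - r by rewrite /p divfK // gt_eqF //; lra.
    by apply: (canRL (mulfK r10)); apply: eqc; rewrite !cE1 ?pE; ring.
  rewrite e1 e2 /w /z /cay; move: a0 b0 r10; set a := 1 +i* y; set b := 1 +i* (- y); set c := (1 + r)%:C.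
  move=> a0 b0 c0; field.
  by apply/and3P; split => //; move: c0; rewrite /c rmorphD.
have [eR eI] := ReIm_quot p y; rewrite -ew in eR eI.
rewrite eI eR; split.
- by rewrite divr_gt0 // mulr_gt0.
- field.
  have q0' := q0; rewrite -exprMn in q0'.
  by rewrite gt_eqF.
- have pj : 0 <= p * (1 + y ^+ 2) by rewrite mulr_ge0 ?(ltW p0) ?(ltW j0).
  by rewrite ler_pdivrMr // ler_peMr // lerDl -exprMn sqr_ge0.
Qed.
Lemma cay1 y : 1 + cay y = 2 / (1 +i* y).
Proof.
have h := cay_den y; apply: (canRL (mulfK h)); rewrite mulrDl mul1r divfK //.
rewrite (_ : (2 : C) = (2 : R)%:C); last by rewrite rmorph_nat.
apply: eqc; rewrite !cE1.
by ring. by ring.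
Qed.
Lemma cay1_neq0 y : 1 + cay y != 0.
Proof. by rewrite cay1 mulf_neq0 ?invr_eq0 ?cay_den // pnatr_eq0. Qed.

(** Once [p |y| <= 1], the image of the radius lies in the cone of aperture
    one; the other factor of [Phi] is continuous at the end point. *)
Lemma clim_radial (F : C -> C) x y l : ei x = cay y -> clim F y l ->
  radial (Phi F) x ((2 * Num.sqrt pi)%:C / (1 + cay y) * l).
Proof.
move=> ex hl; apply/radial0; rewrite ex.
have hz : normc ((1 - t)%:C * cay y - cay y) @[t --> (0:R)^'+] --> 0.
  rewrite -{2}[cay y]mul1r; apply: ccvgM; last exact: ccvg_cst.
  have FF : Filter ((0:R)^'+) by exact: at_right_proper_filter.
  apply: (@ccvg_real R _ _ FF (fun t => 1 - t) 1).
  rewrite -{2}[1](subr0 (1:R)); apply: cvgB; first exact: cvg_cst.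
  by apply: cvg_at_right_filter; exact: cvg_id.
apply: ccvgM.
  apply: ccvgM; first exact: ccvg_cst.
  apply: ccvgV; first exact: cay1_neq0.
  by apply: ccvgD; [exact: ccvg_cst|exact: hz].
apply/cvgrPdist_le => e e0; have [d d0 hd] := hl e e0.
near=> t; rewrite sub0r normrN ger0_norm ?normc_ge0 //.
have t0 : 0 < t by near: t; exact: nbhs_right_gt.
have t1 : t < 1 by near: t; exact: nbhs_right_lt.
have td : t < d / (1 + y ^+ 2) by near: t; apply: nbhs_right_lt; rewrite divr_gt0 // jac_den.
have ty : t < (1 + `|y|)^-1 by near: t; apply: nbhs_right_lt; rewrite invr_gt0 ltr_pwDl.
have r01 : 0 < 1 - t < 1 by apply/andP; split; lra.
have [h1 h2 h3] := cay_radial y r01.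
set z := (1 - t)%:C * cay y in h1 h2 h3 *; set w := (1 - z) / (1 + z) in h1 h2 h3 *.
set p := (1 - (1 - t)) / (1 + (1 - t)) in h2 h3.
have pt : 0 <= p <= t.
  rewrite /p; apply/andP; split; first by rewrite divr_ge0 //; lra.
  by rewrite ler_pdivrMr; nra.
have /andP[p0 pt'] := pt.
have -> : w = Re w +i* Im w by case: (w).
apply: hd.
  rewrite h1 /=; apply: le_lt_trans h3 _; rewrite -ltr_pdivlMr ?jac_den //.
  exact: le_lt_trans pt' td.
rewrite h2 normrN normrM (gtr0_norm h1) ler_piMl ?(ltW h1) // normrM (ger0_norm p0).
have y0 : 0 < 1 + `|y| by rewrite ltr_pwDl.
have := ltW ty; rewrite -[X in _ <= X]mul1r ler_pdivlMr // => h.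
apply: le_trans h; apply: ler_pM => //.
by rewrite lerDr.
Unshelve. all: by end_near. Qed.

(** The kernel in the definition of an outer function of the half plane is the
    Schwarz kernel in the coordinates of the disk. *)
Lemma sk_cay (w : C) (y : R) : Cplus w -> 
  schwarz_ker ((1 - w) / (1 + w)) (theta y) = (y%:C * w + 'i) / (y%:C + 'i * w).
Proof.
move=> w0; have w1 : 1 + w != 0.
  by apply/eqP => /(congr1 (@complex.Re R)); rewrite !cE1 => /eqP; rewrite gt_eqF // ltr_pwDl // ltW.
have w2 : w - (0 +i* y) != 0.
  by apply/eqP => /(congr1 (@complex.Re R)); rewrite !cE1 => /eqP; rewrite subr0 gt_eqF.
have i0 : ('i : C) != 0 by apply/eqP => /(congr1 (@complex.Im R)) /= /eqP; rewrite oner_eq0.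
have a0 := cay_den y; rewrite /schwarz_ker ei_theta.
have -> : y%:C + 'i * w = 'i * (w - (0 +i* y)) by apply: eqc; rewrite !cE1; ring.
have -> : y%:C * w + 'i = 'i * (1 - (0 +i* y) * w) by apply: eqc; rewrite !cE1; ring.
rewrite /cay; have -> : (1 +i* (- y) : C) = 1 - (0 +i* y) by apply: eqc; rewrite !cE1; ring.
have ea : (1 +i* y : C) = 1 + (0 +i* y) by apply: eqc; rewrite !cE1; ring.
move: a0 w2; rewrite ea; set Y := 0 +i* y => a0 w2.
have d0 : (1 - Y) / (1 + Y) - (1 - w) / (1 + w) != 0.
  have -> : (1 - Y) / (1 + Y) - (1 - w) / (1 + w) = 2 * (w - Y) / ((1 + Y) * (1 + w)) by field; rewrite a0 w1.
  by rewrite !mulf_neq0 ?invr_eq0 ?mulf_neq0 // pnatr_eq0.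
apply: (canLR (mulfK d0)); field.
by rewrite i0 w2 a0 w1.
Qed.
Lemma cay_disk (w : C) : Cplus w -> normc ((1 - w) / (1 + w)) < 1.
Proof.
move=> w0; have w1 : 0 < normc (1 + w).
  rewrite normc_gt0; apply/eqP => /(congr1 (@complex.Re R)); rewrite !cE1 => /eqP; rewrite gt_eqF // ltr_pwDl // ltW //.
rewrite normcM normcV ltr_pdivrMr // mul1r -(@ltr_pXn2r _ 2) ?nnegrE ?normc_ge0 //.
rewrite !normcE2 !cE1; have : 0 < Re w by []; nra.
Qed.
Lemma cay_inv (w : C) : Cplus w -> let z := (1 - w) / (1 + w) in 1 + z = 2 / (1 + w) /\ (1 - z) / (1 + z) = w.
Proof.
move=> w0 z; have w1 : 1 + w != 0.
  by apply/eqP => /(congr1 (@complex.Re R)); rewrite !cE1 => /eqP; rewrite gt_eqF // ltr_pwDl // ltW.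
have e : 1 + z = 2 / (1 + w) by rewrite /z; field.
split => //; rewrite e /z; field.
exact: w1.
Qed.

(** The Plancherel theorem bounds the integrals on vertical lines. *)
Lemma H2_lap (f : R -> C) : sqint P f -> H2_Cplus (laplace f).
Proof.
move=> hf; split; first exact: laplace_analytic.
exists (sqnorm P f) => x x0; have [[m1 h1] h2] := plancherel hf x0.
rewrite -(EFin_Rint measurableT h1) lee_fin.
have : nrm setT (vline f x) <= nrm P f by rewrite h2 nrm_damp // ltW.
rewrite -/(sqnorm setT (vline f x)) -(nrm_sqr setT) -(nrm_sqr P) => h.
by apply: lerXn2r => //; rewrite nnegrE nrm_ge0.
Qed.
Lemma outer_neq0 (G : C -> C) z : outer_disk G -> unit_disk z -> G z != 0.
Proof.
move=> [_ _ [l l1 hl]] z1; rewrite hl // mulf_neq0 ?cexp_neq0 //.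
by rewrite -normc_eq0 l1 oner_eq0.
Qed.
Lemma sqpi2_gt0 : 0 < 2 * Num.sqrt pi :> R.
Proof. by rewrite mulr_gt0 // sqrtr_gt0 pi_gt0. Qed.

(** The log-moduli on circle and line differ by that of the factor [2 sqrt pi
    / (1 + z)] of [Phi].  The constant integrates to itself and [1 + z] is the
    factor of [schwarz_factor] with [a = -1], so the Schwarz integral of their
    contribution is exactly the factor removed from [Phi].  What remains is
    the change of variables. *)
Lemma outer_transfer (f : R -> C) : sqint P f -> outer_disk (Phi (laplace f)) -> 
  outer_Cplus (laplace f) /\ {ae mu, forall y, bdry_Cplus (laplace f) y != 0}.
Proof.
move=> hf oG; set G := Phi (laplace f); have [hG _ [l l1 hl]] := oG.
set B := bdry_Cplus (laplace f); set g := bdry_disk G.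
have k0 := sqpi2_gt0; set k := 2 * Num.sqrt pi in k0.
have kC : k%:C != 0 :> C by rewrite -normc_eq0 normc_real gtr0_norm // gt_eqF.
have d0 : unit_disk (0 : C) by suff : normc (0 : C) < 1 by []; rewrite normc0 ltr01.
have mg : mcfun T g by apply: mcS (mc_bdry_disk hG.1).
have hB : {ae mu, forall y, clim (laplace f) y (B y)}.
  apply: aeS (fatou_cone hf) => y [m hm]; rewrite /B (clim_bdry hm); exact: hm.
have hr : {ae mu, forall x, T x -> radial G x (g x)}.
  apply: aeS (ae_pull hB) => x h Tx; have [c0 hc] := h Tx.
  have hr := clim_radial (ei_eta c0) hc; rewrite /g (radial_bdry hr); exact: hr.
have [rg ng] := jensen hG (outer_neq0 oG d0) mg hr.
have gB : {ae mu, forall y, g (theta y) = k%:C / (1 + cay y) * B y}.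
  apply: aeS hB => y hc; exact: radial_bdry (clim_radial (ei_theta y) hc).
have nB : {ae mu, forall y, B y != 0}.
  apply: ae2 gB (ae_push ng) => y e; apply: contraNneq => B0.
  by rewrite e B0 mulr0.
split => //; split; first exact: H2_lap.
  exists 1; first by rewrite /Cplus /= ltr01.
  have := outer_neq0 oG d0; rewrite /G /Phi subr0 addr0 divr1 mulf_eq0 negb_or => /andP[_].
  by rewrite divr1.
exists l => // w w0; set z := (1 - w) / (1 + w); have z1 : normc z < 1 := cay_disk w0.
have [e1 e2] := cay_inv w0; rewrite -/z in e1 e2.
have p1 : 1 + z != 0.
  have := one_sub_neq0 (u := - z); rewrite opprK normcN; exact.
(* The log-modulus, on the circle, of [G * (1 + z) / k]. *)
pose v x := ln (normc (g x)) + (log_factor (-1) x + - ln k).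
have a1 : normc (-1 : C) <= 1 by rewrite normcN normc1.
have rl := rint_lfun a1.
have rv : rint T v by apply: rintD => //; apply: rintD => //; exact: rintT_cst.
have eF : laplace f w = l * cexp (schwarz_int z v).
  have -> : laplace f w = G z * (1 + z) / k%:C.
    by rewrite /G /Phi e2 -/k; field; rewrite p1 kC.
  have hl' : G z = l * cexp (schwarz_int z (fun x => ln (normc (g x)))) by exact: hl z z1.
  rewrite hl'.
  have rr : rint T (fun x => log_factor (-1) x + - ln k) by apply: rintD => //; exact: rintT_cst.
  rewrite (schwarz_int_D z1 rg rr) (schwarz_int_D z1 rl (rintT_cst _)) schwarz_int_cst // !cexpD schwarz_factor //.
  by rewrite cexp_real expRN lnK ?posrE // fmorphV /= mulN1r opprK !mulrA.
rewrite eF; congr (_ * cexp _).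
have [c1 c2] := cov_complex (cint_sk z1 rv).
pose K y : C := (y%:C * w + 'i) / (y%:C + 'i * w) * (v (theta y) / (1 + y ^+ 2))%:C.
have eK y : schwarz_ker z (theta y) * (v (theta y))%:C * (jac y)%:C = 2 * K y.
  rewrite sk_cay // /K /jac [v _ / _]mulrC !rmorphM /=.
  have -> : (2%:C : C) = 2 by rewrite rmorph_nat.
  by set u := _ / _; ring.
have cK : cint setT K.
  apply: (@cint_ext _ _ (fun y => 2^-1 * (schwarz_ker z (theta y) * (v (theta y))%:C * (jac y)%:C))); first exact: measurableT.
    by move=> y _; rewrite eK mulrA mulVf ?mul1r // pnatr_eq0.
  exact: cintZ measurableT c1.
have e3 : schwarz_int z v = pi^-1%:C * Cintegral setT K.
  rewrite /schwarz_int -c2 (Cint_ext (fun y _ => eK y)) (CintZ 2 measurableT cK) mulrA; congr (_ * _).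
  have -> : (2 : C) = (2 : R)%:C by rewrite rmorph_nat.
  by rewrite -rmorphM /= invfM mulrAC mulVf ?mul1r // pnatr_eq0.
rewrite e3; congr (_ * _); apply: Cint_ae; [exact: measurableT|by case: cK| |].
  have mB : mcfun setT B by exact: mc_bdry_lap.
  apply: mcM; first by meas.
  apply: mc_real; apply: mrM; first by apply: mr_ln; exact: mc_norm.
  by apply: mrV; apply: mrD; [exact: mr_cst|apply: mrX; exact: mr_id].
apply: ae2 gB nB => y e b0 _; rewrite /K; congr (_ * (_ / _)%:C).
rewrite /v /log_factor e ei_theta mulN1r opprK normcM normcM normcV normc_real (gtr0_norm k0).
have n1 : 0 < normc (1 + cay y) by rewrite normc_gt0 cay1_neq0.
have n2 : 0 < normc (B y) by rewrite normc_gt0.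
rewrite lnM ?posrE ?divr_gt0 // ln_div ?posrE //; ring.
Qed.
End Transfer.

(** * Linear functionals that do not vanish on zero-free polynomials *)
Section Gleason.
Context {R : realType}.
Local Notation C := R[i].
Implicit Types (p q : {poly C}).

(** The Newton identity for the sum of squares. *)
Lemma prod_coef (s : seq C) : let q := \prod_(t <- s) (1 - t *: 'X) in
  q`_0 = 1 /\ q`_1 ^+ 2 - 2 * q`_2 = \sum_(t <- s) t ^+ 2.
Proof.
move=> q; rewrite {}/q; elim: s => [|t s /=]; first by rewrite !big_nil !coef1 /= expr0n mulr0 subr0.
set q := \prod_(_ <- s) _ => -[h1 h2]; rewrite !big_cons -h2 -/q.
rewrite !mulrBl !mul1r !coefB -!scalerAl !coefZ !coefXM /= h1.
by split; ring.
Qed.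

(** The expression is the sum of the squares of the inverses of the roots,
    each of modulus at most one. *)
Lemma root_sums q n : q`_0 = 1 -> (size q <= n.+1)%N -> (forall z, normc z < 1 -> q.[z] != 0) ->
  normc (q`_1 ^+ 2 - 2 * q`_2) <= n%:R.
Proof.
move=> q0 sqint hz; have [rs e] := closed_field_poly_normal q; set c := lead_coef q in e.
have qn : q != 0 by apply: contra_eq_neq q0 => ->; rewrite poly.coef0 eq_sym oner_eq0.
have hr r : r \in rs -> 1 <= normc r.
  move=> rr; rewrite leNgt; apply/negP => r1; have := hz r r1.
  by rewrite e hornerZ (rootP _) ?mulr0 ?eqxx // root_prod_XsubC.
have srs : (size rs <= n)%N.
  by move: sqint; rewrite {1}e size_scale ?lead_coef_eq0 // size_prod_XsubC.
have e1 : \prod_(r <- rs) ('X - r%:P) = (\prod_(r <- rs) (- r)) *: \prod_(t <- [seq r^-1 | r <- rs]) (1 - t *: 'X).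
  rewrite big_map -mul_polyC rmorph_prod -big_split /= [LHS]big_seq [RHS]big_seq.
  apply: eq_bigr => r /hr r1; have r0 : r != 0 by rewrite -normc_gt0 (lt_le_trans ltr01).
  rewrite mulrBr mulr1 mul_polyC scalerA mulNr mulfV // scaleN1r opprK polyCN addrC //.
have [h1 h2] := prod_coef [seq r^-1 | r <- rs].
rewrite e1 scalerA in e; move: (q0); rewrite e coefZ h1 mulr1 => c1.
rewrite c1 scale1r h2 big_map; apply: le_trans (normc_sum _ _ _) _.
apply: (@le_trans _ _ (\sum_(r <- rs) 1)).
  rewrite [X in X <= _]big_seq [X in _ <= X]big_seq; apply: ler_sum => r /hr r1.
  by rewrite normc_exp normcV exprn_ile1 ?invr_ge0 ?normc_ge0 // invf_le1 // (lt_le_trans ltr01).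
by rewrite big_const_seq count_predT iter_addr_0 ler_nat.
Qed.
Variable phi : {poly C} -> C.
Hypothesis phi_lin : forall a p q, phi (a *: p + q) = a * phi p + phi q.
Hypothesis phi_neq0 : forall p, (forall z, normc z < 1 -> p.[z] != 0) -> phi p != 0.
Lemma phi0 : phi 0 = 0.
Proof. by have := phi_lin (-1) 0 0; rewrite scaler0 addr0 mulN1r addNr. Qed.
Lemma phiZ a p : phi (a *: p) = a * phi p.
Proof. by have := phi_lin a p 0; rewrite phi0 !addr0. Qed.
Lemma phiD p q : phi (p + q) = phi p + phi q.
Proof. by have := phi_lin 1 p q; rewrite scale1r mul1r. Qed.
Lemma phi_sum I (r : seq I) (F : I -> {poly C}) : phi (\sum_(i <- r) F i) = \sum_(i <- r) phi (F i).
Proof. by elim: r => [|i r IH]; rewrite ?big_nil ?phi0 // !big_cons phiD IH. Qed.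
Lemma phi1_neq0 : phi 1 != 0.
Proof. by apply: phi_neq0 => z _; rewrite hornerC oner_eq0. Qed.

(** For [|s| < 1] the polynomial [(1 - s p)^n] has no zeros in the disk, so [s
    |-> phi ((1 - s p)^n)] is a polynomial of degree at most [n] without zeros
    in the disk.  [root_sums] bounds a combination of its first coefficients
    by [n], whereas its size would be of order [n^2] if [phi (p^2) phi 1] and
    [phi p ^ 2] differed. *)
Lemma phi_sqr_bound p n : (forall z, normc z < 1 -> normc p.[z] <= 1) -> (0 < n)%N ->
  normc ((phi p / phi 1) ^+ 2 - phi (p ^+ 2) / phi 1) <= n%:R^-1 * (1 + normc (phi (p ^+ 2) / phi 1)).
Proof.
move=> hp n0; set m := phi 1; have m0 : m != 0 := phi1_neq0.
(* [q.[s]] is [phi ((1 - s p)^n) / phi 1], expanded by the binomial formula. *)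
pose q : {poly C} := \poly_(j < n.+1) ('C(n, j)%:R * (-1) ^+ j * (phi (p ^+ j) / m)).
have qE s : q.[s] = phi ((1 - s *: p) ^+ n) / m.
  rewrite horner_poly exprBn phi_sum mulr_suml; apply: eq_bigr => j _.
  rewrite expr1n mulr1 -[in RHS]scaler_nat phiZ.
  rewrite exprZn (_ : (-1) ^+ j * (s ^+ j *: p ^+ j) = ((-1) ^+ j * s ^+ j) *: p ^+ j); last first.
    rewrite (_ : (-1 : {poly C}) ^+ j = ((-1) ^+ j)%:P); last by rewrite rmorphXn rmorphN1.
    by rewrite mul_polyC scalerA.
  by rewrite phiZ; ring.
have q0 : q`_0 = 1 by rewrite coef_poly /= bin0 expr0 mul1r expr0 mul1r mulfV.
have hq := @root_sums q n q0 (size_poly _ _).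
have {hq} : normc (q`_1 ^+ 2 - 2 * q`_2) <= n%:R.
  apply: hq => s s1; rewrite qE mulf_neq0 ?invr_eq0 //; apply: phi_neq0 => z z1.
  rewrite horner_exp expf_neq0 // hornerD hornerN hornerC hornerZ.
  apply: one_sub_neq0; rewrite normcM; apply: le_lt_trans s1.
  by rewrite ler_piMr ?normc_ge0 // hp.
have e1 : q`_1 = - (n%:R * (phi p / m)).
  by rewrite coef_poly ltnS n0 bin1 !expr1; ring.
have e2 : 2 * q`_2 = n%:R * (n%:R - 1) * (phi (p ^+ 2) / m).
  rewrite coef_poly !ltnS; case: ltnP => n1; last first.
    have -> : n = 1%N by apply/eqP; rewrite eqn_leq n1 n0.
    by rewrite subrr !(mulr0, mul0r).
  have := mul_bin_diag n 1; rewrite bin1 => h.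
  have h' : (2 * 'C(n, 2))%:R = (n * n.-1)%:R :> C by rewrite -h.
  by rewrite mulrA [2 * _]mulrA -natrM h' natrM -[in n.-1%:R]subn1 natrB // sqrrN expr1n mulr1.
rewrite e1 e2; set a := phi p / m; set b := phi (p ^+ 2) / m => h.
have n0' : 0 < n%:R :> R by rewrite ltr0n.
have nC : n%:R != 0 :> C by rewrite pnatr_eq0 -lt0n.
have -> : a ^+ 2 - b = n%:R^-1 ^+ 2 * ((- (n%:R * a)) ^+ 2 - n%:R * (n%:R - 1) * b) - n%:R^-1 * b.
  by field.
apply: le_trans (normcB _ _) _; move: h; set D := _ ^+ 2 - _ => h.
rewrite [leRHS]mulrDr mulr1 [normc (_ ^+ 2 * D)]normcM [normc (_ * b)]normcM normc_exp normcV normc_nat.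
apply: lerD; last by rewrite lexx.
have h2 : n%:R^-1 * normc D <= 1 by rewrite ler_pdivrMl // mulr1.
by rewrite expr2 -mulrA ler_piMr // invr_ge0 ltW.
Qed.

(** The bound of [phi_sqr_bound] tends to zero as [n] grows. *)
Lemma phi_sqr p : (forall z, normc z < 1 -> normc p.[z] <= 1) ->
  phi (p ^+ 2) / phi 1 = (phi p / phi 1) ^+ 2.
Proof.
move=> hp; apply/esym/eqP; rewrite -subr_eq0 -normc_eq0; set x := normc _.
set K := 1 + normc (phi (p ^+ 2) / phi 1).
have h n : x <= n.+1%:R^-1 * K by exact: phi_sqr_bound.
have hc : n.+1%:R^-1 * K @[n --> \oo] --> 0 * K by apply: cvgM; [exact: invn_cvg0|exact: cvg_cst].
rewrite mul0r in hc; apply/eqP/le_anti; rewrite normc_ge0 andbT -(cvg_lim _ hc) //.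
apply: limr_ge; first by apply/cvg_ex; eexists; exact: hc.
by apply: nearW => n; exact: h.
Qed.
Lemma Xn_bound k z : normc z < 1 -> normc ('X^k : {poly C}).[z] <= 1.
Proof. by move=> z1; rewrite hornerXn normc_exp exprn_ile1 ?normc_ge0 // ltW. Qed.

(** Multiplicativity on squares gives multiplicativity on products by
    polarisation, here with [(X + X^k) / 2], which is bounded by one on the
    disk. *)
Lemma phi_Xn k : phi 'X^k / phi 1 = (phi 'X / phi 1) ^+ k.
Proof.
elim: k => [|k IH]; first by rewrite expr0 mulfV // phi1_neq0.
have e1 := phi_sqr (@Xn_bound 1%N); have e2 := phi_sqr (@Xn_bound k).
have e3 : phi ((2^-1 *: ('X + 'X^k)) ^+ 2) / phi 1 = (phi (2^-1 *: ('X + 'X^k)) / phi 1) ^+ 2.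
  apply: phi_sqr => z z1; rewrite hornerZ hornerD normcM normcV normc_nat.
  rewrite ler_pdivrMl // mulr1; apply: le_trans (normc_leD _ _) _.
  have h1 := Xn_bound 1 z1; have h2 := Xn_bound k z1; rewrite expr1 in h1; lra.
move: e3; rewrite exprZn sqrrD !phiZ !phiD -exprS.
move: e1; rewrite expr1 => e1; move=> e3.
suff : phi 'X^(k.+1) / phi 1 = phi 'X / phi 1 * (phi 'X^k / phi 1) by rewrite IH -exprS.
have m0 := phi1_neq0; have n2 : 2 != 0 :> C by rewrite pnatr_eq0.
have : 4 * (2^-1 ^+ 2 * (phi ('X ^+ 2) + (phi 'X^(k.+1) + phi 'X^(k.+1)) + phi ('X^k ^+ 2)) / phi 1) =
  4 * (2^-1 * (phi 'X + phi 'X^k) / phi 1) ^+ 2 by rewrite e3.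
have -> : 4 * (2^-1 ^+ 2 * (phi ('X ^+ 2) + (phi 'X^(k.+1) + phi 'X^(k.+1)) + phi ('X^k ^+ 2)) / phi 1) =
  phi ('X ^+ 2) / phi 1 + 2 * (phi 'X^(k.+1) / phi 1) + phi ('X^k ^+ 2) / phi 1 by field; exact: m0.
have -> : 4 * (2^-1 * (phi 'X + phi 'X^k) / phi 1) ^+ 2 =
  (phi 'X / phi 1) ^+ 2 + 2 * (phi 'X / phi 1 * (phi 'X^k / phi 1)) + (phi 'X^k / phi 1) ^+ 2 by field; exact: m0.
rewrite e1 e2 => /addIr /addrI /(mulfI n2); exact.
Qed.

(** Powers determine the functional.  If [|b| >= 1], then [1 - X / b] has no
    zeros in the disk but lies in the kernel. *)
Lemma gleason : exists2 b : C, normc b < 1 & forall p, phi p = phi 1 * p.[b].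
Proof.
exists (phi 'X / phi 1) => [|p]; last first.
  rewrite -{1}[p]coefK poly_def phi_sum horner_coef mulr_sumr; apply: eq_bigr => i _.
  by rewrite phiZ -phi_Xn; have m0 := phi1_neq0; field.
set b := _ / _; rewrite ltNge; apply/negP => b1.
have b0 : b != 0 by rewrite -normc_gt0 (lt_le_trans ltr01).
have /negP[] : phi (1 - b^-1 *: 'X) != 0.
  apply: phi_neq0 => z z1; rewrite hornerD hornerN hornerC hornerZ hornerX; apply: one_sub_neq0.
  by rewrite normcM normcV mulrC ltr_pdivrMr ?mul1r ?(lt_le_trans z1) // (lt_le_trans ltr01).
rewrite addrC -scaleNr phi_lin mulNr; apply/eqP.
by rewrite /b invf_div divfK ?addNr //; move: b0; rewrite mulf_eq0 negb_or => /andP[].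
Qed.
End Gleason.

(** * The representation of the operator *)
Section Operators.
Context {R : realType}.
Local Notation C := R[i].
Local Notation mu := (@lebesgue_measure R).
Local Notation P := (@Rplus R).
Local Notation s2p := ((Num.sqrt (2 * pi) : R)^-1%:C).
Local Notation mP := (mRplus (R:=R)).

(** The transform of the [k]-th function is a multiple of [(1 + w)^-(k+1)], so
    their span has the polynomials in [(1 + w)^-1], times [(1 + w)^-1], as
    transforms. *)
Definition laguerre (k : nat) : R -> C := fun t => (t ^+ k / k`!%:R * expR (- t))%:C.
Lemma sq_te k : sqint P (laguerre k).
Proof.
apply: (@sq_ext _ _ (fun t => (k`!%:R^-1)%:C * (t ^+ k * expR (- (1 * t)))%:C)) => //.
- by move=> t _; rewrite -rmorphM /laguerre mul1r mulrA [k`!%:R^-1 * _]mulrC.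
- by apply: sqZ; [exact: mP|exact: sq_texp].
Qed.
Definition laguerre_sum (q : {poly C}) : R -> C := fun t => \sum_(k < size q) (q`_k * laguerre k t).
Lemma sq_TP q : sqint P (laguerre_sum q).
Proof. by apply: (sq_sum _ mP) => k; apply: sqZ (sq_te k); exact: mP. Qed.
Lemma one_add_neq0 (w : C) : Cplus w -> 1 + w != 0.
Proof.
by move=> w0; apply/eqP => /(congr1 (@complex.Re R)); rewrite !cE1 => /eqP; rewrite gt_eqF // ltr_pwDl // ltW.
Qed.
Lemma lap_te k (w : C) : Cplus w -> laplace (laguerre k) w = s2p * ((1 + w)^-1 ^+ k.+1).
Proof.
by move=> w0; apply: lap_texp; rewrite Re_add Re_1 ltr_pwDl // ltW.
Qed.
Lemma lap_sum I (r : seq I) (F : I -> R -> C) w : (forall i, sqint P (F i)) -> 0 < Re w ->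
  laplace (fun t => \sum_(i <- r) F i t) w = \sum_(i <- r) laplace (F i) w.
Proof.
move=> hF w0; elim: r => [|i r IH].
  rewrite big_nil (@lap_ext _ _ (fun t => 0 * laguerre 0 t)) => [|t _]; last by rewrite big_nil mul0r.
  by rewrite lap_Z ?mul0r //; exact: sq_te.
rewrite big_cons (@lap_ext _ _ (fun t => 1 * F i t + \sum_(j <- r) F j t)) => [|t _]; last by rewrite big_cons mul1r.
rewrite lap_lin // ?mul1r ?IH //.
exact: (sq_sum _ mP).
Qed.
Lemma lap_TP q (w : C) : Cplus w -> laplace (laguerre_sum q) w = s2p / (1 + w) * q.[(1 + w)^-1].
Proof.
move=> w0; rewrite /laguerre_sum (@lap_sum _ _ (fun (k : 'I_(size q)) t => q`_k * laguerre k t)) //; last first.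
  by move=> k; apply: sqZ (sq_te k); exact: mP.
rewrite horner_coef mulr_sumr; apply: eq_bigr => k _.
by rewrite (lap_Z _ (sq_te k)) // lap_te // exprS; ring.
Qed.

(** With [x = (1 + w)^-1], the point [2 x - 1] is [(1 - w) / (1 + w)]. *)
Definition half (p : {poly C}) : {poly C} := p \Po (2%:P * 'X - 1).
Lemma horner_half p x : (half p).[x] = p.[2 * x - 1].
Proof. by rewrite horner_comp hornerD hornerN hornerC hornerCM hornerX. Qed.

(** The function of L^2 whose transform corresponds to the polynomial [p] on
    the disk, up to the constant [Phi_factor]. *)
Definition poly_preimage (p : {poly C}) := laguerre_sum (half p).
Lemma sq_pre p : sqint P (poly_preimage p). Proof. exact: sq_TP. Qed.
Lemma lap_pre p (w : C) : Cplus w -> laplace (poly_preimage p) w = s2p / (1 + w) * p.[(1 - w) / (1 + w)].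
Proof.
move=> w0; rewrite lap_TP // horner_half; congr (_ * _.[_]).
by have h := one_add_neq0 w0; field.
Qed.
Lemma disk_cay (z : C) : normc z < 1 -> let w := (1 - z) / (1 + z) in
  Cplus w /\ (1 + w = 2 / (1 + z)) /\ (1 - w) / (1 + w) = z.
Proof.
move=> z1 w; have p1 : 1 + z != 0.
  have := one_sub_neq0 (u := - z); rewrite opprK normcN; exact.
have e : 1 + w = 2 / (1 + z) by rewrite /w; field.
split; last first.
  by split => //; rewrite e /w; field.
rewrite /Cplus /= /w Re_mul Re_inv Im_inv.
have d0 : 0 < Re (1 + z) ^+ 2 + Im (1 + z) ^+ 2 by rewrite -normcE2 exprn_gt0 // normc_gt0.
rewrite mulNr mulrN opprK !mulrA -mulrDl divr_gt0 // !cE1.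
have : normc z ^+ 2 < 1 by rewrite exprn_ilt1 ?normc_ge0.
rewrite normcE2; nra.
Qed.
Definition Phi_factor : C := (Num.sqrt pi)%:C * s2p.
Lemma k0_neq0 : Phi_factor != 0.
Proof.
rewrite mulf_neq0 ?s2p_neq0 // -normc_eq0 normc_real gtr0_norm ?gt_eqF //.
all: by rewrite sqrtr_gt0 pi_gt0.
Qed.
Lemma Phi_pre p (z : C) : unit_disk z -> Phi (laplace (poly_preimage p)) z = (Phi_factor *: p).[z].
Proof.
move=> z1; have [w0 [e1 e2]] := disk_cay z1.
have p1 : 1 + z != 0.
  have := one_sub_neq0 (u := - z); rewrite opprK normcN; exact.
rewrite /Phi lap_pre // e2 e1 hornerZ /Phi_factor rmorphM /= rmorph_nat.
by move: p.[z] s2p (Num.sqrt pi)%:C => a b c; field.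
Qed.
Lemma min_phase_pre p : (forall z, normc z < 1 -> p.[z] != 0) -> minimum_phase (poly_preimage p).
Proof.
move=> hp; split; first by apply/(L2P _ mP); exact: sq_pre.
apply: (@outer_disk_ext _ (fun z => (Phi_factor *: p).[z])) => [z z1|]; first by rewrite Phi_pre.
by apply: outer_poly => z z1; rewrite hornerZ mulf_neq0 ?k0_neq0 ?hp.
Qed.
Lemma smp_minimum_phase (f : R -> C) : minimum_phase f -> shifted_minimum_phase f.
Proof.
move=> hf; split; first by case: hf.
exists f, 0; split => //; apply: aeT => t /RplusP t0.
by rewrite /Defs.shift t0 subr0.
Qed.
Lemma smp_lap g : shifted_minimum_phase g -> exists f tau, [/\ sqint P f, outer_disk (Phi (laplace f)), 0 <= tau &
  forall w, Cplus w -> laplace g w = cexp (- (tau%:C * w)) * laplace f w].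
Proof.
move=> [/(L2P _ mP) hg [f [tau [[/(L2P _ mP) hf ho] t0 e]]]]; exists f, tau; split => // w w0.
rewrite -lap_shift //; apply: lap_ae e; first by case: hg.
pose D : set R := `[tau, +oo[%classic.
have m1 : mcfun setT (cut D (fun t => cut P f (t - tau))).
  apply: mc_cut; first exact: measurable_itv.
  apply: (@mcS _ _ _ _ setT) => //; apply: mc_translate; apply: mc_cut; [exact: mP|by case: hf].
have m2 : mcfun P (cut D (fun t => cut P f (t - tau))) by apply: mcS m1.
apply: mc_ext m2 => t _; rewrite /Defs.shift; case: ifPn => th.
  rewrite cut_in ?cut_in //; last by rewrite /D /= in_itv /= th.
  by apply/RplusP; rewrite subr_ge0.
by rewrite cut_notin // /D /= in_itv /= andbT; apply/negP.
Qed.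
Lemma Phi_lap_neq0 (f : R -> C) w : outer_disk (Phi (laplace f)) -> Cplus w -> laplace f w != 0.
Proof.
move=> ho w0; have z1 : unit_disk ((1 - w) / (1 + w)) := cay_disk w0.
have [_ e] := cay_inv w0.
have := outer_neq0 ho z1; rewrite /Phi e mulf_eq0 negb_or; by case/andP.
Qed.

(** Neither the outer factor nor the exponential of the shift vanishes. *)
Lemma smp_neq0 (g : R -> C) w : shifted_minimum_phase g -> Cplus w -> laplace g w != 0.
Proof.
move=> /smp_lap [f [tau [_ ho _ e]]] w0; rewrite e // mulf_neq0 ?cexp_neq0 //.
exact: Phi_lap_neq0.
Qed.
Lemma lap_bound_nrm (f : R -> C) w : sqint P f -> 0 < Re w ->
  normc (laplace f w) <= Num.sqrt ((2 * pi)^-1 * (2 * Re w)^-1) * nrm P f.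
Proof.
move=> hf w0; have h := lap_bound hf w0.
have c0 : 0 <= (2 * pi)^-1 * (2 * Re w)^-1 :> R.
  by rewrite mulr_ge0 // invr_ge0 ltW // mulr_gt0 // pi_gt0.
rewrite -(@ler_pXn2r _ 2) ?nnegrE ?normc_ge0 ?mulr_ge0 ?sqrtr_ge0 //.
rewrite exprMn nrm_sqr (sqr_sqrtr c0); exact: h.
Qed.
Lemma nrm_L2norm D (u : R -> C) : measurable D -> sqint D u -> L2norm D u = (nrm D u)%:E.
Proof. exact: L2normE. Qed.
Lemma L2_cvgI D (u : R -> R -> C) f : measurable D -> (forall T, 0 < T -> sqint D (u T)) -> sqint D f ->
  (forall e, 0 < e -> \forall T \near +oo, nrm D (fun x => u T x - f x) <= e) -> L2_cvg D u f.
Proof.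
move=> mD hu hf h; split; first by move=> T T0; apply/L2P => //; exact: hu.
  by apply/L2P.
have hc : nrm D (fun x => u T x - f x) @[T --> +oo] --> 0.
  apply/cvgrPdist_le => e e0; apply: filterS (h e e0) => T hT.
  by rewrite sub0r normrN ger0_norm ?nrm_ge0.
have hE : (nrm D (fun x => u T x - f x))%:E @[T --> +oo] --> 0%E.
  by apply: cvg_EFin => //; apply: nearW.
apply: cvg_trans hE; apply: near_eq_cvg; near=> T.
have T0 : 0 < T by near: T; exact: nbhs_pinfty_gt.
by rewrite nrm_L2norm //; apply: sqB => //; exact: hu.
Unshelve. all: by end_near. Qed.
Section Preserver.
Variable A : (R -> C) -> R -> C.
Hypothesis hA : continuous_linear_operator P A.
Hypothesis hM : forall f, shifted_minimum_phase f -> shifted_minimum_phase (A f).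
Lemma A_sq f : sqint P f -> sqint P (A f).
Proof. by move=> /(L2P _ mP) h; apply/(L2P _ mP); exact: op_L2 hA _ h. Qed.

(** Injectivity of the transform: [A] sees only the class of a function up to
    null sets. *)
Lemma A_ext f g w : sqint P f -> sqint P g -> (forall v, Cplus v -> laplace f v = laplace g v) ->
  laplace (A f) w = laplace (A g) w.
Proof.
move=> hf hg h; have e := laplace_inj hf hg h.
apply: lap_ae; [by case: (A_sq hf)|by case: (A_sq hg)|].
by apply: (op_ae_eq hA) => //; apply/(L2P _ mP).
Qed.
Lemma A_lin (a : C) f g w : sqint P f -> sqint P g -> Cplus w ->
  laplace (A (fun t => a * f t + g t)) w = a * laplace (A f) w + laplace (A g) w.
Proof.
move=> hf hg w0; have hfg : sqint P (fun t => a * f t + g t) by apply: (sqD mP _ hg); apply: sqZ hf; exact: mP.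
have sA : sqint P (fun t => a * A f t + A g t).
  by apply: sqD; [exact: mP|apply: sqZ; [exact: mP|exact: A_sq]|exact: A_sq].
rewrite -(lap_lin a (A_sq hf) (A_sq hg) w0); apply: lap_ae; [by case: (A_sq hfg)|by case: sA|].
by apply: (op_linear hA); apply/(L2P _ mP).
Qed.
Lemma A_cont f e : sqint P f -> 0 < e -> exists2 d, 0 < d & forall g, sqint P g ->
  nrm P (fun t => g t - f t) < d -> nrm P (fun t => A g t - A f t) < e.
Proof.
move=> hf e0; have [d d0 hd] := op_continuous hA ((L2P _ mP).2 hf) e0.
exists d => // g hg hn; have := hd g ((L2P _ mP).2 hg).
rewrite (nrm_L2norm mP (sqB mP hg hf)) (nrm_L2norm mP (sqB mP (A_sq hg) (A_sq hf))) !lte_fin.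
exact.
Qed.
Definition phiA w (p : {poly C}) : C := laplace (A (poly_preimage p)) w.
Lemma phiA_lin w : Cplus w -> forall a p q, phiA w (a *: p + q) = a * phiA w p + phiA w q.
Proof.
move=> w0 a p q; rewrite /phiA -A_lin //; try exact: sq_pre.
apply: A_ext => [||v v0]; first exact: sq_pre.
  by apply: sqD; [exact: mP|apply: sqZ; [exact: mP|exact: sq_pre]|exact: sq_pre].
rewrite lap_lin //; try exact: sq_pre.
by rewrite !lap_pre // hornerD hornerZ; ring.
Qed.
Lemma phiA_neq0 w : Cplus w -> forall p, (forall z, normc z < 1 -> p.[z] != 0) -> phiA w p != 0.
Proof.
move=> w0 p hp; apply: smp_neq0 => //; apply: hM; apply: smp_minimum_phase; exact: min_phase_pre.
Qed.
Definition alpha_of w := laplace (A sigma0) w + laplace (A sigma1) w.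
Definition xi_of w := laplace (A sigma0) w / laplace (A sigma1) w.

(** The polynomials on the disk that correspond to [sigma0] and [sigma1]. *)
Definition sigma0_poly : {poly C} := 2^-1 *: (1 - 'X).
Definition sigma1_poly : {poly C} := 2^-1 *: (1 + 'X).
Lemma sigma1E : sigma1 =1 (laguerre 1 : R -> C).
Proof. by move=> t; rewrite /sigma1 /laguerre expr1 (_ : 1`!%:R = 1) // divr1 mulrC. Qed.
Lemma sigma0E : sigma0 =1 (fun t => laguerre 0 t - laguerre 1 t : C).
Proof.
move=> t; rewrite /sigma0 /laguerre expr1 expr0 (_ : 1`!%:R = 1) // !divr1 mul1r -rmorphB /=; congr (_%:C); ring.
Qed.
Lemma sq_sigma1 : sqint P sigma1.
Proof. by apply: sq_ext (sq_te 1) => // t _; rewrite sigma1E. Qed.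
Lemma sq_sigma0 : sqint P sigma0.
Proof. by apply: sq_ext (sqB mP (sq_te 0) (sq_te 1)) => // t _; rewrite sigma0E. Qed.
Lemma lap_sigma1 w : Cplus w -> laplace sigma1 w = laplace (poly_preimage sigma1_poly) w.
Proof.
move=> w0; have h := one_add_neq0 w0; rewrite (lap_ext _ (g := laguerre 1)) => [|t _]; last exact: sigma1E.
rewrite lap_te // lap_pre // /sigma1_poly hornerZ hornerD hornerC hornerX.
by move: s2p => c; field.
Qed.
Lemma lap_sigma0 w : Cplus w -> laplace sigma0 w = laplace (poly_preimage sigma0_poly) w.
Proof.
move=> w0; have h := one_add_neq0 w0; rewrite (lap_ext _ (g := fun t => laguerre 0 t - laguerre 1 t)) => [|t _]; last exact: sigma0E.
rewrite lap_B //; try exact: sq_te.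
rewrite !lap_te // lap_pre // /sigma0_poly hornerZ hornerD hornerN hornerC hornerX.
by move: s2p => c; field.
Qed.
Lemma A_sigma w : laplace (A sigma0) w = phiA w sigma0_poly /\ laplace (A sigma1) w = phiA w sigma1_poly.
Proof.
split; apply: A_ext; rewrite ?sq_pre //; [exact: sq_sigma0|exact: sq_pre|exact: lap_sigma0|exact: sq_sigma1|exact: sq_pre|exact: lap_sigma1].
Qed.

(** By [gleason], the functional at [w] is evaluation at a point [b] of the
    disk, up to a constant; [sigma0] and [sigma1] give the constant and [(1 -
    b) / (1 + b)].  This is the formula for the functions [t^k e^{-t}].  Both
    sides are continuous on L^2, so [L2_dense] extends it. *)
Lemma A_repr w : Cplus w -> [/\ alpha_of w = phiA w 1, laplace (A sigma1) w != 0, Cplus (xi_of w) &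
  forall f, sqint P f -> laplace (A f) w = (Num.sqrt (2 * pi))%:C * (1 + xi_of w) * alpha_of w * laplace f (xi_of w)].
Proof.
move=> w0; have [b b1 hb] := gleason (phiA_lin w0) (phiA_neq0 w0).
have [e0 e1] := A_sigma w; have a0 : phiA w 1 != 0.
  by apply: phiA_neq0 => // z _; rewrite hornerC oner_eq0.
have [x0 [x1 x2]] := disk_cay b1.
have b0 : 1 + b != 0.
  have := one_sub_neq0 (u := - b); rewrite opprK normcN; exact.
have E0 : laplace (A sigma0) w = phiA w 1 * ((1 - b) / 2).
  by rewrite e0 hb /sigma0_poly hornerZ hornerD hornerN hornerC hornerX mulrC [_^-1 * _]mulrC mulrC.
have E1 : laplace (A sigma1) w = phiA w 1 * ((1 + b) / 2).
  by rewrite e1 hb /sigma1_poly hornerZ hornerD hornerC hornerX mulrC [_^-1 * _]mulrC mulrC.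
have al : alpha_of w = phiA w 1 by rewrite /alpha_of E0 E1; field.
have n1 : laplace (A sigma1) w != 0.
  by rewrite E1; do 2!apply: mulf_neq0 => //; rewrite invr_eq0 pnatr_eq0.
have xe : xi_of w = (1 - b) / (1 + b).
  by rewrite /xi_of E0 E1; field; rewrite a0 b0.
split => //; first by rewrite xe.
rewrite al xe; set v := (1 - b) / (1 + b) in x0 x1 x2 *.
apply: (@L2_dense _ (fun f => laplace (A f) w = (Num.sqrt (2 * pi))%:C * (1 + v) * phiA w 1 * laplace f v)).
- by move=> a f g hf hg h1 h2; rewrite A_lin // lap_lin // h1 h2; ring.
- move=> u f H hu hf h hH hb' hc.
  have l1 : normc (laplace (A (u n)) w - laplace (A f) w) @[n --> \oo] --> 0.
    apply/cvgrPdist_le => e ep; set K := Num.sqrt ((2 * pi)^-1 * (2 * Re w)^-1).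
    have K0 : 0 < K + 1 by rewrite ltr_pwDr // sqrtr_ge0.
    have [d d0 hd] := A_cont hf (divr_gt0 ep K0).
    have [_ hen] := L2_DCT mP (fun n => (hu n).1) (fun t Pt => hc t ((RplusP t).1 Pt)) (fun n t Pt => hb' n t ((RplusP t).1 Pt)) hH.
    have hn : nrm P (fun t => u n t - f t) @[n --> \oo] --> Num.sqrt 0 by exact: cvg_sqrt.
    rewrite sqrtr0 in hn; have [N _ hN] := (cvgrPdist_lt _ _).1 hn _ d0.
    exists N => // n Nn; change (`|0 - normc (laplace (A (u n)) w - laplace (A f) w)| <= e).
    have := hN n Nn; rewrite !sub0r !normrN ger0_norm ?nrm_ge0 // => hd'.
    have hA' := hd (u n) (hu n) hd'.
    rewrite ger0_norm ?normc_ge0 // -lap_B //; try exact: A_sq.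
    apply: le_trans (lap_bound_nrm (sqB mP (A_sq (hu n)) (A_sq hf)) w0) _.
    apply: le_trans (_ : (K + 1) * (e / (K + 1)) <= _); last by rewrite mulrC divfK // gt_eqF.
    by apply: ler_pM; rewrite ?sqrtr_ge0 ?nrm_ge0 ?lerDl ?(ltW hA').
  have l2 : normc (laplace (A (u n)) w - (Num.sqrt (2 * pi))%:C * (1 + v) * phiA w 1 * laplace f v) @[n --> \oo] --> 0.
    under eq_fun do rewrite h.
    apply: ccvgM; first exact: ccvg_cst.
    exact: lap_dct hu hf hH hb' hc.
  exact: ccvg_unique l1 l2.
- move=> k;
(* [(1 + z) / 2] corresponds to [(1 + w)^-1]. *)
pose pk : {poly C} := k`!%:R *: sigma1_poly ^+ k.
  have hs : sqint P (fun t => (t ^+ k * expR (- t))%:C).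
    by have := sq_texp k (@ltr01 R); under eq_fun do rewrite mul1r.
  have hl y : Cplus y -> laplace (fun t => (t ^+ k * expR (- t))%:C) y = laplace (poly_preimage pk) y.
    move=> y0; have h := one_add_neq0 y0.
    rewrite (lap_ext _ (g := fun t => k`!%:R * laguerre k t)); last first.
      move=> t _; rewrite /laguerre (_ : (k`!%:R : C) = (k`!%:R : R)%:C); last by rewrite rmorph_nat.
      rewrite -rmorphM /=; congr (_%:C).
      by field; rewrite pnatr_eq0 -lt0n fact_gt0.
    rewrite (lap_Z _ (sq_te k)) // lap_te // lap_pre // /pk /sigma1_poly hornerZ horner_exp hornerZ hornerD hornerC hornerX.
    have -> : 2^-1 * (1 + (1 - y) / (1 + y)) = (1 + y)^-1 by field.
    by move: s2p => c; rewrite exprS; ring.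
  rewrite (A_ext _ hs (sq_pre pk) hl) -/(phiA w pk) hb hl // lap_pre // x2.
  have s0 : (Num.sqrt (2 * pi))%:C != 0 :> C.
    by rewrite -normc_eq0 normc_real gtr0_norm ?gt_eqF // sqrtr_gt0 mulr_gt0 // pi_gt0.
  have v0 := one_add_neq0 x0; rewrite fmorphV; by field; rewrite s0 v0.
Qed.
End Preserver.
End Operators.

(** * Boundary form of the representation *)
Section Conclusion.
Context {R : realType}.
Local Notation C := R[i].
Local Notation mu := (@lebesgue_measure R).
Local Notation P := (@Rplus R).
Local Notation s2p := ((Num.sqrt (2 * pi) : R)^-1%:C).
Local Notation mP := (mRplus (R:=R)).
Lemma Cplus_near (F G : C -> C) w : (forall v, Cplus v -> F v = G v) -> Cplus w ->
  derivable (F : C^o -> C^o) w 1 -> derivable (G : C^o -> C^o) w 1.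
Proof.
move=> e w0; apply: near_eq_derivable; exists (Re w)%:C => /=; first by rewrite ltcR.
move=> v; rewrite /ball_ /= normc_norm ltcR => hv; apply: e; rewrite /Cplus /=.
have h := le_lt_trans (le_trans (ler_norm _) (Re_le_normc (w - v))) hv.
by move: h; rewrite Re_add Re_opp; lra.
Qed.
Lemma H2_Cplus_ext (F G : C -> C) : (forall v, Cplus v -> F v = G v) -> H2_Cplus F -> H2_Cplus G.
Proof.
move=> e [aF [M hM]]; split; first by move=> w w0; apply: Cplus_near e w0 (aF w w0).
exists M => x x0; have := hM x x0; congr (_ <= _)%E; apply: eq_integral => y _.
by rewrite e.
Qed.
Lemma bdry_Cplus_ext (F G : C -> C) y : (forall v, Cplus v -> F v = G v) -> bdry_Cplus F y = bdry_Cplus G y.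
Proof.
move=> e; rewrite /bdry_Cplus.
have h : (\forall x \near (0:R)^'+, F (x +i* y) = G (x +i* y)).
  by near=> x; apply: e; rewrite /Cplus /=; near: x; exact: nbhs_right_gt.
have e1 := near_eq_cvg h; have e2 := near_eq_cvg (filterS (fun r e => esym e) h).
have -> // : ((F (x +i* y) : C^o) @[x --> (0:R)^'+]) = ((G (x +i* y) : C^o) @[x --> (0:R)^'+]).
by apply/seteqP; split; [exact: e1|exact: e2].
Unshelve. all: by end_near. Qed.

(** For the outer factor this is part of [outer_transfer]; on the axis the
    exponential of the shift has modulus one. *)
Lemma smp_bdry (g : R -> C) : shifted_minimum_phase g -> {ae mu, forall y, bdry_Cplus (laplace g) y != 0}.
Proof.
move=> hg; have sg : sqint P g by apply/(L2P _ mP); case: hg.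
have [f [tau [hf ho _ e]]] := smp_lap hg; have [_ nf] := outer_transfer hf ho.
have hb := bdry_ae hf; apply: ae2 nf hb => y ny hy.
rewrite (_ : bdry_Cplus (laplace g) y = cexp (- (tau%:C * (0 +i* y))) * bdry_Cplus (laplace f) y).
  by rewrite mulf_neq0 ?cexp_neq0.
rewrite (bdry_Cplus_ext _ e); apply: ccvg_lim; apply: ccvgM; last exact: hy.
apply: ccvg_cexp.
have hx : normc ((x +i* y : C) - (0 +i* y)) @[x --> (0:R)^'+] --> 0.
  apply/ccvg_ReIm; split => /=; last exact: cvg_cst.
  by apply: cvg_at_right_filter; exact: cvg_id.
have h : normc (- tau%:C * (x +i* y) - - tau%:C * (0 +i* y)) @[x --> (0:R)^'+] --> 0.
  by apply: ccvgM hx; exact: ccvg_cst.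
by apply: cvg_trans h; apply: near_eq_cvg; apply: nearW => x; rewrite !mulNr.
Qed.
Section Preserver.
Variable A : (R -> C) -> R -> C.
Hypothesis hA : continuous_linear_operator P A.
Hypothesis hM : forall f, shifted_minimum_phase f -> shifted_minimum_phase (A f).
Local Notation al := (alpha_of A).
Local Notation xi := (xi_of A).
Local Notation B h := (bdry_Cplus (laplace h)).
Local Notation s0 := (A_sq hA sq_sigma0).
Local Notation s1 := (A_sq hA sq_sigma1).
Lemma xi_analytic : analytic_on Cplus xi.
Proof.
move=> w w0; have [_ n1 _ _] := A_repr hA hM w0.
apply: derivableM; first exact: laplace_analytic s0 _ w0.
by apply: derivableV => //; exact: laplace_analytic s1 _ w0.
Qed.
Lemma al_pre w : Cplus w -> al w = laplace (A (poly_preimage 1)) w.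
Proof. by move=> w0; have [-> _ _ _] := A_repr hA hM w0. Qed.

(** [alpha] is the transform of [A] applied to [e^{-t}], the function
    associated with the constant polynomial 1, which is minimum phase. *)
Lemma al_outer : exists (epsilon : R) (alpha0 : C -> C), [/\ 0 <= epsilon, outer_Cplus alpha0 &
  forall w, Cplus w -> al w = cexp (- (epsilon%:C * w)) * alpha0 w].
Proof.
have h1 : shifted_minimum_phase (A (poly_preimage 1)).
  by apply: hM; apply: smp_minimum_phase; apply: min_phase_pre => z _; rewrite hornerC oner_neq0.
have [f [tau [hf ho t0 e]]] := smp_lap h1; exists tau, (laplace f); split => //.
  by have [] := outer_transfer hf ho.
by move=> w w0; rewrite al_pre // e.
Qed.
Lemma A_inverse f : sqint P f -> is_inverse_laplace
  (mul_op (fun w => (Num.sqrt (2 * pi))%:C * (1 + xi w) * al w) (comp_op xi (laplace f))) (A f).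
Proof.
move=> hf; have e v : Cplus v -> laplace (A f) v =
    mul_op (fun w => (Num.sqrt (2 * pi))%:C * (1 + xi w) * al w) (comp_op xi (laplace f)) v.
  by move=> v0; have [_ _ _ h] := A_repr hA hM v0; rewrite /mul_op /comp_op h.
split => //; first by apply: H2_Cplus_ext e _; apply: H2_lap; exact: A_sq.
by apply/(L2P _ mP); exact: A_sq.
Qed.

(** Its boundary values, the denominator of those of [xi], are therefore
    almost nowhere zero. *)
Lemma sigma1_phase : shifted_minimum_phase (A sigma1).
Proof.
apply: hM; apply: smp_minimum_phase; split; first by apply/(L2P _ mP); exact: sq_sigma1.
apply: (@outer_disk_ext _ (Phi (laplace (poly_preimage sigma1_poly)))) => [z z1|].
  by rewrite /Phi lap_sigma1 //; have [] := disk_cay z1.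
have [] // : minimum_phase (poly_preimage (sigma1_poly : {poly C})).
apply: min_phase_pre => z z1; rewrite /sigma1_poly hornerZ hornerD hornerC hornerX mulf_neq0 ?invr_eq0 ?pnatr_eq0 //.
have := one_sub_neq0 (u := - z); rewrite opprK normcN; exact.
Qed.
Lemma bdry_al y : bdry_Cplus al y = B (A (poly_preimage 1)) y.
Proof. by apply: bdry_Cplus_ext; exact: al_pre. Qed.
Lemma mc_al : mcfun setT (bdry_Cplus al).
Proof. by rewrite (_ : bdry_Cplus al = B (A (poly_preimage 1))); [exact: mc_bdry_lap (A_sq hA (sq_pre 1))|apply/funext => y; exact: bdry_al]. Qed.
Lemma mc_xi : mcfun setT (bdry_Cplus xi).
Proof.
apply: mc_bdry xi_analytic _ => x x0.
by apply: mcM; [exact: mc_vl s0.1|apply: mcV; exact: mc_vl s1.1].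
Qed.

(** The value of the inner integral over [[0, T]]. *)
Definition inner f T y : C := bdry_Cplus al y * (1 + bdry_Cplus xi y) *
  ((Num.sqrt (2 * pi))%:C * laplace (trunc T f) (bdry_Cplus xi y)).
Lemma sqrt2pi_neq0 : (Num.sqrt (2 * pi) : R)%:C != 0 :> C.
Proof. by rewrite -normc_eq0 normc_real gtr0_norm ?gt_eqF // sqrtr_gt0 mulr_gt0 // pi_gt0. Qed.
Lemma innerE f T y : sqint P f -> 0 < T ->
  Cintegral `[0, T]%classic (fun tau => bdry_Cplus al y * (1 + bdry_Cplus xi y)
     * cexp (- (tau%:C * bdry_Cplus xi y)) * f tau) = inner f T y.
Proof.
move=> hf T0; rewrite /inner; set a := bdry_Cplus al y; set x := bdry_Cplus xi y.
have hc := cint_compact (sq_trunc T hf) (@trunc_supp _ T f) x.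
have mI : measurable (`[0, T]%classic : set R) by exact: measurable_itv.
have sub : `[0, T]%classic `<=` P by move=> t; rewrite /= in_itv /= => /andP[t0 _]; apply/RplusP.
have hc' : cint `[0, T]%classic (fun t => trunc T f t * exp_ker x t) := cintS mI mP sub hc.
rewrite (Cint_ext (v := fun t => a * (1 + x) * (trunc T f t * exp_ker x t))); last first.
  move=> t; rewrite /= in_itv /= => /andP[_ tT]; rewrite /trunc tT /exp_ker [x * _]mulrC.
  by rewrite -(mulrA (a * _)) [cexp _ * _]mulrC.
rewrite CintZ //; congr (_ * _); rewrite laplaceE mulrA fmorphV mulfV ?sqrt2pi_neq0 // mul1r.
rewrite [LHS]Cint_cut [RHS]Cint_cut; apply: Cint_ext => t _.
have [t0|t0] := leP 0 t; last first.
  rewrite cut_notin; last by rewrite /= in_itv /= leNgt t0.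
  by rewrite cut_notin //; move/RplusP; rewrite leNgt t0.
rewrite [RHS]cut_in; last exact/RplusP.
have [tT|tT] := leP t T; first by rewrite cut_in // /= in_itv /= t0.
rewrite cut_notin; last by rewrite /= in_itv /= t0 /= leNgt tT.
by rewrite /trunc leNgt tT mul0r.
Qed.
Lemma mc_inner f T : sqint P f -> mcfun setT (inner f T).
Proof.
move=> hf; apply: mcM; first by apply: mcM mc_al _; apply: mcD; [exact: mc_cst|exact: mc_xi].
by apply: mcM; [exact: mc_cst|apply: mc_laplace mc_xi; apply: mc_trunc; case: hf].
Qed.

(** The transform of a truncated function is entire, so the representation of
    [A] passes to horizontal limits on the axis, wherever [alpha] and [xi]
    have limits; the limit of [xi] may lie on the axis. *)
Lemma inner_ae f T : sqint P f -> {ae mu, forall y, B (A (trunc T f)) y = inner f T y}.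
Proof.
move=> hf; have hT := sq_trunc T hf.
have [K0 hK0] := lap_compact_lip hT (@trunc_supp _ T f) 0.
have h1 := bdry_ae (A_sq hA hT); have h2 := bdry_ae (A_sq hA (sq_pre 1)).
have h3 := bdry_ae s0; have h4 := bdry_ae s1; have h5 := smp_bdry sigma1_phase.
have h34 := ae2 (fun y a b => conj a b) h3 h4; have h345 := ae2 (fun y a b => conj a b) h34 h5.
have h12 := ae2 (fun y a b => conj a b) h1 h2.
apply: ae2 h12 h345 => y [l1 l2] [[l3 l4] n1].
set x0 := B (A sigma0) y / B (A sigma1) y.
have lx : normc (xi (x +i* y) - x0) @[x --> (0:R)^'+] --> 0.
  by apply: ccvgM l3 _; apply: ccvgV.
have ex : bdry_Cplus xi y = x0 by exact: ccvg_lim lx.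
have la : normc (al (x +i* y) - bdry_Cplus al y) @[x --> (0:R)^'+] --> 0.
  rewrite bdry_al; apply: cvg_trans l2; apply: near_eq_cvg; near=> x.
  by rewrite al_pre // /Cplus /=; near: x; exact: nbhs_right_gt.
have lL : normc (laplace (trunc T f) (xi (x +i* y)) - laplace (trunc T f) x0) @[x --> (0:R)^'+] --> 0.
  have [K hK] := lap_compact_lip hT (@trunc_supp _ T f) x0.
  apply: (@ccvg_squeeze _ _ _ _ _ _ (fun x => K * normc (xi (x +i* y) - x0))).
    have [d d0 hd] := (cvgrPdist_le _ _).1 lx 1 ltr01.
    exists d => // x xd xp; have := hd x xd xp; rewrite sub0r normrN ger0_norm ?normc_ge0 // => hu.
    have e : x0 + (xi (x +i* y) - x0) = xi (x +i* y) by rewrite addrC subrK.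
    by have := hK _ hu; rewrite e.
  exact: cvg_mul0l.
have lI : normc (laplace (A (trunc T f)) (x +i* y) - inner f T y) @[x --> (0:R)^'+] --> 0.
  have h : normc (al (x +i* y) * (1 + xi (x +i* y)) * ((Num.sqrt (2 * pi))%:C * laplace (trunc T f) (xi (x +i* y))) - inner f T y) @[x --> (0:R)^'+] --> 0.
    rewrite /inner ex; apply: ccvgM; last by apply: ccvgM lL; exact: ccvg_cst.
    by apply: ccvgM la _; apply: ccvgD lx; exact: ccvg_cst.
  apply: cvg_trans h; apply: near_eq_cvg; near=> x.
  have xp : Cplus (x +i* y) by rewrite /Cplus /=; near: x; exact: nbhs_right_gt.
  have [_ _ _ hr] := A_repr hA hM xp; rewrite (hr _ hT); congr (normc (_ - _)); ring.
exact: ccvg_unique l1 lI.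
Unshelve. all: by end_near. Qed.

(** The boundary function of the transform of [A f] is the limit in the mean
    of the inner integrals, by [inner_ae], continuity of [A] and the isometry;
    the outer integral is [inversion]. *)
Lemma iterated f : sqint P f -> iterated_fourier_integral
  (fun y tau => bdry_Cplus al y * (1 + bdry_Cplus xi y) * cexp (- (tau%:C * bdry_Cplus xi y)) * f tau) (A f).
Proof.
move=> hf; have hAf := A_sq hA hf; have [sB _] := bdry_le hAf.
have sqi T : sqint setT (inner f T).
  have [h _] := bdry_le (A_sq hA (sq_trunc T hf)).
  apply: sq_ae (mc_inner T hf) _ h => //.
  by apply: aeS (inner_ae T hf) => y ->.
exists (B (A f)); split.
  have hI : L2_cvg setT (inner f) (B (A f)).
    apply: L2_cvgI => // e e0.
    have [d d0 hd] := A_cont hA hf e0.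
    have d2 : 0 < (d / 2) ^+ 2 by rewrite exprn_gt0 // divr_gt0.
    apply: filterS (trunc_cvg hf d2) => T hT.
    have hTf := sq_trunc T hf.
    have hn : nrm P (fun t => trunc T f t - f t) < d.
      apply: (@le_lt_trans _ _ (d / 2)); last by lra.
      rewrite -(@ler_pXn2r _ 2) ?nnegrE ?nrm_ge0 ?divr_ge0 ?(ltW d0) //.
      by rewrite nrm_sqr.
    apply: le_trans (ltW (hd _ hTf hn)).
    apply: le_trans (bdry_B_le (A_sq hA hTf) hAf).
    have [sT _] := bdry_le (A_sq hA hTf).
    rewrite (nrm_ae (v := fun y => B (A (trunc T f)) y - B (A f) y)) //.
    - by have [] := sqB measurableT (sqi T) sB.
    - by have [] := sqB measurableT sT sB.
    - by apply: aeS (inner_ae T hf) => y ->.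
  have [g1 g2 g3] := hI; split => //.
    move=> T T0; rewrite (_ : (fun y => _) = inner f T); first exact: g1.
    by apply/funext => y; rewrite innerE.
  apply: cvg_trans g3; apply: near_eq_cvg; near=> T.
  have T0 : 0 < T by near: T; exact: nbhs_pinfty_gt.
  by congr (L2norm _ _); apply/funext => y; rewrite innerE.
apply: (@L2_cvgI _ _ (fun N => cut_inverse N (B (A f)))) => //.
- by move=> N _; have [] := cut_inverse_le N sB.
- by move=> e e0; exact: inversion.
Unshelve. all: by end_near. Qed.
End Preserver.

(** [alpha] and [xi] depend on the two values only, and [A_repr] with
    injectivity of the transform does the rest. *)
Lemma determined (A A' : (R -> C) -> R -> C) :
  continuous_linear_operator P A -> (forall f, shifted_minimum_phase f -> shifted_minimum_phase (A f)) ->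
  continuous_linear_operator P A' -> (forall f, shifted_minimum_phase f -> shifted_minimum_phase (A' f)) ->
  ae_eq mu P (A sigma0) (A' sigma0) -> ae_eq mu P (A sigma1) (A' sigma1) ->
  forall f, sqint P f -> ae_eq mu P (A f) (A' f).
Proof.
move=> hA hM hA' hM' e0 e1 f hf.
apply: laplace_inj => [||w w0]; [exact: A_sq|exact: A_sq|].
have [_ _ _ h] := A_repr hA hM w0; have [_ _ _ h'] := A_repr hA' hM' w0.
have E (i : R -> C) (hi : sqint P i) : ae_eq mu P (A i) (A' i) -> laplace (A i) w = laplace (A' i) w.
  by move=> e; apply: lap_ae e; [case: (A_sq hA hi)|case: (A_sq hA' hi)].
have E0 := E _ sq_sigma0 e0; have E1 := E _ sq_sigma1 e1.
by rewrite (h f hf) (h' f hf) /xi_of /alpha_of E0 E1.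
Qed.
End Conclusion.
Theorem theorem6 (R : realType) :
  (forall A B : (R -> R[i]) -> R -> R[i],
    continuous_linear_operator Rplus A ->
    (forall f, shifted_minimum_phase f -> shifted_minimum_phase (A f)) ->
    continuous_linear_operator Rplus B ->
    (forall f, shifted_minimum_phase f -> shifted_minimum_phase (B f)) ->
    ae_eq (@lebesgue_measure R) Rplus (A sigma0) (B sigma0) ->
    ae_eq (@lebesgue_measure R) Rplus (A sigma1) (B sigma1) ->
    forall f, L2 Rplus f -> ae_eq (@lebesgue_measure R) Rplus (A f) (B f)) /\
  (forall A : (R -> R[i]) -> R -> R[i],
    continuous_linear_operator Rplus A ->
    (forall f, shifted_minimum_phase f -> shifted_minimum_phase (A f)) ->
    let alpha := fun w : R[i] => laplace (A sigma0) w + laplace (A sigma1) w in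
    let xi := fun w : R[i] => laplace (A sigma0) w / laplace (A sigma1) w in
    let kappa := fun w : R[i] =>
      (Num.sqrt (2 * pi))%:C * (1 + xi w) * alpha w in
    [/\ forall f, L2 Rplus f ->
          is_inverse_laplace (mul_op kappa (comp_op xi (laplace f))) (A f),
        forall f, L2 Rplus f ->
          iterated_fourier_integral
            (fun y tau => bdry_Cplus alpha y * (1 + bdry_Cplus xi y)
                            * cexp (- (tau%:C * bdry_Cplus xi y)) * f tau)
            (A f),
        exists (epsilon : R) (alpha0 : R[i] -> R[i]),
          [/\ 0 <= epsilon,
              outer_Cplus alpha0 &
              forall w, Cplus w -> alpha w = cexp (- (epsilon%:C * w)) * alpha0 w]
      & analytic_on Cplus xi /\ (forall w, Cplus w -> Cplus (xi w))]).
Proof.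
have mP := mRplus (R := R).
split=> [A B hA hM hB hM' e0 e1 f /(L2P _ mP) hf|A hA hM alpha xi kappa].
  exact: determined.
split.
- by move=> f /(L2P _ mP) hf; exact: A_inverse.
- by move=> f /(L2P _ mP) hf; exact: iterated.
- exact: al_outer.
split; first exact: xi_analytic.
by move=> w w0; have [] := A_repr hA hM w0.
Qed.
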